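(* Let $f:[1,\infty)\to\mathbb{R}^+$ satisfy the following conditions: (i) $f$ is four times continuously differentiable; (ii) $f$ is monotonically increasing; (iii) $f(x)\asymp f(2x)$ for all $x\ge1$; (iv) $f^{(k)}(x)\asymp f(x)/x^k$ for all $x\ge 1$ and $k=1,2,3,4$; (v) $f'(x)+xf''(x)\asymp f(x)/x$ for all $x\ge1$; (vi) $2f''(x)+xf'''(x)\asymp f(x)/x^2$ for all $x\ge 1$; (vii) $2f''(x)-xf'''(x)\asymp f(x)/x^2$ for all $x\ge1$. Let $F(s)=\sum_{n\ge1}a_nn^{-s}$ be a Dirichlet series, absolutely convergent for $\Re s>1$, satisfying: (a)(I) there exists $m\in\mathbb{N}$ such that $(s-1)^mF(s)$ extends to a holomorphic function of finite order on the half plane $\Re s\ge 1/2$; (a)(II) $a_1=1$ and $a_n\ll_\varepsilon n^\varepsilon$ for every $\varepsilon>0$; (a)(III) for $\Re s>1$, $F(s)=\prod_p F_p(s)$, where $\log F_p(s)=\sum_{k\ge1}b_{p^k}p^{-ks}$ with complex coefficients satisfying $b_{p^k}=O(p^{k\theta})$ for some $\theta<1/2$; (b) for every Dirichlet character $\chi$, with $F(s,\chi):=\sum_{n\ge1}a_n\chi(n)n^{-s}$ for $\Re s>1$, the function $(s-1)^mF(s,\chi)$ extends to an entire function; (c') for every Dirichlet character $\chi$, all zeros of $F(s,\chi)$ with real part $\ge 1/2$ lie on the line $\Re s=1/2$; moreover, for every $\varepsilon>0$ there exist $A,B\in\mathbb{R}$ and $C,D>0$ such that $C(q|t|)^A\le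 |F(s,\chi)|\le D(q|t|)^B$ for all $s=\sigma+it$ with $\sigma\ge 1/2+\varepsilon$, $|t|\ge1$, all $q\in\mathbb{N}$ and all characters $\chi\bmod q$; (d) the bound $b_{p^k}=O(p^{k\theta})$ in (a)(III) holds for every $\theta>0$. Fix $\eta>0$. Suppose $1\le N<N'\le 2N$ and $N^{3/4+\eta}\le f(N)\le N^{3/2-\eta}$. Then for every $\varepsilon>0$, $$\sum_{N<p\le N'}a_p e(f(p))\ll_{f,\eta,\varepsilon} N^{3/4+\varepsilon}f(N)^{1/6},$$ where the sum runs over primes $p$.
   Context: $e(x):=e^{2\pi i x}$. The notation $A\asymp B$ means $A\ll B\ll A$. $p$ denotes primes. *)

(* Defs.v *)
From Stdlib Require Import Reals ZArith Znumtheory.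
From Coquelicot Require Import Coquelicot.

Open Scope R_scope.

(* Vinogradov symbols for functions on [1, oo).  Both sides are taken in
   absolute value, so that e.g. a negative derivative is allowed. *)
Definition vll (A B : R -> R) : Prop :=
  exists c : R, forall x : R, 1 <= x -> Rabs (A x) <= c * Rabs (B x).

Definition vasymp (A B : R -> R) : Prop := vll A B /\ vll B A.

Definition ge1 (x : R) : Prop := 1 <= x.

(* [df k] is the k-th derivative of [f] on [1, oo), for k <= 4.  [D_in] takes
   the limit of the difference quotient within [1, oo), hence the derivatives
   at 1 are one-sided; values outside [1, oo) are irrelevant. *)
Record C4_with_derivatives (f : R -> R) (df : nat -> R -> R) : Prop := {
  df_0 : forall x, 1 <= x -> df 0%nat x = f x;
  df_S : forall k x, (k < 4)%nat -> 1 <= x -> D_in (df k) (df (S k)) ge1 x;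
  df_4_continuous : forall x, 1 <= x -> continue_in (df 4%nat) ge1 x
}.

Record phase_conditions (f : R -> R) (df : nat -> R -> R) : Prop := {
  phase_pos : forall x, 1 <= x -> 0 < f x;
  phase_C4 : C4_with_derivatives f df;
  phase_incr : forall x y, 1 <= x -> x <= y -> f x <= f y;
  phase_double : vasymp f (fun x => f (2 * x));
  phase_derivatives : forall k, (1 <= k <= 4)%nat ->
    vasymp (df k) (fun x => f x / x ^ k);
  phase_d1_plus_xd2 :
    vasymp (fun x => df 1%nat x + x * df 2%nat x) (fun x => f x / x);
  phase_2d2_plus_xd3 :
    vasymp (fun x => 2 * df 2%nat x + x * df 3%nat x) (fun x => f x / x ^ 2);
  phase_2d2_minus_xd3 :
    vasymp (fun x => 2 * df 2%nat x - x * df 3%nat x) (fun x => f x / x ^ 2)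
}.

Definition Cexp (z : C) : C := (exp (Re z) * cos (Im z), exp (Re z) * sin (Im z)).

Definition e (x : R) : C := Cexp (RtoC (2 * PI * x) * Ci)%C.

(* n ^ s for n >= 1. *)
Definition ncpow (n : nat) (s : C) : C := Cexp (s * RtoC (ln (INR n)))%C.

(* Sum of a complex series; meaningful for convergent series only. *)
Definition CSeries (u : nat -> C) : C :=
  (Series (fun n => Re (u n)), Series (fun n => Im (u n))).

(* The summation index is shifted: the sum runs over n >= 1, [a 0] is unused. *)
Definition dirichlet_term (a : nat -> C) (s : C) (n : nat) : C :=
  (a (S n) * ncpow (S n) (- s))%C.

Definition dirichlet_series (a : nat -> C) (s : C) : C :=
  CSeries (dirichlet_term a s).

Definition is_prime (p : nat) : Prop := prime (Z.of_nat p).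

Definition is_prime_dec (p : nat) : {is_prime p} + {~ is_prime p} :=
  prime_dec (Z.of_nat p).

Fixpoint prod_primes_le (g : nat -> C) (n : nat) : C :=
  match n with
  | O => RtoC 1
  | S k => (prod_primes_le g k * (if is_prime_dec (S k) then g (S k) else RtoC 1))%C
  end.

(* F_p(s), given by log F_p(s) = sum over k >= 1 of b_{p^k} p^{-ks}. *)
Definition euler_factor (b : nat -> C) (p : nat) (s : C) : C :=
  Cexp (CSeries (fun k => (b (p ^ S k)%nat * ncpow p (- (RtoC (INR (S k)) * s)))%C)).

Definition prime_power_bound (b : nat -> C) (theta : R) : Prop :=
  exists K : R, forall p k : nat, is_prime p -> (1 <= k)%nat ->
    Cmod (b (p ^ k)%nat) <= K * Rpower (INR p) (INR k * theta).

Record dirichlet_character (q : nat) (chi : Z -> C) : Prop := {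
  chi_periodic : forall n : Z, chi (n + Z.of_nat q)%Z = chi n;
  chi_mult : forall m n : Z, chi (m * n)%Z = (chi m * chi n)%C;
  chi_support : forall n : Z, chi n <> RtoC 0 <-> Z.gcd n (Z.of_nat q) = 1%Z
}.

Definition twist (a : nat -> C) (chi : Z -> C) (n : nat) : C :=
  (a n * chi (Z.of_nat n))%C.

Definition C_differentiable (G : C -> C) (s : C) : Prop :=
  @ex_derive C_AbsRing C_NormedModule G s.

Definition holomorphic_at (G : C -> C) (s : C) : Prop :=
  @locally C_UniformSpace s (C_differentiable G).

Definition entire (G : C -> C) : Prop := forall s : C, C_differentiable G s.

Definition is_zero (G : C -> C) (s : C) : Prop :=
  holomorphic_at G s /\ G s = RtoC 0.

Definition finite_order_on (H : C -> Prop) (G : C -> C) : Prop :=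
  exists rho r : R, 0 < r /\ forall s : C, H s -> r <= Cmod s ->
    Cmod (G s) <= exp (Rpower (Cmod s) rho).

Definition half_plane (s : C) : Prop := 1 / 2 <= Re s.

(* [Phi] is the meromorphic continuation to C of sum a_n n^{-s}, whose only
   possible pole is at s = 1, of order at most m.  The last clause fills in the
   value at s = 1 when the singularity there is removable; if s = 1 is a pole,
   [Phi 1] is an arbitrary number, but 1 is then not a zero of [Phi] in the
   sense of [is_zero], nor is [Phi] constrained there elsewhere. *)
Record continuation (m : nat) (a : nat -> C) (Phi : C -> C) : Prop := {
  continuation_series : forall s : C, 1 < Re s -> Phi s = dirichlet_series a s;
  continuation_merom : exists G : C -> C, entire G /\
    forall s : C, s <> RtoC 1 -> G s = ((s - RtoC 1) ^ m * Phi s)%C;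
  continuation_removable : forall l : C,
    filterlim Phi (@locally' C_UniformSpace (RtoC 1)) (@locally C_UniformSpace l) ->
    Phi (RtoC 1) = l
}.

Record dirichlet_series_conditions (a b : nat -> C) (m : nat) : Prop := {
  ds_abs_cv : forall s : C, 1 < Re s ->
    ex_series (fun n => Cmod (dirichlet_term a s n));
  ds_half_plane : exists (U : C -> Prop) (G : C -> C),
    @open C_UniformSpace U /\ (forall s : C, half_plane s -> U s) /\
    (forall s : C, U s -> C_differentiable G s) /\
    (forall s : C, 1 < Re s -> G s = ((s - RtoC 1) ^ m * dirichlet_series a s)%C) /\
    finite_order_on half_plane G;
  ds_a1 : a 1%nat = RtoC 1;
  ds_coef_bound : forall eps : R, 0 < eps -> exists K : R, forall n : nat,
    (1 <= n)%nat -> Cmod (a n) <= K * Rpower (INR n) eps;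
  ds_log_bound : exists theta : R, theta < 1 / 2 /\ prime_power_bound b theta;
  ds_euler_product : forall s : C, 1 < Re s ->
    filterlim (prod_primes_le (fun p => euler_factor b p s)) eventually
      (@locally C_UniformSpace (dirichlet_series a s));
  ds_twist_entire : forall (q : nat) (chi : Z -> C), (1 <= q)%nat ->
    dirichlet_character q chi ->
    exists G : C -> C, entire G /\ forall s : C, 1 < Re s ->
      G s = ((s - RtoC 1) ^ m * dirichlet_series (twist a chi) s)%C;
  ds_twist_zeros : forall (q : nat) (chi : Z -> C) (Phi : C -> C) (rho : C),
    (1 <= q)%nat -> dirichlet_character q chi ->
    continuation m (twist a chi) Phi ->
    is_zero Phi rho -> 1 / 2 <= Re rho -> Re rho = 1 / 2;
  ds_twist_growth : forall eps : R, 0 < eps ->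
    exists A B C0 D0 : R, 0 < C0 /\ 0 < D0 /\
    forall (q : nat) (chi : Z -> C) (Phi : C -> C) (s : C),
      (1 <= q)%nat -> dirichlet_character q chi ->
      continuation m (twist a chi) Phi ->
      1 / 2 + eps <= Re s -> 1 <= Rabs (Im s) ->
      C0 * Rpower (INR q * Rabs (Im s)) A <= Cmod (Phi s) /\
      Cmod (Phi s) <= D0 * Rpower (INR q * Rabs (Im s)) B;
  ds_log_bound_all : forall theta : R, 0 < theta -> prime_power_bound b theta
}.

(* Sum of g p over the primes N < p <= N'; every such p is at most up N'. *)
Definition sum_primes_between (g : nat -> C) (N N' : R) : C :=
  @sum_n C_AbelianMonoid
    (fun p => if is_prime_dec p then
                if Rlt_dec N (INR p) then
                  if Rle_dec (INR p) N' then g p else RtoC 0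
                else RtoC 0
              else RtoC 0)
    (Z.to_nat (up N')).

(* Main.v *)
(** On a piece [[y, y+l]] of [[N, 2N]] approximate [f'(y) + y f''(y)] by a fraction [a/q] with
    [q <= Q = N^(1/2) f(N)^(-1/3)], and put [tau = y (f'(y) - a/q)].  Then
    [f(x) - a x/q - tau log x] has vanishing first and small second derivative at [y], so it has
    bounded variation on the piece as soon as [l <= L sqrt(q/Q)] with [L = N f(N)^(-1/3)].  By
    partial summation the piece is controlled by sums of [a_p e(a p/q) p^(2 pi i tau)].  These are
    expanded over the characters mod [q] at a loss of [sqrt q], and each twisted sum is
    [O(N^(1/2+eps))] by Perron's formula with the contour moved to [Re s = 1/2 + 3d], where
    [log F(s,chi)] is bounded through the growth hypothesis and Cauchy-type estimates; [|tau|] is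
    of size [f(N)], which keeps the contour away from the pole at 1.  The cost [sqrt q] for a piece
    of length [L sqrt(q/Q)] is proportional to its length, whatever [q] is, so a greedy dissection
    of [[N, N']] gives the bound.

    The coefficients of [log F(s,chi)] are related to [a_n] through
    [a log = (b log) * a], which follows from the uniqueness of Dirichlet coefficients. *)

Require Import Defs.
From Stdlib Require Import Reals ZArith Znumtheory Zpow_facts Lra Lia List Permutation Classical ClassicalEpsilon.
From Coquelicot Require Import Coquelicot.
Import ListNotations.
Open Scope R_scope.

(** * Complex differentiability and the theorem of Cauchy and Goursat *)

(** Once tau cancels the first derivative of the phase at y, its second derivative there is (f'(y) +
    y f''(y) - a/q) / y; this is why the derivative of x f'(x) is the quantity to approximate. Then
    tau differs little from - y^2 f''(y), which has exact order f(N): the lower bound on f(N) makes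
    the approximation error small in this comparison, while the upper bound gives Q >= 1. L and Q
    solve L^3 f(N) = N^3 and L^2 = Q^2 N, which balances the third against the second derivative in
    the variation of the phase. A piece of length L costs N^(1/2) sqrt Q = N^(3/4) f(N)^(-1/6), and
    N/L = f(N)^(1/3).

    The hypotheses give an Euler product for F, but none for its twists; the coefficient identity,
    which survives multiplication by chi, bridges this gap. Characters are also built by hand, as
    many as orthogonality requires. Exact constants such as 2 pi i and pi/2 are never evaluated:
    lower bounds for the winding integral and for the limit of the sine integral replace them. *)

Definition cont_at {X : Type} (dist : X -> X -> R) (f : X -> C) (x : X) : Prop :=
  forall eps, 0 < eps -> exists d, 0 < d /\
    forall y, dist y x < d -> Cmod (f y - f x) < eps.

Definition Cdist (z w : C) : R := Cmod (z - w).
Notation Ccont := (cont_at Cdist).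
Notation Rcont := (cont_at R_dist).

Lemma Cmod_sub_comm (x y : C) : Cmod (x - y) = Cmod (y - x).
Proof. rewrite <- Cmod_opp. f_equal. ring. Qed.

Lemma Cmod_sub_triangle (x y : C) : Cmod (x - y) <= Cmod x + Cmod y.
Proof. unfold Cminus. rewrite <- (Cmod_opp y). apply Cmod_triangle. Qed.

Lemma Cmod_sub_lower (x y : C) : Cmod x - Cmod y <= Cmod (x - y).
Proof.
  assert (H := Cmod_triangle (x - y) y).
  replace (x - y + y)%C with x in H by ring. lra.
Qed.

Lemma Cmod_le_Re_Im (z : C) : Cmod z <= Rabs (Re z) + Rabs (Im z).
Proof.
  destruct z as [x y]. unfold Cmod; simpl.
  apply Rsqr_incr_0_var.
  - rewrite Rsqr_sqrt by nra. unfold Rsqr.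
    assert (Hx := Rabs_pos x). assert (Hy := Rabs_pos y).
    assert (x * x = Rabs x * Rabs x) by (rewrite <- Rabs_mult, Rabs_right; nra).
    assert (y * y = Rabs y * Rabs y) by (rewrite <- Rabs_mult, Rabs_right; nra).
    nra.
  - assert (Hx := Rabs_pos x). assert (Hy := Rabs_pos y). lra.
Qed.

Lemma Rabs_Im_le_Cmod (z : C) : Rabs (Im z) <= Cmod z.
Proof. eapply Rle_trans; [apply Rmax_r | apply Rmax_Cmod]. Qed.

Section Continuity.
Context {X : Type} (dist : X -> X -> R).

Lemma cont_const (c : C) x : cont_at dist (fun _ => c) x.
Proof.
  intros eps He. exists 1. split; [lra|]. intros y _.
  replace (c - c)%C with (RtoC 0) by ring. rewrite Cmod_0. exact He.
Qed.

Lemma cont_plus f g x : cont_at dist f x -> cont_at dist g x ->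
  cont_at dist (fun y => f y + g y)%C x.
Proof.
  intros Hf Hg eps He.
  destruct (Hf (eps / 2)) as [d1 [Hd1 H1]]; [lra|].
  destruct (Hg (eps / 2)) as [d2 [Hd2 H2]]; [lra|].
  exists (Rmin d1 d2). split; [apply Rmin_pos; auto|]. intros y Hy.
  specialize (H1 y (Rlt_le_trans _ _ _ Hy (Rmin_l _ _))).
  specialize (H2 y (Rlt_le_trans _ _ _ Hy (Rmin_r _ _))).
  replace (f y + g y - (f x + g x))%C with ((f y - f x) + (g y - g x))%C by ring.
  eapply Rle_lt_trans; [apply Cmod_triangle|lra].
Qed.

Lemma cont_mult f g x : cont_at dist f x -> cont_at dist g x ->
  cont_at dist (fun y => f y * g y)%C x.
Proof.
  intros Hf Hg eps He.
  set (A := Cmod (f x) + 1). set (B := Cmod (g x) + 1).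
  assert (HA : 0 < A) by (unfold A; assert (h := Cmod_ge_0 (f x)); lra).
  assert (HB : 0 < B) by (unfold B; assert (h := Cmod_ge_0 (g x)); lra).
  destruct (Hf (Rmin 1 (eps / (2 * B)))) as [d1 [Hd1 H1]].
  { apply Rmin_pos; [lra|]. apply Rdiv_lt_0_compat; lra. }
  destruct (Hg (Rmin 1 (eps / (2 * A)))) as [d2 [Hd2 H2]].
  { apply Rmin_pos; [lra|]. apply Rdiv_lt_0_compat; lra. }
  exists (Rmin d1 d2). split; [apply Rmin_pos; auto|]. intros y Hy.
  specialize (H1 y (Rlt_le_trans _ _ _ Hy (Rmin_l _ _))).
  specialize (H2 y (Rlt_le_trans _ _ _ Hy (Rmin_r _ _))).
  assert (H1a := Rlt_le_trans _ _ _ H1 (Rmin_l _ _)).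
  assert (H1b := Rlt_le_trans _ _ _ H1 (Rmin_r _ _)).
  assert (H2b := Rlt_le_trans _ _ _ H2 (Rmin_r _ _)).
  replace (f y * g y - f x * g x)%C with ((f y) * (g y - g x) + (f y - f x) * g x)%C by ring.
  eapply Rle_lt_trans; [apply Cmod_triangle|]. rewrite !Cmod_mult.
  assert (Hfy : Cmod (f y) <= A).
  { replace (f y) with ((f y - f x) + f x)%C by ring.
    eapply Rle_trans; [apply Cmod_triangle|]. unfold A. lra. }
  assert (E1 : A * (eps / (2 * A)) = eps / 2) by (field; lra).
  assert (E2 : (eps / (2 * B)) * B = eps / 2) by (field; lra).
  assert (P1 := Cmod_ge_0 (g y - g x)). assert (P2 := Cmod_ge_0 (f y - f x)).
  assert (P3 := Cmod_ge_0 (g x)).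
  assert (Cmod (f y) * Cmod (g y - g x) <= A * Cmod (g y - g x)) by nra.
  assert (A * Cmod (g y - g x) < eps / 2) by nra.
  assert (Cmod (f y - f x) * Cmod (g x) <= Cmod (f y - f x) * B) by (unfold B; nra).
  assert (Cmod (f y - f x) * B < eps / 2) by nra.
  lra.
Qed.

Lemma cont_ext_near f g x d : 0 < d -> f x = g x ->
  (forall y, dist y x < d -> f y = g y) -> cont_at dist f x -> cont_at dist g x.
Proof.
  intros Hd E0 E Hf eps He. destruct (Hf eps He) as [d1 [Hd1 H1]].
  exists (Rmin d d1). split; [apply Rmin_pos; auto|]. intros y Hy.
  rewrite <- E0, <- E by (eapply Rlt_le_trans; [apply Hy|apply Rmin_l]).
  apply H1. eapply Rlt_le_trans; [apply Hy|apply Rmin_r].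
Qed.

Lemma cont_ext f g x : (forall y, f y = g y) -> cont_at dist f x -> cont_at dist g x.
Proof. intros E. apply cont_ext_near with 1; auto; lra. Qed.

Lemma cont_opp f x : cont_at dist f x -> cont_at dist (fun y => - f y)%C x.
Proof.
  intros Hf. apply cont_ext with (fun y => (- RtoC 1) * f y)%C.
  - intros y. ring.
  - apply cont_mult; [apply cont_const|exact Hf].
Qed.

Lemma cont_minus f g x : cont_at dist f x -> cont_at dist g x ->
  cont_at dist (fun y => f y - g y)%C x.
Proof. intros Hf Hg. apply cont_plus; [exact Hf|apply cont_opp, Hg]. Qed.

Lemma cont_inv f x : f x <> RtoC 0 -> cont_at dist f x -> cont_at dist (fun y => / f y)%C x.
Proof.
  intros Hn Hf eps He.
  assert (HA : 0 < Cmod (f x)) by (apply Cmod_gt_0; exact Hn).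
  set (A := Cmod (f x)) in *.
  destruct (Hf (Rmin (A / 2) (eps * (A * A / 2)))) as [d [Hd H]].
  { apply Rmin_pos; [lra|]. apply Rmult_lt_0_compat; [lra|]. nra. }
  exists d. split; [exact Hd|]. intros y Hy. specialize (H y Hy).
  assert (Ha := Rlt_le_trans _ _ _ H (Rmin_l _ _)).
  assert (Hb := Rlt_le_trans _ _ _ H (Rmin_r _ _)).
  assert (Hy2 : A / 2 < Cmod (f y)).
  { assert (h := Cmod_sub_lower (f x) (f y)). rewrite Cmod_sub_comm in h. fold A in h. lra. }
  assert (Hyn : f y <> RtoC 0) by (apply Cmod_gt_0; lra).
  replace (/ f y - / f x)%C with (- ((f y - f x) * (/ f y * / f x)))%C by (field; auto).
  rewrite Cmod_opp, !Cmod_mult, !Cmod_inv by auto. fold A.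
  assert (0 < / Cmod (f y) * / A) by (apply Rmult_lt_0_compat; apply Rinv_0_lt_compat; lra).
  apply Rlt_le_trans with (eps * (A * A / 2) * (/ Cmod (f y) * / A)).
  - apply Rmult_lt_compat_r; auto.
  - replace (eps * (A * A / 2) * (/ Cmod (f y) * / A)) with (eps * ((A / 2) / Cmod (f y))) by (field; lra).
    assert (A / 2 / Cmod (f y) <= 1).
    { apply Rmult_le_reg_r with (Cmod (f y)); [lra|]. unfold Rdiv at 1. rewrite Rmult_assoc, Rinv_l; lra. }
    nra.
Qed.

Lemma cont_comp (g : X -> C) (f : C -> C) x : cont_at dist g x -> Ccont f (g x) ->
  cont_at dist (fun y => f (g y)) x.
Proof.
  intros Hg Hf eps He. destruct (Hf eps He) as [d [Hd H]].
  destruct (Hg d Hd) as [d' [Hd' H']]. exists d'. split; auto.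
  intros y Hy. apply H. apply H'. exact Hy.
Qed.

End Continuity.

Lemma cont_id z : Ccont (fun w => w) z.
Proof. intros eps He. exists eps. split; auto. Qed.

Lemma cont_RtoC x : Rcont RtoC x.
Proof.
  intros eps He. exists eps. split; auto. intros y Hy.
  rewrite <- RtoC_minus, Cmod_R. exact Hy.
Qed.

Lemma Rcont_affine (z u : C) x : Rcont (fun t => z + RtoC t * u)%C x.
Proof.
  apply cont_plus; [apply cont_const|]. apply cont_mult; [apply cont_RtoC|apply cont_const].
Qed.

(* Caratheodory's form of differentiability. *)
Definition Cdiff (f : C -> C) (z l : C) : Prop :=
  exists phi, Ccont phi z /\ phi z = l /\ forall w, (f w - f z = phi w * (w - z))%C.

Lemma Cdist_refl z : Cdist z z = 0.
Proof. unfold Cdist. replace (z - z)%C with (RtoC 0) by ring. apply Cmod_0. Qed.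

(** [Cdiff] demands a slope function on all of C. Outside the disc the difference quotient itself is
    inserted; continuity at [z] sees only the disc, where the slope is [phi]. *)
Lemma Cdiff_near (f phi : C -> C) z l d : 0 < d -> Ccont phi z -> phi z = l ->
  (forall w, Cdist w z < d -> f w - f z = phi w * (w - z))%C -> Cdiff f z l.
Proof.
  intros Hd Hc El E.
  exists (fun w => if excluded_middle_informative (Cdist w z < d) then phi w
                   else ((f w - f z) / (w - z))%C).
  assert (Hz : Cdist z z < d) by (rewrite Cdist_refl; exact Hd).
  split; [|split].
  - apply cont_ext_near with (f := phi) (d := d); auto.
    + destruct (excluded_middle_informative _); tauto.
    + intros y Hy. destruct (excluded_middle_informative _); tauto.
  - destruct (excluded_middle_informative _); tauto.
  - intros w. destruct (excluded_middle_informative _) as [h|h]; [auto|].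
    field. intros Hw. apply h. unfold Cdist. rewrite Hw, Cmod_0. exact Hd.
Qed.

Lemma Cdiff_ext_near f g z l d : 0 < d -> (forall w, Cdist w z < d -> f w = g w) ->
  Cdiff f z l -> Cdiff g z l.
Proof.
  intros Hd E [phi [H1 [H2 H3]]]. apply Cdiff_near with phi d; auto.
  intros w Hw. rewrite <- !E; auto. rewrite Cdist_refl; auto.
Qed.

Lemma Cdiff_cont f z l : Cdiff f z l -> Ccont f z.
Proof.
  intros [phi [H1 [H2 H3]]].
  apply cont_ext with (fun w => f z + phi w * (w - z))%C.
  - intros w. rewrite <- H3. ring.
  - apply cont_plus; [apply cont_const|]. apply cont_mult; auto.
    apply cont_minus; [apply cont_id|apply cont_const].
Qed.

Lemma Cdiff_const c z : Cdiff (fun _ => c) z 0.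
Proof. exists (fun _ => RtoC 0). split; [apply cont_const|]. split; auto. intros. ring. Qed.

Lemma Cdiff_id z : Cdiff (fun w => w) z 1.
Proof. exists (fun _ => RtoC 1). split; [apply cont_const|]. split; auto. intros. ring. Qed.

Lemma Cdiff_plus f g z l m : Cdiff f z l -> Cdiff g z m ->
  Cdiff (fun w => f w + g w)%C z (l + m).
Proof.
  intros [p [P1 [P2 P3]]] [r [R1 [R2 R3]]]. exists (fun w => p w + r w)%C.
  split; [apply cont_plus; auto|]. split; [congruence|]. intros w.
  replace (f w + g w - (f z + g z))%C with ((f w - f z) + (g w - g z))%C by ring.
  rewrite P3, R3. ring.
Qed.

Lemma Cdiff_mult f g z l m : Cdiff f z l -> Cdiff g z m ->
  Cdiff (fun w => f w * g w)%C z (l * g z + f z * m).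
Proof.
  intros Hf Hg. assert (Cg := Cdiff_cont _ _ _ Hg).
  destruct Hf as [p [P1 [P2 P3]]], Hg as [r [R1 [R2 R3]]].
  exists (fun w => p w * g w + f z * r w)%C.
  split.
  - apply cont_plus; apply cont_mult; auto. apply cont_const.
  - split; [congruence|]. intros w.
    replace (f w * g w - f z * g z)%C with ((f w - f z) * g w + f z * (g w - g z))%C by ring.
    rewrite P3, R3. ring.
Qed.

Lemma Cdiff_opp f z l : Cdiff f z l -> Cdiff (fun w => - f w)%C z (- l).
Proof.
  intros [p [P1 [P2 P3]]]. exists (fun w => - p w)%C.
  split; [apply cont_opp; auto|]. split; [congruence|]. intros w.
  replace (- f w - - f z)%C with (- (f w - f z))%C by ring. rewrite P3. ring.
Qed.

Lemma Cdiff_minus f g z l m : Cdiff f z l -> Cdiff g z m ->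
  Cdiff (fun w => f w - g w)%C z (l - m).
Proof. intros Hf Hg. apply Cdiff_plus; auto. apply Cdiff_opp; auto. Qed.

Lemma Cdiff_inv f z l : f z <> RtoC 0 -> Cdiff f z l -> Cdiff (fun w => / f w)%C z (- l / (f z * f z)).
Proof.
  intros Hn Hf. assert (Cf := Cdiff_cont _ _ _ Hf).
  assert (HA : 0 < Cmod (f z)) by (apply Cmod_gt_0; auto).
  destruct (Cf _ HA) as [d [Hd H]].
  destruct Hf as [p [P1 [P2 P3]]].
  apply Cdiff_near with (fun w => - p w * (/ f w * / f z))%C d; auto.
  - apply cont_mult; [apply cont_opp; auto|]. apply cont_mult; [apply cont_inv; auto|apply cont_const].
  - rewrite P2. field. auto.
  - intros w Hw. specialize (H w Hw).
    assert (f w <> RtoC 0).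
    { apply Cmod_gt_0. assert (h := Cmod_sub_lower (f z) (f w)). rewrite Cmod_sub_comm in h. lra. }
    replace (/ f w - / f z)%C with (- (f w - f z) * (/ f w * / f z))%C by (field; auto).
    rewrite P3. ring.
Qed.

Lemma Cdiff_comp f g z l m : Cdiff g z m -> Cdiff f (g z) l ->
  Cdiff (fun w => f (g w)) z (l * m).
Proof.
  intros Hg [p [P1 [P2 P3]]]. assert (Cg := Cdiff_cont _ _ _ Hg).
  destruct Hg as [r [R1 [R2 R3]]].
  exists (fun w => p (g w) * r w)%C. split.
  - apply cont_mult; auto. apply (cont_comp Cdist g p); auto.
  - split; [congruence|]. intros w. rewrite P3, R3. ring.
Qed.

Lemma Cdiff_unique f z l m : Cdiff f z l -> Cdiff f z m -> l = m.
Proof.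
  intros [p [P1 [P2 P3]]] [r [R1 [R2 R3]]].
  apply NNPP. intros Hne.
  assert (HA : 0 < Cmod (l - m)).
  { apply Cmod_gt_0. intros h. apply Hne. replace l with (l - m + m)%C by ring. rewrite h. ring. }
  destruct (P1 (Cmod (l - m) / 2)) as [d1 [Hd1 H1]]; [lra|].
  destruct (R1 (Cmod (l - m) / 2)) as [d2 [Hd2 H2]]; [lra|].
  set (d := Rmin d1 d2 / 2).
  assert (Hd : 0 < d) by (unfold d; assert (0 < Rmin d1 d2) by (apply Rmin_pos; auto); lra).
  set (w := (z + RtoC d)%C).
  assert (Hw : Cdist w z = d).
  { unfold Cdist, w. replace (z + d - z)%C with (RtoC d) by ring. rewrite Cmod_R. apply Rabs_right. lra. }
  assert (E : p w = r w).
  { assert (h := P3 w). rewrite R3 in h.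
    assert (w - z <> RtoC 0)%C by (apply Cmod_gt_0; fold (Cdist w z); lra).
    assert (h2 : (r w * (w - z) * / (w - z) = p w * (w - z) * / (w - z))%C) by (rewrite h; auto).
    rewrite <- !Cmult_assoc, !Cinv_r, !Cmult_1_r in h2; auto. }
  assert (D1 := Rmin_l d1 d2). assert (D2 := Rmin_r d1 d2).
  assert (Q1 := H1 w ltac:(rewrite Hw; unfold d in *; lra)).
  assert (Q2 := H2 w ltac:(rewrite Hw; unfold d in *; lra)).
  rewrite P2 in Q1. rewrite R2, <- E in Q2.
  assert (T := Cmod_triangle (l - p w) (p w - m)).
  replace (l - p w + (p w - m))%C with (l - m)%C in T by ring.
  rewrite Cmod_sub_comm in Q1. lra.
Qed.

(** The form in which derivatives of integrals and series arise below: a second-order Taylor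
    remainder, integrated or summed term by term, gives the bound [K |h|^2]. *)
Lemma Cdiff_of_quadratic f z l K d : 0 < d ->
  (forall h, Cmod h < d -> Cmod (f (z + h) - f z - l * h) <= K * (Cmod h * Cmod h))%C ->
  Cdiff f z l.
Proof.
  intros Hd H.
  apply Cdiff_near with
    (fun w => if excluded_middle_informative (w = z) then l else ((f w - f z) / (w - z))%C) d; auto.
  - intros eps He. set (K' := Rabs K + 1). assert (HK' : 0 < K') by (unfold K'; assert (h := Rabs_pos K); lra).
    exists (Rmin d (eps / K')). split; [apply Rmin_pos; auto; apply Rdiv_lt_0_compat; auto|].
    intros w Hw. destruct (excluded_middle_informative (z = z)) as [_|h]; [|tauto].
    destruct (excluded_middle_informative (w = z)) as [E|E].
    + replace (l - l)%C with (RtoC 0) by ring. rewrite Cmod_0. auto.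
    + assert (Hn : (w - z <> RtoC 0)%C).
      { intros h. apply E. replace w with (w - z + z)%C by ring. rewrite h. ring. }
      assert (Hp : 0 < Cmod (w - z)) by (apply Cmod_gt_0; auto).
      unfold Cdist in Hw.
      specialize (H (w - z)%C ltac:(eapply Rlt_le_trans; [apply Hw|apply Rmin_l])).
      replace (z + (w - z))%C with w in H by ring.
      replace ((f w - f z) / (w - z) - l)%C with ((f w - f z - l * (w - z)) / (w - z))%C by (field; auto).
      rewrite Cmod_div by auto.
      assert (Hw2 := Rlt_le_trans _ _ _ Hw (Rmin_r _ _)).
      apply Rle_lt_trans with (K' * Cmod (w - z)).
      * apply Rmult_le_reg_r with (Cmod (w - z)); auto. unfold Rdiv. rewrite Rmult_assoc, Rinv_l by lra.
        rewrite Rmult_1_r. eapply Rle_trans; [apply H|]. rewrite Rmult_assoc.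
        apply Rmult_le_compat_r; [nra|]. unfold K'. assert (h := Rle_abs K). lra.
      * apply Rmult_lt_reg_r with (/ K'); [apply Rinv_0_lt_compat; auto|].
        replace (K' * Cmod (w - z) * / K') with (Cmod (w - z)) by (field; lra). exact Hw2.
  - destruct (excluded_middle_informative _); tauto.
  - intros w _. destruct (excluded_middle_informative _) as [E|E].
    + subst. ring.
    + field. intros h. apply E. replace w with (w - z + z)%C by ring. rewrite h. ring.
Qed.

(** Passage from the notion of derivative in the hypotheses to the slope form. *)
Lemma Cdiff_of_ex_derive (f : C -> C) z : C_differentiable f z -> exists l, Cdiff f z l.
Proof.
  intros [l Hl]. exists l. destruct Hl as [_ H].
  specialize (H z (fun P h => h)).
  exists (fun w => if excluded_middle_informative (w = z) then l else ((f w - f z) / (w - z))%C).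
  split; [|split].
  - intros eps He. 
    specialize (H (mkposreal (eps / 2) ltac:(lra))). destruct H as [d Hd].
    exists d. split; [apply cond_pos|]. intros w Hw.
    destruct (excluded_middle_informative (z = z)) as [_|h]; [|tauto].
    destruct (excluded_middle_informative (w = z)) as [E|E].
    + replace (l - l)%C with (RtoC 0) by ring. rewrite Cmod_0. auto.
    + assert (Hn : (w - z <> RtoC 0)%C).
      { intros h. apply E. replace w with (w - z + z)%C by ring. rewrite h. ring. }
      assert (Hp : 0 < Cmod (w - z)) by (apply Cmod_gt_0; auto).
      specialize (Hd w Hw). simpl in Hd.
      change (Cmod ((f w - f z) - (w - z) * l) <= eps / 2 * Cmod (w - z)) in Hd.
      replace ((f w - f z) / (w - z) - l)%C with ((f w - f z - (w - z) * l) / (w - z))%C by (field; auto).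
      rewrite Cmod_div by auto.
      apply Rle_lt_trans with (eps / 2); [|lra].
      apply Rmult_le_reg_r with (Cmod (w - z)); auto. unfold Rdiv at 1. rewrite Rmult_assoc, Rinv_l by lra. lra.
  - destruct (excluded_middle_informative _); tauto.
  - intros w. destruct (excluded_middle_informative _) as [E|E].
    + subst. ring.
    + field. intros h. apply E. replace w with (w - z + z)%C by ring. rewrite h. ring.
Qed.

(** * Integrals of complex-valued functions over real intervals *)

Definition CInt (f : R -> C) (a b : R) : C :=
  (RInt (fun t => Re (f t)) a b, RInt (fun t => Im (f t)) a b).

Definition cont_on_seg (f : R -> C) (a b : R) : Prop :=
  forall t, Rmin a b <= t <= Rmax a b -> Rcont f t.

Lemma Cmod_Re_sub (z w : C) : Rabs (Re z - Re w) <= Cmod (z - w).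
Proof. destruct z as [a b], w as [c d]. apply (re_le_Cmod ((a, b) - (c, d))%C). Qed.

Lemma Cmod_Im_sub (z w : C) : Rabs (Im z - Im w) <= Cmod (z - w).
Proof. destruct z as [a b], w as [c d]. apply (Rabs_Im_le_Cmod ((a, b) - (c, d))%C). Qed.

Lemma Rcont_Re f x : Rcont f x -> continuous (fun t => Re (f t)) x.
Proof.
  intros H. apply continuity_pt_filterlim. intros eps He.
  destruct (H eps He) as [d [Hd Hy]]. exists d. split; auto.
  intros y [_ Hy']. specialize (Hy y Hy').
  eapply Rle_lt_trans; [apply Cmod_Re_sub|exact Hy].
Qed.

Lemma Rcont_Im f x : Rcont f x -> continuous (fun t => Im (f t)) x.
Proof.
  intros H. apply continuity_pt_filterlim. intros eps He.
  destruct (H eps He) as [d [Hd Hy]]. exists d. split; auto.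
  intros y [_ Hy']. specialize (Hy y Hy').
  eapply Rle_lt_trans; [apply Cmod_Im_sub|exact Hy].
Qed.

Lemma ex_RInt_Re f a b : cont_on_seg f a b -> ex_RInt (fun t => Re (f t)) a b.
Proof. intros H. apply (ex_RInt_continuous (V := R_CompleteNormedModule)). intros; apply Rcont_Re; auto. Qed.

Lemma ex_RInt_Im f a b : cont_on_seg f a b -> ex_RInt (fun t => Im (f t)) a b.
Proof. intros H. apply (ex_RInt_continuous (V := R_CompleteNormedModule)). intros; apply Rcont_Im; auto. Qed.

Lemma CInt_ext f g a b : (forall t, Rmin a b < t < Rmax a b -> f t = g t) -> CInt f a b = CInt g a b.
Proof. intros H. unfold CInt. f_equal; apply RInt_ext; intros; rewrite H; auto. Qed.

Lemma CInt_plus f g a b : cont_on_seg f a b -> cont_on_seg g a b ->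
  CInt (fun t => f t + g t)%C a b = (CInt f a b + CInt g a b)%C.
Proof.
  intros Hf Hg. unfold CInt, Cplus; simpl. f_equal.
  - apply (RInt_plus (V := R_CompleteNormedModule) (fun t => Re (f t)) (fun t => Re (g t)));
    apply ex_RInt_Re; auto.
  - apply (RInt_plus (V := R_CompleteNormedModule) (fun t => Im (f t)) (fun t => Im (g t)));
    apply ex_RInt_Im; auto.
Qed.

Lemma CInt_scal c f a b : cont_on_seg f a b ->
  CInt (fun t => c * f t)%C a b = (c * CInt f a b)%C.
Proof.
  intros Hf. assert (HR := ex_RInt_Re _ _ _ Hf). assert (HI := ex_RInt_Im _ _ _ Hf).
  assert (S1 := fun k => ex_RInt_scal (V := R_NormedModule) (fun t => Re (f t)) a b k HR).
  assert (S2 := fun k => ex_RInt_scal (V := R_NormedModule) (fun t => Im (f t)) a b k HI).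
  unfold CInt, Cmult; simpl. f_equal.
  - transitivity (RInt (fun t => minus (scal (fst c) (Re (f t))) (scal (snd c) (Im (f t)))) a b).
    + apply RInt_ext. intros. reflexivity.
    + rewrite (RInt_minus (V := R_CompleteNormedModule)); auto.
      rewrite !(RInt_scal (V := R_CompleteNormedModule)); auto.
  - transitivity (RInt (fun t => plus (scal (fst c) (Im (f t))) (scal (snd c) (Re (f t)))) a b).
    + apply RInt_ext. intros. reflexivity.
    + rewrite (RInt_plus (V := R_CompleteNormedModule)); auto.
      rewrite !(RInt_scal (V := R_CompleteNormedModule)); auto.
Qed.

Lemma cont_on_seg_scal c f a b : cont_on_seg f a b -> cont_on_seg (fun t => c * f t)%C a b.
Proof. intros Hf t Ht. apply cont_mult; auto. apply cont_const. Qed.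

Lemma CInt_minus f g a b : cont_on_seg f a b -> cont_on_seg g a b ->
  CInt (fun t => f t - g t)%C a b = (CInt f a b - CInt g a b)%C.
Proof.
  intros Hf Hg.
  rewrite (CInt_ext _ (fun t => f t + (- RtoC 1) * g t)%C) by (intros; ring).
  rewrite CInt_plus, CInt_scal; auto; [ring|]. apply cont_on_seg_scal; auto.
Qed.

Lemma CInt_const c a b : CInt (fun _ => c) a b = (RtoC (b - a) * c)%C.
Proof.
  unfold CInt. rewrite !RInt_const. unfold Cmult, scal; simpl. unfold mult; simpl.
  f_equal; unfold Re, Im; ring.
Qed.

Lemma CInt_swap f a b : cont_on_seg f a b -> CInt f b a = (- CInt f a b)%C.
Proof.
  intros H. unfold CInt, Copp; simpl. f_equal; symmetry.
  - apply (opp_RInt_swap (V := R_CompleteNormedModule) (fun t => Re (f t))), ex_RInt_Re; auto.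
  - apply (opp_RInt_swap (V := R_CompleteNormedModule) (fun t => Im (f t))), ex_RInt_Im; auto.
Qed.

Lemma CInt_point f a : CInt f a a = RtoC 0.
Proof. unfold CInt. rewrite !RInt_point. reflexivity. Qed.

Lemma CInt_Chasles f a b c : cont_on_seg f a b -> cont_on_seg f b c ->
  (CInt f a b + CInt f b c = CInt f a c)%C.
Proof.
  intros H1 H2. unfold CInt, Cplus; simpl. f_equal.
  - apply (RInt_Chasles (V := R_CompleteNormedModule) (fun t => Re (f t))); apply ex_RInt_Re; auto.
  - apply (RInt_Chasles (V := R_CompleteNormedModule) (fun t => Im (f t))); apply ex_RInt_Im; auto.
Qed.

Lemma seg_le a b t : a <= b -> Rmin a b <= t <= Rmax a b -> a <= t <= b.
Proof. intros H. rewrite Rmin_left, Rmax_right; tauto. Qed.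

Lemma le_seg a b t : a <= b -> a <= t <= b -> Rmin a b <= t <= Rmax a b.
Proof. intros H. rewrite Rmin_left, Rmax_right; tauto. Qed.

(** Multiplying by the unimodular [u = conj I / |I|] turns the integral [I] into its modulus, so
    comparing the real part of [u f] with [g] costs no constant. *)
Lemma CInt_norm_le f g a b : a <= b -> cont_on_seg f a b -> ex_RInt g a b ->
  (forall t, a <= t <= b -> Cmod (f t) <= g t) -> Cmod (CInt f a b) <= RInt g a b.
Proof.
  intros Hab Hf Hg H.
  destruct (Req_dec (Cmod (CInt f a b)) 0) as [E|E].
  - rewrite E. apply RInt_ge_0; auto. intros x Hx. eapply Rle_trans; [apply Cmod_ge_0|apply H; lra].
  - set (I := CInt f a b) in *. set (u := (Cconj I * / RtoC (Cmod I))%C).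
    assert (Hm : 0 < Cmod I) by (assert (h := Cmod_ge_0 I); lra).
    assert (HI0 : RtoC (Cmod I) <> RtoC 0) by (intros h; apply RtoC_inj in h; lra).
    assert (Hu : Cmod u = 1).
    { unfold u. rewrite Cmod_mult, Cmod_conj, Cmod_inv, Cmod_R, Rabs_right; try lra; auto. field. lra. }
    assert (HuI : (u * I)%C = RtoC (Cmod I)).
    { unfold u. replace (Cconj I * / Cmod I * I)%C with (I * Cconj I * / Cmod I)%C by ring.
      rewrite <- Cmod2_conj. rewrite RtoC_pow. field. auto. }
    assert (Hs := CInt_scal u f a b Hf). fold I in Hs. rewrite HuI in Hs.
    assert (Hr : RInt (fun t => Re (u * f t)%C) a b = Cmod I) by (apply (f_equal Re) in Hs; exact Hs).
    rewrite <- Hr. apply RInt_le; auto.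
    + apply ex_RInt_Re. apply cont_on_seg_scal; auto.
    + intros x Hx. eapply Rle_trans; [apply Rle_abs|]. eapply Rle_trans; [apply re_le_Cmod|].
      rewrite Cmod_mult, Hu, Rmult_1_l. apply H; lra.
Qed.

Lemma CInt_norm_le_const f M a b : a <= b -> cont_on_seg f a b ->
  (forall t, a <= t <= b -> Cmod (f t) <= M) -> Cmod (CInt f a b) <= M * (b - a).
Proof.
  intros Hab Hf H. replace (M * (b - a)) with (RInt (fun _ => M) a b).
  - apply CInt_norm_le; auto. apply ex_RInt_const.
  - rewrite RInt_const. unfold scal; simpl. unfold mult; simpl. ring.
Qed.

Lemma CInt_norm_le_const_abs f M a b : cont_on_seg f a b ->
  (forall t, Rmin a b <= t <= Rmax a b -> Cmod (f t) <= M) -> Cmod (CInt f a b) <= M * Rabs (b - a).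
Proof.
  intros Hf H. destruct (Rle_dec a b) as [h|h].
  - rewrite Rabs_right by lra. apply CInt_norm_le_const; auto. intros; apply H, le_seg; auto.
  - assert (Hf' : cont_on_seg f b a) by (intros t Ht; apply Hf; rewrite Rmin_comm, Rmax_comm; auto).
    rewrite CInt_swap, Cmod_opp, Rabs_minus_sym, Rabs_right by (auto; lra).
    apply CInt_norm_le_const; [lra|auto|].
    + intros t Ht. apply H. rewrite Rmin_comm, Rmax_comm. apply le_seg; lra.
Qed.

Definition Rdiff (F : R -> C) (x : R) (l : C) : Prop :=
  is_derive (fun t => Re (F t)) x (Re l) /\ is_derive (fun t => Im (F t)) x (Im l).

Lemma CInt_FTC F f a b : cont_on_seg f a b ->
  (forall t, Rmin a b <= t <= Rmax a b -> Rdiff F t (f t)) -> CInt f a b = (F b - F a)%C.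
Proof.
  intros Hf H. unfold CInt.
  rewrite (is_RInt_unique (fun t => Re (f t)) a b (minus (Re (F b)) (Re (F a)))).
  2:{ apply (is_RInt_derive (fun t => Re (F t)) (fun t => Re (f t))); intros.
      - apply H; auto. - apply Rcont_Re; auto. }
  rewrite (is_RInt_unique (fun t => Im (f t)) a b (minus (Im (F b)) (Im (F a)))).
  2:{ apply (is_RInt_derive (fun t => Im (F t)) (fun t => Im (f t))); intros.
      - apply H; auto. - apply Rcont_Im; auto. }
  destruct (F b), (F a). reflexivity.
Qed.

Lemma Rdiff_of_slope G psi x : Rcont psi x ->
  (forall y, G y - G x = psi y * RtoC (y - x))%C -> Rdiff G x (psi x).
Proof.
  intros Hc E.
  assert (K : forall y, y <> x ->
    (Re (G y) - Re (G x)) / (y - x) = Re (psi y) /\ (Im (G y) - Im (G x)) / (y - x) = Im (psi y)).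
  { intros y Hy. assert (h := E y). destruct (G y) as [a b], (G x) as [c d], (psi y) as [u v].
    unfold Cminus, Cmult, Copp, Cplus, RtoC in h; simpl in h. injection h as h1 h2.
    unfold Re, Im; simpl. split.
    - replace (a - c) with (a + - c) by ring. rewrite h1. field. lra.
    - replace (b - d) with (b + - d) by ring. rewrite h2. field. lra. }
  split; apply is_derive_Reals; intros eps He; destruct (Hc eps He) as [d [Hd H]];
  exists (mkposreal d Hd); intros h Hh0 Hh; simpl in Hh;
  specialize (H (x + h)); unfold R_dist in H; replace (x + h - x) with h in H by ring; specialize (H Hh);
  destruct (K (x + h) ltac:(lra)) as [K1 K2]; replace (x + h - x) with h in K1, K2 by ring.
  - rewrite K1. eapply Rle_lt_trans; [apply Cmod_Re_sub|exact H].
  - rewrite K2. eapply Rle_lt_trans; [apply Cmod_Im_sub|exact H].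
Qed.

Lemma Rdiff_path F z u x l : Cdiff F (z + RtoC x * u)%C l ->
  Rdiff (fun t => F (z + RtoC t * u)%C) x (l * u)%C.
Proof.
  intros [phi [H1 [H2 H3]]].
  rewrite <- H2. apply (Rdiff_of_slope (fun t => F (z + RtoC t * u)%C) (fun t => phi (z + RtoC t * u) * u)%C).
  - apply cont_mult; [|apply cont_const]. apply (cont_comp _ (fun t => z + RtoC t * u)%C phi); auto.
    apply Rcont_affine.
  - intros y. rewrite H3. rewrite RtoC_minus. ring.
Qed.

Lemma hpath_eq t c : ((t, c) : C) = ((0, c) + RtoC t * RtoC 1)%C.
Proof. unfold RtoC, Cplus, Cmult; simpl. f_equal; ring. Qed.

Lemma vpath_eq t a : ((a, t) : C) = ((a, 0) + RtoC t * Ci)%C.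
Proof. unfold RtoC, Cplus, Cmult, Ci; simpl. f_equal; ring. Qed.

Lemma Rcont_hpath c t : Rcont (fun t => (t, c) : C) t.
Proof. apply cont_ext with (fun t => (0, c) + RtoC t * RtoC 1)%C; [intros; symmetry; apply hpath_eq|apply Rcont_affine]. Qed.

Lemma Rcont_vpath a t : Rcont (fun t => (a, t) : C) t.
Proof. apply cont_ext with (fun t => (a, 0) + RtoC t * Ci)%C; [intros; symmetry; apply vpath_eq|apply Rcont_affine]. Qed.

Lemma Rdiff_ext F G x l : (forall t, F t = G t) -> Rdiff F x l -> Rdiff G x l.
Proof.
  intros E [H1 H2]. split; (eapply is_derive_ext; [|eassumption]); intros t; simpl; rewrite E; reflexivity.
Qed.

Lemma Rdiff_hpath F x c l : Cdiff F (x, c) l -> Rdiff (fun t => F (t, c)) x l.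
Proof.
  intros H. apply Rdiff_ext with (fun t => F ((0, c) + RtoC t * RtoC 1)%C).
  - intros; rewrite <- hpath_eq; auto.
  - replace l with (l * RtoC 1)%C by ring. apply Rdiff_path. rewrite <- hpath_eq. auto.
Qed.

Lemma Rdiff_vpath F x a l : Cdiff F (a, x) l -> Rdiff (fun t => F (a, t)) x (Ci * l)%C.
Proof.
  intros H. apply Rdiff_ext with (fun t => F ((a, 0) + RtoC t * Ci)%C).
  - intros; rewrite <- vpath_eq; auto.
  - replace (Ci * l)%C with (l * Ci)%C by ring. apply Rdiff_path. rewrite <- vpath_eq. auto.
Qed.

(** * Integrals along the boundary of a rectangle *)

(** Counterclockwise: bottom, right, top, left; the factor [Ci] is dz = i dy on the vertical sides.
    Nothing requires ordered corners: exchanging a pair of opposite sides changes the sign. *)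
Definition RectInt (f : C -> C) (a b c d : R) : C :=
  (CInt (fun x => f (x, c)) a b + Ci * CInt (fun y => f (b, y)) c d
   - CInt (fun x => f (x, d)) a b - Ci * CInt (fun y => f (a, y)) c d)%C.

Definition in_rect (a b c d : R) (z : C) : Prop := a <= Re z <= b /\ c <= Im z <= d.

Definition cont_on_rect f a b c d := forall z, in_rect a b c d z -> Ccont f z.

Definition on_boundary (a b c d : R) (z : C) : Prop :=
  in_rect a b c d z /\ (Re z = a \/ Re z = b \/ Im z = c \/ Im z = d).

Definition cont_on_boundary f a b c d := forall z, on_boundary a b c d z -> Ccont f z.

Lemma cont_hseg f a b c : (forall x, Rmin a b <= x <= Rmax a b -> Ccont f (x, c)) ->
  cont_on_seg (fun x => f (x, c)) a b.
Proof. intros H t Ht. apply (cont_comp _ (fun x => (x, c) : C) f); [apply Rcont_hpath|auto]. Qed.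

Lemma cont_vseg f a c d : (forall y, Rmin c d <= y <= Rmax c d -> Ccont f (a, y)) ->
  cont_on_seg (fun y => f (a, y)) c d.
Proof. intros H t Ht. apply (cont_comp _ (fun x => (a, x) : C) f); [apply Rcont_vpath|auto]. Qed.

Section RectBasics.
Variables (a b c d : R).
Hypotheses (Hab : a <= b) (Hcd : c <= d).

Lemma boundary_sides f : cont_on_boundary f a b c d ->
  cont_on_seg (fun x => f (x, c)) a b /\ cont_on_seg (fun x => f (x, d)) a b /\
  cont_on_seg (fun y => f (a, y)) c d /\ cont_on_seg (fun y => f (b, y)) c d.
Proof.
  intros H. repeat split; (apply cont_hseg || apply cont_vseg); intros t Ht; apply seg_le in Ht; auto;
  apply H; repeat split; simpl; auto; try lra.
Qed.

Lemma RectInt_minus f g : cont_on_boundary f a b c d -> cont_on_boundary g a b c d ->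
  RectInt (fun z => f z - g z)%C a b c d = (RectInt f a b c d - RectInt g a b c d)%C.
Proof.
  intros Hf Hg. destruct (boundary_sides f Hf) as [F1 [F2 [F3 F4]]].
  destruct (boundary_sides g Hg) as [G1 [G2 [G3 G4]]].
  unfold RectInt. rewrite !CInt_minus; auto. ring.
Qed.

Lemma RectInt_scal k f : cont_on_boundary f a b c d ->
  RectInt (fun z => k * f z)%C a b c d = (k * RectInt f a b c d)%C.
Proof.
  intros Hf. destruct (boundary_sides f Hf) as [F1 [F2 [F3 F4]]].
  unfold RectInt. rewrite !CInt_scal; auto. ring.
Qed.

Lemma RectInt_ext f g : (forall z, on_boundary a b c d z -> f z = g z) ->
  RectInt f a b c d = RectInt g a b c d.
Proof.
  intros H. unfold RectInt.
  rewrite (CInt_ext (fun x => f (x, c)) (fun x => g (x, c))).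
  rewrite (CInt_ext (fun x => f (x, d)) (fun x => g (x, d))).
  rewrite (CInt_ext (fun x => f (a, x)) (fun x => g (a, x))).
  rewrite (CInt_ext (fun x => f (b, x)) (fun x => g (b, x))). reflexivity.
  all: intros t Ht; rewrite Rmin_left, Rmax_right in Ht by auto; apply H; repeat split; simpl; auto; lra.
Qed.

Lemma RectInt_norm_le f M : cont_on_boundary f a b c d ->
  (forall z, on_boundary a b c d z -> Cmod (f z) <= M) ->
  Cmod (RectInt f a b c d) <= M * (2 * ((b - a) + (d - c))).
Proof.
  intros Hf HM. destruct (boundary_sides f Hf) as [F1 [F2 [F3 F4]]].
  unfold RectInt.
  assert (B1 : Cmod (CInt (fun x => f (x, c)) a b) <= M * (b - a))
    by (apply CInt_norm_le_const; auto; intros; apply HM; repeat split; simpl; auto; lra).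
  assert (B2 : Cmod (CInt (fun x => f (x, d)) a b) <= M * (b - a))
    by (apply CInt_norm_le_const; auto; intros; apply HM; repeat split; simpl; auto; lra).
  assert (B3 : Cmod (CInt (fun x => f (a, x)) c d) <= M * (d - c))
    by (apply CInt_norm_le_const; auto; intros; apply HM; repeat split; simpl; auto; lra).
  assert (B4 : Cmod (CInt (fun x => f (b, x)) c d) <= M * (d - c))
    by (apply CInt_norm_le_const; auto; intros; apply HM; repeat split; simpl; auto; lra).
  eapply Rle_trans; [apply Cmod_sub_triangle|]. rewrite Cmod_mult, Cmod_Ci.
  eapply Rle_trans; [apply Rplus_le_compat_r, Cmod_sub_triangle|].
  eapply Rle_trans; [apply Rplus_le_compat_r, Rplus_le_compat_r, Cmod_triangle|].
  rewrite Cmod_mult, Cmod_Ci. lra.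
Qed.

Lemma RectInt_primitive F f : cont_on_boundary f a b c d ->
  (forall z, on_boundary a b c d z -> Cdiff F z (f z)) -> RectInt f a b c d = RtoC 0.
Proof.
  intros Hf HF. destruct (boundary_sides f Hf) as [F1 [F2 [F3 F4]]].
  unfold RectInt.
  rewrite (CInt_FTC (fun x => F (x, c)) (fun x => f (x, c))); auto.
  2:{ intros t Ht. apply Rdiff_hpath, HF. apply seg_le in Ht; auto. repeat split; simpl; auto; lra. }
  rewrite (CInt_FTC (fun x => F (x, d)) (fun x => f (x, d))); auto.
  2:{ intros t Ht. apply Rdiff_hpath, HF. apply seg_le in Ht; auto. repeat split; simpl; auto; lra. }
  rewrite <- !CInt_scal; auto.
  rewrite (CInt_FTC (fun x => F (b, x)) (fun x => Ci * f (b, x))%C).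
  2:{ apply cont_on_seg_scal; auto. }
  2:{ intros t Ht. apply Rdiff_vpath, HF. apply seg_le in Ht; auto. repeat split; simpl; auto; lra. }
  rewrite (CInt_FTC (fun x => F (a, x)) (fun x => Ci * f (a, x))%C).
  2:{ apply cont_on_seg_scal; auto. }
  2:{ intros t Ht. apply Rdiff_vpath, HF. apply seg_le in Ht; auto. repeat split; simpl; auto; lra. }
  ring.
Qed.

Lemma cont_rect_boundary f : cont_on_rect f a b c d -> cont_on_boundary f a b c d.
Proof. intros H z [Hz _]. auto. Qed.

Lemma RectInt_split_x f m : cont_on_rect f a b c d -> a <= m <= b ->
  (RectInt f a b c d = RectInt f a m c d + RectInt f m b c d)%C.
Proof.
  intros Hf Hm. unfold RectInt.
  rewrite <- (CInt_Chasles (fun x => f (x, c)) a m b).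
  rewrite <- (CInt_Chasles (fun x => f (x, d)) a m b). ring.
  all: apply cont_hseg; intros t Ht; apply seg_le in Ht; try lra; apply Hf; split; simpl; lra.
Qed.

Lemma RectInt_split_y f m : cont_on_rect f a b c d -> c <= m <= d ->
  (RectInt f a b c d = RectInt f a b c m + RectInt f a b m d)%C.
Proof.
  intros Hf Hm. unfold RectInt.
  rewrite <- (CInt_Chasles (fun x => f (a, x)) c m d).
  rewrite <- (CInt_Chasles (fun x => f (b, x)) c m d). ring.
  all: apply cont_vseg; intros t Ht; apply seg_le in Ht; try lra; apply Hf; split; simpl; lra.
Qed.
End RectBasics.

Lemma RectInt_degenerate_x f a c d : RectInt f a a c d = RtoC 0.
Proof. unfold RectInt. rewrite !CInt_point. ring. Qed.

Lemma RectInt_degenerate_y f a b c : RectInt f a b c c = RtoC 0.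
Proof. unfold RectInt. rewrite !CInt_point. ring. Qed.

Lemma RectInt_swap_x f a b c d : a <= b -> c <= d -> cont_on_boundary f a b c d ->
  RectInt f b a c d = (- RectInt f a b c d)%C.
Proof.
  intros Hab Hcd Hf. destruct (boundary_sides a b c d Hab Hcd f Hf) as [F1 [F2 [F3 F4]]].
  unfold RectInt. rewrite !(CInt_swap _ a b) by auto. ring.
Qed.

Lemma RectInt_swap_y f a b c d : a <= b -> c <= d -> cont_on_boundary f a b c d ->
  RectInt f a b d c = (- RectInt f a b c d)%C.
Proof.
  intros Hab Hcd Hf. destruct (boundary_sides a b c d Hab Hcd f Hf) as [F1 [F2 [F3 F4]]].
  unfold RectInt. rewrite !(CInt_swap _ c d) by auto. ring.
Qed.

(** * Bisection of a rectangle and Goursat's theorem *)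

Section Bisection.
Variables (P : R -> R -> R -> R -> R) (A B C0 D : R).
Hypotheses (HAB : A <= B) (HCD : C0 <= D).
Hypothesis Hsub : forall a b c d, A <= a -> a <= b -> b <= B -> C0 <= c -> c <= d -> d <= D ->
  P a b c d <= P a ((a + b) / 2) c ((c + d) / 2) + P ((a + b) / 2) b c ((c + d) / 2)
             + P a ((a + b) / 2) ((c + d) / 2) d + P ((a + b) / 2) b ((c + d) / 2) d.

(** As [P] is subadditive under quartering, some quarter keeps at least a fourth of it. The last
    quarter is taken by default when the other three fail the test, and [Hsub] then shows that it
    passes. *)
Definition quarter (r : (R * R) * (R * R)) : (R * R) * (R * R) :=
  let '((a, b), (c, d)) := r in
  let m := (a + b) / 2 in let k := (c + d) / 2 in
  if Rle_dec (P a b c d) (4 * P a m c k) then ((a, m), (c, k)) else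
  if Rle_dec (P a b c d) (4 * P m b c k) then ((m, b), (c, k)) else
  if Rle_dec (P a b c d) (4 * P a m k d) then ((a, m), (k, d)) else ((m, b), (k, d)).

Fixpoint quarters (n : nat) : (R * R) * (R * R) :=
  match n with O => ((A, B), (C0, D)) | S n => quarter (quarters n) end.

Lemma quarters_spec n : exists a b c d, quarters n = ((a, b), (c, d)) /\
  A <= a /\ a <= b /\ b <= B /\ C0 <= c /\ c <= d /\ d <= D /\
  b - a = (B - A) / 2 ^ n /\ d - c = (D - C0) / 2 ^ n /\ P A B C0 D <= 4 ^ n * P a b c d.
Proof.
  induction n as [|n IH].
  - exists A, B, C0, D. simpl. repeat split; try lra; auto.
  - destruct IH as [a [b [c [d [E [H1 [H2 [H3 [H4 [H5 [H6 [H7 [H8 H9]]]]]]]]]]]]].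
    assert (Hs := Hsub a b c d H1 H2 H3 H4 H5 H6).
    assert (E2 : forall x, x / 2 ^ S n = (x / 2 ^ n) / 2).
    { intros x. simpl. field. apply pow_nonzero; lra. }
    assert (Hp : 0 < 4 ^ n) by (apply pow_lt; lra).
    rewrite !E2, <- H7, <- H8.
    simpl quarters. rewrite E. unfold quarter.
    assert (F : forall v, P a b c d <= 4 * v -> P A B C0 D <= 4 ^ S n * v).
    { intros v Hv. simpl. apply Rle_trans with (4 ^ n * P a b c d); auto.
      replace (4 * 4 ^ n * v) with (4 ^ n * (4 * v)) by ring. apply Rmult_le_compat_l; lra. }
    destruct (Rle_dec _ _) as [h1|h1]; [|destruct (Rle_dec _ _) as [h2|h2]; [|destruct (Rle_dec _ _) as [h3|h3]]];
    do 4 eexists; (split; [reflexivity|]); repeat split; try lra; apply F; lra.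
Qed.

Lemma quarters_nested n : 
  fst (fst (quarters n)) <= fst (fst (quarters (S n))) /\ snd (fst (quarters (S n))) <= snd (fst (quarters n)) /\
  fst (snd (quarters n)) <= fst (snd (quarters (S n))) /\ snd (snd (quarters (S n))) <= snd (snd (quarters n)).
Proof.
  destruct (quarters_spec n) as [a [b [c [d [E [H1 [H2 [H3 [H4 [H5 [H6 _]]]]]]]]]]].
  simpl. rewrite E. unfold quarter. repeat (destruct (Rle_dec _ _)); simpl; lra.
Qed.
End Bisection.

Lemma nested_intervals_point (u v : nat -> R) :
  (forall n, u n <= u (S n)) -> (forall n, v (S n) <= v n) -> (forall n, u n <= v n) ->
  exists x, forall n, u n <= x <= v n.
Proof.
  intros Hu Hv Huv.
  assert (Mu : forall n m, (n <= m)%nat -> u n <= u m).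
  { intros n m H. induction H; [lra|]. specialize (Hu m). lra. }
  assert (Mv : forall n m, (n <= m)%nat -> v m <= v n).
  { intros n m H. induction H; [lra|]. specialize (Hv m). lra. }
  assert (Hcross : forall n m, u n <= v m).
  { intros n m. apply Rle_trans with (u (max n m)); [apply Mu; lia|].
    apply Rle_trans with (v (max n m)); [auto|apply Mv; lia]. }
  destruct (completeness (fun x => exists n, x = u n)) as [x [Hx1 Hx2]].
  - exists (v O). intros y [n ->]. auto.
  - exists (u O), O. auto.
  - exists x. intros n. split.
    + apply Hx1. exists n. auto.
    + apply Hx2. intros y [m ->]. auto.
Qed.

Lemma rect_bisection (P : R -> R -> R -> R -> R) A B C0 D : A <= B -> C0 <= D ->
  (forall a b c d, A <= a -> a <= b -> b <= B -> C0 <= c -> c <= d -> d <= D ->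
    P a b c d <= P a ((a + b) / 2) c ((c + d) / 2) + P ((a + b) / 2) b c ((c + d) / 2)
             + P a ((a + b) / 2) ((c + d) / 2) d + P ((a + b) / 2) b ((c + d) / 2) d) ->
  exists x y, A <= x <= B /\ C0 <= y <= D /\ forall n, exists a b c d,
    A <= a /\ a <= x <= b /\ b <= B /\ C0 <= c /\ c <= y <= d /\ d <= D /\
    b - a = (B - A) / 2 ^ n /\ d - c = (D - C0) / 2 ^ n /\ P A B C0 D <= 4 ^ n * P a b c d.
Proof.
  intros HAB HCD Hsub. set (s := quarters P A B C0 D).
  assert (S0 := quarters_spec P A B C0 D HAB HCD Hsub).
  assert (S1 := quarters_nested P A B C0 D HAB HCD Hsub).
  destruct (nested_intervals_point (fun n => fst (fst (s n))) (fun n => snd (fst (s n)))) as [x Hx].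
  { intros n. apply S1. } { intros n. apply S1. }
  { intros n. destruct (S0 n) as [a [b [c [d [E H]]]]]. unfold s. rewrite E. simpl. tauto. }
  destruct (nested_intervals_point (fun n => fst (snd (s n))) (fun n => snd (snd (s n)))) as [y Hy].
  { intros n. apply S1. } { intros n. apply S1. }
  { intros n. destruct (S0 n) as [a [b [c [d [E H]]]]]. unfold s. rewrite E. simpl. tauto. }
  exists x, y. split; [apply (Hx O)|]. split; [apply (Hy O)|].
  intros n. destruct (S0 n) as [a [b [c [d [E H]]]]].
  specialize (Hx n). specialize (Hy n). unfold s in Hx, Hy. rewrite E in Hx, Hy. simpl in Hx, Hy.
  exists a, b, c, d. tauto.
Qed.

Definition holo_on_rect f a b c d := forall z, in_rect a b c d z -> exists l, Cdiff f z l.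

Lemma holo_cont_rect f a b c d : holo_on_rect f a b c d -> cont_on_rect f a b c d.
Proof. intros H z Hz. destruct (H z Hz) as [l Hl]. eapply Cdiff_cont; eauto. Qed.

Lemma pow2_eventually_small s e : 0 < e -> exists n : nat, s / 2 ^ n < e.
Proof.
  intros He. destruct (Rle_dec s 0) as [h|h].
  - exists O. simpl. lra.
  - destruct (pow_lt_1_zero (/ 2) ltac:(rewrite Rabs_right; lra) (e / s)) as [n Hn].
    { apply Rdiv_lt_0_compat; lra. }
    exists n. specialize (Hn n (Nat.le_refl n)). rewrite Rabs_right in Hn.
    2:{ apply Rle_ge, pow_le; lra. }
    rewrite pow_inv in Hn. apply Rmult_lt_reg_r with (/ s); [apply Rinv_0_lt_compat; lra|].
    unfold Rdiv in *. replace (s * / 2 ^ n * / s) with (/ 2 ^ n); auto. field.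
    assert (0 < 2 ^ n) by (apply pow_lt; lra). split; lra.
Qed.

Lemma Cdiff_affine_primitive (p l z0 z : C) :
  Cdiff (fun w => p * w + l * ((w - z0) * (w - z0) * / 2))%C z (p + l * (z - z0)).
Proof.
  assert (H2 : (RtoC 2 <> RtoC 0)%C) by (intros h; apply RtoC_inj in h; lra).
  exists (fun w => p + l * ((w - z0) + (z - z0)) * / 2)%C. split; [|split].
  - apply cont_plus; [apply cont_const|]. apply cont_mult; [|apply cont_const].
    apply cont_mult; [apply cont_const|]. apply cont_plus; [|apply cont_const].
    apply cont_minus; [apply cont_id|apply cont_const].
  - field.
  - intros w. field.
Qed.

(* The affine part of [f] at the limit point of the bisection integrates to 0, and the
   remainder is small compared with (diameter) * (perimeter). *)
Theorem goursat f a b c d : a <= b -> c <= d -> holo_on_rect f a b c d -> RectInt f a b c d = RtoC 0.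
Proof.
  intros Hab Hcd Hf. assert (Hc := holo_cont_rect _ _ _ _ _ Hf).
  destruct (rect_bisection (fun a b c d => Cmod (RectInt f a b c d)) a b c d Hab Hcd)
    as [x [y [Hx [Hy Hn]]]].
  { intros a' b' c' d' H1 H2 H3 H4 H5 H6.
    assert (Hc' : forall u v w t, a <= u -> v <= b -> c <= w -> t <= d -> cont_on_rect f u v w t).
    { intros u v w t ? ? ? ? z [Hz1 Hz2]. apply Hc. split; lra. }
    rewrite (RectInt_split_x a' b' c' d' ltac:(lra) f ((a' + b') / 2)) by (try apply Hc'; lra).
    rewrite (RectInt_split_y a' ((a' + b') / 2) c' d' ltac:(lra) f ((c' + d') / 2)) by (try apply Hc'; lra).
    rewrite (RectInt_split_y ((a' + b') / 2) b' c' d' ltac:(lra) f ((c' + d') / 2)) by (try apply Hc'; lra).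
    eapply Rle_trans; [apply Cmod_triangle|].
    eapply Rle_trans; [apply Rplus_le_compat; apply Cmod_triangle|]. lra. }
  apply Cmod_eq_0. apply NNPP. intros Hne.
  set (I := Cmod (RectInt f a b c d)) in *.
  assert (HI : 0 < I) by (assert (h := Cmod_ge_0 (RectInt f a b c d)); fold I in h; lra).
  (* The added 1 keeps [s] positive for degenerate rectangles. With [eps = I / (4 s^2)] below, [4^n]
     times the final estimate equals [I / 2], which contradicts [I > 0]. *)
  set (s := (b - a) + (d - c) + 1).
  destruct (Hf (x, y) ltac:(split; simpl; lra)) as [l [phi [P1 [P2 P3]]]].
  set (eps := I / (4 * (s * s))).
  assert (Hs : 1 <= s) by (unfold s; lra).
  assert (Heps : 0 < eps) by (apply Rdiv_lt_0_compat; nra).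
  destruct (P1 eps Heps) as [dl [Hdl Hphi]].
  destruct (pow2_eventually_small s dl Hdl) as [n Hsn].
  destruct (Hn n) as [a' [b' [c' [d' [H1 [H2 [H3 [H4 [H5 [H6 [H7 [H8 H9]]]]]]]]]]]].
  assert (Hp : 0 < 2 ^ n) by (apply pow_lt; lra).
  assert (Hsz : (b' - a') + (d' - c') <= s / 2 ^ n).
  { rewrite H7, H8. unfold s, Rdiv. rewrite <- Rmult_plus_distr_r.
    apply Rmult_le_compat_r; [left; apply Rinv_0_lt_compat; auto|lra]. }
  set (z0 := (x, y) : C). set (A := fun w : C => (f z0 + l * (w - z0))%C).
  assert (CA : forall w, Ccont A w).
  { intros w. apply cont_plus; [apply cont_const|]. apply cont_mult; [apply cont_const|].
    apply cont_minus; [apply cont_id|apply cont_const]. }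
  assert (Cf : cont_on_boundary f a' b' c' d') by (intros z [[Hz1 Hz2] _]; apply Hc; split; lra).
  assert (CAb : cont_on_boundary A a' b' c' d') by (intros z _; apply CA).
  assert (RA : RectInt A a' b' c' d' = RtoC 0).
  { apply (RectInt_primitive a' b' c' d' ltac:(lra) ltac:(lra)
      (fun w => f z0 * w + l * ((w - z0) * (w - z0) * / 2))%C); auto.
    intros z _. apply Cdiff_affine_primitive. }
  assert (E : RectInt f a' b' c' d' = RectInt (fun z => f z - A z)%C a' b' c' d').
  { rewrite RectInt_minus; try lra; auto. rewrite RA. ring. }
  assert (Bd : Cmod (RectInt f a' b' c' d') <= (eps * (s / 2 ^ n)) * (2 * ((b' - a') + (d' - c')))).
  { rewrite E. apply RectInt_norm_le; try lra.
    - intros z Hz. apply cont_minus; auto.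
    - intros z [[Hz1 Hz2] _].
      assert (Hzd : Cmod (z - z0) <= s / 2 ^ n).
      { eapply Rle_trans; [apply Cmod_le_Re_Im|]. destruct z as [zx zy]. simpl in *.
        apply Rle_trans with ((b' - a') + (d' - c')); auto.
        apply Rplus_le_compat; apply Rabs_le; lra. }
      unfold A. replace (f z - (f z0 + l * (z - z0)))%C with ((phi z - l) * (z - z0))%C.
      2:{ unfold z0. rewrite <- P2. replace ((phi z - phi (x, y)) * (z - (x, y)))%C with (phi z * (z - (x, y)) - phi (x, y) * (z - (x, y)))%C by ring. rewrite <- P3. ring. }
      rewrite Cmod_mult. apply Rmult_le_compat; try apply Cmod_ge_0; auto.
      left. rewrite <- P2. apply Hphi. unfold Cdist. fold z0. lra. }
  assert (H0 : Cmod (RectInt f a' b' c' d') <= 2 * eps * (s / 2 ^ n) * (s / 2 ^ n)).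
  { eapply Rle_trans; [apply Bd|].
    assert (0 <= eps * (s / 2 ^ n)) by (apply Rmult_le_pos; [lra|]; apply Rlt_le, Rdiv_lt_0_compat; lra).
    nra. }
  assert (H10 : I <= 4 ^ n * (2 * eps * (s / 2 ^ n) * (s / 2 ^ n))).
  { eapply Rle_trans; [apply H9|]. apply Rmult_le_compat_l; auto. apply pow_le; lra. }
  replace (4 ^ n * (2 * eps * (s / 2 ^ n) * (s / 2 ^ n))) with (I / 2) in H10.
  - lra.
  - replace 4 with (2 * 2) by ring. rewrite Rpow_mult_distr. unfold eps. field. split; lra.
Qed.

Lemma in_rect_sub a b c d a' b' c' d' z : a <= a' -> b' <= b -> c <= c' -> d' <= d ->
  in_rect a' b' c' d' z -> in_rect a b c d z.
Proof. intros ? ? ? ? [? ?]. split; lra. Qed.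

(** Continuity bounds [f] near [z0], so a small rectangle around [z0], of perimeter at most [8 e],
    contributes [O(e)], and Goursat's theorem disposes of the four rectangles around it. Intended
    for difference quotients, which at their centre are only known to be continuous. *)
Theorem goursat_except f a b c d z0 : a <= b -> c <= d -> cont_on_rect f a b c d ->
  (forall z, in_rect a b c d z -> z <> z0 -> exists l, Cdiff f z l) ->
  RectInt f a b c d = RtoC 0.
Proof.
  intros Hab Hcd Hc Hf.
  destruct (classic (in_rect a b c d z0)) as [Hz|Hz].
  2:{ apply goursat; auto. intros z Hzr. apply Hf; auto. intros ->. auto. }
  destruct (Hc z0 Hz 1 ltac:(lra)) as [dl [Hdl HM]].
  set (M := Cmod (f z0) + 1).
  assert (HM0 : 0 < M) by (unfold M; assert (h := Cmod_ge_0 (f z0)); lra).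
  destruct z0 as [x0 y0]. destruct Hz as [Hzx Hzy]. simpl in Hzx, Hzy.
  assert (Main : forall e, 0 < e -> e < dl / 4 -> Cmod (RectInt f a b c d) <= M * (8 * e)).
  { intros e He1 He2.
    (* The small rectangle is clipped to the large one because [z0] may lie on or near the boundary;
       a clipped side leaves a degenerate rectangle, whose integral is 0. *)
    set (x1 := Rmax a (x0 - e)). set (x2 := Rmin b (x0 + e)).
    set (y1 := Rmax c (y0 - e)). set (y2 := Rmin d (y0 + e)).
    assert (Hx1 : a <= x1 <= x0 /\ x0 - e <= x1) by (unfold x1; split; [split; [apply Rmax_l|apply Rmax_lub; lra]|apply Rmax_r]).
    assert (Hx2 : x0 <= x2 <= b /\ x2 <= x0 + e) by (unfold x2; split; [split; [apply Rmin_glb; lra|apply Rmin_l]|apply Rmin_r]).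
    assert (Hy1 : c <= y1 <= y0 /\ y0 - e <= y1) by (unfold y1; split; [split; [apply Rmax_l|apply Rmax_lub; lra]|apply Rmax_r]).
    assert (Hy2 : y0 <= y2 <= d /\ y2 <= y0 + e) by (unfold y2; split; [split; [apply Rmin_glb; lra|apply Rmin_l]|apply Rmin_r]).
    assert (G : forall u v w t, a <= u -> u <= v -> v <= b -> c <= w -> w <= t -> t <= d ->
       (v < x0 \/ x0 < u \/ t < y0 \/ y0 < w) -> RectInt f u v w t = RtoC 0).
    { intros u v w t ? ? ? ? ? ? Ho. apply goursat; auto. intros z Hzr.
      apply Hf. { eapply in_rect_sub; [| | | |exact Hzr]; auto. }
      intros ->. destruct Hzr as [? ?]; simpl in *. lra. }
    assert (Cs : forall u v w t, a <= u -> v <= b -> c <= w -> t <= d -> cont_on_rect f u v w t).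
    { intros u v w t ? ? ? ? z Hzr. apply Hc. eapply in_rect_sub; [| | | |exact Hzr]; auto. }
    rewrite (RectInt_split_x a b c d Hcd f x1) by (auto; lra).
    rewrite (RectInt_split_x x1 b c d Hcd f x2) by (try apply Cs; lra).
    rewrite (RectInt_split_y x1 x2 c d ltac:(lra) f y1) by (try apply Cs; lra).
    rewrite (RectInt_split_y x1 x2 y1 d ltac:(lra) f y2) by (try apply Cs; lra).
    assert (Z1 : RectInt f a x1 c d = RtoC 0).
    { unfold x1, Rmax. destruct (Rle_dec a (x0 - e)); [|apply RectInt_degenerate_x]. apply G; lra. }
    assert (Z2 : RectInt f x2 b c d = RtoC 0).
    { unfold x2, Rmin. destruct (Rle_dec b (x0 + e)); [apply RectInt_degenerate_x|]. apply G; lra. }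
    assert (Z3 : RectInt f x1 x2 c y1 = RtoC 0).
    { unfold y1, Rmax. destruct (Rle_dec c (y0 - e)); [|apply RectInt_degenerate_y]. apply G; lra. }
    assert (Z4 : RectInt f x1 x2 y2 d = RtoC 0).
    { unfold y2, Rmin. destruct (Rle_dec d (y0 + e)); [apply RectInt_degenerate_y|]. apply G; lra. }
    rewrite Z1, Z2, Z3, Z4.
    match goal with |- Cmod ?u <= _ => replace u with (RectInt f x1 x2 y1 y2) by ring end.
    eapply Rle_trans.
    - apply (RectInt_norm_le x1 x2 y1 y2 ltac:(lra) ltac:(lra) f M).
      + apply cont_rect_boundary. apply Cs; lra.
      + intros z [[Hz1 Hz2] _]. specialize (HM z).
        assert (Hd : Cdist z (x0, y0) < dl).
        { unfold Cdist. eapply Rle_lt_trans; [apply Cmod_le_Re_Im|]. destruct z as [zx zy]; simpl in *.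
          apply Rle_lt_trans with (e + e); [|lra]. apply Rplus_le_compat; apply Rabs_le; lra. }
        specialize (HM Hd). assert (h := Cmod_sub_lower (f z) (f (x0, y0))). unfold M. lra.
    - apply Rmult_le_compat_l; lra. }
  apply Cmod_eq_0. apply NNPP. intros Hne.
  set (I := Cmod (RectInt f a b c d)) in *.
  assert (HI : 0 < I) by (assert (h := Cmod_ge_0 (RectInt f a b c d)); fold I in h; lra).
  set (e := Rmin (dl / 8) (I / (16 * M))).
  assert (He : 0 < e) by (apply Rmin_pos; [lra|apply Rdiv_lt_0_compat; lra]).
  assert (He2 : e <= dl / 8) by apply Rmin_l.
  assert (He3 : e <= I / (16 * M)) by apply Rmin_r.
  specialize (Main e He ltac:(lra)).
  assert (M * (8 * e) <= M * (8 * (I / (16 * M)))) by (apply Rmult_le_compat_l; lra).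
  replace (M * (8 * (I / (16 * M)))) with (I / 2) in * by (field; lra). lra.
Qed.

(** * Cauchy's integral formula on a rectangle *)

Definition strictly_inside (a b c d : R) (z : C) : Prop := a < Re z < b /\ c < Im z < d.

Lemma boundary_dist a b c d z : strictly_inside a b c d z -> exists dl, 0 < dl /\
  forall w, on_boundary a b c d w -> dl <= Cmod (w - z).
Proof.
  intros [Hx Hy].
  exists (Rmin (Rmin (Re z - a) (b - Re z)) (Rmin (Im z - c) (d - Im z))).
  split; [repeat apply Rmin_pos; lra|].
  intros w [[Hw1 Hw2] Hb].
  assert (H1 := Cmod_Re_sub w z). assert (H2 := Cmod_Im_sub w z).
  assert (M1 := Rmin_l (Rmin (Re z - a) (b - Re z)) (Rmin (Im z - c) (d - Im z))).
  assert (M2 := Rmin_r (Rmin (Re z - a) (b - Re z)) (Rmin (Im z - c) (d - Im z))).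
  assert (M3 := Rmin_l (Re z - a) (b - Re z)). assert (M4 := Rmin_r (Re z - a) (b - Re z)).
  assert (M5 := Rmin_l (Im z - c) (d - Im z)). assert (M6 := Rmin_r (Im z - c) (d - Im z)).
  destruct Hb as [E|[E|[E|E]]]; rewrite E in *.
  - rewrite Rabs_left in H1; lra.
  - rewrite Rabs_right in H1; lra.
  - rewrite Rabs_left in H2; lra.
  - rewrite Rabs_right in H2; lra.
Qed.

Lemma seg_bounded f a b : a <= b -> cont_on_seg f a b -> exists M, forall t, a <= t <= b -> Cmod (f t) <= M.
Proof.
  intros Hab Hf. destruct (continuity_ab_maj (fun t => Cmod (f t)) a b Hab) as [x [Hx _]].
  - intros t Ht eps He. destruct (Hf t (le_seg _ _ _ Hab Ht) eps He) as [d [Hd H]].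
    exists d. split; auto. intros y [_ Hy]. specialize (H y Hy).
    eapply Rle_lt_trans; [|exact H]. simpl. unfold R_dist. apply Rabs_le.
    assert (h1 := Cmod_sub_lower (f y) (f t)). assert (h2 := Cmod_sub_lower (f t) (f y)).
    rewrite Cmod_sub_comm in h2. lra.
  - exists (Cmod (f x)). auto.
Qed.

Lemma boundary_bounded f a b c d : a <= b -> c <= d -> cont_on_boundary f a b c d ->
  exists M, 0 < M /\ forall z, on_boundary a b c d z -> Cmod (f z) <= M.
Proof.
  intros Hab Hcd Hf. destruct (boundary_sides a b c d Hab Hcd f Hf) as [F1 [F2 [F3 F4]]].
  destruct (seg_bounded _ _ _ Hab F1) as [M1 H1]. destruct (seg_bounded _ _ _ Hab F2) as [M2 H2].
  destruct (seg_bounded _ _ _ Hcd F3) as [M3 H3]. destruct (seg_bounded _ _ _ Hcd F4) as [M4 H4].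
  exists (Rabs M1 + Rabs M2 + Rabs M3 + Rabs M4 + 1).
  assert (A1 := Rle_abs M1). assert (A2 := Rle_abs M2). assert (A3 := Rle_abs M3). assert (A4 := Rle_abs M4).
  assert (B1 := Rabs_pos M1). assert (B2 := Rabs_pos M2). assert (B3 := Rabs_pos M3). assert (B4 := Rabs_pos M4).
  split; [lra|].
  intros [x y] [[Hx Hy] Hb]; simpl in *. destruct Hb as [E|[E|[E|E]]]; subst.
  - specialize (H3 y Hy). lra.
  - specialize (H4 y Hy). lra.
  - specialize (H1 x Hx). lra.
  - specialize (H2 x Hx). lra.
Qed.

Lemma Cmod_neq_0 (z : C) : 0 < Cmod z -> z <> RtoC 0.
Proof. apply Cmod_gt_0. Qed.

Lemma cont_shift z w : Ccont (fun v => v - z)%C w.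
Proof. apply cont_minus; [apply cont_id|apply cont_const]. Qed.

Lemma Cdiff_shift z w : Cdiff (fun v => v - z)%C w 1.
Proof.
  replace (RtoC 1) with (RtoC 1 - RtoC 0)%C by ring. apply Cdiff_minus; [apply Cdiff_id|apply Cdiff_const].
Qed.

Lemma sub_neq_0 (w z : C) : w <> z -> (w - z <> RtoC 0)%C.
Proof. intros H h. apply H. replace w with (w - z + z)%C by ring. rewrite h. ring. Qed.

Section CauchyFormula.
Variables (a b c d : R).
Hypotheses (Hab : a <= b) (Hcd : c <= d).

Lemma cont_kernel phi z : cont_on_boundary phi a b c d -> strictly_inside a b c d z ->
  cont_on_boundary (fun w => phi w / (w - z))%C a b c d /\
  cont_on_boundary (fun w => phi w / ((w - z) * (w - z)))%C a b c d /\
  cont_on_boundary (fun w => phi w / ((w - z) * (w - z) * (w - z)))%C a b c d.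
Proof.
  intros Hphi Hz. destruct (boundary_dist _ _ _ _ _ Hz) as [dl [Hdl Hd]].
  assert (Hn : forall w, on_boundary a b c d w -> (w - z <> RtoC 0)%C).
  { intros w Hw. apply Cmod_neq_0. specialize (Hd w Hw). lra. }
  repeat split; intros w Hw; (apply cont_mult; [auto|apply cont_inv]);
  repeat apply Cmult_neq_0; auto; repeat apply cont_mult; apply cont_shift.
Qed.

(** Goursat's theorem, with [z] as exceptional point, for the slope function of [f] at [z]. The
    integral of [1 / (w - z)] stays as a factor, so its value [2 pi i] is never computed. *)
Theorem cauchy_rect f z : holo_on_rect f a b c d -> strictly_inside a b c d z ->
  (RectInt (fun w => f w / (w - z)) a b c d = f z * RectInt (fun w => RtoC 1 / (w - z)) a b c d)%C.
Proof.
  intros Hf Hz. 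
  assert (Hzr : in_rect a b c d z) by (destruct Hz; split; lra).
  assert (Hcf := holo_cont_rect _ _ _ _ _ Hf).
  destruct (Hf z Hzr) as [l [phi [P1 [P2 P3]]]].
  destruct (boundary_dist _ _ _ _ _ Hz) as [dl [Hdl Hd]].
  assert (Hn : forall w, on_boundary a b c d w -> (w - z <> RtoC 0)%C).
  { intros w Hw. apply Cmod_neq_0. specialize (Hd w Hw). lra. }
  assert (Ephi : forall w, w <> z -> phi w = ((f w - f z) / (w - z))%C).
  { intros w Hw. rewrite P3. field. apply sub_neq_0; auto. }
  assert (Dphi : forall w, in_rect a b c d w -> w <> z -> exists l, Cdiff phi w l).
  { intros w Hw Hwz. destruct (Hf w Hw) as [m Hm].
    eexists. apply (Cdiff_ext_near (fun v => (f v - f z) * / (v - z))%C phi w _ (Cmod (w - z))).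
    - apply Cmod_gt_0, sub_neq_0; auto.
    - intros v Hv. symmetry. apply Ephi. intros ->. unfold Cdist in Hv. rewrite Cmod_sub_comm in Hv. lra.
    - apply (Cdiff_mult (fun v => f v - f z)%C (fun v => / (v - z))%C).
      + apply Cdiff_minus; [exact Hm|apply Cdiff_const].
      + apply (Cdiff_inv (fun v => v - z)%C); [apply sub_neq_0; auto|apply Cdiff_shift]. }
  assert (G : RectInt phi a b c d = RtoC 0).
  { apply goursat_except with z; auto. intros w Hw. destruct (classic (w = z)) as [->|h]; auto.
    destruct (Dphi w Hw h) as [m Hm]. eapply Cdiff_cont; eauto. }
  rewrite (RectInt_ext a b c d Hab Hcd phi (fun w => f w / (w - z) - f z * (RtoC 1 / (w - z)))%C) in G.
  2:{ intros w Hw. rewrite Ephi. field; auto. intros ->. apply (Hn z Hw). ring. }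
  destruct (cont_kernel f z (cont_rect_boundary _ _ _ _ _ Hcf) Hz) as [K1 _].
  destruct (cont_kernel (fun _ => RtoC 1) z (fun w _ => cont_const _ _ _) Hz) as [K2 _].
  rewrite RectInt_minus, RectInt_scal in G; auto.
  2:{ intros w Hw. apply cont_mult; [apply cont_const|apply K2; auto]. }
  replace (RectInt (fun w => f w / (w - z)) a b c d)%C with
    (RectInt (fun w => f w / (w - z)) a b c d - f z * RectInt (fun w => RtoC 1 / (w - z)) a b c d
     + f z * RectInt (fun w => RtoC 1 / (w - z)) a b c d)%C by ring.
  rewrite G. ring.
Qed.

(** The distance hypothesis is tested at the four projections of [z] onto the sides. *)
Lemma strictly_inside_near z dl h : (forall w, on_boundary a b c d w -> dl <= Cmod (w - z)) ->
  strictly_inside a b c d z -> Cmod h < dl -> strictly_inside a b c d (z + h).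
Proof.
  intros Hd [Hx Hy] Hh.
  assert (B : forall w, on_boundary a b c d w -> dl <= Cmod (w - z)) by exact Hd.
  assert (H1 := re_le_Cmod h). assert (H2 := Rabs_Im_le_Cmod h).
  assert (E1 : Rabs (Re h) < dl) by lra. assert (E2 : Rabs (Im h) < dl) by lra.
  apply Rabs_def2 in E1. apply Rabs_def2 in E2.
  destruct z as [x y]. destruct h as [hx hy]. simpl in *.
  assert (Q : forall u, Cmod (u, 0)%R = Rabs u) by (intros u; apply (Cmod_R u)).
  assert (Q' : forall u, Cmod (0, u)%R = Rabs u).
  { intros u. unfold Cmod; simpl. replace (0 * (0 * 1) + u * (u * 1)) with (u²) by (unfold Rsqr; ring). apply sqrt_Rsqr_abs. }
  assert (D1 := B (a, y) ltac:(split; [split; simpl; lra|auto])).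
  assert (D2 := B (b, y) ltac:(split; [split; simpl; lra|auto])).
  assert (D3 := B (x, c) ltac:(split; [split; simpl; lra|auto])).
  assert (D4 := B (x, d) ltac:(split; [split; simpl; lra|auto])).
  unfold Cminus, Cplus, Copp in *; simpl in *.
  replace (y + - y) with 0 in * by ring. replace (x + - x) with 0 in * by ring.
  rewrite Q in D1, D2. rewrite Q' in D3, D4.
  rewrite Rabs_left in D1 by lra. rewrite Rabs_right in D2 by lra.
  rewrite Rabs_left in D3 by lra. rewrite Rabs_right in D4 by lra.
  split; simpl; lra.
Qed.

(** Differentiation under the integral sign: [k 0] is a kernel depending on [z], [k 1] its
    derivative in [z], and a quadratic remainder uniform on the boundary passes through the
    integral. It serves for the kernels [1 / (w - z)] and [1 / (w - z)^2]. *)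
Lemma Cdiff_RectInt (k : nat -> C -> C -> C) K phi z dl : 0 < dl ->
  cont_on_boundary phi a b c d -> strictly_inside a b c d z ->
  (forall w, on_boundary a b c d w -> dl <= Cmod (w - z)) ->
  (forall z, strictly_inside a b c d z -> cont_on_boundary (fun w => phi w * k O w z)%C a b c d) ->
  (forall z, strictly_inside a b c d z -> cont_on_boundary (fun w => phi w * k 1%nat w z)%C a b c d) ->
  (forall w h, on_boundary a b c d w -> Cmod h < dl / 2 ->
     Cmod (k O w (z + h) - k O w z - h * k 1%nat w z) <= K * (Cmod h * Cmod h))%C ->
  Cdiff (fun z => RectInt (fun w => phi w * k O w z) a b c d)%C z
    (RectInt (fun w => phi w * k 1%nat w z) a b c d)%C.
Proof.
  intros Hdl Hphi Hz Hd C0 C1 Hk.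
  destruct (boundary_bounded phi a b c d Hab Hcd Hphi) as [M [HM0 HM]].
  apply Cdiff_of_quadratic with (M * K * (2 * ((b - a) + (d - c)))) (dl / 2); [lra|].
  intros h Hh.
  assert (Hzh : strictly_inside a b c d (z + h)) by (apply strictly_inside_near with dl; auto; lra).
  assert (Cd : cont_on_boundary (fun w => phi w * k O w (z + h) - phi w * k O w z)%C a b c d).
  { intros w Hw. apply cont_minus; [apply (C0 _ Hzh w Hw)|apply (C0 _ Hz w Hw)]. }
  assert (Ce : cont_on_boundary (fun w => h * (phi w * k 1%nat w z))%C a b c d).
  { intros w Hw. apply cont_mult; [apply cont_const|apply (C1 _ Hz w Hw)]. }
  replace (RectInt (fun w => phi w * k O w (z + h)) a b c d - RectInt (fun w => phi w * k O w z) a b c d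
     - RectInt (fun w => phi w * k 1%nat w z) a b c d * h)%C with
    (RectInt (fun w => phi w * k O w (z + h) - phi w * k O w z - h * (phi w * k 1%nat w z)) a b c d)%C.
  2:{ rewrite (RectInt_minus a b c d Hab Hcd (fun w => phi w * k O w (z + h) - phi w * k O w z)%C); auto.
      rewrite RectInt_minus, RectInt_scal; auto. ring. }
  replace (M * K * (2 * ((b - a) + (d - c))) * (Cmod h * Cmod h)) with
    ((M * (K * (Cmod h * Cmod h))) * (2 * ((b - a) + (d - c)))) by ring.
  apply RectInt_norm_le; auto.
  - intros w Hw. apply cont_minus; [apply (Cd w Hw)|apply (Ce w Hw)].
  - intros w Hw.
    replace (phi w * k O w (z + h) - phi w * k O w z - h * (phi w * k 1%nat w z))%C with
      (phi w * (k O w (z + h) - k O w z - h * k 1%nat w z))%C by ring.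
    rewrite Cmod_mult. apply Rmult_le_compat; auto; apply Cmod_ge_0.
Qed.

Lemma Cmod_inv_le (u : C) dl : 0 < dl -> dl <= Cmod u -> Cmod (/ u) <= / dl.
Proof.
  intros H1 H2. rewrite Cmod_inv by (apply Cmod_neq_0; lra). apply Rinv_le_contravar; auto.
Qed.

Lemma Cdiff_cauchy1 phi z : cont_on_boundary phi a b c d -> strictly_inside a b c d z ->
  Cdiff (fun z => RectInt (fun w => phi w / (w - z)) a b c d)%C z
    (RectInt (fun w => phi w / ((w - z) * (w - z))) a b c d)%C.
Proof.
  intros Hphi Hz. destruct (boundary_dist _ _ _ _ _ Hz) as [dl [Hdl Hd]].
  apply (Cdiff_RectInt (fun n w z => match n with O => / (w - z) | _ => / ((w - z) * (w - z)) end)%C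
     (/ dl * / dl * / (dl / 2)) phi z dl); auto.
  - intros z' Hz'. apply cont_kernel; auto.
  - intros z' Hz'. apply cont_kernel; auto.
  - intros w h Hw Hh. specialize (Hd w Hw). set (u := (w - z)%C) in *.
    replace (w - (z + h))%C with (u - h)%C by (unfold u; ring).
    assert (Hu : u <> RtoC 0) by (apply Cmod_neq_0; lra).
    assert (Huh' : dl / 2 <= Cmod (u - h)) by (assert (q := Cmod_sub_lower u h); lra).
    assert (Huh : (u - h)%C <> RtoC 0) by (apply Cmod_neq_0; lra).
    replace (/ (u - h) - / u - h * / (u * u))%C with ((/ u * / u * / (u - h)) * (h * h))%C by (field; auto).
    rewrite !Cmod_mult. apply Rmult_le_compat_r; [apply Rmult_le_pos; apply Cmod_ge_0|].
    assert (I1 := Cmod_inv_le u dl Hdl Hd). assert (I2 := Cmod_inv_le (u - h) (dl / 2) ltac:(lra) Huh').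
    repeat apply Rmult_le_compat; auto; try apply Rmult_le_pos; apply Cmod_ge_0.
Qed.

Lemma Cdiff_cauchy2 phi z : cont_on_boundary phi a b c d -> strictly_inside a b c d z ->
  exists l, Cdiff (fun z => RectInt (fun w => phi w / ((w - z) * (w - z))) a b c d)%C z l.
Proof.
  intros Hphi Hz. destruct (boundary_dist _ _ _ _ _ Hz) as [dl [Hdl Hd]]. eexists.
  apply (Cdiff_RectInt (fun n w z => match n with O => / ((w - z) * (w - z)) | _ => / ((w - z) * (w - z) * (w - z)) * RtoC 2 end)%C
     (3 * (/ dl * / dl * / (dl / 2) * / (dl / 2)) + 2 * (/ dl * / dl * / dl * / (dl / 2))) phi z dl); auto.
  - intros z' Hz'. apply cont_kernel; auto.
  - intros z' Hz' w Hw. apply cont_ext with (fun w => (phi w / ((w - z') * (w - z') * (w - z'))) * RtoC 2)%C.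
    { intros v. unfold Cdiv. ring. }
    apply cont_mult; [|apply cont_const]. apply (cont_kernel phi z' Hphi Hz'); auto.
  - intros w h Hw Hh. specialize (Hd w Hw). set (u := (w - z)%C) in *.
    replace (w - (z + h))%C with (u - h)%C by (unfold u; ring).
    assert (Hu : u <> RtoC 0) by (apply Cmod_neq_0; lra).
    assert (Huh' : dl / 2 <= Cmod (u - h)) by (assert (q := Cmod_sub_lower u h); lra).
    assert (Huh : (u - h)%C <> RtoC 0) by (apply Cmod_neq_0; lra).
    replace (/ ((u - h) * (u - h)) - / (u * u) - h * (/ (u * u * u) * RtoC 2))%C with
      ((RtoC 1 * (/ u * / u * / (u - h) * / (u - h)) + RtoC 2 * (/ u * / u * / u * / (u - h))) * (h * h))%C
      by (field; auto).
    rewrite Cmod_mult, Cmod_mult. apply Rmult_le_compat_r; [apply Rmult_le_pos; apply Cmod_ge_0|].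
    assert (I1 := Cmod_inv_le u dl Hdl Hd). assert (I2 := Cmod_inv_le (u - h) (dl / 2) ltac:(lra) Huh').
    eapply Rle_trans; [apply Cmod_triangle|].
    rewrite !Cmod_mult, !Cmod_R. rewrite (Rabs_right 2), (Rabs_right 1) by lra.
    assert (D : 0 < / dl) by (apply Rinv_0_lt_compat; auto). assert (D' : 0 < / (dl / 2)) by (apply Rinv_0_lt_compat; lra).
    apply Rplus_le_compat.
    + apply Rmult_le_compat; try lra.
      { repeat apply Rmult_le_pos; apply Cmod_ge_0. }
      repeat apply Rmult_le_compat; auto; repeat apply Rmult_le_pos; apply Cmod_ge_0.
    + apply Rmult_le_compat_l; [lra|].
      repeat apply Rmult_le_compat; auto; repeat apply Rmult_le_pos; apply Cmod_ge_0.
Qed.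

(** This integral is the derivative in [z] of the winding integral; it vanishes because its
    integrand has the primitive [- 1 / (w - z)]. *)
Lemma winding_const z : strictly_inside a b c d z ->
  RectInt (fun w => RtoC 1 / ((w - z) * (w - z)))%C a b c d = RtoC 0.
Proof.
  intros Hz. destruct (boundary_dist _ _ _ _ _ Hz) as [dl [Hdl Hd]].
  assert (Hn : forall w, on_boundary a b c d w -> (w - z <> RtoC 0)%C).
  { intros w Hw. apply Cmod_neq_0. specialize (Hd w Hw). lra. }
  apply RectInt_primitive with (fun w => - / (w - z))%C; auto.
  - apply (cont_kernel (fun _ => RtoC 1) z); auto. intros w _. apply cont_const.
  - intros w Hw. replace (RtoC 1 / ((w - z) * (w - z)))%C with (- (- RtoC 1 / ((w - z) * (w - z))))%C by (field; auto).
    apply Cdiff_opp. apply (Cdiff_inv (fun v => v - z)%C); auto. apply Cdiff_shift.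
Qed.
End CauchyFormula.

(** * Winding integrals, Cauchy's estimate and differentiability of the derivative *)

Definition in_square (z : C) (rho : R) : C -> Prop :=
  in_rect (Re z - rho) (Re z + rho) (Im z - rho) (Im z + rho).

Definition SquareInt (f : C -> C) (z : C) (rho : R) : C :=
  RectInt f (Re z - rho) (Re z + rho) (Im z - rho) (Im z + rho).

Lemma RInt_lower (g : R -> R) a b m : a <= b -> ex_RInt g a b ->
  (forall t, a < t < b -> m <= g t) -> m * (b - a) <= RInt g a b.
Proof.
  intros Hab Hg H. replace (m * (b - a)) with (RInt (fun _ => m) a b).
  - apply RInt_le; auto. apply ex_RInt_const.
  - rewrite RInt_const. unfold scal; simpl. unfold mult; simpl. ring.
Qed.

Lemma inv_kernel_bound u rho : 0 < rho -> - rho < u < rho -> / (2 * rho) <= rho / (u * u + rho * rho).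
Proof.
  intros H1 H2. assert (Hp : 0 < u * u + rho * rho) by nra.
  apply Rmult_le_reg_r with ((2 * rho) * (u * u + rho * rho)); [apply Rmult_lt_0_compat; lra|].
  replace (/ (2 * rho) * (2 * rho * (u * u + rho * rho))) with (u * u + rho * rho) by (field; lra).
  replace (rho / (u * u + rho * rho) * (2 * rho * (u * u + rho * rho))) with (2 * (rho * rho)) by (field; nra).
  nra.
Qed.

Lemma CInt_Re f a b : Re (CInt f a b) = RInt (fun t => Re (f t)) a b.
Proof. reflexivity. Qed.

Lemma CInt_Im f a b : Im (CInt f a b) = RInt (fun t => Im (f t)) a b.
Proof. reflexivity. Qed.

(** A substitute for the value [2 pi]: each side contributes the integral of
    [rho / (u^2 + rho^2) >= 1 / (2 rho)] over a length [2 rho], hence at least 1. *)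
Lemma winding_ge_4 z rho : 0 < rho -> 4 <= Im (SquareInt (fun w => RtoC 1 / (w - z))%C z rho).
Proof.
  intros Hr. destruct z as [x y]. unfold SquareInt. change (Re (x, y)) with x. change (Im (x, y)) with y.
  assert (Hz : strictly_inside (x - rho) (x + rho) (y - rho) (y + rho) (x, y)) by (split; simpl; lra).
  destruct (cont_kernel (x - rho) (x + rho) (y - rho) (y + rho) (fun _ => RtoC 1) (x, y)
    (fun w _ => cont_const _ _ _) Hz) as [K _].
  destruct (boundary_sides (x - rho) (x + rho) (y - rho) (y + rho) ltac:(lra) ltac:(lra) _ K) as [F1 [F2 [F3 F4]]].
  assert (E : forall p q, (RtoC 1 / ((p, q) - (x, y)))%C = ((p - x) / ((p - x)^2 + (q - y)^2), - (q - y) / ((p - x)^2 + (q - y)^2))).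
  { intros p q. unfold Cdiv, Cinv, Cminus, Cplus, Copp, Cmult, RtoC; simpl. f_equal; unfold Rdiv, Rminus; ring. }
  unfold RectInt.
  set (I1 := CInt (fun t => (RtoC 1 / ((t, (y - rho)%R) - (x, y)))%C) (x - rho) (x + rho)).
  set (I2 := CInt (fun t => (RtoC 1 / (((x + rho)%R, t) - (x, y)))%C) (y - rho) (y + rho)).
  set (I3 := CInt (fun t => (RtoC 1 / ((t, (y + rho)%R) - (x, y)))%C) (x - rho) (x + rho)).
  set (I4 := CInt (fun t => (RtoC 1 / (((x - rho)%R, t) - (x, y)))%C) (y - rho) (y + rho)).
  replace (Im (I1 + Ci * I2 - I3 - Ci * I4)%C) with (Im I1 + Re I2 - Im I3 - Re I4).
  2:{ destruct I1, I2, I3, I4. simpl. ring. }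
  assert (one : / (2 * rho) * (x + rho - (x - rho)) = 1) by (field; lra).
  assert (one' : / (2 * rho) * (y + rho - (y - rho)) = 1) by (field; lra).
  assert (B1 : 1 <= Im I1).
  { unfold I1. rewrite CInt_Im. eapply Rle_trans; [right; symmetry; exact one|]. apply RInt_lower; [lra|apply ex_RInt_Im; exact F1|].
    intros t Ht. rewrite E. simpl Im. eapply Rle_trans; [apply (inv_kernel_bound (t - x) rho Hr); lra|].
    right. unfold Rdiv. apply f_equal2; [ring|apply f_equal; ring]. }
  assert (B2 : 1 <= Re I2).
  { unfold I2. rewrite CInt_Re. eapply Rle_trans; [right; symmetry; exact one'|]. apply RInt_lower; [lra|apply ex_RInt_Re; exact F4|].
    intros t Ht. rewrite E. simpl Re. eapply Rle_trans; [apply (inv_kernel_bound (t - y) rho Hr); lra|].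
    right. unfold Rdiv. apply f_equal2; [ring|apply f_equal; ring]. }
  assert (B3 : 1 <= - Im I3).
  { unfold I3. replace (CInt (fun t => (RtoC 1 / ((t, (y + rho)%R) - (x, y)))%C) (x - rho) (x + rho)) with
      (- CInt (fun t => - RtoC 1 * (RtoC 1 / ((t, (y + rho)%R) - (x, y))))%C (x - rho) (x + rho))%C.
    2:{ rewrite CInt_scal; [ring|exact F2]. }
    match goal with |- 1 <= - Im (- ?u)%C => replace (- Im (- u)%C) with (Im u) by (destruct u; simpl; ring) end.
    rewrite CInt_Im. eapply Rle_trans; [right; symmetry; exact one|]. apply RInt_lower; [lra| |].
    - apply (ex_RInt_Im (fun t => - RtoC 1 * (RtoC 1 / ((t, (y + rho)%R) - (x, y))))%C).
      apply cont_on_seg_scal. exact F2.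
    - intros t Ht. eapply Rle_trans; [apply (inv_kernel_bound (t - x) rho Hr); lra|].
      right. match goal with |- _ = Im ?u => replace u with (- (RtoC 1 / ((t, (y + rho)%R) - (x, y))))%C by (unfold Cdiv; ring) end.
      rewrite E. simpl. unfold Rdiv.
      match goal with |- _ = - (_ * / ?D) => match goal with |- _ * / ?D' = _ => replace D with D' by ring end end. ring. }
  assert (B4 : 1 <= - Re I4).
  { unfold I4. replace (CInt (fun t => (RtoC 1 / (((x - rho)%R, t) - (x, y)))%C) (y - rho) (y + rho)) with
      (- CInt (fun t => - RtoC 1 * (RtoC 1 / (((x - rho)%R, t) - (x, y))))%C (y - rho) (y + rho))%C.
    2:{ rewrite CInt_scal; [ring|exact F3]. }
    match goal with |- 1 <= - Re (- ?u)%C => replace (- Re (- u)%C) with (Re u) by (destruct u; simpl; ring) end.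
    rewrite CInt_Re. eapply Rle_trans; [right; symmetry; exact one'|]. apply RInt_lower; [lra| |].
    - apply (ex_RInt_Re (fun t => - RtoC 1 * (RtoC 1 / (((x - rho)%R, t) - (x, y))))%C).
      apply cont_on_seg_scal. exact F3.
    - intros t Ht. eapply Rle_trans; [apply (inv_kernel_bound (t - y) rho Hr); lra|].
      right. match goal with |- _ = Re ?u => replace u with (- (RtoC 1 / (((x - rho)%R, t) - (x, y))))%C by (unfold Cdiv; ring) end.
      rewrite E. simpl. unfold Rdiv.
      match goal with |- _ = - (_ * / ?D) => match goal with |- _ * / ?D' = _ => replace D with D' by ring end end. ring. }
  lra.
Qed.

(** Selected by choice so that the derivative is a total function; meaningful only where some [l]
    satisfies [Cdiff f z l]. *)
Definition Cder (f : C -> C) (z : C) : C := epsilon (inhabits (RtoC 0)) (Cdiff f z).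

Lemma Cder_spec f z : (exists l, Cdiff f z l) -> Cdiff f z (Cder f z).
Proof. intros H. exact (epsilon_spec (inhabits (RtoC 0)) (Cdiff f z) H). Qed.

Lemma Cder_eq f z l : Cdiff f z l -> Cder f z = l.
Proof. intros H. eapply Cdiff_unique; [|exact H]. apply Cder_spec. eauto. Qed.

Definition holo_on_square f z rho := forall w, in_square z rho w -> exists l, Cdiff f w l.

(** Cauchy's formula is differentiated in the interior point. The winding integral has derivative 0,
    so the product rule leaves only the term with [f']. *)
Lemma Cder_cauchy f z rho z' : 0 < rho -> holo_on_square f z rho ->
  strictly_inside (Re z - rho) (Re z + rho) (Im z - rho) (Im z + rho) z' ->
  (Cder f z' * SquareInt (fun w => RtoC 1 / (w - z')) z rho = SquareInt (fun w => f w / ((w - z') * (w - z'))) z rho)%C.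
Proof.
  intros Hr Hf Hz'. unfold SquareInt.
  set (a := Re z - rho) in *. set (b := Re z + rho) in *. set (c := Im z - rho) in *. set (d := Im z + rho) in *.
  assert (Hab : a <= b) by (unfold a, b; lra). assert (Hcd : c <= d) by (unfold c, d; lra).
  assert (Hb : cont_on_boundary f a b c d) by (apply cont_rect_boundary, holo_cont_rect; exact Hf).
  assert (H1 := Cdiff_cauchy1 a b c d Hab Hcd f z' Hb Hz').
  assert (H2 := Cdiff_cauchy1 a b c d Hab Hcd (fun _ => RtoC 1) z' (fun w _ => cont_const _ _ _) Hz').
  rewrite winding_const in H2; auto.
  assert (H3 : Cdiff f z' (Cder f z')) by (apply Cder_spec, Hf; destruct Hz'; split; unfold a, b, c, d in *; lra).
  assert (H4 := Cdiff_mult _ _ _ _ _ H3 H2).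
  destruct (boundary_dist _ _ _ _ _ Hz') as [dl [Hdl Hd]].
  assert (H5 : Cdiff (fun v => RectInt (fun w => f w / (w - v)) a b c d)%C z'
     (Cder f z' * RectInt (fun w => RtoC 1 / (w - z')) a b c d + f z' * RtoC 0)%C).
  { eapply (Cdiff_ext_near _ _ _ _ dl Hdl); [|exact H4]. intros v Hv. simpl. symmetry.
    apply cauchy_rect; auto. replace v with (z' + (v - z'))%C by ring.
    apply strictly_inside_near with dl; auto. }
  assert (U := Cdiff_unique _ _ _ _ H1 H5). rewrite U. ring.
Qed.

(** The perimeter is [8 rho], the kernel is at most [rho^(-2)] and the winding integral is at least
    4 in modulus, whence [2 M / rho]. *)
Theorem cauchy_estimate f z rho M : 0 < rho -> holo_on_square f z rho ->
  (forall w, in_square z rho w -> Cmod (f w) <= M) -> Cmod (Cder f z) <= 2 * M / rho.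
Proof.
  intros Hr Hf HM.
  assert (Hz : strictly_inside (Re z - rho) (Re z + rho) (Im z - rho) (Im z + rho) z) by (split; lra).
  assert (E := Cder_cauchy f z rho z Hr Hf Hz).
  assert (W := winding_ge_4 z rho Hr). assert (W' := Rabs_Im_le_Cmod (SquareInt (fun w => RtoC 1 / (w - z))%C z rho)).
  assert (W2 := Rle_abs (Im (SquareInt (fun w => RtoC 1 / (w - z))%C z rho))).
  apply (f_equal Cmod) in E. rewrite Cmod_mult in E.
  assert (B : Cmod (SquareInt (fun w => f w / ((w - z) * (w - z))) z rho)%C <= (M * (/ rho * / rho)) * (2 * ((Re z + rho - (Re z - rho)) + (Im z + rho - (Im z - rho))))).
  { assert (Hd : forall w, on_boundary (Re z - rho) (Re z + rho) (Im z - rho) (Im z + rho) w -> rho <= Cmod (w - z)).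
    { intros w [[Hw1 Hw2] Hb]. assert (H1 := Cmod_Re_sub w z). assert (H2 := Cmod_Im_sub w z).
      destruct Hb as [q|[q|[q|q]]]; rewrite q in *.
      - rewrite Rabs_left in H1; lra. - rewrite Rabs_right in H1; lra.
      - rewrite Rabs_left in H2; lra. - rewrite Rabs_right in H2; lra. }
    unfold SquareInt. apply RectInt_norm_le; [lra|lra| |].
    - apply cont_kernel; auto. apply cont_rect_boundary, holo_cont_rect; exact Hf.
    - intros w Hw. specialize (Hd w Hw).
      assert (Hn : (w - z)%C <> RtoC 0) by (apply Cmod_neq_0; lra).
      assert (I := Cmod_inv_le (w - z) rho Hr Hd).
      unfold Cdiv. replace (/ ((w - z) * (w - z)))%C with (/ (w - z) * / (w - z))%C by (field; auto).
      rewrite !Cmod_mult. repeat apply Rmult_le_compat; try apply Rmult_le_pos; try apply Cmod_ge_0; auto.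
      apply HM. destruct Hw; auto. }
  rewrite <- E in B. assert (P := Cmod_ge_0 (Cder f z)).
  replace (M * (/ rho * / rho) * (2 * (Re z + rho - (Re z - rho) + (Im z + rho - (Im z - rho))))) with (4 * (2 * M / rho)) in B by (field; lra).
  assert (Cmod (Cder f z) * 4 <= Cmod (Cder f z) * Cmod (SquareInt (fun w => RtoC 1 / (w - z))%C z rho)) by (apply Rmult_le_compat_l; lra).
  lra.
Qed.

(** Near [z] the derivative is a quotient of two boundary integrals, both differentiable in the
    interior point, and the denominator stays nonzero by continuity. *)
Theorem holo_Cder f z rho : 0 < rho -> holo_on_square f z rho -> exists l, Cdiff (Cder f) z l.
Proof.
  intros Hr Hf.
  assert (Hz : strictly_inside (Re z - rho) (Re z + rho) (Im z - rho) (Im z + rho) z) by (split; lra).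
  assert (Hb : cont_on_boundary f (Re z - rho) (Re z + rho) (Im z - rho) (Im z + rho)) by (apply cont_rect_boundary, holo_cont_rect; exact Hf).
  assert (W := winding_ge_4 z rho Hr). assert (W' := Rabs_Im_le_Cmod (SquareInt (fun w => RtoC 1 / (w - z))%C z rho)).
  assert (W2 := Rle_abs (Im (SquareInt (fun w => RtoC 1 / (w - z))%C z rho))).
  destruct (Cdiff_cauchy2 (Re z - rho) (Re z + rho) (Im z - rho) (Im z + rho) ltac:(lra) ltac:(lra) f z Hb Hz) as [l2 H2].
  assert (H1 := Cdiff_cauchy1 (Re z - rho) (Re z + rho) (Im z - rho) (Im z + rho) ltac:(lra) ltac:(lra) (fun _ => RtoC 1) z (fun w _ => cont_const _ _ _) Hz).
  fold (SquareInt (fun w => RtoC 1 / ((w - z) * (w - z)))%C z rho) in H1.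
  change (Cdiff (fun v => SquareInt (fun w => f w / ((w - v) * (w - v)))%C z rho) z l2) in H2.
  change (Cdiff (fun v => SquareInt (fun w => RtoC 1 / (w - v))%C z rho) z (SquareInt (fun w => RtoC 1 / ((w - z) * (w - z)))%C z rho)) in H1.
  set (c := fun v => SquareInt (fun w => RtoC 1 / (w - v))%C z rho) in *.
  assert (Hc0 : c z <> RtoC 0) by (apply Cmod_neq_0; unfold c; lra).
  assert (Hcc := Cdiff_cont _ _ _ H1).
  destruct (Hcc (Cmod (c z)) ltac:(apply Cmod_gt_0; auto)) as [d1 [Hd1 Hcn]].
  destruct (boundary_dist _ _ _ _ _ Hz) as [dl [Hdl Hd]].
  eexists. apply (Cdiff_ext_near (fun v => SquareInt (fun w => f w / ((w - v) * (w - v)))%C z rho * / c v)%C _ z _ (Rmin d1 dl)).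
  - apply Rmin_pos; auto.
  - intros v Hv.
    assert (Hv1 := Rlt_le_trans _ _ _ Hv (Rmin_l _ _)). assert (Hv2 := Rlt_le_trans _ _ _ Hv (Rmin_r _ _)).
    specialize (Hcn v Hv1).
    assert (Hcv : c v <> RtoC 0).
    { apply Cmod_neq_0. assert (q := Cmod_sub_lower (c z) (c v)). rewrite Cmod_sub_comm in q. lra. }
    rewrite <- Cder_cauchy; auto.
    + fold (c v). field. auto.
    + replace v with (z + (v - z))%C by ring. apply strictly_inside_near with dl; auto; lra.
  - apply Cdiff_mult; [exact H2|]. apply Cdiff_inv; [exact Hc0|exact H1].
Qed.

(** * Primitives and logarithms on products of open intervals *)

Definition in_box (x0 x1 y0 y1 : R) (z : C) : Prop := x0 < Re z < x1 /\ y0 < Im z < y1.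

Lemma box_open x0 x1 y0 y1 z : in_box x0 x1 y0 y1 z -> exists rho, 0 < rho /\
  forall w, in_square z rho w -> in_box x0 x1 y0 y1 w.
Proof.
  intros [Hx Hy].
  set (r := Rmin (Rmin (Re z - x0) (x1 - Re z)) (Rmin (Im z - y0) (y1 - Im z))).
  assert (Hr : 0 < r) by (unfold r; repeat apply Rmin_pos; lra).
  assert (M1 := Rmin_l (Rmin (Re z - x0) (x1 - Re z)) (Rmin (Im z - y0) (y1 - Im z))).
  assert (M2 := Rmin_r (Rmin (Re z - x0) (x1 - Re z)) (Rmin (Im z - y0) (y1 - Im z))).
  assert (M3 := Rmin_l (Re z - x0) (x1 - Re z)). assert (M4 := Rmin_r (Re z - x0) (x1 - Re z)).
  assert (M5 := Rmin_l (Im z - y0) (y1 - Im z)). assert (M6 := Rmin_r (Im z - y0) (y1 - Im z)).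
  fold r in M1, M2.
  exists (r / 2). split; [lra|]. intros w [H1 H2]. split; lra.
Qed.

Lemma dist_in_square z rho w : Cdist w z <= rho -> in_square z rho w.
Proof.
  intros H. assert (H1 := Cmod_Re_sub w z). assert (H2 := Cmod_Im_sub w z). unfold Cdist in H.
  assert (A1 : Rabs (Re w - Re z) <= rho) by lra. assert (A2 : Rabs (Im w - Im z) <= rho) by lra.
  apply Rabs_le_between in A1. apply Rabs_le_between in A2. split; lra.
Qed.

Section Box.
Variables x0 x1 y0 y1 : R.
Notation U := (in_box x0 x1 y0 y1).

(** The corners come in any order, as they do for the increments of a primitive; the cases reduce to
    ordered corners by reversing sides. *)
Lemma goursat_box h a b c d : (forall z, U z -> exists l, Cdiff h z l) ->
  U (a, c) -> U (b, d) -> RectInt h a b c d = RtoC 0.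
Proof.
  intros Hh [Ha Hc] [Hb Hd]. simpl in *.
  assert (G : forall a b c d, x0 < a -> b < x1 -> y0 < c -> d < y1 -> holo_on_rect h a b c d).
  { intros ? ? ? ? ? ? ? ? z [? ?]. apply Hh. split; lra. }
  assert (G1 : forall a b c d, x0 < a < x1 -> x0 < b < x1 -> y0 < c < y1 -> y0 < d < y1 -> c <= d -> RectInt h a b c d = RtoC 0).
  { intros a' b' c' d' ? ? ? ? Hcd. destruct (Rle_dec a' b') as [q|q].
    - apply goursat; auto. apply G; lra.
    - rewrite RectInt_swap_x; auto; [|lra|].
      + rewrite goursat; auto; [ring|lra|apply G; lra].
      + apply cont_rect_boundary, holo_cont_rect, G; lra. }
  destruct (Rle_dec c d) as [q|q]; [apply G1; auto|].
  destruct (Rle_dec a b) as [q'|q'].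
  - rewrite RectInt_swap_y; auto; [|lra|].
    + rewrite G1; auto; [ring|lra].
    + apply cont_rect_boundary, holo_cont_rect, G; lra.
  - assert (K : cont_on_boundary h b a d c) by (apply cont_rect_boundary, holo_cont_rect, G; lra).
    destruct (boundary_sides b a d c ltac:(lra) ltac:(lra) h K) as [F1 [F2 [F3 F4]]].
    assert (Z := G1 b a d c Hb Ha Hd Hc ltac:(lra)).
    unfold RectInt in *. rewrite !(CInt_swap _ b a), !(CInt_swap _ d c) by auto.
    rewrite <- Z. ring.
Qed.

Definition box_primitive (h : C -> C) (zb z : C) : C :=
  (CInt (fun u => h (u, Im zb)) (Re zb) (Re z) + Ci * CInt (fun v => h (Re z, v)) (Im zb) (Im z))%C.

Lemma seg_bounds p r t u v : u < p < v -> u < r < v -> Rmin p r <= t <= Rmax p r -> u < t < v.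
Proof. unfold Rmin, Rmax. destruct (Rle_dec p r); lra. Qed.

(** By Goursat's theorem the horizontal path at height [Im zb] may be moved to the height of [z].
    The increment from [z] to [w] is then an integral along an L-shaped path near [z], where [h] is
    almost constant. *)
Lemma box_primitive_diff h zb z : (forall z, U z -> exists l, Cdiff h z l) -> U zb -> U z ->
  Cdiff (box_primitive h zb) z (h z).
Proof.
  intros Hh Hzb Hz.
  assert (Hc : forall w, U w -> Ccont h w) by (intros w Hw; destruct (Hh w Hw); eapply Cdiff_cont; eauto).
  destruct (box_open _ _ _ _ _ Hz) as [rho [Hrho Hsq]].
  destruct zb as [xb yb], z as [x y].
  destruct Hzb as [Hxb Hyb], Hz as [Hx Hy]; simpl in Hxb, Hyb, Hx, Hy.
  assert (HS : forall u v yy, x0 < u < x1 -> x0 < v < x1 -> y0 < yy < y1 -> cont_on_seg (fun t => h (t, yy)) u v).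
  { intros u v yy ? ? ?. apply cont_hseg. intros t Ht. apply Hc. split; simpl; auto. eapply seg_bounds; [| |exact Ht]; auto. }
  assert (VS : forall u v xx, y0 < u < y1 -> y0 < v < y1 -> x0 < xx < x1 -> cont_on_seg (fun t => h (xx, t)) u v).
  { intros u v yy ? ? ?. apply cont_vseg. intros t Ht. apply Hc. split; simpl; auto. eapply seg_bounds; [| |exact Ht]; auto. }
  assert (D : forall x' y', U (x', y') -> (box_primitive h (xb, yb) (x', y') - box_primitive h (xb, yb) (x, y)
     = CInt (fun u => h (u, y)) x x' + Ci * CInt (fun v => h (x', v)) y y')%C).
  { intros x' y' [Hx' Hy']; simpl in Hx', Hy'. unfold box_primitive; simpl.
    rewrite <- (CInt_Chasles (fun u => h (u, yb)) xb x x') by auto.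
    rewrite <- (CInt_Chasles (fun v => h (x', v)) yb y y') by auto.
    assert (Z := goursat_box h x x' yb y Hh ltac:(split; simpl; auto) ltac:(split; simpl; auto)).
    unfold RectInt in Z.
    match goal with |- ?l = ?r => replace l with (r + (CInt (fun x => h (x, yb)) x x' + Ci * CInt (fun y => h (x', y)) yb y -
     CInt (fun x => h (x, y)) x x' - Ci * CInt (fun y => h (x, y)) yb y))%C by ring end.
    rewrite Z. ring. }
  set (z := (x, y) : C).
  exists (fun w => if excluded_middle_informative (w = z) then h z
     else ((box_primitive h (xb, yb) w - box_primitive h (xb, yb) z) / (w - z))%C).
  split; [|split].
  2:{ destruct (excluded_middle_informative (z = z)); tauto. }
  2:{ intros w. destruct (excluded_middle_informative (w = z)) as [->|n]; [ring|]. field. apply sub_neq_0; auto. }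
  intros eps He. destruct (Hc z ltac:(split; simpl; auto) (eps / 4) ltac:(lra)) as [dl [Hdl Hcz]].
  exists (Rmin rho (dl / 2)). split; [apply Rmin_pos; lra|].
  intros w Hw. assert (Hw1 := Rlt_le_trans _ _ _ Hw (Rmin_l _ _)). assert (Hw2 := Rlt_le_trans _ _ _ Hw (Rmin_r _ _)).
  destruct (excluded_middle_informative (z = z)) as [_|n]; [|tauto].
  destruct (excluded_middle_informative (w = z)) as [E|n].
  { replace (h z - h z)%C with (RtoC 0) by ring. rewrite Cmod_0. auto. }
  assert (HwU : U w) by (apply Hsq, dist_in_square; unfold z in Hw1; lra).
  assert (Hp : 0 < Cmod (w - z)) by (apply Cmod_gt_0, sub_neq_0; auto).
  assert (N0 : (w - z <> RtoC 0)%C) by (apply sub_neq_0; auto).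
  replace ((box_primitive h (xb, yb) w - box_primitive h (xb, yb) z) / (w - z) - h z)%C with
    ((box_primitive h (xb, yb) w - box_primitive h (xb, yb) z - h z * (w - z)) / (w - z))%C by (field; auto).
  rewrite Cmod_div by auto.
  assert (R1 := Cmod_Re_sub w z). assert (R2 := Cmod_Im_sub w z). unfold Cdist in Hw2.
  destruct w as [x' y']. unfold z in *. simpl in R1, R2. rewrite D by auto.
  destruct HwU as [HwU1 HwU2]; simpl in HwU1, HwU2.
  replace (CInt (fun u => h (u, y)) x x' + Ci * CInt (fun v => h (x', v)) y y' - h (x, y) * ((x', y') - (x, y)))%C with
    (CInt (fun u => h (u, y) - h (x, y)) x x' + Ci * CInt (fun v => h (x', v) - h (x, y)) y y')%C.
  2:{ rewrite (CInt_minus (fun u => h (u, y)) (fun _ => h (x, y))) by (auto; intros t _; apply cont_const).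
      rewrite (CInt_minus (fun u => h (x', u)) (fun _ => h (x, y))) by (auto; intros t _; apply cont_const).
      rewrite !CInt_const.
      replace ((x', y') - (x, y))%C with (RtoC (x' - x) + Ci * RtoC (y' - y))%C.
      - ring.
      - unfold RtoC, Cminus, Cplus, Copp, Ci, Cmult; simpl. f_equal; ring. }
  assert (near : forall p q, Rmin x x' <= p <= Rmax x x' -> Rmin y y' <= q <= Rmax y y' -> Cmod (h (p, q) - h (x, y)) <= eps / 4).
  { intros p q Hp' Hq'. left. apply Hcz. unfold Cdist.
    eapply Rle_lt_trans; [apply Cmod_le_Re_Im|]. simpl.
    assert (Rabs (p + - x) <= Rabs (x' - x)).
    { unfold Rmin, Rmax in Hp'. destruct (Rle_dec x x'); unfold Rabs; repeat destruct (Rcase_abs _); lra. }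
    assert (Rabs (q + - y) <= Rabs (y' - y)).
    { unfold Rmin, Rmax in Hq'. destruct (Rle_dec y y'); unfold Rabs; repeat destruct (Rcase_abs _); lra. }
    lra. }
  assert (mm : forall p r, Rmin p r <= p <= Rmax p r /\ Rmin p r <= r <= Rmax p r).
  { intros p r. unfold Rmin, Rmax. destruct (Rle_dec p r); lra. }
  assert (B1 : Cmod (CInt (fun u => h (u, y) - h (x, y))%C x x') <= eps / 4 * Rabs (x' - x)).
  { apply CInt_norm_le_const_abs.
    - intros t Ht. apply cont_minus; [|apply cont_const]. apply (HS x x' y); auto.
    - intros t Ht. apply near; auto. apply mm. }
  assert (B2 : Cmod (CInt (fun u => h (x', u) - h (x, y))%C y y') <= eps / 4 * Rabs (y' - y)).
  { apply CInt_norm_le_const_abs.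
    - intros t Ht. apply cont_minus; [|apply cont_const]. apply (VS y y' x'); auto.
    - intros t Ht. apply near; auto. apply mm. }
  apply Rle_lt_trans with (eps / 2); [|lra].
  apply Rmult_le_reg_r with (Cmod ((x', y') - (x, y))%C); auto.
  unfold Rdiv at 1. rewrite Rmult_assoc, Rinv_l, Rmult_1_r by lra.
  eapply Rle_trans; [apply Cmod_triangle|]. rewrite Cmod_mult, Cmod_Ci. nra.
Qed.

Lemma box_zero_derivative F : (forall z, U z -> Cdiff F z 0) -> forall z w, U z -> U w -> F z = F w.
Proof.
  intros HF [x y] [x' y'] [Hx Hy] [Hx' Hy']; simpl in *.
  assert (E1 : CInt (fun _ => RtoC 0) x x' = (F (x', y) - F (x, y))%C).
  { apply (CInt_FTC (fun t => F (t, y))); [intros t _; apply cont_const|].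
    intros t Ht. apply Rdiff_hpath, HF. split; simpl; auto. eapply seg_bounds; [| |exact Ht]; auto. }
  assert (E2 : CInt (fun _ => Ci * RtoC 0)%C y y' = (F (x', y') - F (x', y))%C).
  { apply (CInt_FTC (fun t => F (x', t))); [intros t _; apply cont_const|].
    intros t Ht. apply Rdiff_vpath, HF. split; simpl; auto. eapply seg_bounds; [| |exact Ht]; auto. }
  rewrite CInt_const in E1, E2.
  replace (F (x', y')) with ((F (x', y') - F (x', y)) + (F (x', y) - F (x, y)) + F (x, y))%C by ring.
  rewrite <- E1, <- E2. ring.
Qed.
End Box.

(** * The complex exponential *)

Lemma Cexp_plus z w : Cexp (z + w) = (Cexp z * Cexp w)%C.
Proof.
  destruct z as [a b], w as [c d]. unfold Cexp, Cmult; simpl.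
  rewrite exp_plus, cos_plus, sin_plus. f_equal; ring.
Qed.

Lemma exp_le x y : x <= y -> exp x <= exp y.
Proof. intros [H| ->]; [left; apply exp_increasing; auto|right; auto]. Qed.

Lemma Cexp_0 : Cexp 0 = RtoC 1.
Proof. unfold Cexp; simpl. rewrite exp_0, cos_0, sin_0. unfold RtoC. f_equal; ring. Qed.

Lemma Cmod_Cexp z : Cmod (Cexp z) = exp (Re z).
Proof.
  destruct z as [a b]. unfold Cexp, Cmod; simpl.
  replace (exp a * cos b * (exp a * cos b * 1) + exp a * sin b * (exp a * sin b * 1)) with ((exp a)²).
  - apply sqrt_Rsqr. left; apply exp_pos.
  - assert (h := sin2_cos2 b). unfold Rsqr in *.
    replace (exp a * cos b * (exp a * cos b * 1) + exp a * sin b * (exp a * sin b * 1)) with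
      (exp a * exp a * (sin b * sin b + cos b * cos b)) by ring. rewrite h. ring.
Qed.

Lemma Cexp_neq_0 z : Cexp z <> RtoC 0.
Proof. apply Cmod_neq_0. rewrite Cmod_Cexp. apply exp_pos. Qed.

Lemma Cexp_opp z : (Cexp (- z) = / Cexp z)%C.
Proof.
  assert (H : (Cexp (- z) * Cexp z = RtoC 1)%C) by (rewrite <- Cexp_plus; replace (- z + z)%C with (RtoC 0) by ring; apply Cexp_0).
  replace (Cexp (- z))%C with (Cexp (- z) * Cexp z * / Cexp z)%C by (field; apply Cexp_neq_0).
  rewrite H. ring.
Qed.

Lemma Rcont_of_continuous f x : continuous (fun t => Re (f t)) x -> continuous (fun t => Im (f t)) x -> Rcont f x.
Proof.
  intros H1 H2 eps He.
  apply continuity_pt_filterlim in H1. apply continuity_pt_filterlim in H2.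
  destruct (H1 (eps / 2) ltac:(lra)) as [d1 [Hd1 K1]]. destruct (H2 (eps / 2) ltac:(lra)) as [d2 [Hd2 K2]].
  exists (Rmin d1 d2). split; [apply Rmin_pos; auto|]. intros y Hy.
  destruct (Req_dec y x) as [->|n].
  { replace (f x - f x)%C with (RtoC 0) by ring. rewrite Cmod_0. auto. }
  specialize (K1 y). specialize (K2 y). simpl in K1, K2. unfold R_dist in K1, K2.
  assert (Q1 := K1 ltac:(split; [split; [exact I|auto]|eapply Rlt_le_trans; [apply Hy|apply Rmin_l]])).
  assert (Q2 := K2 ltac:(split; [split; [exact I|auto]|eapply Rlt_le_trans; [apply Hy|apply Rmin_r]])).
  eapply Rle_lt_trans; [apply Cmod_le_Re_Im|].
  replace (Re (f y - f x)%C) with (Re (f y) - Re (f x)) by (destruct (f y), (f x); reflexivity).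
  replace (Im (f y - f x)%C) with (Im (f y) - Im (f x)) by (destruct (f y), (f x); reflexivity).
  lra.
Qed.

Lemma Rdiff_Rcont f x l : Rdiff f x l -> Rcont f x.
Proof.
  intros [H1 H2]. apply Rcont_of_continuous.
  - apply (ex_derive_continuous (V := R_NormedModule) (fun t => Re (f t))). eexists; eauto.
  - apply (ex_derive_continuous (V := R_NormedModule) (fun t => Im (f t))). eexists; eauto.
Qed.

Lemma Rdiff_Cexp w t : Rdiff (fun t => Cexp (RtoC t * w)) t (w * Cexp (RtoC t * w))%C.
Proof.
  destruct w as [x y]. split.
  - apply is_derive_ext with (fun t => exp (t * x) * cos (t * y)).
    { intros s. unfold Cexp; simpl. f_equal; f_equal; ring. }
    auto_derive; auto. unfold Cexp; simpl.
    replace (t * x - 0 * y) with (t * x) by ring. replace (t * y + 0 * x) with (t * y) by ring. ring.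
  - apply is_derive_ext with (fun t => exp (t * x) * sin (t * y)).
    { intros s. unfold Cexp; simpl. f_equal; f_equal; ring. }
    auto_derive; auto. unfold Cexp; simpl.
    replace (t * x - 0 * y) with (t * x) by ring. replace (t * y + 0 * x) with (t * y) by ring. ring.
Qed.

Lemma cont_on_seg_Cexp w a b : cont_on_seg (fun t => Cexp (RtoC t * w)) a b.
Proof. intros t _. eapply Rdiff_Rcont, Rdiff_Cexp. Qed.

Lemma Re_scal_le t w : 0 <= t -> Re (RtoC t * w)%C <= t * Cmod w.
Proof.
  intros Ht. destruct w as [x y]. simpl. replace (t * x - 0 * y) with (t * x) by ring.
  apply Rmult_le_compat_l; auto. eapply Rle_trans; [apply Rle_abs|apply (re_le_Cmod (x, y))].
Qed.

(** The derivative of [exp (t w)] is integrated over [[0, 1]]; a second round of the same argument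
    gives the quadratic remainder of the next lemma. *)
Lemma Cexp_sub_1_le w : Cmod (Cexp w - 1) <= Cmod w * exp (Cmod w).
Proof.
  assert (E := CInt_FTC (fun t => Cexp (RtoC t * w)) (fun t => w * Cexp (RtoC t * w))%C 0 1).
  cbv beta in E. rewrite Cmult_1_l, Cmult_0_l, Cexp_0 in E. rewrite <- E.
  - assert (P := Cmod_ge_0 w).
    eapply Rle_trans; [apply (CInt_norm_le_const _ (Cmod w * exp (Cmod w))); [lra| |]|lra].
    + apply cont_on_seg_scal, cont_on_seg_Cexp.
    + intros t Ht. rewrite Cmod_mult, Cmod_Cexp. apply Rmult_le_compat_l; auto.
      apply exp_le. eapply Rle_trans; [apply Re_scal_le; lra|]. nra.
  - apply cont_on_seg_scal, cont_on_seg_Cexp.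
  - intros t _. apply Rdiff_Cexp.
Qed.

Lemma Cexp_sub_1_sub_le w : Cmod (Cexp w - 1 - w) <= Cmod w * Cmod w * exp (Cmod w).
Proof.
  assert (P := Cmod_ge_0 w).
  assert (E := CInt_FTC (fun t => Cexp (RtoC t * w)) (fun t => w * Cexp (RtoC t * w))%C 0 1).
  cbv beta in E. rewrite Cmult_1_l, Cmult_0_l, Cexp_0 in E.
  assert (C1 : cont_on_seg (fun t => w * Cexp (RtoC t * w))%C 0 1) by apply cont_on_seg_scal, cont_on_seg_Cexp.
  specialize (E C1 (fun t _ => Rdiff_Cexp w t)).
  replace (Cexp w - 1 - w)%C with (CInt (fun t => w * Cexp (RtoC t * w) - w)%C 0 1).
  - eapply Rle_trans; [apply (CInt_norm_le_const _ (Cmod w * Cmod w * exp (Cmod w))); [lra| |]|lra].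
    + intros t Ht. apply cont_minus; [apply C1; auto|apply cont_const].
    + intros t Ht. replace (w * Cexp (t * w) - w)%C with (w * (Cexp (t * w) - 1))%C by ring.
      rewrite Cmod_mult, Rmult_assoc. apply Rmult_le_compat_l; auto.
      eapply Rle_trans; [apply Cexp_sub_1_le|]. rewrite Cmod_mult, Cmod_R, Rabs_right by lra.
      apply Rmult_le_compat; try nra; [left; apply exp_pos|]. apply exp_le. nra.
  - rewrite CInt_minus, CInt_const, E; auto; [|intros t _; apply cont_const].
    replace (1 - 0) with 1 by ring. ring.
Qed.

Lemma Cdiff_Cexp z : Cdiff Cexp z (Cexp z).
Proof.
  apply Cdiff_of_quadratic with (Cmod (Cexp z) * exp 1) 1; [lra|].
  intros h Hh. rewrite Cexp_plus.
  replace (Cexp z * Cexp h - Cexp z - Cexp z * h)%C with (Cexp z * (Cexp h - 1 - h))%C by ring.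
  rewrite Cmod_mult, Rmult_assoc. apply Rmult_le_compat_l; [apply Cmod_ge_0|].
  eapply Rle_trans; [apply Cexp_sub_1_sub_le|]. rewrite Rmult_comm. apply Rmult_le_compat_r.
  - apply Rmult_le_pos; apply Cmod_ge_0.
  - apply exp_le. lra.
Qed.

(** * Holomorphic logarithms on a box and their growth *)

Section BoxLog.
Variables x0 x1 y0 y1 : R.
Notation U := (in_box x0 x1 y0 y1).

Lemma holo_Cder_box f : (forall z, U z -> exists l, Cdiff f z l) -> forall z, U z -> exists l, Cdiff (Cder f) z l.
Proof.
  intros Hf z Hz. destruct (box_open _ _ _ _ _ Hz) as [rho [Hr Hsq]].
  apply holo_Cder with rho; auto. intros w Hw. auto.
Qed.

(** [L] is [kappa] plus a primitive of [Phi' / Phi]; then [Phi exp (- L)] has derivative 0 and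
    equals 1 at [zb]. The choice of [kappa] selects the branch. *)
Theorem box_log Phi zb kappa : (forall z, U z -> exists l, Cdiff Phi z l) ->
  (forall z, U z -> Phi z <> RtoC 0) -> U zb -> Phi zb = Cexp kappa ->
  exists L, (forall z, U z -> Cdiff L z (Cder Phi z / Phi z)%C) /\
    (forall z, U z -> Cexp (L z) = Phi z) /\ L zb = kappa.
Proof.
  intros Hf Hn Hzb Hk.
  set (h := fun z => (Cder Phi z / Phi z)%C).
  assert (Hh : forall z, U z -> exists l, Cdiff h z l).
  { intros z Hz. destruct (holo_Cder_box Phi Hf z Hz) as [l Hl]. destruct (Hf z Hz) as [m Hm].
    eexists. apply Cdiff_mult; [exact Hl|]. apply Cdiff_inv; [auto|exact Hm]. }
  set (L := fun z => (kappa + box_primitive h zb z)%C).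
  assert (HL : forall z, U z -> Cdiff L z (h z)).
  { intros z Hz. replace (h z) with (RtoC 0 + h z)%C by ring.
    apply Cdiff_plus; [apply Cdiff_const|]. apply (box_primitive_diff x0 x1 y0 y1); auto. }
  assert (HLb : L zb = kappa).
  { unfold L, box_primitive. rewrite !CInt_point. ring. }
  exists L. split; [exact HL|]. split; [|exact HLb].
  intros z Hz.
  assert (Z := box_zero_derivative x0 x1 y0 y1 (fun w => Phi w * Cexp (- L w))%C).
  assert (HZ : forall w, U w -> Cdiff (fun w => Phi w * Cexp (- L w))%C w 0).
  { intros w Hw.
    assert (D1 := Cder_spec Phi w (Hf w Hw)).
    assert (D2 := Cdiff_comp Cexp (fun w => - L w)%C w _ _ (Cdiff_opp _ _ _ (HL w Hw)) (Cdiff_Cexp _)).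
    assert (D3 := Cdiff_mult _ _ _ _ _ D1 D2). simpl in D3.
    replace (RtoC 0) with (Cder Phi w * Cexp (- L w) + Phi w * (Cexp (- L w) * - h w))%C; [exact D3|].
    unfold h. field. auto. }
  specialize (Z HZ z zb Hz Hzb). simpl in Z.
  rewrite HLb, Hk, !Cexp_opp in Z.
  rewrite Cinv_r in Z by apply Cexp_neq_0.
  replace (Phi z) with (Phi z * / Cexp (L z) * Cexp (L z))%C by (field; apply Cexp_neq_0).
  rewrite Z. ring.
Qed.

(** Plays the role of the Borel-Caratheodory theorem. The function [E = exp ((L - L z) / M)] is at
    most [exp 2] in modulus, while [E z = 1] and [E' z = L' z / M]; Cauchy's estimate for [E]
    therefore bounds [L'] from control of the real part of [L] alone. *)
Lemma log_derivative_bound L z rho M : 0 < rho -> 0 < M ->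
  holo_on_square L z rho -> (forall w, in_square z rho w -> Rabs (Re (L w)) <= M) ->
  Cmod (Cder L z) <= 2 * exp 2 * M / rho.
Proof.
  intros Hr HM Hf HB.
  set (E := fun w => Cexp ((L w - L z) * RtoC (/ M))%C).
  assert (Hz : in_square z rho z) by (split; lra).
  assert (DE : forall w l, Cdiff L w l -> Cdiff E w (E w * (l * RtoC (/ M)))%C).
  { intros w l Hl. unfold E.
    apply (Cdiff_comp Cexp (fun w => (L w - L z) * RtoC (/ M))%C); [|apply Cdiff_Cexp].
    replace (l * RtoC (/ M))%C with ((l - 0) * RtoC (/ M) + (L w - L z) * 0)%C by ring.
    apply (Cdiff_mult (fun w => L w - L z)%C (fun _ => RtoC (/ M))); [|apply Cdiff_const].
    apply (Cdiff_minus L (fun _ => L z)); [exact Hl|apply Cdiff_const]. }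
  assert (EE : forall w, in_square z rho w -> Cmod (E w) <= exp 2).
  { intros w Hw. unfold E. rewrite Cmod_Cexp. apply exp_le.
    assert (B1 := HB w Hw). assert (B2 := HB z Hz).
    apply Rabs_le_between in B1. apply Rabs_le_between in B2.
    replace (Re ((L w - L z) * RtoC (/ M))%C) with ((Re (L w) - Re (L z)) * / M).
    2:{ destruct (L w), (L z). simpl. ring. }
    apply Rmult_le_reg_r with M; auto. rewrite Rmult_assoc, Rinv_l by lra. lra. }
  assert (HE : holo_on_square E z rho).
  { intros w Hw. destruct (Hf w Hw) as [l Hl]. eexists. apply DE; eauto. }
  assert (B := cauchy_estimate E z rho (exp 2) Hr HE EE).
  assert (Ez : E z = RtoC 1).
  { unfold E. replace ((L z - L z) * RtoC (/ M))%C with (RtoC 0) by ring. apply Cexp_0. }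
  rewrite (Cder_eq _ _ _ (DE z _ (Cder_spec L z (Hf z Hz)))) in B.
  rewrite Ez, Cmult_1_l, Cmod_mult, Cmod_R in B.
  rewrite Rabs_right in B by (apply Rle_ge; left; apply Rinv_0_lt_compat; auto).
  apply Rmult_le_reg_r with (/ M); [apply Rinv_0_lt_compat; auto|].
  eapply Rle_trans; [exact B|]. right. field. lra.
Qed.

(** Integration of [L'] along a horizontal segment that keeps distance [rho] from the sides of the
    box. *)
Lemma log_growth L rho M x x' y : 0 < rho -> 0 < M ->
  (forall z, U z -> exists l, Cdiff L z l) -> (forall z, U z -> Rabs (Re (L z)) <= M) ->
  x0 + rho < x -> x <= x' -> x' < x1 - rho -> y0 + rho < y < y1 - rho ->
  Cmod (L (x, y)) <= Cmod (L (x', y)) + 2 * exp 2 * M / rho * (x' - x).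
Proof.
  intros Hr HM HL HB H1 H2 H3 H4.
  assert (HU : forall t, x <= t <= x' -> U (t, y)) by (intros t Ht; split; simpl; lra).
  assert (Hsq : forall t w, x <= t <= x' -> in_square (t, y) rho w -> U w).
  { intros t w Ht [W1 W2]. simpl in W1, W2. split; lra. }
  assert (Hc : cont_on_seg (fun t => Cder L (t, y)) x x').
  { apply cont_hseg. intros t Ht. apply seg_le in Ht; auto.
    destruct (holo_Cder_box L HL (t, y) (HU t Ht)) as [l Hl]. eapply Cdiff_cont; eauto. }
  assert (E := CInt_FTC (fun t => L (t, y)) (fun t => Cder L (t, y)) x x' Hc).
  assert (E' : CInt (fun t => Cder L (t, y)) x x' = (L (x', y) - L (x, y))%C).
  { apply E. intros t Ht. apply seg_le in Ht; auto. apply Rdiff_hpath, Cder_spec, HL, HU; auto. }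
  assert (B : Cmod (CInt (fun t => Cder L (t, y)) x x') <= 2 * exp 2 * M / rho * (x' - x)).
  { apply CInt_norm_le_const; auto. intros t Ht. apply log_derivative_bound; auto.
    - intros w Hw. apply HL. eapply Hsq; eauto.
    - intros w Hw. apply HB. eapply Hsq; eauto. }
  rewrite E', Cmod_sub_comm in B. assert (q := Cmod_sub_lower (L (x, y)) (L (x', y))). lra.
Qed.
End BoxLog.

(** * Finite sums over lists *)

Section ListSums.
Context {A : Type}.
Implicit Types (l : list A) (f g : A -> C) (u v : A -> R).

Definition lsum l f : C := fold_right (fun a s => f a + s)%C (RtoC 0) l.
Definition rsum l u : R := fold_right (fun a s => u a + s) 0 l.

Lemma lsum_cons a l f : lsum (a :: l) f = (f a + lsum l f)%C.
Proof. reflexivity. Qed.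

Lemma rsum_cons a l u : rsum (a :: l) u = u a + rsum l u.
Proof. reflexivity. Qed.

Lemma lsum_app l l' f : lsum (l ++ l') f = (lsum l f + lsum l' f)%C.
Proof. induction l as [|a l IH]; simpl app; [unfold lsum at 2; simpl; ring|]. rewrite !lsum_cons, IH. ring. Qed.

Lemma rsum_app l l' u : rsum (l ++ l') u = rsum l u + rsum l' u.
Proof. induction l as [|a l IH]; simpl app; [unfold rsum at 2; simpl; ring|]. rewrite !rsum_cons, IH. ring. Qed.

Lemma lsum_ext l f g : (forall a, In a l -> f a = g a) -> lsum l f = lsum l g.
Proof.
  induction l as [|a l IH]; intros H; [reflexivity|]. rewrite !lsum_cons, IH, (H a); auto.
  - left; auto. - intros; apply H; right; auto.
Qed.

Lemma rsum_ext l u v : (forall a, In a l -> u a = v a) -> rsum l u = rsum l v.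
Proof.
  induction l as [|a l IH]; intros H; [reflexivity|]. rewrite !rsum_cons, IH, (H a); auto.
  - left; auto. - intros; apply H; right; auto.
Qed.

Lemma lsum_plus l f g : lsum l (fun a => f a + g a)%C = (lsum l f + lsum l g)%C.
Proof. induction l as [|a l IH]; [unfold lsum; simpl; ring|]. rewrite !lsum_cons, IH. ring. Qed.

Lemma lsum_scal c l f : lsum l (fun a => c * f a)%C = (c * lsum l f)%C.
Proof. induction l as [|a l IH]; [unfold lsum; simpl; ring|]. rewrite !lsum_cons, IH. ring. Qed.

Lemma lsum_minus l f g : lsum l (fun a => f a - g a)%C = (lsum l f - lsum l g)%C.
Proof. induction l as [|a l IH]; [unfold lsum; simpl; ring|]. rewrite !lsum_cons, IH. ring. Qed.

Lemma rsum_plus l u v : rsum l (fun a => u a + v a) = rsum l u + rsum l v.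
Proof. induction l as [|a l IH]; [unfold rsum; simpl; ring|]. rewrite !rsum_cons, IH. ring. Qed.

Lemma rsum_scal c l u : rsum l (fun a => c * u a) = c * rsum l u.
Proof. induction l as [|a l IH]; [unfold rsum; simpl; ring|]. rewrite !rsum_cons, IH. ring. Qed.

Lemma rsum_le l u v : (forall a, In a l -> u a <= v a) -> rsum l u <= rsum l v.
Proof.
  induction l as [|a l IH]; intros H; [right; reflexivity|]. rewrite !rsum_cons.
  apply Rplus_le_compat; [apply H; left; auto|apply IH; intros; apply H; right; auto].
Qed.

Lemma rsum_const l c : rsum l (fun _ => c) = INR (length l) * c.
Proof.
  induction l as [|a l IH]; [unfold rsum; simpl; ring|]. rewrite rsum_cons, IH.
  simpl length. rewrite S_INR. ring.
Qed.

Lemma rsum_nonneg l u : (forall a, In a l -> 0 <= u a) -> 0 <= rsum l u.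
Proof. intros H. replace 0 with (rsum l (fun _ => 0)) by (rewrite rsum_const; ring). apply rsum_le; auto. Qed.

Lemma lsum_norm_le l f : Cmod (lsum l f) <= rsum l (fun a => Cmod (f a)).
Proof.
  induction l as [|a l IH]; [unfold lsum, rsum; simpl; rewrite Cmod_0; lra|].
  rewrite lsum_cons, rsum_cons. eapply Rle_trans; [apply Cmod_triangle|lra].
Qed.

Lemma lsum_zero l f : (forall a, In a l -> f a = RtoC 0) -> lsum l f = RtoC 0.
Proof.
  intros H. apply Cmod_eq_0, Rle_antisym; [|apply Cmod_ge_0].
  eapply Rle_trans; [apply lsum_norm_le|]. right.
  transitivity (rsum l (fun _ => 0)); [apply rsum_ext; intros; rewrite H, Cmod_0; auto|rewrite rsum_const; ring].
Qed.

Lemma rsum_incl l l' u : NoDup l -> incl l l' -> (forall a, In a l' -> 0 <= u a) -> rsum l u <= rsum l' u.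
Proof.
  intros Hn. revert l'. induction Hn as [|a l Ha Hn IH]; intros l' Hi Hu.
  - apply rsum_nonneg; auto.
  - destruct (in_split a l' (Hi a (or_introl eq_refl))) as [l1 [l2 ->]].
    rewrite rsum_cons, rsum_app, rsum_cons.
    assert (H : rsum l u <= rsum (l1 ++ l2) u).
    { apply IH.
      - intros b Hb. assert (Hb' := Hi b (or_intror Hb)). apply in_app_or in Hb'. apply in_or_app.
        destruct Hb' as [?|[->|?]]; auto. contradiction.
      - intros b Hb. apply Hu. apply in_app_or in Hb. apply in_or_app. simpl. tauto. }
    rewrite rsum_app in H. lra.
Qed.

Lemma lsum_split (p : A -> bool) l f :
  lsum l f = (lsum (filter p l) f + lsum (filter (fun a => negb (p a)) l) f)%C.
Proof.
  induction l as [|a l IH]; [unfold lsum; simpl; ring|].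
  cbn [filter]. destruct (p a); cbn [negb]; rewrite !lsum_cons, IH; ring.
Qed.

Lemma lsum_conj l f : Cconj (lsum l f) = lsum l (fun a => Cconj (f a)).
Proof.
  induction l as [|a l IH]; [unfold lsum, Cconj, RtoC; simpl; f_equal; ring|].
  rewrite !lsum_cons, <- IH. destruct (f a), (lsum l f). unfold Cconj, Cplus; simpl. f_equal; ring.
Qed.
End ListSums.

Lemma lsum_swap {A B} (l : list A) (l' : list B) (f : A -> B -> C) :
  lsum l (fun a => lsum l' (fun b => f a b)) = lsum l' (fun b => lsum l (fun a => f a b)).
Proof.
  induction l as [|a l IH].
  - symmetry. apply lsum_zero. auto.
  - rewrite lsum_cons, IH. rewrite <- lsum_plus. apply lsum_ext. intros; reflexivity.
Qed.

Lemma lsum_map {A B} (h : A -> B) l (f : B -> C) : lsum (map h l) f = lsum l (fun a => f (h a)).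
Proof. induction l as [|a l IH]; [reflexivity|]. simpl map. rewrite !lsum_cons, IH. reflexivity. Qed.

Lemma rsum_map {A B} (h : A -> B) l (f : B -> R) : rsum (map h l) f = rsum l (fun a => f (h a)).
Proof. induction l as [|a l IH]; [reflexivity|]. simpl map. rewrite !rsum_cons, IH. reflexivity. Qed.

(** Cauchy-Schwarz against the constant 1; the cross terms are handled by [2 u v <= u^2 + v^2]. *)
Lemma rsum_Rsqr_cauchy {A} (l : list A) (u : A -> R) (M : R) :
  (forall a, In a l -> 0 <= u a) -> rsum l (fun a => u a * u a) <= M ->
  rsum l u * rsum l u <= INR (length l) * M.
Proof.
  intros Hu HM.
  apply Rle_trans with (INR (length l) * rsum l (fun a => u a * u a)).
  2:{ apply Rmult_le_compat_l; auto. apply pos_INR. }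
  clear HM Hu. induction l as [|a l IH]; [unfold rsum; simpl; lra|].
  rewrite !rsum_cons. simpl length. rewrite S_INR.
  assert (K : 2 * (u a * rsum l u) <= INR (length l) * (u a * u a) + rsum l (fun b => u b * u b)).
  { clear IH. induction l as [|b l IH]; [unfold rsum; simpl; lra|].
    rewrite !rsum_cons. simpl length. rewrite S_INR. assert (h := Rle_0_sqr (u a - u b)). unfold Rsqr in h. nra. }
  nra.
Qed.

Lemma seq_S_1 n : seq 1 (S n) = seq 1 n ++ [S n].
Proof. rewrite seq_S. reflexivity. Qed.

Lemma lsum_seq_S n (f : nat -> C) : lsum (seq 1 (S n)) f = (lsum (seq 1 n) f + f (S n))%C.
Proof. rewrite seq_S_1, lsum_app. unfold lsum at 2; simpl. ring. Qed.

Lemma rsum_seq_S n (f : nat -> R) : rsum (seq 1 (S n)) f = rsum (seq 1 n) f + f (S n).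
Proof. rewrite seq_S_1, rsum_app. unfold rsum at 2; simpl. ring. Qed.

Lemma seq_1_app m n : (m <= n)%nat -> seq 1 n = seq 1 m ++ seq (S m) (n - m).
Proof. intros H. replace n with (m + (n - m))%nat at 1 by lia. rewrite seq_app. reflexivity. Qed.

Lemma NoDup_bounded_list (l : list nat) : exists n, forall k, In k l -> (k <= n)%nat.
Proof.
  induction l as [|a l [n IH]]; [exists O; intros k []|].
  exists (max a n). intros k [->|H]; [lia|]. specialize (IH k H). lia.
Qed.

(** Stated for arbitrary finite sets of large indices and not only for intervals, because the Euler
    product rearranges the series by primes and exponents. *)
Lemma tail_small (f : nat -> R) M : (forall k, 0 <= f k) -> (forall n, rsum (seq 1 n) f <= M) ->
  forall eps, 0 < eps -> exists n0, forall l, NoDup l -> (forall k, In k l -> (n0 < k)%nat) -> rsum l f <= eps.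
Proof.
  intros Hf HM eps He.
  destruct (completeness (fun x => exists n, x = rsum (seq 1 n) f)) as [S [HS1 HS2]].
  { exists M. intros x [n ->]. auto. }
  { exists (rsum (seq 1 0) f), O. auto. }
  assert (Hn : exists n0, S - eps < rsum (seq 1 n0) f).
  { apply NNPP. intros Hno. assert (S <= S - eps); [|lra]. apply HS2. intros x [n ->].
    apply Rnot_lt_le. intros h. apply Hno. exists n; auto. }
  destruct Hn as [n0 Hn0]. exists n0. intros l Hl Hk.
  destruct (NoDup_bounded_list l) as [n Hn].
  assert (rsum l f <= rsum (seq (Datatypes.S n0) (max n n0 - n0)) f).
  { apply rsum_incl; auto. intros k Hk'. apply in_seq. specialize (Hk k Hk'). specialize (Hn k Hk'). lia. }
  assert (H2 := HS1 _ (ex_intro _ (max n n0) eq_refl)).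
  rewrite (seq_1_app n0 (max n n0)), rsum_app in H2 by lia. lra.
Qed.

(** * Convergence of complex series indexed from 1 *)

Definition Csums (u : nat -> C) (S : C) : Prop :=
  forall eps, 0 < eps -> exists n0, forall n, (n0 <= n)%nat -> Cmod (lsum (seq 1 n) u - S) < eps.

Lemma Csums_unique u S S' : Csums u S -> Csums u S' -> S = S'.
Proof.
  intros H H'. apply NNPP. intros Hne.
  assert (Hp : 0 < Cmod (S - S')) by (apply Cmod_gt_0, sub_neq_0; auto).
  destruct (H (Cmod (S - S') / 2) ltac:(lra)) as [n Hn]. destruct (H' (Cmod (S - S') / 2) ltac:(lra)) as [n' Hn'].
  specialize (Hn (max n n') ltac:(lia)). specialize (Hn' (max n n') ltac:(lia)).
  rewrite Cmod_sub_comm in Hn.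
  assert (T := Cmod_triangle (S - lsum (seq 1 (max n n')) u) (lsum (seq 1 (max n n')) u - S')).
  replace (S - lsum (seq 1 (max n n')) u + (lsum (seq 1 (max n n')) u - S'))%C with (S - S')%C in T by ring.
  lra.
Qed.

Lemma Csums_ext u v S : (forall k, (1 <= k)%nat -> u k = v k) -> Csums u S -> Csums v S.
Proof.
  intros E H eps He. destruct (H eps He) as [n0 Hn]. exists n0. intros n Hn'.
  rewrite <- (lsum_ext _ u v); auto. intros a Ha. apply in_seq in Ha. apply E; lia.
Qed.

Lemma Csums_minus u v S S' : Csums u S -> Csums v S' -> Csums (fun k => u k - v k)%C (S - S')%C.
Proof.
  intros H H' eps He.
  destruct (H (eps / 2) ltac:(lra)) as [n Hn]. destruct (H' (eps / 2) ltac:(lra)) as [n' Hn'].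
  exists (max n n'). intros k Hk. specialize (Hn k ltac:(lia)). specialize (Hn' k ltac:(lia)).
  rewrite lsum_minus.
  replace (lsum (seq 1 k) u - lsum (seq 1 k) v - (S - S'))%C with
    ((lsum (seq 1 k) u - S) - (lsum (seq 1 k) v - S'))%C by ring.
  eapply Rle_lt_trans; [apply Cmod_sub_triangle|lra].
Qed.

Lemma Csums_scal c u S : Csums u S -> Csums (fun k => c * u k)%C (c * S)%C.
Proof.
  intros H eps He. assert (P := Cmod_ge_0 c).
  destruct (H (eps / (Cmod c + 1))) as [n Hn]; [apply Rdiv_lt_0_compat; lra|].
  exists n. intros k Hk. specialize (Hn k Hk). rewrite lsum_scal.
  replace (c * lsum (seq 1 k) u - c * S)%C with (c * (lsum (seq 1 k) u - S))%C by ring.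
  rewrite Cmod_mult. apply Rle_lt_trans with (Cmod c * (eps / (Cmod c + 1))).
  - apply Rmult_le_compat_l; lra.
  - apply Rmult_lt_reg_r with (Cmod c + 1); [lra|].
    replace (Cmod c * (eps / (Cmod c + 1)) * (Cmod c + 1)) with (Cmod c * eps) by (field; lra). nra.
Qed.

Lemma Csums_norm_le u S M : Csums u S -> (forall n, Cmod (lsum (seq 1 n) u) <= M) -> Cmod S <= M.
Proof.
  intros H HM. apply Rnot_lt_le. intros Hlt.
  destruct (H (Cmod S - M) ltac:(lra)) as [n Hn]. specialize (Hn n (Nat.le_refl _)). specialize (HM n).
  rewrite Cmod_sub_comm in Hn. assert (q := Cmod_sub_lower S (lsum (seq 1 n) u)). lra.
Qed.

Lemma Csums_tail_le (u : nat -> C) S (f : nat -> R) m eps : Csums u S ->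
  (forall k, (1 <= k)%nat -> Cmod (u k) <= f k) ->
  (forall l, NoDup l -> (forall k, In k l -> (m < k)%nat) -> rsum l f <= eps) ->
  Cmod (S - lsum (seq 1 m) u) <= eps.
Proof.
  intros H Hu Ht. apply Rnot_lt_le. intros Hlt.
  destruct (H (Cmod (S - lsum (seq 1 m) u) - eps) ltac:(lra)) as [n Hn].
  specialize (Hn (max n m) ltac:(lia)).
  rewrite (seq_1_app m (max n m)), lsum_app in Hn by lia.
  assert (B : Cmod (lsum (seq (Datatypes.S m) (max n m - m)) u) <= eps).
  { eapply Rle_trans; [apply lsum_norm_le|]. eapply Rle_trans; [apply rsum_le|apply Ht].
    - intros a Ha. apply Hu. apply in_seq in Ha. lia.
    - apply seq_NoDup.
    - intros k Hk. apply in_seq in Hk. lia. }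
  rewrite Cmod_sub_comm in Hn.
  assert (q := Cmod_sub_lower (S - lsum (seq 1 m) u) (lsum (seq (Datatypes.S m) (max n m - m)) u)).
  replace (S - lsum (seq 1 m) u - lsum (seq (Datatypes.S m) (max n m - m)) u)%C with
    (S - (lsum (seq 1 m) u + lsum (seq (Datatypes.S m) (max n m - m)) u))%C in q by ring.
  lra.
Qed.

Lemma sum_n_rsum (f : nat -> R) n : sum_n f n = rsum (seq 0 (S n)) f.
Proof.
  induction n as [|n IH]; [rewrite sum_O; unfold rsum; simpl; ring|].
  rewrite sum_Sn, IH. rewrite (seq_S (S n)), rsum_app. unfold rsum at 3; simpl. unfold plus; simpl. ring.
Qed.

Lemma rsum_shift (f : nat -> R) n : rsum (seq 0 n) (fun k => f (S k)) = rsum (seq 1 n) f.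
Proof. rewrite <- seq_shift, rsum_map. reflexivity. Qed.

Lemma lsum_components {A} (l : list A) (f : A -> C) :
  lsum l f = (rsum l (fun a => Re (f a)), rsum l (fun a => Im (f a))).
Proof.
  induction l as [|a l IH]; [reflexivity|]. rewrite lsum_cons, !rsum_cons, IH. reflexivity.
Qed.

Lemma ex_series_of_bounded (f : nat -> R) M : (forall k, 0 <= f k) -> (forall n, rsum (seq 0 n) f <= M) -> ex_series f.
Proof.
  intros Hf HM.
  destruct (ex_finite_lim_seq_incr (sum_n f) M) as [l Hl].
  - intros n. rewrite sum_Sn. specialize (Hf (S n)). unfold plus; simpl. lra.
  - intros n. rewrite sum_n_rsum. auto.
  - exists l. exact Hl.
Qed.

(** Links partial sums to the componentwise [CSeries] of the hypotheses; bounded absolute sums make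
    both components converge. *)
Lemma Csums_CSeries (u : nat -> C) M : (forall n, rsum (seq 1 n) (fun k => Cmod (u k)) <= M) ->
  Csums u (CSeries (fun n => u (S n))).
Proof.
  intros HM.
  assert (E : ex_series (fun k => Cmod (u (S k)))).
  { apply ex_series_of_bounded with M; [intros; apply Cmod_ge_0|].
    intros n. rewrite (rsum_shift (fun k => Cmod (u k))). auto. }
  assert (ER : ex_series (fun k => Re (u (S k)))).
  { apply (ex_series_le (V := R_CompleteNormedModule) _ (fun k => Cmod (u (S k)))); auto. intros n. apply re_le_Cmod. }
  assert (EI : ex_series (fun k => Im (u (S k)))).
  { apply (ex_series_le (V := R_CompleteNormedModule) _ (fun k => Cmod (u (S k)))); auto. intros n. apply Rabs_Im_le_Cmod. }
  apply Series_correct in ER. apply Series_correct in EI.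
  assert (LR : is_lim_seq (sum_n (fun k => Re (u (S k)))) (Series (fun k => Re (u (S k))))) by exact ER.
  assert (LI : is_lim_seq (sum_n (fun k => Im (u (S k)))) (Series (fun k => Im (u (S k))))) by exact EI.
  apply is_lim_seq_spec in LR. apply is_lim_seq_spec in LI.
  intros eps He.
  destruct (LR (mkposreal (eps / 2) ltac:(lra))) as [n1 H1]. destruct (LI (mkposreal (eps / 2) ltac:(lra))) as [n2 H2].
  exists (S (max n1 n2)). intros n Hn. destruct n as [|n]; [lia|].
  specialize (H1 n ltac:(lia)). specialize (H2 n ltac:(lia)). simpl in H1, H2.
  rewrite sum_n_rsum, (rsum_shift (fun k => Re (u k))) in H1.
  rewrite sum_n_rsum, (rsum_shift (fun k => Im (u k))) in H2.
  eapply Rle_lt_trans; [apply Cmod_le_Re_Im|]. rewrite lsum_components. unfold CSeries. simpl Re. simpl Im.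
  unfold Rminus in H1, H2.
  change (Rabs (rsum (seq 1 (S n)) (fun a => Re (u a)) + - Series (fun k => Re (u (S k)))) +
          Rabs (rsum (seq 1 (S n)) (fun a => Im (u a)) + - Series (fun k => Im (u (S k)))) < eps).
  lra.
Qed.

(** * Dirichlet series *)

Lemma INR_ge_1 k : (1 <= k)%nat -> 1 <= INR k.
Proof. intros H. apply (le_INR 1 k) in H. exact H. Qed.

Lemma ln_nonneg x : 1 <= x -> 0 <= ln x.
Proof. intros H. rewrite <- ln_1. apply ln_le; lra. Qed.

Lemma Rpower_pos x y : 0 < Rpower x y.
Proof. apply exp_pos. Qed.

Lemma Rpower_le_exp x y z : 1 <= x -> y <= z -> Rpower x y <= Rpower x z.
Proof. intros Hx Hyz. apply exp_le. apply Rmult_le_compat_r; auto. apply ln_nonneg; auto. Qed.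

Lemma Rpower_ge_1 x y : 1 <= x -> 0 <= y -> 1 <= Rpower x y.
Proof. intros. rewrite <- (Rpower_O x) by lra. apply Rpower_le_exp; auto. Qed.

Lemma Rpower_le_base x y z : 0 < x -> x <= y -> 0 <= z -> Rpower x z <= Rpower y z.
Proof. intros Hx Hxy Hz. apply exp_le. apply Rmult_le_compat_l; auto. apply ln_le; auto. Qed.

Lemma Rpower_le_base_neg x y z : 0 < x -> x <= y -> z <= 0 -> Rpower y z <= Rpower x z.
Proof. intros Hx Hxy Hz. apply exp_le. assert (h := ln_le x y Hx Hxy). nra. Qed.

Lemma exp_ge_1_plus u : 1 + u <= exp u.
Proof.
  destruct (Req_dec u 0) as [->|h]; [rewrite exp_0; lra|]. left. apply exp_ineq1; auto.
Qed.

Lemma ln_le_Rpower x d : 1 <= x -> 0 < d -> ln x <= Rpower x d / d.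
Proof.
  intros Hx Hd. assert (h := exp_ge_1_plus (d * ln x)). unfold Rpower.
  apply Rmult_le_reg_r with d; auto. unfold Rdiv. rewrite Rmult_assoc, Rinv_l; lra.
Qed.

Lemma Cmod_ncpow n s : Cmod (ncpow n s) = Rpower (INR n) (Re s).
Proof.
  unfold ncpow. rewrite Cmod_Cexp. unfold Rpower. f_equal. destruct s; simpl. ring.
Qed.

Lemma ncpow_mult n m s : (1 <= n)%nat -> (1 <= m)%nat -> ncpow (n * m) s = (ncpow n s * ncpow m s)%C.
Proof.
  intros Hn Hm. apply INR_ge_1 in Hn. apply INR_ge_1 in Hm.
  unfold ncpow. rewrite mult_INR, ln_mult by lra. rewrite <- Cexp_plus, RtoC_plus. f_equal. ring.
Qed.

Lemma ncpow_plus n s t : ncpow n (s + t) = (ncpow n s * ncpow n t)%C.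
Proof. unfold ncpow. rewrite <- Cexp_plus. f_equal. ring. Qed.

Lemma ncpow_1 s : ncpow 1 s = RtoC 1.
Proof. unfold ncpow. simpl INR. rewrite ln_1. rewrite Cmult_0_r. apply Cexp_0. Qed.

(* [d / k^(1+d) <= (k-1)^(-d) - k^(-d)], from [exp u >= 1 + u] used twice. *)
Lemma zeta_partial_bound d n : 0 < d ->
  rsum (seq 1 (S n)) (fun k => Rpower (INR k) (- (1 + d))) <= 1 + / d - / d * Rpower (INR (S n)) (- d).
Proof.
  intros Hd. induction n as [|n IH].
  - unfold rsum; simpl. unfold Rpower. rewrite ln_1, !Rmult_0_r, exp_0. lra.
  - rewrite rsum_seq_S.
    assert (Hx : 1 <= INR (S n)) by (apply INR_ge_1; lia).
    rewrite (S_INR (S n)). set (x := INR (S n)) in *.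
    assert (K : Rpower (x + 1) (- (1 + d)) <= / d * Rpower x (- d) - / d * Rpower (x + 1) (- d)); [|lra].
    assert (E1 : Rpower x (- d) = Rpower (x + 1) (- d) * exp (d * (ln (x + 1) - ln x))).
    { unfold Rpower. rewrite <- exp_plus. f_equal. ring. }
    assert (E2 : Rpower (x + 1) (- (1 + d)) = Rpower (x + 1) (- d) * / (x + 1)).
    { replace (- (1 + d)) with (- d + Ropp 1) by ring. rewrite Rpower_plus, (Rpower_Ropp (x + 1) 1), Rpower_1 by lra. auto. }
    assert (L : / (x + 1) <= ln (x + 1) - ln x).
    { assert (h := exp_ge_1_plus (ln x - ln (x + 1))).
      replace (exp (ln x - ln (x + 1))) with (exp (ln x + - ln (x + 1))) in h by reflexivity. rewrite exp_plus, exp_Ropp, !exp_ln in h by lra.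
      replace (x * / (x + 1)) with (1 - / (x + 1)) in h by (field; lra). lra. }
    assert (h := exp_ge_1_plus (d * (ln (x + 1) - ln x))).
    assert (P := Rpower_pos (x + 1) (- d)).
    rewrite E1, E2.
    replace (/ d * (Rpower (x + 1) (- d) * exp (d * (ln (x + 1) - ln x))) - / d * Rpower (x + 1) (- d)) with
      (Rpower (x + 1) (- d) * (/ d * (exp (d * (ln (x + 1) - ln x)) - 1))) by ring.
    apply Rmult_le_compat_l; [lra|].
    apply Rle_trans with (/ d * (d * / (x + 1))); [right; field; lra|].
    apply Rmult_le_compat_l; [left; apply Rinv_0_lt_compat; auto|]. nra.
Qed.

Lemma zeta_bound d n : 0 < d -> rsum (seq 1 n) (fun k => Rpower (INR k) (- (1 + d))) <= 1 + / d.
Proof.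
  intros Hd. assert (Hi : 0 < / d) by (apply Rinv_0_lt_compat; auto).
  destruct n as [|n]; [unfold rsum; simpl; lra|].
  eapply Rle_trans; [apply zeta_partial_bound; auto|]. assert (P := Rpower_pos (INR (S n)) (- d)). nra.
Qed.

Definition abs_conv (beta : nat -> C) (sigma : R) : Prop :=
  exists M, forall n, rsum (seq 1 n) (fun k => Cmod (beta k) * Rpower (INR k) (- sigma)) <= M.

Lemma abs_conv_dom beta gamma sigma sigma' :
  (exists K, 0 <= K /\ forall k, (1 <= k)%nat ->
    Cmod (gamma k) * Rpower (INR k) (- sigma') <= K * (Cmod (beta k) * Rpower (INR k) (- sigma))) ->
  abs_conv beta sigma -> abs_conv gamma sigma'.
Proof.
  intros [K [HK H]] [M HM]. exists (K * M). intros n.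
  eapply Rle_trans; [apply rsum_le|].
  - intros k Hk. apply in_seq in Hk. apply H. lia.
  - cbv beta. rewrite rsum_scal. apply Rmult_le_compat_l; auto.
Qed.

Lemma abs_conv_mono beta sigma sigma' : sigma <= sigma' -> abs_conv beta sigma -> abs_conv beta sigma'.
Proof.
  intros Hs. apply abs_conv_dom. exists 1. split; [lra|]. intros k Hk. rewrite Rmult_1_l.
  apply Rmult_le_compat_l; [apply Cmod_ge_0|]. apply Rpower_le_exp; [apply INR_ge_1; auto|lra].
Qed.

Lemma abs_conv_le beta gamma sigma : (forall k, (1 <= k)%nat -> Cmod (gamma k) <= Cmod (beta k)) ->
  abs_conv beta sigma -> abs_conv gamma sigma.
Proof.
  intros H. apply abs_conv_dom. exists 1. split; [lra|]. intros k Hk. rewrite Rmult_1_l.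
  apply Rmult_le_compat_r; auto. left; apply Rpower_pos.
Qed.

Lemma abs_conv_of_bound beta K theta sigma :
  (forall k, (1 <= k)%nat -> Cmod (beta k) <= K * Rpower (INR k) theta) -> 1 + theta < sigma -> abs_conv beta sigma.
Proof.
  intros H Hs. set (d := sigma - theta - 1). assert (Hd : 0 < d) by (unfold d; lra).
  assert (HK : 0 <= K).
  { assert (h := H 1%nat (Nat.le_refl _)). assert (P := Cmod_ge_0 (beta 1%nat)). assert (Q := Rpower_pos (INR 1) theta). nra. }
  exists (K * (1 + / d)). intros n. eapply Rle_trans; [|apply Rmult_le_compat_l; [exact HK|apply (zeta_bound d n Hd)]].
  rewrite <- rsum_scal. apply rsum_le. intros k Hk. apply in_seq in Hk. 
  replace (- (1 + d)) with (theta + - sigma) by (unfold d; ring). rewrite Rpower_plus, <- Rmult_assoc.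
  apply Rmult_le_compat_r; [left; apply Rpower_pos|]. apply H; lia.
Qed.

Definition times_log (beta : nat -> C) (k : nat) : C := (RtoC (ln (INR k)) * beta k)%C.

Lemma abs_conv_log beta sigma sigma' : sigma < sigma' -> abs_conv beta sigma -> abs_conv (times_log beta) sigma'.
Proof.
  intros Hs. apply abs_conv_dom. set (d := sigma' - sigma). assert (Hd : 0 < d) by (unfold d; lra).
  exists (/ d). split; [left; apply Rinv_0_lt_compat; auto|]. intros k Hk.
  assert (H1 := INR_ge_1 k Hk). unfold times_log. rewrite Cmod_mult, Cmod_R, Rabs_right by (apply Rle_ge, ln_nonneg; auto).
  assert (h := ln_le_Rpower (INR k) d H1 Hd).
  replace (- sigma) with (d + - sigma') by (unfold d; ring). rewrite Rpower_plus.
  assert (P := Rpower_pos (INR k) (- sigma')). assert (Q := Cmod_ge_0 (beta k)).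
  replace (/ d * (Cmod (beta k) * (Rpower (INR k) d * Rpower (INR k) (- sigma')))) with
    (Rpower (INR k) d / d * (Cmod (beta k) * Rpower (INR k) (- sigma'))) by (unfold Rdiv; ring).
  rewrite Rmult_assoc. apply Rmult_le_compat_r; auto. apply Rmult_le_pos; lra.
Qed.

Lemma Cmod_dirichlet_summand beta k s :
  Cmod (beta k * ncpow k (- s)) = Cmod (beta k) * Rpower (INR k) (- Re s).
Proof. rewrite Cmod_mult, Cmod_ncpow. destruct s; reflexivity. Qed.

Lemma dirichlet_sums beta s : abs_conv beta (Re s) ->
  Csums (fun k => beta k * ncpow k (- s))%C (dirichlet_series beta s).
Proof.
  intros [M HM]. apply (Csums_CSeries (fun k => beta k * ncpow k (- s))%C M).
  intros n. erewrite rsum_ext; [apply HM|]. intros k _. apply Cmod_dirichlet_summand.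
Qed.

(** The remainder contains [(ln k)^2 exp (|h| ln k)]. Each [ln k] is at most [k^d / d], and the
    exponential is at most [k^d], which explains [3 d] in the exponent. *)
Lemma ncpow_taylor k s h d : (1 <= k)%nat -> 0 < d -> Cmod h < d ->
  Cmod (ncpow k (- (s + h)) - ncpow k (- s) + h * (RtoC (ln (INR k)) * ncpow k (- s))) <=
  (Cmod h * Cmod h) * (/ d * / d * Rpower (INR k) (- (Re s - 3 * d))).
Proof.
  intros Hk Hd Hh. assert (H1 := INR_ge_1 k Hk). assert (Hl := ln_nonneg _ H1).
  set (x := ln (INR k)) in *. set (w := (- h * RtoC x)%C).
  assert (E : ncpow k (- (s + h)) = (ncpow k (- s) * Cexp w)%C).
  { unfold ncpow, w. fold x. rewrite <- Cexp_plus. f_equal. ring. }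
  rewrite E.
  replace (ncpow k (- s) * Cexp w - ncpow k (- s) + h * (x * ncpow k (- s)))%C with
    (ncpow k (- s) * (Cexp w - 1 - w))%C by (unfold w; ring).
  rewrite Cmod_mult, Cmod_ncpow. replace (Re (- s)) with (- Re s) by (destruct s; reflexivity).
  assert (Ew : Cmod w = Cmod h * x) by (unfold w; rewrite Cmod_mult, Cmod_opp, Cmod_R, Rabs_right; auto; lra).
  assert (B := Cexp_sub_1_sub_le w). rewrite Ew in B.
  assert (P := Cmod_ge_0 h).
  assert (L := ln_le_Rpower (INR k) d H1 Hd). fold x in L.
  assert (X : exp (Cmod h * x) <= Rpower (INR k) d).
  { apply exp_le. fold x. apply Rmult_le_compat_r; lra. }
  set (p := Rpower (INR k) d) in *. assert (Pp : 0 < p) by apply Rpower_pos.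
  replace (Rpower (INR k) (- (Re s - 3 * d))) with (Rpower (INR k) (- Re s) * (p * p * p)).
  2:{ unfold p. rewrite <- !Rpower_plus. f_equal. ring. }
  assert (Pr := Rpower_pos (INR k) (- Re s)). set (r := Rpower (INR k) (- Re s)) in *.
  apply Rle_trans with (r * ((Cmod h * Cmod h) * (p / d * (p / d) * p))).
  - apply Rmult_le_compat_l; [lra|]. eapply Rle_trans; [exact B|].
    replace (Cmod h * x * (Cmod h * x) * exp (Cmod h * x)) with ((Cmod h * Cmod h) * (x * x * exp (Cmod h * x))) by ring.
    apply Rmult_le_compat_l; [nra|].
    apply Rmult_le_compat; [nra|left; apply exp_pos| |exact X]. apply Rmult_le_compat; lra.
  - right. field. lra.
Qed.

Lemma Cdiff_dirichlet beta sigma s : abs_conv beta sigma -> sigma < Re s ->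
  Cdiff (dirichlet_series beta) s (- dirichlet_series (times_log beta) s)%C.
Proof.
  intros [M HM] Hs.
  (* A quarter of the gap: the Taylor bound loses [3 d], and [s + h] still lies to the right of
     [sigma]. *)
  set (d := (Re s - sigma) / 4). assert (Hd : 0 < d) by (unfold d; lra).
  apply Cdiff_of_quadratic with (/ d * / d * M) d; auto. intros h Hh.
  assert (Hre : Rabs (Re h) < d) by (eapply Rle_lt_trans; [apply re_le_Cmod|auto]). apply Rabs_def2 in Hre.
  assert (S1 := dirichlet_sums beta (s + h)%C ltac:(apply abs_conv_mono with sigma; [destruct s, h; simpl in *; unfold d in *; lra|exists M; auto])).
  assert (S2 := dirichlet_sums beta s ltac:(apply abs_conv_mono with sigma; [lra|exists M; auto])).
  assert (S3 := dirichlet_sums (times_log beta) s ltac:(apply abs_conv_log with sigma; [lra|exists M; auto])).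
  assert (S4 := Csums_minus _ _ _ _ (Csums_minus _ _ _ _ S1 S2) (Csums_scal (- h)%C _ _ S3)).
  replace (dirichlet_series beta (s + h) - dirichlet_series beta s - - dirichlet_series (times_log beta) s * h)%C with
    (dirichlet_series beta (s + h) - dirichlet_series beta s - - h * dirichlet_series (times_log beta) s)%C by ring.
  eapply Csums_norm_le; [exact S4|]. intros n.
  eapply Rle_trans; [apply lsum_norm_le|].
  apply Rle_trans with (rsum (seq 1 n) (fun k => (Cmod h * Cmod h * (/ d * / d)) * (Cmod (beta k) * Rpower (INR k) (- sigma)))).
  - apply rsum_le. intros k Hk. apply in_seq in Hk.
    assert (T := ncpow_taylor k s h d ltac:(lia) Hd Hh).
    match goal with |- Cmod ?u <= _ => replace u with (beta k * (ncpow k (- (s + h)) - ncpow k (- s) + h * (RtoC (ln (INR k)) * ncpow k (- s))))%C by (unfold times_log; ring) end.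
    rewrite Cmod_mult.
    replace (Cmod h * Cmod h * (/ d * / d) * (Cmod (beta k) * Rpower (INR k) (- sigma))) with
      (Cmod (beta k) * (Cmod h * Cmod h * (/ d * / d * Rpower (INR k) (- sigma)))) by ring.
    apply Rmult_le_compat_l; [apply Cmod_ge_0|]. eapply Rle_trans; [exact T|].
    apply Rmult_le_compat_l; [apply Rmult_le_pos; apply Cmod_ge_0|].
    apply Rmult_le_compat_l; [apply Rmult_le_pos; left; apply Rinv_0_lt_compat; auto|].
    apply Rpower_le_exp; [apply INR_ge_1; lia|]. unfold d. lra.
  - rewrite rsum_scal.
    apply Rle_trans with (Cmod h * Cmod h * (/ d * / d) * M); [|right; ring].
    apply Rmult_le_compat_l; auto.
    apply Rmult_le_pos; apply Rmult_le_pos; try apply Cmod_ge_0; left; apply Rinv_0_lt_compat; auto.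
Qed.

(** Every term beyond the first decays at least like [2^(-Re s)]. The limit serves to identify a
    constant of integration when the twisted series is written as an exponential. *)
Lemma dirichlet_limit beta sigma : abs_conv beta sigma -> forall eps, 0 < eps -> exists X, forall s, X <= Re s ->
  Cmod (dirichlet_series beta s - beta 1%nat) <= eps.
Proof.
  intros [M HM] eps He.
  assert (HM0 : 0 <= M) by (apply (HM O)).
  assert (Hl2 : 0 < ln 2) by (rewrite <- ln_1; apply ln_increasing; lra).
  assert (He' : 0 < M / eps + 1) by (assert (0 <= M / eps) by (apply Rdiv_le_0_compat; lra); lra).
  (* Chosen so that [2^Y >= M / eps + 1]. In the majorant used below, the index 1 carries its own
     term as a default value, since the tail starts at 2. *)
  set (Y := Rmax 0 (ln (M / eps + 1) / ln 2)).
  exists (sigma + Y). intros s Hs. assert (HY : 0 <= Y) by apply Rmax_l.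
  assert (HY2 : M * exp (- (Y * ln 2)) <= eps).
  { assert (HY3 : ln (M / eps + 1) <= Y * ln 2).
    { apply Rmult_le_reg_r with (/ ln 2); [apply Rinv_0_lt_compat; auto|].
      rewrite Rmult_assoc, Rinv_r, Rmult_1_r by lra. apply Rmax_r. }
    assert (h := exp_le _ _ HY3). rewrite exp_ln in h by auto. rewrite exp_Ropp.
    assert (Pe := exp_pos (Y * ln 2)).
    apply Rmult_le_reg_r with (exp (Y * ln 2)); auto. rewrite Rmult_assoc, Rinv_l by lra.
    assert (eps * (M / eps + 1) <= eps * exp (Y * ln 2)) by (apply Rmult_le_compat_l; lra).
    replace (eps * (M / eps + 1)) with (M + eps) in H by (field; lra). lra. }
  assert (HS := dirichlet_sums beta s ltac:(apply abs_conv_mono with sigma; [lra|exists M; auto])).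
  apply Rle_trans with (M * exp (- (Y * ln 2))); auto.
  assert (T := Csums_tail_le (fun k => beta k * ncpow k (- s))%C _
    (fun k => if le_dec 2 k then exp (- (Y * ln 2)) * (Cmod (beta k) * Rpower (INR k) (- sigma)) else Cmod (beta k * ncpow k (- s))%C) 1 (M * exp (- (Y * ln 2))) HS).
  replace (lsum (seq 1 1) (fun k => beta k * ncpow k (- s))%C) with (beta 1%nat) in T.
  2:{ unfold lsum; simpl. rewrite ncpow_1. ring. }
  apply T.
  - intros k Hk. destruct (le_dec 2 k) as [h|h]; [|lra]. rewrite Cmod_dirichlet_summand.
    replace (exp (- (Y * ln 2)) * (Cmod (beta k) * Rpower (INR k) (- sigma))) with
      (Cmod (beta k) * (exp (- (Y * ln 2)) * Rpower (INR k) (- sigma))) by ring.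
    apply Rmult_le_compat_l; [apply Cmod_ge_0|].
    unfold Rpower. rewrite <- exp_plus. apply exp_le.
    assert (Hk2 : ln 2 <= ln (INR k)) by (apply ln_le; [lra|]; apply (le_INR 2 k) in h; simpl in h; lra).
    nra.
  - intros l Hl Hk. destruct (NoDup_bounded_list l) as [n Hn].
    rewrite (rsum_ext l _ (fun k => exp (- (Y * ln 2)) * (Cmod (beta k) * Rpower (INR k) (- sigma)))).
    2:{ intros k Hk'. destruct (le_dec 2 k); auto. specialize (Hk k Hk'). lia. }
    rewrite rsum_scal, Rmult_comm. apply Rmult_le_compat_r; [left; apply exp_pos|].
    eapply Rle_trans; [|apply (HM n)]. apply rsum_incl; auto.
    + intros k Hk'. apply in_seq. specialize (Hk k Hk'). specialize (Hn k Hk'). lia.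
    + intros k _. apply Rmult_le_pos; [apply Cmod_ge_0|left; apply Rpower_pos].
Qed.

(** * Dirichlet convolution and uniqueness of Dirichlet coefficients *)

Definition dconv (u v : nat -> C) (n : nat) : C :=
  lsum (seq 1 n) (fun d => if (n mod d =? 0)%nat then u d * v (n / d)%nat else RtoC 0)%C.

Lemma div_succ_cases d X : (1 <= d)%nat ->
  if (S X mod d =? 0)%nat then (S X / d = S (X / d))%nat else (S X / d = X / d)%nat.
Proof.
  intros Hd. assert (E := Nat.div_mod X d ltac:(lia)). assert (B := Nat.mod_upper_bound X d ltac:(lia)).
  set (r := (X mod d)%nat) in *. set (k := (X / d)%nat) in *.
  destruct (Nat.eq_dec (S r) d) as [h|h].
  - assert (E1 : (S X = d * S k + 0)%nat) by nia.
    assert (M := Nat.mod_unique (S X) d (S k) 0 ltac:(lia) E1). assert (D := Nat.div_unique (S X) d (S k) 0 ltac:(lia) E1).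
    rewrite <- M, <- D. reflexivity.
  - assert (E1 : (S X = d * k + S r)%nat) by nia.
    assert (M := Nat.mod_unique (S X) d k (S r) ltac:(lia) E1). assert (D := Nat.div_unique (S X) d k (S r) ltac:(lia) E1).
    rewrite <- M, <- D. reflexivity.
Qed.

(** The pairs with product at most [X] are grouped by their first entry. In the induction, passing
    from [X] to [X + 1] increases [X / d] exactly when [d] divides [X + 1]. *)
Lemma dconv_partial_sum (u v : nat -> C) X :
  lsum (seq 1 X) (dconv u v) = lsum (seq 1 X) (fun d => u d * lsum (seq 1 (X / d)) v)%C.
Proof.
  induction X as [|X IH]; [reflexivity|].
  rewrite lsum_seq_S, IH.
  replace (lsum (seq 1 X) (fun d => u d * lsum (seq 1 (X / d)) v)%C) with
    (lsum (seq 1 (S X)) (fun d => u d * lsum (seq 1 (X / d)) v)%C).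
  2:{ rewrite lsum_seq_S. rewrite (Nat.div_small X (S X)) by lia. simpl seq. unfold lsum at 3. simpl. ring. }
  unfold dconv. rewrite <- lsum_plus. apply lsum_ext. intros d Hd. apply in_seq in Hd.
  assert (h := div_succ_cases d X ltac:(lia)). destruct (S X mod d =? 0)%nat; rewrite h; [rewrite lsum_seq_S|]; ring.
Qed.

Lemma dconv_twist (u v g : nat -> C) n : (forall a b, (1 <= a)%nat -> (1 <= b)%nat -> g (a * b)%nat = g a * g b)%C ->
  (1 <= n)%nat -> (dconv u v n * g n = dconv (fun k => u k * g k) (fun k => v k * g k) n)%C.
Proof.
  intros Hg Hn. unfold dconv. rewrite Cmult_comm, <- lsum_scal. apply lsum_ext. intros d Hd. apply in_seq in Hd.
  destruct (n mod d =? 0)%nat eqn:E; [|ring]. apply Nat.eqb_eq in E.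
  assert (En : n = (d * (n / d))%nat) by (assert (q := Nat.div_mod n d ltac:(lia)); lia).
  assert (Hq : (1 <= n / d)%nat) by (destruct (n / d)%nat; lia).
  rewrite En at 1. rewrite Hg by lia. ring.
Qed.

(** Mertens' theorem: absolute convergence of one factor is enough. In the formula for the partial
    sums, the inner sums are close to [V] for [d <= n1], and for [d > n1] the tail of [u] is small
    while the inner errors are bounded. *)
Lemma Csums_dconv (u v : nat -> C) U V M : Csums u U -> Csums v V ->
  (forall n, rsum (seq 1 n) (fun k => Cmod (u k)) <= M) -> Csums (dconv u v) (U * V)%C.
Proof.
  intros HU HV HM eps He.
  assert (HM0 : 0 <= M) by (apply (HM O)).
  assert (Pv := Cmod_ge_0 V). assert (Pm := Cmod_ge_0 U).
  assert (HB : exists B, 0 < B /\ forall n, Cmod (lsum (seq 1 n) v - V) <= B).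
  { destruct (HV 1 ltac:(lra)) as [n0 Hn0].
    assert (Fin : forall m, exists B, 0 < B /\ forall n, (n < m)%nat -> Cmod (lsum (seq 1 n) v - V) <= B).
    { induction m as [|m [B [HB1 HB2]]]; [exists 1; split; [lra|lia]|].
      exists (B + Cmod (lsum (seq 1 m) v - V)). assert (q := Cmod_ge_0 (lsum (seq 1 m) v - V)). split; [lra|].
      intros n Hn. destruct (Nat.eq_dec n m) as [->|h]; [lra|]. specialize (HB2 n ltac:(lia)). lra. }
    destruct (Fin n0) as [B [HB1 HB2]]. exists (B + 1). split; [lra|]. intros n.
    destruct (Nat.lt_ge_cases n n0) as [h|h]; [specialize (HB2 n h); lra|specialize (Hn0 n h); lra]. }
  destruct HB as [B [HB0 HB]].
  destruct (HV (eps / (4 * (M + 1)))) as [Y HY]; [apply Rdiv_lt_0_compat; lra|].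
  destruct (tail_small (fun k => Cmod (u k)) M (fun k => Cmod_ge_0 _) HM (eps / (4 * B))) as [n1 Hn1];
    [apply Rdiv_lt_0_compat; lra|].
  destruct (HU (eps / (4 * (Cmod V + 1)))) as [n2 Hn2]; [apply Rdiv_lt_0_compat; lra|].
  (* The product guarantees [X / d >= Y] for every [d <= n1]. *)
  exists (max n2 ((S n1) * (S Y))). intros X HX. rewrite dconv_partial_sum.
  specialize (Hn2 X ltac:(lia)).
  replace (lsum (seq 1 X) (fun d => u d * lsum (seq 1 (X / d)) v) - U * V)%C with
    (lsum (seq 1 X) (fun d => u d * (lsum (seq 1 (X / d)) v - V)) + (lsum (seq 1 X) u - U) * V)%C.
  2:{ rewrite (lsum_ext _ (fun d => u d * (lsum (seq 1 (X / d)) v - V))%C (fun d => u d * lsum (seq 1 (X / d)) v - V * u d)%C) by (intros; ring).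
      rewrite lsum_minus, lsum_scal. ring. }
  eapply Rle_lt_trans; [apply Cmod_triangle|]. rewrite Cmod_mult.
  assert (T2 : Cmod (lsum (seq 1 X) u - U) * Cmod V <= eps / 4).
  { apply Rle_trans with (eps / (4 * (Cmod V + 1)) * Cmod V); [apply Rmult_le_compat_r; lra|].
    apply Rmult_le_reg_r with (4 * (Cmod V + 1)); [lra|].
    replace (eps / (4 * (Cmod V + 1)) * Cmod V * (4 * (Cmod V + 1))) with (eps * Cmod V) by (field; lra).
    replace (eps / 4 * (4 * (Cmod V + 1))) with (eps * (Cmod V + 1)) by (field; lra). nra. }
  assert (T1 : Cmod (lsum (seq 1 X) (fun d => u d * (lsum (seq 1 (X / d)) v - V))%C) <= eps / 4 + eps / 4).
  { rewrite (seq_1_app n1 X) by nia. rewrite lsum_app.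
    eapply Rle_trans; [apply Cmod_triangle|]. apply Rplus_le_compat.
    - eapply Rle_trans; [apply lsum_norm_le|].
      apply Rle_trans with (rsum (seq 1 n1) (fun k => eps / (4 * (M + 1)) * Cmod (u k))).
      + apply rsum_le. intros d Hd. apply in_seq in Hd. rewrite Cmod_mult, Rmult_comm.
        apply Rmult_le_compat_r; [apply Cmod_ge_0|]. left. apply HY.
        apply Nat.div_le_lower_bound; nia.
      + rewrite rsum_scal. specialize (HM n1).
        apply Rle_trans with (eps / (4 * (M + 1)) * M).
        { apply Rmult_le_compat_l; auto. left. apply Rdiv_lt_0_compat; lra. }
        apply Rmult_le_reg_r with (4 * (M + 1)); [lra|].
        replace (eps / (4 * (M + 1)) * M * (4 * (M + 1))) with (eps * M) by (field; lra).
        replace (eps / 4 * (4 * (M + 1))) with (eps * (M + 1)) by (field; lra). nra.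
    - eapply Rle_trans; [apply lsum_norm_le|].
      apply Rle_trans with (rsum (seq (S n1) (X - n1)) (fun k => B * Cmod (u k))).
      + apply rsum_le. intros d Hd. rewrite Cmod_mult, Rmult_comm.
        apply Rmult_le_compat_r; [apply Cmod_ge_0|]. auto.
      + rewrite rsum_scal. apply Rle_trans with (B * (eps / (4 * B))); [|right; field; lra].
        apply Rmult_le_compat_l; [lra|]. apply Hn1; [apply seq_NoDup|]. intros k Hk. apply in_seq in Hk. lia. }
  lra.
Qed.

(** Once the coefficients below [m] vanish, multiplication by [m^x] isolates [w m] as [x] grows,
    because the remaining terms decay like [(m / (m + 1))^x]. Strong induction on [m]. *)
Lemma dirichlet_unique (w : nat -> C) (sigma : R) :
  (forall x, sigma <= x -> Csums (fun k => w k * ncpow k (- RtoC x))%C 0) ->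
  forall k, (1 <= k)%nat -> w k = RtoC 0.
Proof.
  intros H.
  assert (Hb : exists B, 0 < B /\ forall k, (1 <= k)%nat -> Cmod (w k) <= B * Rpower (INR k) sigma).
  { destruct (H sigma ltac:(lra) 1 ltac:(lra)) as [n0 Hn0].
    set (t := fun k => (w k * ncpow k (- RtoC sigma))%C).
    assert (Fin : forall m, exists B, 0 < B /\ forall n, (n < m)%nat -> Cmod (t n) <= B).
    { induction m as [|m [B [HB1 HB2]]]; [exists 1; split; [lra|lia]|].
      exists (B + Cmod (t m)). assert (q := Cmod_ge_0 (t m)). split; [lra|].
      intros n Hn. destruct (Nat.eq_dec n m) as [->|h]; [lra|]. specialize (HB2 n ltac:(lia)). lra. }
    destruct (Fin (S n0)) as [B [HB1 HB2]]. exists (B + 2). split; [lra|]. intros k Hk.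
    assert (Ht : Cmod (t k) <= B + 2).
    { destruct (Nat.lt_ge_cases k (S n0)) as [h|h]; [specialize (HB2 k h); lra|].
      destruct k as [|k]; [lia|]. assert (A1 := Hn0 k ltac:(lia)). assert (A2 := Hn0 (S k) ltac:(lia)).
      rewrite lsum_seq_S in A2. fold t in A1, A2.
      replace (t (S k)) with ((lsum (seq 1 k) t + t (S k) - 0) - (lsum (seq 1 k) t - 0))%C by ring.
      eapply Rle_trans; [apply Cmod_sub_triangle|]. unfold t in *. lra. }
    unfold t in Ht. rewrite Cmod_dirichlet_summand in Ht. simpl Re in Ht. rewrite Rpower_Ropp in Ht.
    assert (P := Rpower_pos (INR k) sigma).
    apply Rmult_le_reg_r with (/ Rpower (INR k) sigma); [apply Rinv_0_lt_compat; auto|].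
    rewrite (Rmult_assoc (B + 2)), Rinv_r by lra. lra. }
  destruct Hb as [B [HB0 HB]].
  intros k. induction k as [m IH] using lt_wf_ind. intros Hm.
  apply Cmod_eq_0. apply NNPP. intros Hne.
  assert (Hwm : 0 < Cmod (w m)) by (assert (q := Cmod_ge_0 (w m)); lra).
  set (x1 := INR m). assert (Hx1 : 1 <= x1) by (apply INR_ge_1; auto).
  (* With [|w k| <= B k^sigma] and [x = sigma + 2 + n], the tail is at most [B (m + 1)^(-n)] times
     the sum of [k^(-2)], which is at most 2. Multiplication by [m^x] leaves [D (m / (m + 1))^n]. *)
  set (D := B * 2 * Rpower x1 (sigma + 2)). assert (HD : 0 < D) by (unfold D; assert (q := Rpower_pos x1 (sigma + 2)); nra).
  assert (Hr : 0 < x1 / (x1 + 1) < 1).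
  { split; [apply Rdiv_lt_0_compat; lra|]. apply Rmult_lt_reg_r with (x1 + 1); [lra|].
    unfold Rdiv. rewrite Rmult_assoc, Rinv_l; lra. }
  destruct (pow_lt_1_zero (x1 / (x1 + 1)) ltac:(rewrite Rabs_right; lra) (Cmod (w m) / D)) as [n Hn].
  { apply Rdiv_lt_0_compat; auto. }
  specialize (Hn n (Nat.le_refl _)). rewrite Rabs_right in Hn by (apply Rle_ge, pow_le; lra).
  set (x := sigma + 2 + INR n). assert (Pn := pos_INR n).
  assert (HS := H x ltac:(unfold x; lra)).
  set (t := fun k => (w k * ncpow k (- RtoC x))%C) in HS.
  assert (T := Csums_tail_le t _ (fun k => if le_dec m k then B * (Rpower (x1 + 1) (- INR n) * Rpower (INR k) (-(1 + 1))) + (if le_dec (S m) k then 0 else Cmod (t k)) else 0) m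
     (B * (Rpower (x1 + 1) (- INR n) * 2)) HS).
  assert (Elead : lsum (seq 1 m) t = t m).
  { destruct m as [|m']; [lia|]. rewrite lsum_seq_S. rewrite lsum_zero; [ring|].
    intros j Hj. apply in_seq in Hj. unfold t. rewrite IH by lia. ring. }
  rewrite Elead in T.
  assert (T' : Cmod (0 - t m)%C <= B * (Rpower (x1 + 1) (- INR n) * 2)).
  { apply T.
    - intros j Hj. destruct (le_dec m j) as [h|h].
      + destruct (le_dec (S m) j) as [h'|h'].
        * rewrite Rplus_0_r. unfold t. rewrite Cmod_dirichlet_summand. simpl Re.
          assert (Hj1 := INR_ge_1 j Hj).
          apply Rle_trans with (B * Rpower (INR j) sigma * Rpower (INR j) (- x)).
          { apply Rmult_le_compat_r; [left; apply Rpower_pos|auto]. }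
          rewrite Rmult_assoc. apply Rmult_le_compat_l; [lra|]. rewrite <- Rpower_plus.
          replace (sigma + - x) with (- INR n + - (1 + 1)) by (unfold x; ring). rewrite Rpower_plus.
          apply Rmult_le_compat_r; [left; apply Rpower_pos|]. apply Rpower_le_base_neg; try lra.
          apply (le_INR (S m) j) in h'. rewrite S_INR in h'. unfold x1. lra.
        * assert (0 <= B * (Rpower (x1 + 1) (- INR n) * Rpower (INR j) (- (1 + 1)))); [|lra].
          apply Rmult_le_pos; [lra|]. apply Rmult_le_pos; left; apply Rpower_pos.
      + unfold t. rewrite IH by lia. rewrite Cmult_0_l, Cmod_0. lra.
    - intros l Hl Hk. destruct (NoDup_bounded_list l) as [nn Hnn].
      rewrite (rsum_ext l _ (fun k => (B * Rpower (x1 + 1) (- INR n)) * Rpower (INR k) (- (1 + 1)))).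
      2:{ intros j Hj. specialize (Hk j Hj). destruct (le_dec m j); [|lia]. destruct (le_dec (S m) j); [ring|lia]. }
      rewrite rsum_scal, <- Rmult_assoc. apply Rmult_le_compat_l.
      { apply Rmult_le_pos; [lra|left; apply Rpower_pos]. }
      apply Rle_trans with (1 + / 1); [|lra]. eapply Rle_trans; [|apply (zeta_bound 1 nn); lra].
      apply rsum_incl; auto.
      + intros j Hj. apply in_seq. specialize (Hk j Hj). specialize (Hnn j Hj). lia.
      + intros j _. left; apply Rpower_pos. }
  replace (0 - t m)%C with (- t m)%C in T' by ring. rewrite Cmod_opp in T'. unfold t in T'.
  rewrite Cmod_dirichlet_summand in T'. simpl Re in T'. fold x1 in T'.
  replace (- x) with (- (sigma + 2) + - INR n) in T' by (unfold x; ring).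
  rewrite Rpower_plus in T'. rewrite !Rpower_Ropp in T'. rewrite !Rpower_pow in T' by lra.
  assert (P1 := Rpower_pos x1 (sigma + 2)).
  assert (P2 : 0 < x1 ^ n) by (apply pow_lt; lra). assert (P3 : 0 < (x1 + 1) ^ n) by (apply pow_lt; lra).
  assert (Hfin : Cmod (w m) <= D * (x1 / (x1 + 1)) ^ n).
  { unfold Rdiv. rewrite Rpow_mult_distr, pow_inv. unfold D.
    apply Rmult_le_reg_r with (/ Rpower x1 (sigma + 2) * / x1 ^ n).
    { apply Rmult_lt_0_compat; apply Rinv_0_lt_compat; auto. }
    eapply Rle_trans; [exact T'|]. right. field. lra. }
  assert (D * (x1 / (x1 + 1)) ^ n < D * (Cmod (w m) / D)) by (apply Rmult_lt_compat_l; auto).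
  replace (D * (Cmod (w m) / D)) with (Cmod (w m)) in H0 by (field; lra). lra.
Qed.

(** * The Euler product and the logarithm of the twisted series *)

Definition is_prime_power (n : nat) : Prop := exists p k, is_prime p /\ (1 <= k)%nat /\ n = (p ^ k)%nat.

(** The coefficients of [log F]. The hypotheses speak about [b] at prime powers only, so its other
    values are replaced by 0. *)
Definition log_coef (b : nat -> C) (n : nat) : C :=
  if excluded_middle_informative (is_prime_power n) then b n else RtoC 0.

Lemma prime_ge_2_nat p : is_prime p -> (2 <= p)%nat.
Proof. intros H. apply prime_ge_2 in H. lia. Qed.

Lemma prime_power_base p p' j j' : is_prime p -> is_prime p' -> (1 <= j)%nat -> (p ^ j = p' ^ j')%nat -> p = p'.
Proof.
  intros Hp Hp' Hj E. apply Nat2Z.inj.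
  apply (prime_power_prime (Z.of_nat p) (Z.of_nat p') (Z.of_nat j')); auto; [lia|].
  rewrite <- Nat2Z.inj_pow, <- E, Nat2Z.inj_pow.
  exists (Z.of_nat p ^ (Z.of_nat j - 1))%Z.
  rewrite <- (Z.pow_1_r (Z.of_nat p)) at 3. rewrite <- Z.pow_add_r by lia. f_equal. lia.
Qed.

Lemma INR_pow_ln p k : (1 <= p)%nat -> ln (INR (p ^ k)) = INR k * ln (INR p).
Proof.
  intros Hp. apply INR_ge_1 in Hp. rewrite pow_INR, <- Rpower_pow by lra. unfold Rpower. rewrite ln_exp. auto.
Qed.

Lemma ncpow_pow p k s : (1 <= p)%nat -> ncpow (p ^ k) (- s) = ncpow p (- (RtoC (INR k) * s)).
Proof. intros Hp. unfold ncpow. rewrite INR_pow_ln, RtoC_mult by auto. f_equal. ring. Qed.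

Lemma log_coef_bound b theta : prime_power_bound b theta ->
  exists K, 0 <= K /\ forall n, (1 <= n)%nat -> Cmod (log_coef b n) <= K * Rpower (INR n) theta.
Proof.
  intros [K HK]. exists (Rabs K). split; [apply Rabs_pos|]. intros n Hn.
  assert (P := Rpower_pos (INR n) theta). unfold log_coef.
  destruct (excluded_middle_informative _) as [[p [k [Hp [Hk E]]]]|h].
  - subst n. eapply Rle_trans; [apply (HK p k Hp Hk)|].
    replace (Rpower (INR p) (INR k * theta)) with (Rpower (INR (p ^ k)) theta).
    + apply Rmult_le_compat_r; [lra|apply Rle_abs].
    + unfold Rpower. rewrite INR_pow_ln by (apply prime_ge_2_nat in Hp; lia). f_equal. ring.
  - rewrite Cmod_0. apply Rmult_le_pos; [apply Rabs_pos|lra].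
Qed.

Lemma lsum_perm {A} (l l' : list A) f : Permutation l l' -> lsum l f = lsum l' f.
Proof.
  induction 1; auto.
  - rewrite !lsum_cons, IHPermutation. auto.
  - rewrite !lsum_cons. ring.
  - congruence.
Qed.

Lemma lsum_flat_map {A B} (l : list A) (h : A -> list B) f : lsum (flat_map h l) f = lsum l (fun a => lsum (h a) f).
Proof. induction l as [|a l IH]; [reflexivity|]. simpl flat_map. rewrite lsum_app, lsum_cons, IH. auto. Qed.

Lemma NoDup_map_pow p n : (2 <= p)%nat -> NoDup (map (fun j => (p ^ j)%nat) (seq 1 n)).
Proof.
  intros Hp. apply FinFun.Injective_map_NoDup; [|apply seq_NoDup].
  intros x y E. apply Nat.pow_inj_r in E; auto; lia.
Qed.

Definition prime_b (p : nat) : bool := if is_prime_dec p then true else false.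

Lemma prime_b_spec p : prime_b p = true <-> is_prime p.
Proof. unfold prime_b. destruct (is_prime_dec p); split; auto; discriminate. Qed.

Lemma NoDup_prime_powers (P : list nat) K : NoDup P -> (forall p, In p P -> is_prime p) ->
  NoDup (flat_map (fun p => map (fun j => (p ^ j)%nat) (seq 1 K)) P).
Proof.
  intros HP. induction HP as [|p P Hp HP IH]; intros Hpr; [constructor|]. simpl.
  apply NoDup_app.
  - apply NoDup_map_pow, prime_ge_2_nat, Hpr. left; auto.
  - apply IH. intros; apply Hpr; right; auto.
  - intros n Hn Hn'. apply in_map_iff in Hn. destruct Hn as [j [E Hj]]. apply in_seq in Hj.
    apply in_flat_map in Hn'. destruct Hn' as [p' [Hp' Hn']].
    apply in_map_iff in Hn'. destruct Hn' as [j' [E' Hj']].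
    apply Hp. rewrite (prime_power_base p p' j j'); auto; try lia; try congruence;
    apply Hpr; simpl; auto.
Qed.

Lemma prod_primes_le_Cexp (S : nat -> C) n :
  prod_primes_le (fun p => Cexp (S p)) n = Cexp (lsum (filter prime_b (seq 1 n)) S).
Proof.
  induction n as [|n IH]; [symmetry; apply Cexp_0|].
  rewrite seq_S_1, filter_app, lsum_app, Cexp_plus, <- IH. simpl prod_primes_le. f_equal.
  simpl filter. unfold prime_b. destruct (is_prime_dec (Datatypes.S n)).
  - unfold lsum; simpl. f_equal. ring.
  - symmetry. apply Cexp_0.
Qed.

Lemma Csums_plus u v S S' : Csums u S -> Csums v S' -> Csums (fun k => u k + v k)%C (S + S')%C.
Proof.
  intros H H'. assert (Q := Csums_minus _ _ _ _ H (Csums_scal (- RtoC 1)%C _ _ H')).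
  replace (S + S')%C with (S - - RtoC 1 * S')%C by ring. eapply Csums_ext; [|exact Q]. intros; simpl; ring.
Qed.

Lemma Csums_lsum {A} (l : list A) (u : A -> nat -> C) (S : A -> C) :
  (forall a, In a l -> Csums (u a) (S a)) -> Csums (fun k => lsum l (fun a => u a k)) (lsum l S).
Proof.
  induction l as [|a l IH]; intros H.
  - intros eps He. exists O. intros n _. rewrite lsum_zero by auto. unfold lsum; simpl.
    replace (0 - 0)%C with (RtoC 0) by ring. rewrite Cmod_0. auto.
  - apply (Csums_plus (u a) (fun k => lsum l (fun a => u a k))); [apply H; left; auto|].
    apply IH. intros; apply H; right; auto.
Qed.

Lemma Csums_close u S c eps n0 : Csums u S ->
  (forall n, (n0 <= n)%nat -> Cmod (lsum (seq 1 n) u - c) <= eps) -> Cmod (S - c) <= eps.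
Proof.
  intros H Hc. apply Rnot_lt_le. intros Hlt.
  destruct (H (Cmod (S - c) - eps) ltac:(lra)) as [n1 Hn1].
  specialize (Hn1 (max n0 n1) ltac:(lia)). specialize (Hc (max n0 n1) ltac:(lia)).
  rewrite Cmod_sub_comm in Hn1.
  assert (T := Cmod_triangle (S - lsum (seq 1 (max n0 n1)) u) (lsum (seq 1 (max n0 n1)) u - c)).
  replace (S - lsum (seq 1 (max n0 n1)) u + (lsum (seq 1 (max n0 n1)) u - c))%C with (S - c)%C in T by ring. lra.
Qed.

Section EulerProduct.
Variable b : nat -> C.

Definition euler_exponent (p : nat) (s : C) : C :=
  CSeries (fun k => (b (p ^ S k)%nat * ncpow p (- (RtoC (INR (S k)) * s)))%C).

Lemma euler_exponent_sums M p s :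
  (forall n, rsum (seq 1 n) (fun k => Cmod (log_coef b k * ncpow k (- s))%C) <= M) -> is_prime p ->
  Csums (fun j => log_coef b (p ^ j) * ncpow (p ^ j) (- s))%C (euler_exponent p s).
Proof.
  intros HM Hp. assert (Hp2 := prime_ge_2_nat p Hp).
  assert (E : forall j, (1 <= j)%nat -> (b (p ^ j)%nat * ncpow p (- (RtoC (INR j) * s)) = log_coef b (p ^ j) * ncpow (p ^ j) (- s))%C).
  { intros j Hj. rewrite <- ncpow_pow by lia. unfold log_coef.
    destruct (excluded_middle_informative _) as [_|h]; auto. exfalso. apply h. exists p, j. auto. }
  eapply Csums_ext; [intros k Hk; apply E; exact Hk|].
  apply (Csums_CSeries (fun j => b (p ^ j)%nat * ncpow p (- (RtoC (INR j) * s)))%C M).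
  intros n. rewrite (rsum_ext _ _ (fun j => Cmod (log_coef b (p ^ j) * ncpow (p ^ j) (- s))%C)).
  2:{ intros j Hj. apply in_seq in Hj. rewrite E by lia. auto. }
  rewrite <- (rsum_map (fun j => (p ^ j)%nat) (seq 1 n) (fun k => Cmod (log_coef b k * ncpow k (- s))%C)).
  eapply Rle_trans; [|apply (HM (p ^ n)%nat)]. apply rsum_incl.
  - apply NoDup_map_pow; auto.
  - intros k Hk. apply in_map_iff in Hk. destruct Hk as [j [<- Hj]]. apply in_seq in Hj. apply in_seq.
    assert (p ^ j <= p ^ n)%nat by (apply Nat.pow_le_mono_r; lia).
    assert (p ^ j <> 0)%nat by (apply Nat.pow_nonzero; lia). lia.
  - intros; apply Cmod_ge_0.
Qed.

(** A rearrangement. The powers [p^j] with [p <= n] and [j <= K] contain every prime power up to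
    [n0] as soon as [n] and [K] reach [n0]; the others exceed [n0] and form part of a small tail. *)
Lemma euler_sum_converges s : abs_conv (log_coef b) (Re s) ->
  forall eps, 0 < eps -> exists n0, forall n, (n0 <= n)%nat ->
   Cmod (lsum (filter prime_b (seq 1 n)) (fun p => euler_exponent p s) - dirichlet_series (log_coef b) s) <= eps.
Proof.
  intros Hac eps He. set (t := fun k => (log_coef b k * ncpow k (- s))%C).
  assert (HS := dirichlet_sums _ _ Hac). fold t in HS.
  destruct Hac as [M HM].
  assert (HM' : forall n, rsum (seq 1 n) (fun k => Cmod (t k)) <= M).
  { intros n. erewrite rsum_ext; [apply HM|]. intros k _. apply Cmod_dirichlet_summand. }
  destruct (tail_small (fun k => Cmod (t k)) M (fun k => Cmod_ge_0 _) HM' (eps / 2) ltac:(lra)) as [n0 Hn0].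
  exists n0. intros n Hn.
  assert (T1 : Cmod (dirichlet_series (log_coef b) s - lsum (seq 1 n0) t) <= eps / 2).
  { apply (Csums_tail_le t _ (fun k => Cmod (t k))); auto. intros; lra. }
  set (P := filter prime_b (seq 1 n)).
  assert (HP : NoDup P) by apply NoDup_filter, seq_NoDup.
  assert (HPp : forall p, In p P -> is_prime p) by (intros p Hp; apply filter_In in Hp; apply prime_b_spec; tauto).
  assert (T2 : Cmod (lsum P (fun p => euler_exponent p s) - lsum (seq 1 n0) t) <= eps / 2).
  { apply (Csums_close (fun j => lsum P (fun p => t (p ^ j)%nat)) _ _ _ n0).
    - apply (Csums_lsum P (fun p j => t (p ^ j)%nat)). intros p Hp. apply (euler_exponent_sums M); auto.
    - intros K HK. rewrite lsum_swap.
      rewrite (lsum_ext P _ (fun p => lsum (map (fun j => (p ^ j)%nat) (seq 1 K)) t)).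
      2:{ intros p _. rewrite lsum_map. reflexivity. }
      rewrite <- lsum_flat_map.
      set (l := flat_map (fun p => map (fun j => (p ^ j)%nat) (seq 1 K)) P).
      assert (Hl : NoDup l) by (apply NoDup_prime_powers; auto).
      rewrite (lsum_split (fun k => k <=? n0)%nat l t).
      assert (E : lsum (filter (fun k => (k <=? n0)%nat) l) t = lsum (seq 1 n0) t).
      (* Up to [n0] the two index lists differ only by integers that are not prime powers, where the
         coefficient is 0. *)
      { set (pp := fun k => if excluded_middle_informative (is_prime_power k) then true else false).
        rewrite (lsum_split pp (seq 1 n0) t).
        rewrite (lsum_zero (filter (fun a => negb (pp a)) (seq 1 n0))).
        2:{ intros k Hk. apply filter_In in Hk. destruct Hk as [_ Hk]. unfold pp in Hk. unfold t, log_coef.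
            destruct (excluded_middle_informative (is_prime_power k)); [discriminate|ring]. }
        rewrite Cplus_0_r. apply lsum_perm. apply NoDup_Permutation.
        - apply NoDup_filter; auto.
        - apply NoDup_filter, seq_NoDup.
        - intros k. rewrite !filter_In. rewrite in_seq. unfold pp. split.
          + intros [Hk Hk']. apply Nat.leb_le in Hk'. apply in_flat_map in Hk. destruct Hk as [p [Hp Hk]].
            apply in_map_iff in Hk. destruct Hk as [j [<- Hj]]. apply in_seq in Hj.
            assert (q := prime_ge_2_nat p (HPp p Hp)).
            assert (p ^ j <> 0)%nat by (apply Nat.pow_nonzero; lia). split; [lia|].
            destruct (excluded_middle_informative _) as [_|h]; auto. exfalso. apply h. exists p, j.
            split; [apply HPp; auto|]. split; [lia|auto].
          + intros [Hk1 Hk2]. split; [|apply Nat.leb_le; lia].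
            destruct (excluded_middle_informative _) as [[p [j [Hp [Hj ->]]]]|h]; [|discriminate].
            assert (q := prime_ge_2_nat p Hp).
            assert (p ^ 1 <= p ^ j)%nat by (apply Nat.pow_le_mono_r; lia).
            assert (j < p ^ j)%nat by (apply Nat.pow_gt_lin_r; lia). rewrite Nat.pow_1_r in *.
            apply in_flat_map. exists p. split.
            * apply filter_In. split; [apply in_seq; lia|apply prime_b_spec; auto].
            * apply in_map_iff. exists j. split; auto. apply in_seq. lia. }
      rewrite E.
      match goal with |- Cmod ?u <= _ => replace u with (lsum (filter (fun a => negb (a <=? n0)%nat) l) t) by ring end.
      eapply Rle_trans; [apply lsum_norm_le|]. apply Hn0; [apply NoDup_filter; auto|].
      intros k Hk. apply filter_In in Hk. destruct Hk as [_ Hk]. apply Bool.negb_true_iff, Nat.leb_gt in Hk. auto. }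
  rewrite Cmod_sub_comm in T1.
  assert (T := Cmod_triangle (lsum P (fun p => euler_exponent p s) - lsum (seq 1 n0) t) (lsum (seq 1 n0) t - dirichlet_series (log_coef b) s)).
  replace (lsum P (fun p => euler_exponent p s) - lsum (seq 1 n0) t + (lsum (seq 1 n0) t - dirichlet_series (log_coef b) s))%C with
    (lsum P (fun p => euler_exponent p s) - dirichlet_series (log_coef b) s)%C in T by ring.
  lra.
Qed.
End EulerProduct.

Lemma ball_Cmod (x y : C) eps : @ball C_UniformSpace x eps y -> Cmod (y - x) < 2 * eps.
Proof.
  intros [H1 H2]. eapply Rle_lt_trans; [apply Cmod_le_Re_Im|].
  change (Rabs (Re y - Re x) < eps) in H1. change (Rabs (Im y - Im x) < eps) in H2.
  destruct x, y. simpl in *. unfold Rminus in *. lra.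
Qed.

(** * The series and its twists as exponentials *)

Section TwistedLog.
Variables (a b : nat -> C) (m : nat).
Hypothesis HF : dirichlet_series_conditions a b m.
Notation beta := (log_coef b).

Lemma abs_conv_a sigma : 1 < sigma -> abs_conv a sigma.
Proof.
  intros Hs. destruct (ds_coef_bound _ _ _ HF ((sigma - 1) / 2) ltac:(lra)) as [K HK].
  apply abs_conv_of_bound with K ((sigma - 1) / 2); auto. lra.
Qed.

Lemma abs_conv_beta sigma : 1 < sigma -> abs_conv beta sigma.
Proof.
  intros Hs. destruct (log_coef_bound b ((sigma - 1) / 2) (ds_log_bound_all _ _ _ HF ((sigma - 1) / 2) ltac:(lra))) as [K [_ HK]].
  apply abs_conv_of_bound with K ((sigma - 1) / 2); auto. lra.
Qed.

(** Partial Euler products are exponentials of partial sums over primes; continuity of [Cexp] and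
    uniqueness of limits give the identity. *)
Lemma dirichlet_a_exp s : 1 < Re s -> dirichlet_series a s = Cexp (dirichlet_series beta s).
Proof.
  intros Hs. assert (He := ds_euler_product _ _ _ HF s Hs).
  assert (Hsum := euler_sum_converges b s (abs_conv_beta _ Hs)).
  apply NNPP. intros Hne. set (D := Cmod (dirichlet_series a s - Cexp (dirichlet_series beta s))).
  assert (HD : 0 < D) by (apply Cmod_gt_0, sub_neq_0; auto).
  assert (Hc := Cdiff_cont _ _ _ (Cdiff_Cexp (dirichlet_series beta s))).
  destruct (Hc (D / 2) ltac:(lra)) as [dl [Hdl Hcc]].
  destruct (Hsum (dl / 2) ltac:(lra)) as [n1 Hn1].
  assert (Hev := He (fun y => Cmod (y - dirichlet_series a s) < D / 2)).
  unfold filtermap in Hev.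
  destruct Hev as [n2 Hn2].
  { exists (mkposreal (D / 4) ltac:(lra)). intros y Hy. apply ball_Cmod in Hy. simpl in Hy. lra. }
  specialize (Hn1 (max n1 n2) ltac:(lia)). specialize (Hn2 (max n1 n2) ltac:(lia)).
  change (prod_primes_le (fun p => euler_factor b p s) (max n1 n2)) with
    (prod_primes_le (fun p => Cexp (euler_exponent b p s)) (max n1 n2)) in Hn2.
  rewrite prod_primes_le_Cexp in Hn2.
  set (z := lsum (filter prime_b (seq 1 (max n1 n2))) (fun p => euler_exponent b p s)) in *.
  assert (Hz := Hcc z ltac:(unfold Cdist; lra)).
  assert (T := Cmod_triangle (dirichlet_series a s - Cexp z) (Cexp z - Cexp (dirichlet_series beta s))).
  replace (dirichlet_series a s - Cexp z + (Cexp z - Cexp (dirichlet_series beta s)))%C with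
    (dirichlet_series a s - Cexp (dirichlet_series beta s))%C in T by ring.
  fold D in T. rewrite Cmod_sub_comm in Hn2. lra.
Qed.

Lemma half_plane_nbhd s x : x < Re s -> exists d, 0 < d /\ forall w, Cdist w s < d -> x < Re w.
Proof.
  intros H. exists (Re s - x). split; [lra|]. intros w Hw.
  assert (h := Cmod_Re_sub w s). unfold Cdist in Hw. assert (Rabs (Re w - Re s) < Re s - x) by lra.
  apply Rabs_def2 in H0. lra.
Qed.

(* Comparing coefficients in F' = F (log F)'. *)
Lemma log_recursion n : (1 <= n)%nat -> times_log a n = dconv (times_log beta) a n.
Proof.
  intros Hn.
  assert (Z : forall k, (1 <= k)%nat -> (times_log a k - dconv (times_log beta) a k = 0)%C).
  { apply (dirichlet_unique (fun k => times_log a k - dconv (times_log beta) a k)%C 2).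
    intros x Hx. set (s := RtoC x). assert (Hs : 1 < Re s) by (simpl; lra).
    assert (Hmid : 1 < (1 + x) / 2 < x) by lra.
    assert (D1 := Cdiff_dirichlet a ((1 + x) / 2) s (abs_conv_a ((1 + x) / 2) ltac:(lra)) ltac:(simpl; lra)).
    assert (D2 := Cdiff_dirichlet beta ((1 + x) / 2) s (abs_conv_beta ((1 + x) / 2) ltac:(lra)) ltac:(simpl; lra)).
    assert (D3 := Cdiff_comp Cexp (dirichlet_series beta) s _ _ D2 (Cdiff_Cexp _)).
    destruct (half_plane_nbhd s 1 Hs) as [d [Hd Hnb]].
    assert (D4 := Cdiff_ext_near _ (dirichlet_series a) s _ d Hd (fun w Hw => eq_sym (dirichlet_a_exp w (Hnb w Hw))) D3).
    assert (E := Cdiff_unique _ _ _ _ D1 D4). rewrite <- dirichlet_a_exp in E by auto.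
    assert (S1 := dirichlet_sums (times_log a) s (abs_conv_log a ((1 + x) / 2) x ltac:(lra) (abs_conv_a ((1 + x) / 2) ltac:(lra)))).
    assert (Ab := abs_conv_log beta ((1 + x) / 2) x ltac:(lra) (abs_conv_beta ((1 + x) / 2) ltac:(lra))).
    assert (S2 := dirichlet_sums (times_log beta) s Ab).
    assert (S3 := dirichlet_sums a s (abs_conv_a _ Hs)).
    destruct Ab as [M HM].
    assert (S4 := Csums_dconv _ _ _ _ M S2 S3 ltac:(intros n0; erewrite rsum_ext; [apply HM|]; intros k _; rewrite Cmod_dirichlet_summand; reflexivity)).
    assert (S5 := Csums_minus _ _ _ _ S1 S4).
    replace (RtoC 0) with (dirichlet_series (times_log a) s - dirichlet_series (times_log beta) s * dirichlet_series a s)%C.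
    - eapply Csums_ext; [|exact S5]. intros k Hk. simpl.
      rewrite <- (dconv_twist (times_log beta) a (fun k => ncpow k (- s))); auto.
      + fold s. ring.
      + intros; apply ncpow_mult; auto.
    - replace (dirichlet_series (times_log a) s) with (- - dirichlet_series (times_log a) s)%C by ring. rewrite E. ring. }
  specialize (Z n Hn). replace (times_log a n) with (times_log a n - dconv (times_log beta) a n + dconv (times_log beta) a n)%C by ring.
  rewrite Z. ring.
Qed.

Lemma log_coef_1 : beta 1%nat = RtoC 0.
Proof.
  unfold log_coef. destruct (excluded_middle_informative _) as [[p [k [Hp [Hk E]]]]|h]; auto.
  apply prime_ge_2_nat in Hp. assert (p ^ 1 <= p ^ k)%nat by (apply Nat.pow_le_mono_r; lia).
  rewrite Nat.pow_1_r in H. lia.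
Qed.

(** In the recursion at a prime only the divisors 1 and [p] occur. The first is killed by
    [ln 1 = 0], the second gives [ln p] times [b_p a_1] with [a_1 = 1]. *)
Lemma a_prime p : is_prime p -> a p = beta p.
Proof.
  intros Hp. assert (Hp2 := prime_ge_2_nat p Hp).
  assert (R := log_recursion p ltac:(lia)).
  assert (E : dconv (times_log beta) a p = times_log beta p).
  { unfold dconv. destruct p as [|p]; [lia|]. rewrite lsum_seq_S.
    rewrite lsum_zero.
    - rewrite Nat.Div0.mod_same, Nat.div_same by lia. simpl. rewrite (ds_a1 _ _ _ HF). ring.
    - intros d Hd. apply in_seq in Hd. destruct (S p mod d =? 0)%nat eqn:Ed; auto.
      apply Nat.eqb_eq in Ed. destruct (Nat.eq_dec d 1) as [->|h].
      + unfold times_log. simpl INR. rewrite ln_1. ring.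
      + exfalso. apply Nat.Lcm0.mod_divide in Ed. destruct Ed as [c Ec].
        assert (Hdiv : (Z.of_nat d | Z.of_nat (S p))%Z) by (exists (Z.of_nat c); lia).
        apply prime_divisors in Hdiv; auto. lia. }
  rewrite E in R. unfold times_log in R.
  assert (Hl : 0 < ln (INR p)).
  { rewrite <- ln_1. apply ln_increasing; [lra|]. apply (le_INR 2) in Hp2. simpl in Hp2. lra. }
  assert (Hn : RtoC (ln (INR p)) <> RtoC 0) by (intros h; apply RtoC_inj in h; lra).
  replace (a p) with (RtoC (ln (INR p)) * a p * / RtoC (ln (INR p)))%C by (field; auto).
  rewrite R. field. auto.
Qed.

Section Twist.
Variables (q : nat) (chi : Z -> C).
Hypotheses (Hchi : dirichlet_character q chi) (Hchi1 : forall n, Cmod (chi n) <= 1).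

Lemma twist_le u k : Cmod (twist u chi k) <= Cmod (u k).
Proof.
  unfold twist. rewrite Cmod_mult. assert (h := Hchi1 (Z.of_nat k)). assert (h2 := Cmod_ge_0 (u k)). nra.
Qed.

Lemma abs_conv_twist u sigma : abs_conv u sigma -> abs_conv (twist u chi) sigma.
Proof. apply abs_conv_le. intros; apply twist_le. Qed.

Lemma chi_one : chi 1%Z = RtoC 1.
Proof.
  assert (H1 : chi 1%Z <> RtoC 0) by (apply (chi_support _ _ Hchi); apply Z.gcd_1_l).
  assert (H2 := chi_mult _ _ Hchi 1%Z 1%Z). rewrite Z.mul_1_l in H2.
  replace (chi 1%Z) with (chi 1%Z * chi 1%Z * / chi 1%Z)%C by (field; auto). rewrite <- H2. field. auto.
Qed.

(** A completely multiplicative factor commutes with Dirichlet convolution, so the recursion for the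
    coefficients passes to the twist. *)
Lemma twist_log_relation s : 1 < Re s ->
  (dirichlet_series (times_log (twist a chi)) s =
   dirichlet_series (times_log (twist beta chi)) s * dirichlet_series (twist a chi) s)%C.
Proof.
  intros Hs. assert (Hmid : 1 < (1 + Re s) / 2 < Re s) by lra.
  assert (S1 := dirichlet_sums (times_log (twist a chi)) s (abs_conv_log _ ((1 + Re s) / 2) (Re s) ltac:(lra) (abs_conv_twist _ _ (abs_conv_a ((1 + Re s) / 2) ltac:(lra))))).
  assert (Ab := abs_conv_log _ ((1 + Re s) / 2) (Re s) ltac:(lra) (abs_conv_twist _ _ (abs_conv_beta ((1 + Re s) / 2) ltac:(lra)))).
  assert (S2 := dirichlet_sums _ s Ab).
  assert (S3 := dirichlet_sums _ s (abs_conv_twist _ _ (abs_conv_a _ Hs))).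
  destruct Ab as [M HM].
  assert (S4 := Csums_dconv _ _ _ _ M S2 S3 ltac:(intros n0; erewrite rsum_ext; [apply HM|]; intros k _; rewrite Cmod_dirichlet_summand; reflexivity)).
  eapply Csums_unique; [exact S1|]. eapply Csums_ext; [|exact S4].
  intros k Hk. cbv beta.
  set (g := fun k => (chi (Z.of_nat k) * ncpow k (- s))%C).
  transitivity (dconv (times_log beta) a k * g k)%C.
  - rewrite (dconv_twist (times_log beta) a g); auto.
    + unfold dconv. apply lsum_ext. intros d _. destruct (k mod d =? 0)%nat; auto. unfold g, times_log, twist. ring.
    + intros x y Hx Hy. unfold g. rewrite ncpow_mult, Nat2Z.inj_mul, (chi_mult _ _ Hchi) by auto. ring.
  - rewrite <- log_recursion by auto. unfold g, times_log, twist. ring.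
Qed.

(** By the previous relation [A exp (- B)] has derivative 0, so it is constant along horizontal
    lines. Far to the right it tends to 1, because the first coefficient is 1 for [A] and 0 for
    [B]. *)
Theorem twist_exp s : 1 < Re s -> dirichlet_series (twist a chi) s = Cexp (dirichlet_series (twist beta chi) s).
Proof.
  intros Hs. set (A := dirichlet_series (twist a chi)). set (B := dirichlet_series (twist beta chi)).
  set (F := fun w => (A w * Cexp (- B w))%C).
  assert (HF0 : forall w, 1 < Re w -> Cdiff F w 0).
  { intros w Hw. assert (Hmid : 1 < (1 + Re w) / 2 < Re w) by lra.
    assert (D1 := Cdiff_dirichlet _ ((1 + Re w) / 2) w (abs_conv_twist _ _ (abs_conv_a ((1 + Re w) / 2) ltac:(lra))) ltac:(lra)).
    assert (D2 := Cdiff_dirichlet _ ((1 + Re w) / 2) w (abs_conv_twist _ _ (abs_conv_beta ((1 + Re w) / 2) ltac:(lra))) ltac:(lra)).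
    assert (D3 := Cdiff_comp Cexp (fun v => - B v)%C w _ _ (Cdiff_opp _ _ _ D2) (Cdiff_Cexp _)).
    assert (D4 := Cdiff_mult _ _ _ _ _ D1 D3). cbv beta in D4.
    match type of D4 with Cdiff _ _ ?l => replace (RtoC 0) with l; [exact D4|] end.
    rewrite twist_log_relation by auto. fold A B. ring. }
  set (c := F s).
  assert (Hconst : forall x, 1 < x -> F (x, Im s) = c).
  { intros x Hx. apply (box_zero_derivative 1 (Rmax (Re s) x + 1) (Im s - 1) (Im s + 1)).
    - intros z [Hz _]. apply HF0. lra.
    - assert (h := Rmax_r (Re s) x). split; simpl; lra.
    - assert (h := Rmax_l (Re s) x). split; simpl; lra. }
  assert (Hc1 : c = RtoC 1).
  { apply NNPP. intros Hne. set (e := Cmod (c - 1)).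
    assert (He : 0 < e) by (apply Cmod_gt_0, sub_neq_0; auto).
    assert (Pc := Cmod_ge_0 c).
    assert (Hcont := Cdiff_cont _ _ _ (Cdiff_Cexp (RtoC 0))).
    destruct (Hcont (e / (4 * (Cmod c + 1)))) as [dl [Hdl Hcc]]; [apply Rdiv_lt_0_compat; lra|].
    destruct (dirichlet_limit _ 2 (abs_conv_twist _ _ (abs_conv_a 2 ltac:(lra))) (e / 4) ltac:(lra)) as [X1 HX1].
    destruct (dirichlet_limit _ 2 (abs_conv_twist _ _ (abs_conv_beta 2 ltac:(lra))) (dl / 2) ltac:(lra)) as [X2 HX2].
    set (x := Rmax 2 (Rmax X1 X2)).
    assert (Hx1 : 2 <= x) by apply Rmax_l.
    assert (Hx2 : X1 <= x) by (unfold x; eapply Rle_trans; [apply Rmax_l|apply Rmax_r]).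
    assert (Hx3 : X2 <= x) by (unfold x; eapply Rle_trans; [apply Rmax_r|apply Rmax_r]).
    set (z := (x, Im s) : C).
    specialize (HX1 z Hx2). specialize (HX2 z Hx3). fold A in HX1. fold B in HX2.
    assert (E1 : twist a chi 1 = RtoC 1) by (unfold twist; simpl; rewrite (ds_a1 _ _ _ HF), chi_one; ring).
    assert (E2 : twist beta chi 1 = RtoC 0) by (unfold twist; rewrite log_coef_1; ring).
    rewrite E1 in HX1. rewrite E2 in HX2.
    assert (K := Hconst x ltac:(lra)). fold z in K. unfold F in K.
    assert (K2 : A z = (c * Cexp (B z))%C).
    { rewrite <- K, Cexp_opp. field. apply Cexp_neq_0. }
    rewrite K2 in HX1.
    specialize (Hcc (B z) ltac:(unfold Cdist; lra)). rewrite Cexp_0 in Hcc.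
    assert (T := Cmod_triangle (c * Cexp (B z) - 1) (- (c * (Cexp (B z) - 1)))%C).
    replace (c * Cexp (B z) - 1 + - (c * (Cexp (B z) - 1)))%C with (c - 1)%C in T by ring.
    fold e in T. rewrite Cmod_opp, Cmod_mult in T.
    assert (Cmod c * Cmod (Cexp (B z) - 1) <= e / 4).
    { apply Rle_trans with (Cmod c * (e / (4 * (Cmod c + 1)))); [apply Rmult_le_compat_l; lra|].
      apply Rmult_le_reg_r with (4 * (Cmod c + 1)); [lra|].
      replace (Cmod c * (e / (4 * (Cmod c + 1))) * (4 * (Cmod c + 1))) with (Cmod c * e) by (field; lra).
      replace (e / 4 * (4 * (Cmod c + 1))) with (e * (Cmod c + 1)) by (field; lra). nra. }
    lra. }
  unfold c, F in Hc1. rewrite Cexp_opp in Hc1.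
  replace (A s) with (A s * / Cexp (B s) * Cexp (B s))%C by (field; apply Cexp_neq_0). rewrite Hc1. ring.
Qed.
End Twist.
End TwistedLog.

(** * Dirichlet characters *)

Lemma e_plus x y : e (x + y) = (e x * e y)%C.
Proof. unfold e. rewrite <- Cexp_plus. f_equal. rewrite <- Cmult_plus_distr_r, <- RtoC_plus. do 2 f_equal. ring. Qed.

Lemma e_0 : e 0 = RtoC 1.
Proof. unfold e. rewrite Rmult_0_r, Cmult_0_l. apply Cexp_0. Qed.

Lemma e_1 : e 1 = RtoC 1.
Proof.
  unfold e, Cexp; simpl. replace (2 * PI * 1 * 0 - 0 * 1) with 0 by ring.
  replace (2 * PI * 1 * 1 + 0 * 0) with (2 * PI) by ring.
  rewrite exp_0, cos_2PI, sin_2PI. unfold RtoC. f_equal; ring.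
Qed.

Lemma Cmod_e x : Cmod (e x) = 1.
Proof.
  unfold e. rewrite Cmod_Cexp. simpl. replace (2 * PI * x * 0 - 0 * 1) with 0 by ring. apply exp_0.
Qed.

Lemma e_neq_0 x : e x <> RtoC 0.
Proof. apply Cexp_neq_0. Qed.

Lemma e_inv_neq_1 r : (2 <= r)%nat -> e (/ INR r) <> RtoC 1.
Proof.
  intros Hr H. apply (le_INR 2) in Hr. simpl in Hr.
  apply (f_equal Re) in H. unfold e, Cexp in H; simpl in H.
  replace (2 * PI * / INR r * 0 - 0 * 1) with 0 in H by ring. rewrite exp_0, Rmult_1_l in H.
  replace (2 * PI * / INR r * 1 + 0 * 0) with (2 * PI * / INR r) in H by ring.
  assert (P := PI_RGT_0).
  assert (Hi : 0 < / INR r <= / 2) by (split; [apply Rinv_0_lt_compat; lra|apply Rinv_le_contravar; lra]).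
  assert (cos (2 * PI * / INR r) < cos 0); [apply cos_decreasing_1; nra|]. rewrite cos_0 in *. lra.
Qed.

Lemma e_scal (n : nat) x : e (INR n * x) = (e x ^ n)%C.
Proof.
  induction n as [|n IH]; [simpl INR; rewrite Rmult_0_l; apply e_0|].
  rewrite S_INR, Rmult_plus_distr_r, Rmult_1_l, e_plus, IH. simpl. ring.
Qed.

Section Characters.
Variable q : nat.
Hypothesis Hq : (1 <= q)%nat.
Notation Q := (Z.of_nat q).

Definition congr (x y : Z) : Prop := (Q | x - y)%Z.
Definition cunit (x : Z) : Prop := Z.gcd x Q = 1%Z.
Definition npow (g : Z) (k : nat) : Z := (g ^ Z.of_nat k)%Z.

Lemma congr_refl x : congr x x.
Proof. unfold congr. rewrite Z.sub_diag. apply Z.divide_0_r. Qed.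

Lemma congr_sym x y : congr x y -> congr y x.
Proof. unfold congr. intros [k H]. exists (- k)%Z. lia. Qed.

Lemma congr_trans x y z : congr x y -> congr y z -> congr x z.
Proof. unfold congr. intros [k H] [j H']. exists (k + j)%Z. lia. Qed.

Lemma congr_mul x y x' y' : congr x x' -> congr y y' -> congr (x * y) (x' * y').
Proof. unfold congr. intros [k H] [j H']. exists (k * y + x' * j)%Z. nia. Qed.

Lemma npow_S g k : npow g (S k) = (g * npow g k)%Z.
Proof. unfold npow. rewrite Nat2Z.inj_succ, Z.pow_succ_r by lia. reflexivity. Qed.

Lemma npow_add g i j : npow g (i + j) = (npow g i * npow g j)%Z.
Proof. unfold npow. rewrite Nat2Z.inj_add, Z.pow_add_r by lia. reflexivity. Qed.

Lemma congr_unit x y : congr x y -> cunit x -> cunit y.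
Proof.
  unfold congr, cunit. intros [k H] Hx. replace y with (x + - k * Q)%Z by lia.
  rewrite Z.gcd_comm, Z.gcd_add_mult_diag_r, Z.gcd_comm. auto.
Qed.

Lemma unit_mul x y : cunit x -> cunit y -> cunit (x * y).
Proof.
  unfold cunit. intros Hx Hy. apply Zgcd_1_rel_prime. apply rel_prime_sym, rel_prime_mult; apply rel_prime_sym, Zgcd_1_rel_prime; auto.
Qed.

Lemma unit_mul_inv x y : cunit (x * y) -> cunit x /\ cunit y.
Proof.
  assert (K : forall x y, cunit (x * y) -> cunit x).
  { unfold cunit. intros u v H. apply Zgcd_1_rel_prime in H. apply Zgcd_1_rel_prime.
    apply bezout_rel_prime. destruct (rel_prime_bezout _ _ H) as [s t E]. apply Bezout_intro with (s * v)%Z t. lia. }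
  intros H. split; [eapply K; eauto|]. rewrite Z.mul_comm in H. eapply K; eauto.
Qed.

Lemma unit_1 : cunit 1.
Proof. apply Z.gcd_1_l. Qed.

Lemma unit_npow g k : cunit g -> cunit (npow g k).
Proof. intros H. induction k as [|k IH]; [apply unit_1|]. rewrite npow_S. apply unit_mul; auto. Qed.

Lemma congr_cancel g x y : cunit g -> congr (g * x) (g * y) -> congr x y.
Proof.
  unfold congr, cunit. intros Hg H. rewrite <- Z.mul_sub_distr_l in H.
  apply Z.gauss with g; auto. rewrite Z.gcd_comm. auto.
Qed.

Lemma congr_mod x : congr x (x mod Q)%Z.
Proof. unfold congr. exists (x / Q)%Z. assert (h := Z.div_mod x Q ltac:(lia)). lia. Qed.

Lemma congr_mod_eq x y : congr x y <-> (x mod Q = y mod Q)%Z.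
Proof.
  split.
  - intros [k H]. replace x with (y + k * Q)%Z by lia. apply Z_mod_plus_full.
  - intros H. apply congr_trans with (x mod Q)%Z; [apply congr_mod|]. rewrite H. apply congr_sym, congr_mod.
Qed.

(** Pigeonhole: the [q + 1] powers [g^0, ..., g^q] cannot have distinct residues mod [q], and units
    cancel. *)
Lemma unit_order g : cunit g -> exists k, (1 <= k)%nat /\ congr (npow g k) 1.
Proof.
  intros Hg. apply NNPP. intros Hno.
  assert (Inj : forall i j, (i < j)%nat -> ~ congr (npow g i) (npow g j)).
  { intros i j Hij Hc. apply Hno. exists (j - i)%nat. split; [lia|].
    replace j with (i + (j - i))%nat in Hc by lia. rewrite npow_add in Hc.
    apply congr_sym. apply congr_cancel with (npow g i); [apply unit_npow; auto|]. rewrite Z.mul_1_r. auto. }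
  set (l := map (fun i => (npow g i mod Q)%Z) (seq 0 (S q))).
  assert (ND : NoDup l).
  { apply FinFun.Injective_map_NoDup; [|apply seq_NoDup]. intros i j E. apply congr_mod_eq in E.
    destruct (Nat.lt_trichotomy i j) as [h|[h|h]]; auto; exfalso.
    - eapply Inj; eauto. - eapply Inj; [exact h|]. apply congr_sym; auto. }
  assert (IN : incl l (map Z.of_nat (seq 0 q))).
  { intros x Hx. apply in_map_iff in Hx. destruct Hx as [i [<- _]].
    assert (B := Z.mod_pos_bound (npow g i) Q ltac:(lia)).
    apply in_map_iff. exists (Z.to_nat (npow g i mod Q)). split; [lia|]. apply in_seq. lia. }
  assert (L := NoDup_incl_length ND IN). unfold l in L. rewrite !length_map, !length_seq in L. lia.
Qed.

(** * Extension of characters from subgroups of the units *)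

(** A character on a subgroup [H] of the units, described by a real phase of which only [e (kap x)]
    matters. With a phase, an [r]-th root is obtained by dividing by [r]. *)
Record partial_char (H : Z -> Prop) (kap : Z -> R) : Prop := {
  pc_1 : H 1%Z;
  pc_congr : forall x y, congr x y -> H x -> H y;
  pc_mul : forall x y, H x -> H y -> H (x * y)%Z;
  pc_unit : forall x, H x -> cunit x;
  pc_val_congr : forall x y, congr x y -> H x -> e (kap x) = e (kap y);
  pc_val_mul : forall x y, H x -> H y -> e (kap (x * y)%Z) = (e (kap x) * e (kap y))%C
}.

Lemma pc_npow H kap g k : partial_char H kap -> H g -> H (npow g k) /\ e (kap (npow g k)) = (e (kap g) ^ k)%C.
Proof.
  intros P Hg. induction k as [|k [IH1 IH2]].
  - split; [apply (pc_1 _ _ P)|]. simpl.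
    assert (E := pc_val_mul _ _ P 1%Z 1%Z (pc_1 _ _ P) (pc_1 _ _ P)). rewrite Z.mul_1_l in E.
    assert (N := e_neq_0 (kap 1%Z)). change (npow g 0) with 1%Z.
    replace (e (kap 1%Z)) with (e (kap 1%Z) * e (kap 1%Z) * / e (kap 1%Z))%C by (field; auto). rewrite <- E. field; auto.
  - rewrite npow_S. split; [apply (pc_mul _ _ P); auto|]. rewrite (pc_val_mul _ _ P), IH2; auto.
Qed.

(** [x] has finite order, so its inverse mod [q] is one of its powers and lies in [H]. *)
Lemma pc_divide H kap x y : partial_char H kap -> H x -> H (x * y)%Z -> H y.
Proof.
  intros P Hx Hxy. destruct (unit_order x (pc_unit _ _ P x Hx)) as [k [Hk Ek]].
  destruct k as [|k]; [lia|]. rewrite npow_S in Ek.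
  apply (pc_congr _ _ P) with (npow x k * (x * y))%Z.
  - replace (npow x k * (x * y))%Z with (x * npow x k * y)%Z by ring.
    rewrite <- (Z.mul_1_l y) at 2. apply congr_mul; auto. apply congr_refl.
  - apply (pc_mul _ _ P); auto. apply (pc_npow H kap); auto.
Qed.

Section Extend.
Variables (H : Z -> Prop) (kap : Z -> R) (g : Z) (r : nat) (th : R).
Hypotheses (P : partial_char H kap) (Hg : cunit g) (Hr : (1 <= r)%nat) (Hgr : H (npow g r))
  (Hmin : forall k, (1 <= k)%nat -> H (npow g k) -> (r <= k)%nat)
  (Hth : e (INR r * th) = e (kap (npow g r))).

(** Division with remainder by the minimal exponent [r]: a nonzero remainder would be a smaller
    exponent with power in [H]. *)
Lemma npow_in_H k : H (npow g k) -> exists m, k = (r * m)%nat /\ e (kap (npow g k)) = e (INR k * th).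
Proof.
  intros Hk.
  assert (E := Nat.div_mod k r ltac:(lia)). assert (B := Nat.mod_upper_bound k r ltac:(lia)).
  set (m := (k / r)%nat) in *. set (s := (k mod r)%nat) in *.
  destruct (pc_npow H kap (npow g r) m P Hgr) as [Hm Em].
  assert (Epow : npow (npow g r) m = npow g (r * m)).
  { unfold npow. rewrite Nat2Z.inj_mul, Z.pow_mul_r by lia. reflexivity. }
  rewrite Epow in Hm, Em.
  assert (Hs : H (npow g s)).
  { apply (pc_divide H kap (npow g (r * m))); auto. rewrite <- npow_add. rewrite <- E. auto. }
  assert (s = 0)%nat by (destruct s; auto; specialize (Hmin (S s) ltac:(lia) Hs); lia).
  exists m. split; [lia|]. replace k with (r * m)%nat by lia.
  rewrite Em, <- Hth, <- e_scal, mult_INR. f_equal. ring.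
Qed.

(** The subgroup generated by [H] and [g]. The phase on it is picked by choice among all
    representations [h g^j]; [ext_well_defined] shows that [e] of the phase does not depend on the
    pick. *)
Definition ext_dom (x : Z) : Prop := exists h j, H h /\ congr x (h * npow g j).
Definition ext_rep (x : Z) (v : R) : Prop := exists h j, H h /\ congr x (h * npow g j) /\ v = kap h + INR j * th.
Definition ext_val (x : Z) : R := epsilon (inhabits 0) (ext_rep x).

(** Cancelling the smaller power of [g] leaves [g^(j-i)] in [H], where the minimality of [r] already
    forces the value [e ((j-i) th)]. *)
Lemma ext_well_defined h h' i j : H h -> H h' -> congr (h * npow g i) (h' * npow g j) ->
  e (kap h + INR i * th) = e (kap h' + INR j * th).
Proof.
  assert (K : forall h h' i j, (i <= j)%nat -> H h -> H h' -> congr (h * npow g i) (h' * npow g j) ->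
    e (kap h + INR i * th) = e (kap h' + INR j * th)).
  { clear h h' i j. intros h h' i j Hij Hh Hh' Hc.
    replace j with ((j - i) + i)%nat in Hc by lia. rewrite npow_add in Hc.
    assert (Hc' : congr h (h' * npow g (j - i))).
    { apply congr_cancel with (npow g i); [apply unit_npow; auto|].
      replace (npow g i * h)%Z with (h * npow g i)%Z by ring.
      replace (npow g i * (h' * npow g (j - i)))%Z with (h' * (npow g (j - i) * npow g i))%Z by ring. auto. }
    assert (Hin : H (h' * npow g (j - i))%Z) by (apply (pc_congr _ _ P) with h; auto).
    assert (Hgji := pc_divide H kap h' (npow g (j - i)) P Hh' Hin).
    destruct (npow_in_H _ Hgji) as [m [_ Em]].
    assert (E := pc_val_congr _ _ P _ _ Hc' Hh). rewrite (pc_val_mul _ _ P), Em in E; auto.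
    rewrite e_plus, E, <- !e_plus. f_equal. rewrite minus_INR by auto. ring. }
  intros Hh Hh' Hc. destruct (Nat.le_ge_cases i j) as [q1|q1]; [apply K; auto|].
  symmetry. apply K; auto. apply congr_sym; auto.
Qed.

Lemma ext_val_eq x h j : H h -> congr x (h * npow g j) -> e (ext_val x) = e (kap h + INR j * th).
Proof.
  intros Hh Hc. assert (S : ext_rep x (ext_val x)).
  { apply (epsilon_spec (inhabits 0) (ext_rep x)). exists (kap h + INR j * th), h, j. auto. }
  destruct S as [h' [j' [Hh' [Hc' E]]]]. rewrite E. apply ext_well_defined; auto.
  apply congr_trans with x; auto. apply congr_sym; auto.
Qed.

Lemma extend_char : partial_char ext_dom ext_val /\ (forall x, H x -> ext_dom x) /\ ext_dom g /\
  (forall x, H x -> e (ext_val x) = e (kap x)) /\ e (ext_val g) = e th.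
Proof.
  assert (one_r : forall x, (x * npow g 0 = x)%Z) by (intros; apply Z.mul_1_r).
  assert (H1 := pc_1 _ _ P).
  assert (E1 : e (kap 1%Z) = RtoC 1) by (apply (pc_npow H kap 1%Z 0 P H1)).
  assert (g1 : congr g (1 * npow g 1)).
  { unfold npow. simpl Z.of_nat. rewrite Z.pow_1_r, Z.mul_1_l. apply congr_refl. }
  split; [|split; [|split; [|split]]].
  - constructor.
    + exists 1%Z, O. split; auto. rewrite one_r. apply congr_refl.
    + intros x y Hxy [h [j [Hh Hc]]]. exists h, j. split; auto. apply congr_trans with x; auto. apply congr_sym; auto.
    + intros x y [h [j [Hh Hc]]] [h' [j' [Hh' Hc']]]. exists (h * h')%Z, (j + j')%nat.
      split; [apply (pc_mul _ _ P); auto|]. rewrite npow_add.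
      replace (h * h' * (npow g j * npow g j'))%Z with ((h * npow g j) * (h' * npow g j'))%Z by ring. apply congr_mul; auto.
    + intros x [h [j [Hh Hc]]]. apply congr_unit with (h * npow g j)%Z; [apply congr_sym; auto|].
      apply unit_mul; [apply (pc_unit _ _ P); auto|apply unit_npow; auto].
    + intros x y Hxy [h [j [Hh Hc]]]. rewrite (ext_val_eq x h j), (ext_val_eq y h j); auto.
      apply congr_trans with x; auto. apply congr_sym; auto.
    + intros x y [h [j [Hh Hc]]] [h' [j' [Hh' Hc']]].
      rewrite (ext_val_eq x h j), (ext_val_eq y h' j'), (ext_val_eq (x * y) (h * h') (j + j')); auto.
      * rewrite !e_plus, (pc_val_mul _ _ P), plus_INR, Rmult_plus_distr_r, e_plus by auto. ring.
      * apply (pc_mul _ _ P); auto.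
      * rewrite npow_add. replace (h * h' * (npow g j * npow g j'))%Z with ((h * npow g j) * (h' * npow g j'))%Z by ring.
        apply congr_mul; auto.
  - intros x Hx. exists x, O. split; auto. rewrite one_r. apply congr_refl.
  - exists 1%Z, 1%nat. auto.
  - intros x Hx. rewrite (ext_val_eq x x 0); auto; [|rewrite one_r; apply congr_refl].
    simpl INR. f_equal. ring.
  - rewrite (ext_val_eq g 1 1); auto. rewrite e_plus, E1. simpl INR. rewrite Rmult_1_l. ring.
Qed.
End Extend.

Lemma least_nat (S : nat -> Prop) : (exists k, (1 <= k)%nat /\ S k) ->
  exists r, (1 <= r)%nat /\ S r /\ forall k, (1 <= k)%nat -> S k -> (r <= k)%nat.
Proof.
  intros [k [Hk HS]]. induction k as [k IH] using lt_wf_ind.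
  destruct (classic (exists j, (1 <= j)%nat /\ S j /\ (j < k)%nat)) as [[j [H1 [H2 H3]]]|h].
  - apply (IH j); auto.
  - exists k. split; [auto|]. split; [auto|]. intros j Hj HSj. apply Nat.nlt_ge. intros q1. apply h. exists j. auto.
Qed.

Lemma extend_all H kap (l : list Z) : partial_char H kap -> (forall x, In x l -> cunit x) ->
  exists H' kap', partial_char H' kap' /\ (forall x, H x -> H' x) /\ (forall x, H x -> e (kap' x) = e (kap x)) /\
    forall x, In x l -> H' x.
Proof.
  revert H kap. induction l as [|g l IH]; intros H kap P Hl.
  - exists H, kap. split; [auto|]. split; [auto|]. split; [auto|]. intros x [].
  - assert (Hg := Hl g (or_introl eq_refl)).
    destruct (least_nat (fun k => H (npow g k))) as [r [Hr1 [Hr2 Hr3]]].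
    { destruct (unit_order g Hg) as [k [Hk Ek]]. exists k. split; auto. apply (pc_congr _ _ P) with 1%Z; [apply congr_sym; auto|apply (pc_1 _ _ P)]. }
    assert (Hr0 : INR r <> 0) by (apply not_0_INR; lia).
    (* Dividing the phase at [g^r] by [r] gives an admissible phase for [g]. *)
    destruct (extend_char H kap g r (kap (npow g r) / INR r) P Hg Hr1 Hr2 Hr3) as [P' [S1 [S2 [S3 _]]]].
    { f_equal. field. auto. }
    destruct (IH _ _ P' (fun x Hx => Hl x (or_intror Hx))) as [H' [kap' [P'' [T1 [T2 T3]]]]].
    exists H', kap'. split; [auto|]. split; [auto|]. split.
    + intros x Hx. rewrite T2, S3; auto.
    + intros x [<-|Hx]; auto.
Qed.

Definition residues : list Z := map Z.of_nat (seq 0 q).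

Lemma mod_in_residues x : In (x mod Q)%Z residues.
Proof.
  assert (B := Z.mod_pos_bound x Q ltac:(lia)). apply in_map_iff. exists (Z.to_nat (x mod Q)). split; [lia|]. apply in_seq. lia.
Qed.

Lemma char_of_total H kap : partial_char H kap -> (forall x, cunit x -> H x) ->
  dirichlet_character q (fun x => if excluded_middle_informative (cunit x) then e (kap x) else RtoC 0).
Proof.
  intros P Htot. constructor.
  - intros n. assert (Hc : congr n (n + Q)) by (exists (-1)%Z; lia).
    destruct (excluded_middle_informative (cunit (n + Q))) as [h|h], (excluded_middle_informative (cunit n)) as [h'|h']; auto.
    + symmetry. apply (pc_val_congr _ _ P); auto.
    + exfalso. apply h'. apply congr_unit with (n + Q)%Z; auto. apply congr_sym; auto.
    + exfalso. apply h. apply congr_unit with n; auto.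
  - intros m n.
    destruct (excluded_middle_informative (cunit (m * n))) as [h|h].
    + destruct (unit_mul_inv _ _ h) as [h1 h2].
      destruct (excluded_middle_informative (cunit m)); [|tauto]. destruct (excluded_middle_informative (cunit n)); [|tauto].
      apply (pc_val_mul _ _ P); auto.
    + destruct (excluded_middle_informative (cunit m)); [|ring]. destruct (excluded_middle_informative (cunit n)); [|ring].
      exfalso. apply h. apply unit_mul; auto.
  - intros n. destruct (excluded_middle_informative (cunit n)) as [h|h]; split; intros K.
    + exact h. + apply e_neq_0. + exfalso; apply K; auto. + exfalso; apply h; exact K.
Qed.

(** Starting from the trivial subgroup, [n] receives the value [e (1/r)], where [r >= 2] is its
    order; the character is then extended to all units. *)
Lemma char_separates n : cunit n -> ~ congr n 1 -> exists chi, dirichlet_character q chi /\ chi n <> RtoC 1.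
Proof.
  intros Hn Hn1.
  assert (P0 : partial_char (fun x => congr x 1) (fun _ => 0)).
  { constructor.
    - apply congr_refl.
    - intros x y Hxy Hx. apply congr_trans with x; auto. apply congr_sym; auto.
    - intros x y Hx Hy. apply (congr_mul _ _ 1 1); auto.
    - intros x Hx. apply congr_unit with 1%Z; [apply congr_sym; auto|apply unit_1].
    - auto.
    - intros. rewrite e_0. ring. }
  destruct (least_nat (fun k => congr (npow n k) 1) (unit_order n Hn)) as [r [Hr1 [Hr2 Hr3]]].
  assert (Hr : (2 <= r)%nat).
  { destruct (Nat.eq_dec r 1) as [->|h]; [|lia]. exfalso. apply Hn1. unfold npow in Hr2. simpl Z.of_nat in Hr2. rewrite Z.pow_1_r in Hr2. auto. }
  assert (Hr0 : INR r <> 0) by (apply not_0_INR; lia).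
  destruct (extend_char _ _ n r (/ INR r) P0 Hn Hr1 Hr2 Hr3) as [P1 [S1 [S2 [S3 S4]]]].
  { rewrite Rinv_r, e_1, e_0; auto. }
  set (l := filter (fun x => (Z.gcd x Q =? 1)%Z) residues).
  destruct (extend_all _ _ l P1) as [H' [kap' [P' [T1 [T2 T3]]]]].
  { intros x Hx. apply filter_In in Hx. apply Z.eqb_eq. tauto. }
  assert (Htot : forall x, cunit x -> H' x).
  { intros x Hx. apply (pc_congr _ _ P') with (x mod Q)%Z; [apply congr_sym, congr_mod|]. apply T3.
    apply filter_In. split; [apply mod_in_residues|]. apply Z.eqb_eq. apply congr_unit with x; auto. apply congr_mod. }
  eexists. split; [apply (char_of_total H' kap' P' Htot)|]. cbv beta.
  destruct (excluded_middle_informative (cunit n)) as [_|h]; [|tauto].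
  rewrite T2, S4; auto. apply e_inv_neq_1; auto.
Qed.

Section OneChar.
Variable chi : Z -> C.
Hypothesis Hchi : dirichlet_character q chi.

Lemma char_npow g k : chi (npow g k) = (chi g ^ k)%C.
Proof.
  induction k as [|k IH]; [apply (chi_one q); auto|]. rewrite npow_S, (chi_mult _ _ Hchi), IH. reflexivity.
Qed.

Lemma char_congr x y : congr x y -> chi x = chi y.
Proof.
  assert (K : forall z (n : nat), chi (z + Z.of_nat n * Q)%Z = chi z).
  { intros z n. induction n as [|n IH]; [f_equal; lia|].
    rewrite <- IH, <- (chi_periodic _ _ Hchi (z + Z.of_nat n * Q)%Z). f_equal. lia. }
  intros [k Hk]. destruct (Z.le_ge_cases 0 k) as [h|h].
  - replace x with (y + Z.of_nat (Z.to_nat k) * Q)%Z by lia. apply K.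
  - replace y with (x + Z.of_nat (Z.to_nat (- k)) * Q)%Z by nia. symmetry. apply K.
Qed.

(** A power of [g] is congruent to 1, so [chi g] is a root of unity. *)
Lemma char_unit_mod g : cunit g -> Cmod (chi g) = 1.
Proof.
  intros Hg. destruct (unit_order g Hg) as [k [Hk Ek]].
  assert (E := char_congr _ _ Ek). rewrite char_npow, (chi_one q) in E by auto.
  apply (f_equal Cmod) in E. rewrite Cmod_pow, Cmod_1 in E.
  destruct (pow_R1 _ _ E) as [h|h]; [|lia]. rewrite Rabs_right in h; auto. apply Rle_ge, Cmod_ge_0.
Qed.

Lemma char_zero g : ~ cunit g -> chi g = RtoC 0.
Proof. intros H. apply NNPP. intros h. apply H. apply (chi_support _ _ Hchi); auto. Qed.

Lemma char_mod_le_1 g : Cmod (chi g) <= 1.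
Proof.
  destruct (classic (cunit g)) as [h|h]; [rewrite char_unit_mod; auto; lra|]. rewrite char_zero, Cmod_0; auto; lra.
Qed.
End OneChar.

(** * Families of characters, orthogonality and expansion in characters *)

Lemma char_mul_pow chi psi j : dirichlet_character q chi -> dirichlet_character q psi ->
  dirichlet_character q (fun x => chi x ^ j * psi x)%C.
Proof.
  intros Hc Hp. constructor.
  - intros n. rewrite (chi_periodic _ _ Hc), (chi_periodic _ _ Hp). auto.
  - intros x y. rewrite (chi_mult _ _ Hc), (chi_mult _ _ Hp), Cpow_mult_l. ring.
  - intros n. split.
    + intros h. apply (chi_support _ _ Hp). intros E. apply h. rewrite E. ring.
    + intros h. apply Cmult_neq_0.
      * apply Cpow_nz. apply (chi_support _ _ Hc); auto.
      * apply (chi_support _ _ Hp); auto.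
Qed.

Lemma geometric_zero (z : C) k : (z ^ k)%C = RtoC 1 -> z <> RtoC 1 -> lsum (seq 0 k) (fun j => z ^ j)%C = RtoC 0.
Proof.
  intros Hk Hz.
  assert (E : forall n, ((z - 1) * lsum (seq 0 n) (fun j => z ^ j) = z ^ n - 1)%C).
  { induction n as [|n IH]; [unfold lsum; simpl; ring|].
    rewrite seq_S, lsum_app, Cmult_plus_distr_l, IH. unfold lsum; simpl. ring. }
  specialize (E k). rewrite Hk in E.
  assert (N : (z - 1)%C <> RtoC 0) by (apply sub_neq_0; auto).
  replace (lsum (seq 0 k) (fun j => z ^ j)%C) with (/ (z - 1) * ((z - 1) * lsum (seq 0 k) (fun j => z ^ j)))%C by (field; auto).
  rewrite E. ring.
Qed.

(* The characters [prod_n chi_n^{j_n}], where [chi_n] separates [n] from 1. *)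
Lemma char_list_for (l : list Z) : (forall n, In n l -> cunit n /\ ~ congr n 1) ->
  exists X : list (Z -> C), X <> [] /\ (forall chi, In chi X -> dirichlet_character q chi) /\
    forall n, In n l -> lsum X (fun chi => chi n) = RtoC 0.
Proof.
  induction l as [|n l IH]; intros Hl.
  - exists [fun x => if excluded_middle_informative (cunit x) then e ((fun _ => 0) x) else RtoC 0].
    split; [discriminate|]. split; [|intros n []].
    intros chi [<-|[]]. apply (char_of_total cunit (fun _ => 0)); auto. constructor.
    + apply unit_1. + apply congr_unit. + apply unit_mul. + auto. + auto. + intros; rewrite e_0; ring.
  - destruct IH as [X [HX0 [HX1 HX2]]]; [intros; apply Hl; right; auto|].
    destruct (Hl n (or_introl eq_refl)) as [Hn Hn1].
    destruct (char_separates n Hn Hn1) as [chi [Hchi Hc]].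
    destruct (unit_order n Hn) as [k [Hk Ek]].
    exists (flat_map (fun j => map (fun psi x => chi x ^ j * psi x)%C X) (seq 0 k)).
    assert (ES : forall x, lsum (flat_map (fun j => map (fun psi x => chi x ^ j * psi x)%C X) (seq 0 k)) (fun chi => chi x)
        = (lsum (seq 0 k) (fun j => chi x ^ j) * lsum X (fun psi => psi x))%C).
    { intros x. rewrite lsum_flat_map.
      rewrite (lsum_ext _ _ (fun j => lsum X (fun psi => psi x) * chi x ^ j)%C).
      - rewrite lsum_scal. apply Cmult_comm.
      - intros j _. rewrite lsum_map, lsum_scal. apply Cmult_comm. }
    split; [|split].
    + destruct k as [|k]; [lia|]. destruct X as [|psi X]; [tauto|]. simpl. discriminate.
    + intros psi' Hpsi'. apply in_flat_map in Hpsi'. destruct Hpsi' as [j [_ Hj]].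
      apply in_map_iff in Hj. destruct Hj as [psi [<- Hpsi]]. apply char_mul_pow; auto.
    + intros x [<-|Hx]; rewrite ES.
      * rewrite geometric_zero; auto; [ring|]. rewrite <- (char_npow chi) by auto. rewrite (char_congr chi Hchi _ _ Ek).
        apply (chi_one q); auto.
      * rewrite HX2; auto. ring.
Qed.

(** The list is not claimed to contain every character, nor to be free of repetitions: vanishing
    sums at the units other than 1 give orthogonality with [length X] as the normalisation. *)
Lemma char_list_exists : exists X : list (Z -> C), X <> [] /\ (forall chi, In chi X -> dirichlet_character q chi) /\
  forall n, cunit n -> ~ congr n 1 -> lsum X (fun chi => chi n) = RtoC 0.
Proof.
  set (l := filter (fun x => if excluded_middle_informative (cunit x /\ ~ congr x 1) then true else false) residues).
  destruct (char_list_for l) as [X [H0 [H1 H2]]].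
  { intros n Hn. apply filter_In in Hn. destruct (excluded_middle_informative (cunit n /\ ~ congr n 1)); auto. destruct Hn; discriminate. }
  exists X. split; [auto|]. split; [auto|]. intros n Hn Hn1.
  rewrite (lsum_ext X _ (fun chi => chi (n mod Q)%Z)).
  2:{ intros chi Hchi. apply char_congr; auto. apply congr_mod. }
  apply H2. apply filter_In. split; [apply mod_in_residues|].
  destruct (excluded_middle_informative _) as [_|h]; auto. exfalso. apply h. split.
  - apply congr_unit with n; auto. apply congr_mod.
  - intros K. apply Hn1. apply congr_trans with (n mod Q)%Z; auto. apply congr_mod.
Qed.

Lemma Cconj_unimodular (z w : C) : Cmod z = 1 -> (z * w)%C = RtoC 1 -> Cconj z = w.
Proof.
  intros Hz Hw. assert (E := Cmod2_conj z). rewrite Hz in E.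
  replace (Cconj z) with (Cconj z * (z * w))%C by (rewrite Hw; ring).
  replace (Cconj z * (z * w))%C with (z * Cconj z * w)%C by ring. rewrite <- E.
  replace (1 ^ 2) with 1 by ring. ring.
Qed.

Lemma char_orthogonality (X : list (Z -> C)) (r r' : Z) :
  (forall chi, In chi X -> dirichlet_character q chi) ->
  (forall n, cunit n -> ~ congr n 1 -> lsum X (fun chi => chi n) = RtoC 0) ->
  lsum X (fun chi => chi r * Cconj (chi r'))%C =
   if excluded_middle_informative (cunit r /\ congr r r') then RtoC (INR (length X)) else RtoC 0.
Proof.
  intros HX HZ. destruct (excluded_middle_informative _) as [[h1 h2]|h].
  - rewrite (lsum_ext X _ (fun _ => RtoC 1)).
    + clear. induction X as [|chi X IH]; [reflexivity|]. rewrite lsum_cons, IH. simpl length. rewrite S_INR, RtoC_plus. ring.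
    + intros chi Hchi. rewrite <- (char_congr chi (HX chi Hchi) _ _ h2). rewrite <- Cmod2_conj, (char_unit_mod chi (HX chi Hchi)); auto.
      replace (1 ^ 2) with 1 by ring. reflexivity.
  - destruct (classic (cunit r)) as [u|u].
    2:{ apply lsum_zero. intros chi Hchi. rewrite (char_zero chi (HX chi Hchi) r u). ring. }
    destruct (classic (cunit r')) as [u'|u'].
    2:{ apply lsum_zero. intros chi Hchi. rewrite (char_zero chi (HX chi Hchi) r' u'). unfold Cconj, RtoC; simpl. apply injective_projections; simpl; ring. }
    (* For units the conjugate of [chi r'] is [chi] at the inverse [r'^k], so the sum is the one at
       [r r'^k], a unit not congruent to 1. *)
    destruct (unit_order r' u') as [k [Hk Ek]]. destruct k as [|k]; [lia|]. rewrite npow_S in Ek.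
    rewrite <- (HZ (r * npow r' k)%Z).
    + apply lsum_ext. intros chi Hchi. rewrite (chi_mult _ _ (HX chi Hchi)). f_equal.
      apply Cconj_unimodular; [apply char_unit_mod; auto|].
      rewrite <- (chi_mult _ _ (HX chi Hchi)). rewrite (char_congr chi (HX chi Hchi) _ _ Ek). apply (chi_one q); auto.
    + apply unit_mul; auto. apply unit_npow; auto.
    + intros K. apply h. split; auto. apply congr_cancel with (npow r' k); [apply unit_npow; auto|].
      apply congr_trans with 1%Z.
      * rewrite Z.mul_comm. auto.
      * apply congr_sym. rewrite Z.mul_comm. auto.
Qed.

Lemma lsum_by_residue (l : list nat) (F : nat -> C) :
  lsum l F = lsum (seq 0 q) (fun r => lsum l (fun n => if (n mod q =? r)%nat then F n else RtoC 0)).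
Proof.
  rewrite lsum_swap. apply lsum_ext. intros n _.
  assert (K : forall s k, (s <= n mod q < s + k)%nat -> lsum (seq s k) (fun b => if (n mod q =? b)%nat then F n else RtoC 0) = F n).
  { intros s k. revert s. induction k as [|k IH]; intros s Hs; [lia|]. simpl seq. rewrite lsum_cons.
    destruct (n mod q =? s)%nat eqn:E.
    - apply Nat.eqb_eq in E. rewrite lsum_zero; [ring|]. intros b Hb. apply in_seq in Hb.
      destruct (n mod q =? b)%nat eqn:E'; auto. apply Nat.eqb_eq in E'. lia.
    - apply Nat.eqb_neq in E. rewrite IH by lia. ring. }
  symmetry. apply K. assert (B := Nat.mod_upper_bound n q ltac:(lia)). lia.
Qed.

Lemma Re_lsum {A} (l : list A) f : Re (lsum l f) = rsum l (fun a => Re (f a)).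
Proof. rewrite lsum_components. reflexivity. Qed.

(** Sorting by residues expresses every character sum through the class sums [Cr]. The mean of the
    squared moduli over [X] is the sum of [|Cr r|^2] over the unit classes, hence at most [B^2], and
    Cauchy-Schwarz over [q] classes yields [sqrt q]. *)
Theorem char_expansion_bound (l : list nat) (c : nat -> C) (u : Z -> C) B :
  (forall x y, congr x y -> u x = u y) -> (forall x, Cmod (u x) <= 1) -> (forall x, ~ cunit x -> u x = RtoC 0) ->
  (forall chi, dirichlet_character q chi -> Cmod (lsum l (fun n => c n * chi (Z.of_nat n))%C) <= B) ->
  Cmod (lsum l (fun n => c n * u (Z.of_nat n))%C) <= sqrt (INR q) * B.
Proof.
  intros Hu Hu1 Hu0 HB.
  destruct char_list_exists as [X [HX0 [HX HZ]]].
  set (Cr := fun r => lsum l (fun n => if (n mod q =? r)%nat then c n else RtoC 0)).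
  assert (Hmod : forall n, congr (Z.of_nat n) (Z.of_nat (n mod q))).
  { intros n. rewrite Nat2Z.inj_mod. apply congr_mod. }
  assert (Group : forall v : Z -> C, (forall x y, congr x y -> v x = v y) ->
    lsum l (fun n => c n * v (Z.of_nat n))%C = lsum (seq 0 q) (fun r => v (Z.of_nat r) * Cr r)%C).
  { intros v Hv. rewrite lsum_by_residue. apply lsum_ext. intros r _. unfold Cr. rewrite <- lsum_scal.
    apply lsum_ext. intros n _. destruct (n mod q =? r)%nat eqn:E; [|ring]. apply Nat.eqb_eq in E.
    rewrite (Hv _ _ (Hmod n)), E. ring. }
  assert (B0 : 0 <= B).
  { destruct X as [|chi X]; [tauto|]. eapply Rle_trans; [apply Cmod_ge_0|apply (HB chi)]. apply HX; left; auto. }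
  set (w := fun r => if excluded_middle_informative (cunit (Z.of_nat r)) then Cmod (Cr r) else 0).
  assert (Hw0 : forall r, 0 <= w r) by (intros r; unfold w; destruct (excluded_middle_informative _); [apply Cmod_ge_0|lra]).
  assert (S1 : Cmod (lsum l (fun n => c n * u (Z.of_nat n))%C) <= rsum (seq 0 q) w).
  { rewrite Group by auto. eapply Rle_trans; [apply lsum_norm_le|]. apply rsum_le. intros r _. unfold w.
    rewrite Cmod_mult. destruct (excluded_middle_informative _) as [h|h].
    - specialize (Hu1 (Z.of_nat r)). assert (P := Cmod_ge_0 (Cr r)). nra.
    - rewrite Hu0, Cmod_0; auto. lra. }
  set (A := fun chi : Z -> C => lsum l (fun n => c n * chi (Z.of_nat n))%C).
  assert (LX : 0 < INR (length X)) by (destruct X; [tauto|]; simpl length; apply lt_0_INR; lia).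
  set (w2 := fun r => w r * w r).
  (* Parseval's identity for the family [X]: after expanding the square, orthogonality leaves only
     the diagonal. *)
  assert (S2 : lsum X (fun chi => A chi * Cconj (A chi))%C = (RtoC (INR (length X)) * RtoC (rsum (seq 0 q) w2))%C).
  { rewrite (lsum_ext X _ (fun chi => lsum (seq 0 q) (fun r => lsum (seq 0 q) (fun r' =>
       (Cr r * Cconj (Cr r')) * (chi (Z.of_nat r) * Cconj (chi (Z.of_nat r'))))))%C).
    2:{ intros chi Hchi. unfold A. rewrite (Group chi) by (apply char_congr; auto).
        rewrite lsum_conj, Cmult_comm, <- lsum_scal. apply lsum_ext. intros r _. rewrite Cmult_comm, <- lsum_scal.
        apply lsum_ext. intros r' _. destruct (chi (Z.of_nat r)), (chi (Z.of_nat r')), (Cr r), (Cr r'). unfold Cconj, Cmult; simpl. f_equal; ring. }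
    rewrite lsum_swap. 
    rewrite (lsum_ext _ _ (fun r => RtoC (INR (length X)) * RtoC (w2 r))%C).
    - rewrite lsum_scal. f_equal. rewrite lsum_components.
      apply injective_projections; [reflexivity|]. change (rsum (seq 0 q) (fun _ => 0) = 0). rewrite rsum_const. ring.
    - intros r Hr. apply in_seq in Hr. rewrite lsum_swap.
      rewrite (lsum_ext _ _ (fun r' => if (r' =? r)%nat then RtoC (INR (length X)) * RtoC (w2 r) else RtoC 0)%C).
      + transitivity (lsum (seq 0 q) (fun r' => if ((r mod q) =? r')%nat then (fun _ => RtoC (INR (length X)) * RtoC (w2 r))%C r else RtoC 0)).
        * apply lsum_ext. intros r' Hr'. rewrite Nat.mod_small by lia. rewrite Nat.eqb_sym. reflexivity.
        * assert (K := lsum_by_residue [r] (fun _ => RtoC (INR (length X)) * RtoC (w2 r))%C).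
          transitivity (lsum [r] (fun _ => RtoC (INR (length X)) * RtoC (w2 r))%C); [|unfold lsum; simpl; ring].
          rewrite K. apply lsum_ext. intros b _. unfold lsum; simpl. destruct (r mod q =? b)%nat; ring.
      + intros r' Hr'. apply in_seq in Hr'. rewrite lsum_scal, (char_orthogonality X); auto.
        destruct (r' =? r)%nat eqn:E.
        * apply Nat.eqb_eq in E. subst r'. unfold w2, w.
          destruct (excluded_middle_informative (cunit (Z.of_nat r) /\ _)) as [[h1 _]|h].
          -- destruct (excluded_middle_informative (cunit (Z.of_nat r))); [|tauto].
             rewrite <- Cmod2_conj. replace (Cmod (Cr r) ^ 2) with (Cmod (Cr r) * Cmod (Cr r)) by ring. ring.
          -- destruct (excluded_middle_informative (cunit (Z.of_nat r))) as [h'|h'].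
             { exfalso. apply h. split; auto. apply congr_refl. }
             replace (0 * 0) with 0 by ring. ring.
        * apply Nat.eqb_neq in E. destruct (excluded_middle_informative (_ /\ _)) as [[_ h]|h]; [|ring].
          exfalso. apply E. apply congr_mod_eq in h. rewrite !Z.mod_small in h by lia. lia. }
  assert (S3 : rsum (seq 0 q) w2 <= B * B).
  { assert (E : rsum X (fun chi => Cmod (A chi) * Cmod (A chi)) = INR (length X) * rsum (seq 0 q) w2).
    { apply (f_equal Re) in S2. rewrite Re_lsum in S2. rewrite <- RtoC_mult in S2. simpl Re in S2 at 2.
      transitivity (rsum X (fun a => Re (A a * Cconj (A a))%C)); [|exact S2].
      apply rsum_ext. intros chi _. rewrite <- Cmod2_conj. simpl. ring. }
    assert (E2 : rsum X (fun chi => Cmod (A chi) * Cmod (A chi)) <= INR (length X) * (B * B)).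
    { rewrite <- (rsum_const X). apply rsum_le. intros chi Hchi. specialize (HB chi (HX chi Hchi)).
      assert (P := Cmod_ge_0 (A chi)). apply Rmult_le_compat; auto. }
    rewrite E in E2. apply Rmult_le_reg_l with (INR (length X)); auto. }
  eapply Rle_trans; [exact S1|].
  assert (S4 := rsum_Rsqr_cauchy (seq 0 q) w (B * B) (fun r _ => Hw0 r) S3).
  rewrite length_seq in S4.
  apply Rsqr_incr_0_var; [|apply Rmult_le_pos; auto; apply sqrt_pos].
  rewrite Rsqr_mult, Rsqr_sqrt by apply pos_INR. unfold Rsqr. auto.
Qed.
End Characters.

(** * The sine integral *)

Lemma continuous_cos_scal v s : continuous (fun s => cos (v * s)) s.
Proof. apply (ex_derive_continuous (V := R_NormedModule)). auto_derive. auto. Qed.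

Lemma ex_RInt_cos_scal v a b : ex_RInt (fun s => cos (v * s)) a b.
Proof. apply (ex_RInt_continuous (V := R_CompleteNormedModule)). intros; apply continuous_cos_scal. Qed.

(** The function [sin v / v], in a form without a singularity at 0. *)
Definition sinc (v : R) : R := RInt (fun s => cos (v * s)) 0 1.

Lemma sinc_mul v : v * sinc v = sin v.
Proof.
  unfold sinc. rewrite <- (RInt_scal (V := R_CompleteNormedModule)) by apply ex_RInt_cos_scal.
  replace (sin v) with (minus (sin (v * 1)) (sin (v * 0))).
  2:{ unfold minus, plus, opp; simpl. rewrite Rmult_1_r, Rmult_0_r, sin_0. ring. }
  apply is_RInt_unique. apply (is_RInt_derive (fun s => sin (v * s))).
  - intros x _. auto_derive; auto. unfold scal; simpl. unfold mult; simpl. ring.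
  - intros x _. apply (continuous_scal_r (V := R_NormedModule)). apply continuous_cos_scal.
Qed.

Lemma cos_lipschitz x y : Rabs (cos x - cos y) <= Rabs (x - y).
Proof.
  destruct (MVT_gen cos y x (fun z => - sin z)) as [c [_ Hc]].
  - intros z _. apply is_derive_Reals, derivable_pt_lim_cos.
  - intros z _. apply continuity_cos.
  - rewrite Hc, Rabs_mult. rewrite <- (Rmult_1_l (Rabs (x - y))) at 2.
    apply Rmult_le_compat_r; [apply Rabs_pos|]. apply Rabs_le. assert (h := SIN_bound c). lra.
Qed.

Lemma sin_lipschitz x y : Rabs (sin x - sin y) <= Rabs (x - y).
Proof.
  destruct (MVT_gen sin y x cos) as [c [_ Hc]].
  - intros z _. apply is_derive_Reals, derivable_pt_lim_sin.
  - intros z _. apply continuity_sin.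
  - rewrite Hc, Rabs_mult. rewrite <- (Rmult_1_l (Rabs (x - y))) at 2.
    apply Rmult_le_compat_r; [apply Rabs_pos|]. apply Rabs_le, COS_bound.
Qed.

Lemma cos_ge_parabola x : 1 - x * x / 2 <= cos x.
Proof.
  replace x with (2 * (x / 2)) at 3 by field. rewrite cos_2a_sin.
  assert (h := sin_lipschitz (x / 2) 0). rewrite sin_0, !Rminus_0_r in h.
  assert (h2 : Rabs (sin (x / 2)) * Rabs (sin (x / 2)) <= Rabs (x / 2) * Rabs (x / 2)).
  { apply Rmult_le_compat; auto; apply Rabs_pos. }
  rewrite <- !Rabs_mult in h2. rewrite !Rabs_right in h2 by (apply Rle_ge, Rle_0_sqr). lra.
Qed.

Lemma sinc_lipschitz v v' : Rabs (sinc v - sinc v') <= Rabs (v - v').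
Proof.
  unfold sinc.
  replace (RInt (fun s => cos (v * s)) 0 1 - RInt (fun s => cos (v' * s)) 0 1) with
    (RInt (fun s => minus (cos (v * s)) (cos (v' * s))) 0 1).
  2:{ rewrite (RInt_minus (V := R_CompleteNormedModule)) by apply ex_RInt_cos_scal. reflexivity. }
  assert (Ex : ex_RInt (fun s => minus (cos (v * s)) (cos (v' * s))) 0 1)
    by (apply (ex_RInt_minus (V := R_NormedModule)); apply ex_RInt_cos_scal).
  assert (h := abs_RInt_le_const _ 0 1 (Rabs (v - v')) ltac:(lra) Ex).
  eapply Rle_trans; [apply h|lra].
  intros t Ht. unfold minus, plus, opp; simpl. eapply Rle_trans; [apply cos_lipschitz|].
  rewrite <- Rmult_minus_distr_r, Rabs_mult, (Rabs_right t) by lra. assert (P := Rabs_pos (v - v')). nra.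
Qed.

Lemma continuous_sinc v : continuous sinc v.
Proof.
  apply continuity_pt_filterlim. intros eps He. exists eps. split; auto.
  intros y [_ Hy]. simpl in *. unfold R_dist in *. eapply Rle_lt_trans; [apply sinc_lipschitz|auto].
Qed.

Lemma ex_RInt_sinc a b : ex_RInt sinc a b.
Proof. apply (ex_RInt_continuous (V := R_CompleteNormedModule)). intros; apply continuous_sinc. Qed.

Definition Si (x : R) : R := RInt sinc 0 x.

Lemma Si_diff x y : Si y - Si x = RInt sinc x y.
Proof.
  unfold Si. assert (h := RInt_Chasles sinc 0 x y (ex_RInt_sinc _ _) (ex_RInt_sinc _ _)).
  unfold plus in h; simpl in h. lra.
Qed.

Lemma sinc_even v : sinc (- v) = sinc v.
Proof. unfold sinc. apply RInt_ext. intros s _. rewrite <- cos_neg. f_equal. ring. Qed.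

Lemma Si_odd x : Si (- x) = - Si x.
Proof.
  unfold Si.
  assert (h := RInt_comp_lin sinc (- (1)) 0 0 x (ex_RInt_sinc _ _)).
  replace (- (1) * 0 + 0) with 0 in h by ring. replace (- (1) * x + 0) with (- x) in h by ring. rewrite <- h.
  rewrite (RInt_ext _ (fun y => opp (sinc y))).
  - rewrite (RInt_opp (V := R_CompleteNormedModule)) by apply ex_RInt_sinc. reflexivity.
  - intros y _. replace (- (1) * y + 0) with (- y) by ring. rewrite sinc_even. unfold scal, opp; simpl. unfold mult; simpl. ring.
Qed.

(** Integration by parts: [sin t / t = - (cos t / t)' - cos t / t^2]. Boundary terms and remaining
    integral add up to at most [1/x + 1/y + (1/x - 1/y)]. *)
Lemma Si_increment x y : 0 < x -> x <= y -> Rabs (Si y - Si x) <= 2 / x.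
Proof.
  intros Hx Hxy. rewrite Si_diff.
  assert (Hpos : forall t, Rmin x y <= t <= Rmax x y -> 0 < t) by (intros t Ht; rewrite Rmin_left in Ht by auto; lra).
  assert (C1 : forall t, 0 < t -> continuous (fun t => cos t / (t * t)) t).
  { intros t Ht. apply (ex_derive_continuous (V := R_NormedModule)). auto_derive. nra. }
  assert (I1 : is_RInt (fun t => plus (sinc t) (cos t / (t * t))) x y (minus (- cos y / y) (- cos x / x))).
  { apply (is_RInt_derive (fun t => - cos t / t)).
    - intros t Ht. specialize (Hpos t Ht). auto_derive; [lra|]. rewrite <- (sinc_mul t). unfold plus; simpl. field. lra.
    - intros t Ht. apply (continuous_plus (V := R_NormedModule)); [apply continuous_sinc|apply C1; auto]. }
  assert (Ex2 : ex_RInt (fun t => cos t / (t * t)) x y) by (apply (ex_RInt_continuous (V := R_CompleteNormedModule)); auto).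
  apply (is_RInt_unique (V := R_CompleteNormedModule)) in I1. rewrite (RInt_plus (V := R_CompleteNormedModule)) in I1; auto; [|apply ex_RInt_sinc].
  assert (I3 : is_RInt (fun t => / (t * t)) x y (minus (- / y) (- / x))).
  { apply (is_RInt_derive (fun t => - / t)).
    - intros t Ht. specialize (Hpos t Ht). auto_derive; [lra|]. field. lra.
    - intros t Ht. apply (ex_derive_continuous (V := R_NormedModule)). specialize (Hpos t Ht). auto_derive. nra. }
  assert (B : Rabs (RInt (fun t => cos t / (t * t)) x y) <= / x - / y).
  { replace (/ x - / y) with (RInt (fun t => / (t * t)) x y).
    2:{ rewrite (is_RInt_unique _ _ _ _ I3). unfold minus, plus, opp; simpl. ring. }
    eapply Rle_trans; [apply abs_RInt_le; auto|]. apply RInt_le; auto.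
    - apply (ex_RInt_norm (fun t => cos t / (t * t))); auto.
    - exists (minus (- / y) (- / x)). auto.
    - intros t Ht. assert (Pt : 0 < / (t * t)) by (apply Rinv_0_lt_compat; nra).
      unfold Rdiv. rewrite Rabs_mult, (Rabs_right (/ (t * t))) by lra.
      rewrite <- (Rmult_1_l (/ (t * t))) at 2. apply Rmult_le_compat_r; [lra|]. apply Rabs_le, COS_bound. }
  unfold plus, minus, plus, opp in I1; simpl in I1.
  assert (Hix : 0 < / x) by (apply Rinv_0_lt_compat; auto). assert (Hiy : 0 < / y) by (apply Rinv_0_lt_compat; lra).
  apply Rabs_le_between in B. apply Rabs_le.
  assert (cx := COS_bound x). assert (cy := COS_bound y).
  assert (- / y <= cos y * / y <= / y) by (split; nra). assert (- / x <= cos x * / x <= / x) by (split; nra).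
  unfold Rdiv in *. lra.
Qed.

Lemma sinc_lower v : 1 - v * v / 6 <= sinc v.
Proof.
  unfold sinc.
  assert (I : is_RInt (fun s => 1 - v * v * (s * s) / 2) 0 1 (minus (1 - v * v * (1 * 1 * 1) / 6) (0 - v * v * (0 * 0 * 0) / 6))).
  { apply (is_RInt_derive (fun s => s - v * v * (s * s * s) / 6)).
    - intros s _. auto_derive; auto. field.
    - intros s _. apply (ex_derive_continuous (V := R_NormedModule)). auto_derive. auto. }
  replace (1 - v * v / 6) with (minus (1 - v * v * (1 * 1 * 1) / 6) (0 - v * v * (0 * 0 * 0) / 6))
    by (unfold minus, plus, opp; simpl; field).
  rewrite <- (is_RInt_unique _ _ _ _ I). apply RInt_le; [lra|eexists; apply I|apply ex_RInt_cos_scal|].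
  intros s _. assert (h := cos_ge_parabola (v * s)). lra.
Qed.

Lemma Si_lower x : 0 <= x -> x - x * x * x / 18 <= Si x.
Proof.
  intros Hx. unfold Si.
  assert (I : is_RInt (fun v => 1 - v * v / 6) 0 x (minus (x - x * x * x / 18) (0 - 0 * 0 * 0 / 18))).
  { apply (is_RInt_derive (fun v => v - v * v * v / 18)).
    - intros s _. auto_derive; auto. field.
    - intros s _. apply (ex_derive_continuous (V := R_NormedModule)). auto_derive. auto. }
  replace (x - x * x * x / 18) with (minus (x - x * x * x / 18) (0 - 0 * 0 * 0 / 18)) by (unfold minus, plus, opp; simpl; field).
  rewrite <- (is_RInt_unique _ _ _ _ I). apply RInt_le; [lra|eexists; apply I|apply ex_RInt_sinc|].
  intros v _. apply sinc_lower.
Qed.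

Lemma sinc_abs_le_1 v : Rabs (sinc v) <= 1.
Proof.
  unfold sinc. eapply Rle_trans; [apply (abs_RInt_le_const _ 0 1 1); [lra|apply ex_RInt_cos_scal|]|lra].
  intros t _. apply Rabs_le, COS_bound.
Qed.

Lemma Si_le x : 0 <= x -> Rabs (Si x) <= x.
Proof.
  intros Hx. unfold Si. eapply Rle_trans; [apply (abs_RInt_le_const _ 0 x 1); [lra|apply ex_RInt_sinc|]|lra].
  intros t _. apply sinc_abs_le_1.
Qed.

(** The limit is [pi / 2]; the argument below works with any positive [kappa] within these bounds,
    provided the convergence has this rate. *)
Lemma Si_limit : exists kappa, 1 / 2 <= kappa <= 3 /\ forall x, 0 < x -> Rabs (Si x - kappa) <= 2 / x.
Proof.
  assert (Hc : ex_lim_seq_cauchy (fun n => Si (INR n + 1))).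
  { intros eps. destruct (archimed (2 / eps)) as [Ha _].
    exists (Z.to_nat (up (2 / eps))). 
    assert (Hpos : 0 < 2 / eps) by (apply Rdiv_lt_0_compat; [lra|apply cond_pos]).
    assert (K : forall n m, (Z.to_nat (up (2 / eps)) <= n)%nat -> (n <= m)%nat -> Rabs (Si (INR m + 1) - Si (INR n + 1)) < eps).
    { intros n m Hn Hm. apply le_INR in Hn. apply le_INR in Hm.
      assert (Hup : (0 <= up (2 / eps))%Z) by (apply le_IZR; lra).
      rewrite INR_IZR_INZ, Z2Nat.id in Hn by auto.
      eapply Rle_lt_trans; [apply Si_increment; lra|].
      apply Rmult_lt_reg_r with ((INR n + 1) / eps); [apply Rdiv_lt_0_compat; [lra|apply cond_pos]|].
      assert (Pe := cond_pos eps).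
      replace (2 / (INR n + 1) * ((INR n + 1) / eps)) with (2 / eps) by (field; lra).
      replace (eps * ((INR n + 1) / eps)) with (INR n + 1) by (field; lra). lra. }
    intros n m Hn Hm. destruct (Nat.le_ge_cases n m) as [h|h].
    - rewrite Rabs_minus_sym. apply K; auto.
    - apply K; auto. }
  apply ex_lim_seq_cauchy_corr in Hc. destruct Hc as [kappa Hk]. apply is_lim_seq_spec in Hk.
  assert (HB : forall x, 0 < x -> Rabs (Si x - kappa) <= 2 / x).
  { intros x Hx. apply Rnot_lt_le. intros Hlt.
    set (eps := Rabs (Si x - kappa) - 2 / x). assert (He : 0 < eps) by (unfold eps; lra).
    destruct (Hk (mkposreal eps He)) as [n0 Hn0]. simpl in Hn0.
    destruct (archimed x) as [Ha _]. assert (Hup : (0 <= up x)%Z) by (apply le_IZR; lra).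
    set (n := max n0 (Z.to_nat (up x))). specialize (Hn0 n ltac:(unfold n; lia)).
    assert (Hn : x <= INR n + 1).
    { assert (h : INR (Z.to_nat (up x)) <= INR n) by (apply le_INR; unfold n; lia).
      rewrite INR_IZR_INZ, Z2Nat.id in h by auto. lra. }
    assert (I := Si_increment x (INR n + 1) Hx Hn).
    assert (T := Rabs_triang (Si x - Si (INR n + 1)) (Si (INR n + 1) - kappa)).
    replace (Si x - Si (INR n + 1) + (Si (INR n + 1) - kappa)) with (Si x - kappa) in T by ring.
    rewrite Rabs_minus_sym in I. unfold eps in Hn0. lra. }
  exists kappa. split; auto.
  (* [Si 2 >= 14/9] and [|Si 2 - kappa| <= 1] give the lower bound; [Si 1 <= 1] and
     [|Si 1 - kappa| <= 2] give the upper bound. *)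
  assert (B2 := HB 2 ltac:(lra)). assert (B1 := HB 1 ltac:(lra)).
  assert (L2 := Si_lower 2 ltac:(lra)). assert (U1 := Si_le 1 ltac:(lra)).
  apply Rabs_le_between in B1. apply Rabs_le_between in B2. apply Rabs_le_between in U1. lra.
Qed.

(** * The kernel [int_{w1}^{w2} exp (z u) du] of Perron's formula *)

(** Equal to [(exp (w2 z) - exp (w1 z)) / z] for [z <> 0]. As an integral it is entire, so the point
    [z = 0], which lies on the path of integration in Perron's formula, needs no separate
    treatment. *)
Definition expint (w1 w2 : R) (z : C) : C := CInt (fun u => Cexp (RtoC u * z)) w1 w2.

Lemma expint_mul w1 w2 z : (z * expint w1 w2 z = Cexp (RtoC w2 * z) - Cexp (RtoC w1 * z))%C.
Proof.
  unfold expint. rewrite <- CInt_scal by apply cont_on_seg_Cexp.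
  apply (CInt_FTC (fun u => Cexp (RtoC u * z))%C).
  - apply cont_on_seg_scal, cont_on_seg_Cexp.
  - intros t _. apply Rdiff_Cexp.
Qed.

Lemma expint_bound w1 w2 z : w1 <= w2 -> Re z <= 0 -> z <> RtoC 0 ->
  Cmod (expint w1 w2 z) <= 2 * exp (w1 * Re z) / Cmod z.
Proof.
  intros Hw Hz Hz0. assert (Hm : 0 < Cmod z) by (apply Cmod_gt_0; auto).
  apply Rmult_le_reg_l with (Cmod z); auto. rewrite <- Cmod_mult, expint_mul.
  replace (Cmod z * (2 * exp (w1 * Re z) / Cmod z)) with (exp (w1 * Re z) + exp (w1 * Re z)) by (field; lra).
  eapply Rle_trans; [apply Cmod_sub_triangle|]. rewrite !Cmod_Cexp.
  assert (E : forall w, Re (RtoC w * z)%C = w * Re z) by (intros w; destruct z; simpl; ring).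
  rewrite !E. apply Rplus_le_compat; [apply exp_le; nra|lra].
Qed.

Lemma Rcont_expint_path w1 w2 (p : R -> C) x : Ccont (expint w1 w2) (p x) -> Rcont p x -> Rcont (fun y => expint w1 w2 (p y)) x.
Proof. intros H1 H2. apply (cont_comp _ p (expint w1 w2)); auto. Qed.

Lemma Cdiff_expint w1 w2 z : exists l, Cdiff (expint w1 w2) z l.
Proof.
  set (W := Rabs w1 + Rabs w2).
  assert (HW : forall t, Rmin w1 w2 <= t <= Rmax w1 w2 -> Rabs t <= W).
  { intros t Ht. unfold W. assert (P1 := Rabs_pos w1). assert (P2 := Rabs_pos w2).
    assert (A1 := Rle_abs w1). assert (A2 := Rle_abs w2). assert (B1 := Rle_abs (- w1)). assert (B2 := Rle_abs (- w2)).
    rewrite Rabs_Ropp in B1, B2. apply Rabs_le. unfold Rmin, Rmax in Ht. destruct (Rle_dec w1 w2); lra. }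
  assert (PW : 0 <= W) by (unfold W; assert (h := Rabs_pos w1); assert (h' := Rabs_pos w2); lra).
  assert (Ct : forall t, Rcont (fun u => RtoC u * Cexp (RtoC u * z))%C t).
  { intros t. apply cont_mult; [apply cont_RtoC|]. apply (cont_on_seg_Cexp z t t). unfold Rmin, Rmax. destruct (Rle_dec t t); lra. }
  assert (Ce : forall v t, Rcont (fun u => Cexp (RtoC u * v))%C t).
  { intros v t. apply (cont_on_seg_Cexp v t t). unfold Rmin, Rmax. destruct (Rle_dec t t); lra. }
  exists (CInt (fun u => RtoC u * Cexp (RtoC u * z))%C w1 w2).
  apply Cdiff_of_quadratic with (exp (W * Cmod z) * (W * W * exp W) * Rabs (w2 - w1)) 1; [lra|].
  intros h Hh. unfold expint.
  replace (CInt (fun u => Cexp (RtoC u * (z + h))) w1 w2 - CInt (fun u => Cexp (RtoC u * z)) w1 w2 - CInt (fun u => RtoC u * Cexp (RtoC u * z)) w1 w2 * h)%C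
    with (CInt (fun u => Cexp (RtoC u * (z + h)) - Cexp (RtoC u * z) - h * (RtoC u * Cexp (RtoC u * z)))%C w1 w2).
  2:{ rewrite (CInt_minus (fun u => Cexp (RtoC u * (z + h)) - Cexp (RtoC u * z))%C).
      - rewrite CInt_minus, CInt_scal by (intros t _; auto). ring.
      - intros t _. apply cont_minus; auto.
      - intros t _. apply cont_mult; [apply cont_const|auto]. }
  assert (Ph := Cmod_ge_0 h). assert (Pz := Cmod_ge_0 z).
  replace (exp (W * Cmod z) * (W * W * exp W) * Rabs (w2 - w1) * (Cmod h * Cmod h)) with
    ((exp (W * Cmod z) * (W * W * exp W) * (Cmod h * Cmod h)) * Rabs (w2 - w1)) by ring.
  apply CInt_norm_le_const_abs.
  - intros t _. apply cont_minus; [apply cont_minus; auto|]. apply cont_mult; [apply cont_const|auto].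
  - intros t Ht. specialize (HW t Ht).
    replace (Cexp (RtoC t * (z + h)) - Cexp (RtoC t * z) - h * (RtoC t * Cexp (RtoC t * z)))%C with
      (Cexp (RtoC t * z) * (Cexp (RtoC t * h) - 1 - RtoC t * h))%C.
    2:{ replace (RtoC t * (z + h))%C with (RtoC t * z + RtoC t * h)%C by ring. rewrite Cexp_plus. ring. }
    rewrite Cmod_mult, Rmult_assoc. apply Rmult_le_compat; try apply Cmod_ge_0.
    + rewrite Cmod_Cexp. apply exp_le. eapply Rle_trans; [apply Rle_abs|]. eapply Rle_trans; [apply re_le_Cmod|].
      rewrite Cmod_mult, Cmod_R. apply Rmult_le_compat_r; auto.
    + eapply Rle_trans; [apply Cexp_sub_1_sub_le|]. rewrite Cmod_mult, Cmod_R.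
      assert (Pt := Rabs_pos t).
      assert (H1 : Rabs t * Cmod h <= W * Cmod h) by (apply Rmult_le_compat_r; auto).
      assert (H2 : 0 <= Rabs t * Cmod h) by (apply Rmult_le_pos; auto).
      assert (H3 : exp (Rabs t * Cmod h) <= exp W) by (apply exp_le; nra).
      replace (W * W * exp W * (Cmod h * Cmod h)) with ((W * Cmod h) * (W * Cmod h) * exp W) by ring.
      apply Rmult_le_compat; auto; [nra|left; apply exp_pos|]. apply Rmult_le_compat; auto.
Qed.

Lemma Ccont_expint w1 w2 z : Ccont (expint w1 w2) z.
Proof. destruct (Cdiff_expint w1 w2 z) as [l Hl]. eapply Cdiff_cont; eauto. Qed.

Lemma expint_0_Re w y : Re (expint 0 w (0, y)) = w * sinc (y * w).
Proof.
  unfold expint, CInt. unfold Re at 1. simpl fst. unfold sinc.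
  rewrite (RInt_ext _ (fun u => cos (y * u))).
  2:{ intros u _. unfold Cexp; simpl. replace (u * 0 - 0 * y) with 0 by ring. rewrite exp_0, Rmult_1_l. f_equal. ring. }
  assert (h := RInt_comp_lin (fun u => cos (y * u)) w 0 0 1 (ex_RInt_cos_scal _ _ _)).
  replace (w * 0 + 0) with 0 in h by ring. replace (w * 1 + 0) with w in h by ring. rewrite <- h.
  rewrite <- (RInt_scal (V := R_CompleteNormedModule)) by apply ex_RInt_cos_scal.
  apply RInt_ext. intros s _. unfold scal; simpl. unfold mult; simpl. do 2 f_equal. ring.
Qed.

Lemma expint_0_Im_odd w y : Im (expint 0 w (0, - y)) = - Im (expint 0 w (0, y)).
Proof.
  unfold expint. rewrite !CInt_Im.
  assert (Ex : ex_RInt (fun u => Im (Cexp (RtoC u * (0, y)))) 0 w) by (apply ex_RInt_Im, cont_on_seg_Cexp).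
  rewrite <- (RInt_opp (V := R_CompleteNormedModule)) by exact Ex.
  apply RInt_ext. intros u _. unfold Cexp, opp; simpl.
  replace (u * 0 - 0 * - y) with 0 by ring. replace (u * 0 - 0 * y) with 0 by ring.
  replace (u * - y + 0 * 0) with (- (u * y)) by ring. replace (u * y + 0 * 0) with (u * y) by ring.
  rewrite sin_neg. ring.
Qed.

Lemma Rcont_expint_v w1 w2 y : Rcont (fun y => expint w1 w2 (0, y)) y.
Proof. apply (Rcont_expint_path w1 w2 (fun y => (0, y) : C)); [apply Ccont_expint|apply Rcont_vpath]. Qed.

(** Over [[-T, T]] the imaginary part is odd and cancels; the real part [w sinc (y w)] integrates to
    twice [Si (T w)]. *)
Lemma CInt_expint_0 w T : CInt (fun y => expint 0 w (0, y)) (- T) T = RtoC (2 * Si (T * w)).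
Proof.
  assert (Cc : forall a b, cont_on_seg (fun y => expint 0 w (0, y)) a b) by (intros a b t _; apply Rcont_expint_v).
  apply injective_projections.
  - change (Re (CInt (fun y => expint 0 w (0, y)) (- T) T) = 2 * Si (T * w)). rewrite CInt_Re.
    rewrite (RInt_ext _ (fun y => scal w (sinc (w * y + 0)))).
    2:{ intros y _. rewrite expint_0_Re. unfold scal; simpl. unfold mult; simpl. do 2 f_equal. ring. }
    rewrite (RInt_comp_lin (V := R_CompleteNormedModule) sinc w 0) by apply ex_RInt_sinc. rewrite <- Si_diff.
    replace (w * T + 0) with (T * w) by ring. replace (w * - T + 0) with (- (T * w)) by ring. rewrite Si_odd. ring.
  - change (Im (CInt (fun y => expint 0 w (0, y)) (- T) T) = 0). rewrite CInt_Im.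
    assert (Ex : forall a b, ex_RInt (fun y => Im (expint 0 w (0, y))) a b) by (intros a b; apply ex_RInt_Im; auto).
    assert (h := RInt_comp_lin (fun y => Im (expint 0 w (0, y))) (- (1)) 0 (- T) T (Ex _ _)).
    replace (- (1) * - T + 0) with T in h by ring. replace (- (1) * T + 0) with (- T) in h by ring.
    rewrite (RInt_ext _ (fun y => Im (expint 0 w (0, y)))) in h.
    2:{ intros y _. replace (- (1) * y + 0) with (- y) by ring. rewrite expint_0_Im_odd. unfold scal; simpl. unfold mult; simpl. ring. }
    rewrite <- (opp_RInt_swap (V := R_CompleteNormedModule) (fun y => Im (expint 0 w (0, y))) (- T) T) in h by apply Ex.
    set (I := RInt (fun y => Im (expint 0 w (0, y))) (- T) T) in *. change (I = - I) in h. lra.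
Qed.

(** Multiplication by [exp (- lam z)] translates the interval of integration. At [z = 0] one cannot
    divide by [z], and both sides are computed directly. *)
Lemma expint_shift w1 w2 lam z : (Cexp (- (RtoC lam * z)) * expint w1 w2 z = expint 0 (w2 - lam) z - expint 0 (w1 - lam) z)%C.
Proof.
  destruct (classic (z = RtoC 0)) as [->|Hz].
  - rewrite Cmult_0_r. replace (- RtoC 0)%C with (RtoC 0) by ring. rewrite Cexp_0. unfold expint.
    assert (E : forall a b, CInt (fun u => Cexp (RtoC u * RtoC 0)) a b = RtoC (b - a)).
    { intros a b. rewrite (CInt_ext _ (fun _ => RtoC 1)), CInt_const; [ring|].
      intros t _. rewrite Cmult_0_r. apply Cexp_0. }
    rewrite !E, !RtoC_minus. ring.
  - assert (E1 := expint_mul w1 w2 z). assert (E2 := expint_mul 0 (w2 - lam) z). assert (E3 := expint_mul 0 (w1 - lam) z).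
    rewrite Cmult_0_l in E2, E3.
    replace (expint w1 w2 z) with (/ z * (z * expint w1 w2 z))%C by (field; auto).
    replace (expint 0 (w2 - lam) z) with (/ z * (z * expint 0 (w2 - lam) z))%C by (field; auto).
    replace (expint 0 (w1 - lam) z) with (/ z * (z * expint 0 (w1 - lam) z))%C by (field; auto).
    rewrite E1, E2, E3.
    replace (RtoC (w2 - lam) * z)%C with (- (RtoC lam * z) + RtoC w2 * z)%C by (rewrite RtoC_minus; ring).
    replace (RtoC (w1 - lam) * z)%C with (- (RtoC lam * z) + RtoC w1 * z)%C by (rewrite RtoC_minus; ring).
    rewrite !Cexp_plus. ring.
Qed.

(** The discontinuous integral: each [Si] is near a constant times the sign of its argument, so the
    difference detects whether [ln n] lies between [w1] and [w2]. *)
Lemma perron_kernel n w1 w2 T :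
  CInt (fun y => ncpow n (- (0, y)) * expint w1 w2 (0, y))%C (- T) T =
  RtoC (2 * Si (T * (w2 - ln (INR n))) - 2 * Si (T * (w1 - ln (INR n)))).
Proof.
  rewrite RtoC_minus, <- !CInt_expint_0. rewrite <- CInt_minus by (intros t _; apply Rcont_expint_v).
  apply CInt_ext. intros y _. rewrite <- expint_shift. unfold ncpow. do 2 f_equal. ring.
Qed.

(** * Perron's formula *)

(** The exchange of sum and integral rests on a majorant [f] that does not depend on [y] and hence
    makes the tails uniformly small. *)
Lemma CInt_termwise (u : nat -> R -> C) (S w : R -> C) (f : nat -> R) a b W M : a <= b ->
  (forall n, (1 <= n)%nat -> cont_on_seg (u n) a b) -> cont_on_seg S a b -> cont_on_seg w a b ->
  (forall y, a <= y <= b -> Cmod (w y) <= W) ->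
  (forall n y, (1 <= n)%nat -> a <= y <= b -> Cmod (u n y) <= f n) -> (forall n, 0 <= f n) ->
  (forall n, rsum (seq 1 n) f <= M) ->
  (forall y, a <= y <= b -> Csums (fun n => u n y) (S y)) ->
  Csums (fun n => CInt (fun y => u n y * w y)%C a b) (CInt (fun y => S y * w y)%C a b).
Proof.
  intros Hab Hu HS Hw HW Hf Hf0 HM Hsum eps He.
  assert (W0 : 0 <= W) by (eapply Rle_trans; [apply Cmod_ge_0|apply (HW a); lra]).
  set (D := W * (b - a) + 1). assert (HD : 0 < D) by (unfold D; nra).
  destruct (tail_small f M Hf0 HM (eps / (2 * D))) as [n0 Hn0]; [apply Rdiv_lt_0_compat; lra|].
  exists n0. intros n Hn.
  assert (E : lsum (seq 1 n) (fun n => CInt (fun y => u n y * w y)%C a b) =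
     CInt (fun y => lsum (seq 1 n) (fun k => u k y) * w y)%C a b /\ cont_on_seg (fun y => lsum (seq 1 n) (fun k => u k y)) a b).
  { clear Hn. induction n as [|n [IH1 IH2]].
    - split.
      + unfold lsum; simpl. rewrite (CInt_ext _ (fun _ => RtoC 0)), CInt_const; [ring|]. intros; ring.
      + intros t _. exact (cont_const R_dist (RtoC 0) t).
    - split.
      + rewrite lsum_seq_S, IH1. rewrite <- CInt_plus.
        * apply CInt_ext. intros y _. rewrite lsum_seq_S. ring.
        * intros t Ht. apply cont_mult; auto.
        * intros t Ht. apply cont_mult; auto. apply Hu; auto. lia.
      + intros t Ht. apply cont_ext with (fun y => lsum (seq 1 n) (fun k => u k y) + u (Datatypes.S n) y)%C.
        * intros y. rewrite lsum_seq_S. auto.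
        * apply cont_plus; auto. apply Hu; auto. lia. }
  destruct E as [E Ec]. rewrite E, Cmod_sub_comm.
  assert (Cx : cont_on_seg (fun y => S y * w y)%C a b) by (intros t Ht; apply cont_mult; auto).
  assert (Cy : cont_on_seg (fun y => lsum (seq 1 n) (fun k => u k y) * w y)%C a b) by (intros t Ht; apply cont_mult; auto).
  rewrite <- CInt_minus by auto.
  assert (B : Cmod (CInt (fun y => S y * w y - lsum (seq 1 n) (fun k => u k y) * w y)%C a b) <= (eps / (2 * D) * W) * (b - a)).
  { apply CInt_norm_le_const; auto.
    - intros t Ht. apply cont_minus; auto.
    - intros t Ht. replace (S t * w t - lsum (seq 1 n) (fun k => u k t) * w t)%C with ((S t - lsum (seq 1 n) (fun k => u k t)) * w t)%C by ring.
      rewrite Cmod_mult. apply Rmult_le_compat; try apply Cmod_ge_0; auto.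
      apply (Csums_tail_le (fun k => u k t) _ f); auto.
      intros l Hl Hk. apply Hn0; auto. intros k Hk'. specialize (Hk k Hk'). lia. }
  eapply Rle_lt_trans; [exact B|].
  assert (Q : 0 < eps / (2 * D)) by (apply Rdiv_lt_0_compat; lra).
  apply Rle_lt_trans with (eps / (2 * D) * D); [rewrite Rmult_assoc; apply Rmult_le_compat_l; [lra|unfold D; lra]|].
  replace (eps / (2 * D) * D) with (eps / 2) by (field; lra). lra.
Qed.

(** * The truncation error of the kernel *)

Lemma ln_diff_lower a b : 0 < b -> b <= a -> (a - b) / a <= ln a - ln b.
Proof.
  intros Hb Hab. assert (h := exp_ge_1_plus (ln b - ln a)).
  replace (exp (ln b - ln a)) with (b / a) in h.
  2:{ unfold Rminus. rewrite exp_plus, exp_Ropp, !exp_ln by lra. reflexivity. }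
  replace ((a - b) / a) with (1 - b / a) by (field; lra). lra.
Qed.

Lemma ln_dist_lower a b B : 0 < a <= B -> 0 < b <= B -> Rabs (a - b) / B <= Rabs (ln a - ln b).
Proof.
  assert (K : forall a b, 0 < b -> b <= a -> a <= B -> Rabs (a - b) / B <= Rabs (ln a - ln b)).
  { intros x y Hy Hxy HB. assert (h := ln_diff_lower x y Hy Hxy).
    rewrite Rabs_right by lra. eapply Rle_trans; [|apply Rle_abs]. eapply Rle_trans; [|exact h].
    unfold Rdiv. apply Rmult_le_compat_l; [lra|]. apply Rinv_le_contravar; lra. }
  intros Ha Hb. destruct (Rle_dec b a) as [h|h]; [apply K; lra|].
  rewrite (Rabs_minus_sym a b), (Rabs_minus_sym (ln a)). apply K; lra.
Qed.

Lemma harmonic_bound n : (1 <= n)%nat -> rsum (seq 1 n) (fun j => / INR j) <= 1 + ln (INR n).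
Proof.
  intros Hn. destruct n as [|n]; [lia|]. clear Hn. induction n as [|n IH].
  - unfold rsum; simpl. rewrite ln_1. lra.
  - rewrite rsum_seq_S. assert (H1 : 1 <= INR (S n)) by (apply INR_ge_1; lia).
    rewrite (S_INR (S n)). assert (h := ln_diff_lower (INR (S n) + 1) (INR (S n)) ltac:(lra) ltac:(lra)).
    replace ((INR (S n) + 1 - INR (S n)) / (INR (S n) + 1)) with (/ (INR (S n) + 1)) in h by (field; lra). lra.
Qed.

(** The value 1 on the diagonal covers the index next to the end point, where the kernel error has
    no decay and the trivial bound is used. *)
Definition inv_dist (n m : nat) : R := if Nat.eq_dec n m then 1 else / Rabs (INR n - INR m).

Lemma inv_dist_nonneg n m : 0 <= inv_dist n m.
Proof.
  unfold inv_dist. destruct (Nat.eq_dec n m); [lra|]. left. apply Rinv_0_lt_compat, Rabs_pos_lt.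
  intros h. apply n0. apply INR_eq. lra.
Qed.

Lemma inv_dist_sum m P : (m <= P)%nat -> (1 <= m)%nat -> rsum (seq 1 P) (fun n => inv_dist n m) <= 3 + 2 * ln (INR P).
Proof.
  intros HmP Hm.
  set (l1 := seq 1 (m - 1)). set (l2 := seq (S m) (P - m)).
  assert (E : seq 1 P = l1 ++ [m] ++ l2).
  { unfold l1, l2. replace P with ((m - 1) + (1 + (P - m)))%nat at 1 by lia.
    rewrite !seq_app. replace (1 + (m - 1))%nat with m by lia. simpl seq at 2. replace (m + 1)%nat with (S m) by lia. reflexivity. }
  rewrite E, !rsum_app.
  assert (H := harmonic_bound P ltac:(lia)).
  assert (pos : forall j, In j (seq 1 P) -> 0 <= / INR j).
  { intros j Hj. apply in_seq in Hj. left. apply Rinv_0_lt_compat. apply lt_0_INR. lia. }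
  assert (B1 : rsum l1 (fun n => inv_dist n m) <= rsum (seq 1 P) (fun j => / INR j)).
  { rewrite (rsum_ext l1 _ (fun n => / INR (m - n))).
    - rewrite <- (rsum_map (fun n => (m - n)%nat) l1 (fun j => / INR j)). apply rsum_incl; auto.
      + apply NoDup_map_NoDup_ForallPairs; [|apply seq_NoDup].
        intros x y Hx Hy Exy. apply in_seq in Hx. apply in_seq in Hy. lia.
      + intros j Hj. apply in_map_iff in Hj. destruct Hj as [n [<- Hn]]. apply in_seq in Hn. apply in_seq. lia.
    - intros n Hn. apply in_seq in Hn. unfold inv_dist. destruct (Nat.eq_dec n m); [lia|].
      f_equal. rewrite minus_INR by lia. rewrite Rabs_left; [ring|]. assert (INR n < INR m) by (apply lt_INR; lia). lra. }
  assert (B2 : rsum l2 (fun n => inv_dist n m) <= rsum (seq 1 P) (fun j => / INR j)).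
  { rewrite (rsum_ext l2 _ (fun n => / INR (n - m))).
    - rewrite <- (rsum_map (fun n => (n - m)%nat) l2 (fun j => / INR j)). apply rsum_incl; auto.
      + apply NoDup_map_NoDup_ForallPairs; [|apply seq_NoDup].
        intros x y Hx Hy Exy. apply in_seq in Hx. apply in_seq in Hy. lia.
      + intros j Hj. apply in_map_iff in Hj. destruct Hj as [n [<- Hn]]. apply in_seq in Hn. apply in_seq. lia.
    - intros n Hn. apply in_seq in Hn. unfold inv_dist. destruct (Nat.eq_dec n m); [lia|].
      f_equal. rewrite minus_INR by lia. rewrite Rabs_right; [ring|]. assert (INR m < INR n) by (apply lt_INR; lia). lra. }
  assert (B3 : rsum [m] (fun n => inv_dist n m) = 1).
  { unfold rsum, inv_dist; simpl. destruct (Nat.eq_dec m m); [ring|tauto]. }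
  lra.
Qed.

Lemma nat_floor (y : R) : 1 <= y -> exists m, (1 <= m)%nat /\ INR m <= y < INR m + 1.
Proof.
  intros Hy. destruct (archimed y) as [H1 H2].
  exists (Z.to_nat (up y - 1)). assert (Hup : (2 <= up y)%Z) by (assert (1 < up y)%Z by (apply lt_IZR; lra); lia).
  rewrite INR_IZR_INZ, Z2Nat.id, minus_IZR by lia. split; [lia|lra].
Qed.

(** A jump function with [kappa] in place of [pi / 2]. The value at 0 is [kappa], so that with
    [x = ln y - ln n] the index [n = y] counts as [n <= y]; this matches intervals that are open on
    the left and closed on the right. *)
Definition step_at (kappa x : R) : R := if Rle_dec 0 x then kappa else - kappa.

Section KernelError.
Variables (kappa : R).
Hypotheses (Hk : 1 / 2 <= kappa <= 3) (HSi : forall x, 0 < x -> Rabs (Si x - kappa) <= 2 / x).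

Lemma Si_abs_le x : Rabs (Si x) <= 5.
Proof.
  assert (K : forall x, 0 <= x -> Rabs (Si x) <= 5).
  { intros y Hy. destruct (Rle_dec y 1) as [h|h]; [eapply Rle_trans; [apply Si_le; auto|lra]|].
    assert (B := HSi y ltac:(lra)). assert (2 / y <= 2).
    { apply Rmult_le_reg_r with y; [lra|]. unfold Rdiv. rewrite Rmult_assoc, Rinv_l; lra. }
    apply Rabs_le_between in B. apply Rabs_le. lra. }
  destruct (Rle_dec 0 x) as [h|h]; [apply K; auto|].
  rewrite <- (Ropp_involutive x), Si_odd, Rabs_Ropp. apply K. lra.
Qed.

Lemma Si_step_bounded T x : Rabs (Si (T * x) - step_at kappa x) <= 8.
Proof.
  assert (h := Si_abs_le (T * x)). apply Rabs_le_between in h. apply Rabs_le.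
  unfold step_at. destruct (Rle_dec 0 x); lra.
Qed.

Lemma Si_step_far T x : 0 < T -> x <> 0 -> Rabs (Si (T * x) - step_at kappa x) <= 2 / (T * Rabs x).
Proof.
  intros HT Hx. unfold step_at. destruct (Rle_dec 0 x) as [h|h].
  - rewrite (Rabs_right x) by lra. apply HSi. apply Rmult_lt_0_compat; lra.
  - replace (T * x) with (- (T * - x)) by ring. rewrite Si_odd.
    replace (- Si (T * - x) - - kappa) with (- (Si (T * - x) - kappa)) by ring. rewrite Rabs_Ropp, (Rabs_left x) by lra.
    apply HSi. apply Rmult_lt_0_compat; lra.
Qed.

Variables (N y : R) (m : nat).
Hypotheses (HN : 1 <= N) (Hy : N <= y <= 2 * N) (Hm : INR m <= y < INR m + 1).
Notation T := (sqrt N).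

Lemma sqrt_ge_1 : 1 <= T.
Proof. rewrite <- sqrt_1. apply sqrt_le_1_alt; auto. Qed.

(** For [|n - m| <= 2] the trivial bound 8 suffices. Otherwise [|y - n| >= |n - m| / 2], so
    [|ln (y/n)| >= |n - m| / (8 N)], and [T^2 = N] turns [2 / (T |ln (y/n)|)] into at most
    [16 T / |n - m|]. *)
Lemma kernel_error_near n : (1 <= n)%nat -> INR n <= 4 * N ->
  Rabs (Si (T * (ln y - ln (INR n))) - step_at kappa (ln y - ln (INR n))) <= 64 * T * inv_dist n m.
Proof.
  intros Hn HnN. assert (HT := sqrt_ge_1). assert (Hn1 := INR_ge_1 n Hn).
  set (x := ln y - ln (INR n)). assert (B8 := Si_step_bounded T x).
  unfold inv_dist. destruct (Nat.eq_dec n m) as [E|E]; [nra|].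
  assert (Hd : 1 <= Rabs (INR n - INR m)).
  { rewrite !INR_IZR_INZ, <- minus_IZR, <- abs_IZR. apply IZR_le. lia. }
  set (d := Rabs (INR n - INR m)) in *.
  assert (Hi : 0 < / d) by (apply Rinv_0_lt_compat; lra).
  destruct (Rle_dec d 2) as [h|h].
  - assert (/ 2 <= / d) by (apply Rinv_le_contravar; lra). nra.
  - assert (Hdy : d / 2 <= Rabs (y - INR n)).
    { assert (Tr := Rabs_triang (INR n - y) (y - INR m)).
      replace (INR n - y + (y - INR m)) with (INR n - INR m) in Tr by ring. fold d in Tr.
      rewrite (Rabs_minus_sym (INR n) y), (Rabs_right (y - INR m)) in Tr by lra. lra. }
    assert (HL := ln_dist_lower y (INR n) (4 * N) ltac:(lra) ltac:(lra)). fold x in HL.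
    assert (Hx : d / (8 * N) <= Rabs x).
    { eapply Rle_trans; [|exact HL]. unfold Rdiv at 1 2.
      replace (d * / (8 * N)) with ((d / 2) * / (4 * N)) by (field; lra).
      apply Rmult_le_compat_r; [left; apply Rinv_0_lt_compat; lra|auto]. }
    assert (Hx0 : 0 < d / (8 * N)) by (apply Rdiv_lt_0_compat; lra).
    eapply Rle_trans; [apply Si_step_far; [lra|]|].
    { intros h0. rewrite h0, Rabs_R0 in Hx. lra. }
    apply Rle_trans with (2 / (T * (d / (8 * N)))).
    + unfold Rdiv at 1 2. apply Rmult_le_compat_l; [lra|]. apply Rinv_le_contravar.
      * apply Rmult_lt_0_compat; lra.
      * apply Rmult_le_compat_l; lra.
    + assert (ET : T * T = N) by (apply sqrt_sqrt; lra).
      replace (2 / (T * (d / (8 * N)))) with (16 * (T * / d)).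
      2:{ assert (EN : forall r, 0 < r -> 2 / (r * (d / (8 * (r * r)))) = 16 * (r * / d)) by (intros; field; split; lra).
          rewrite <- (EN T), ET by lra. reflexivity. }
      assert (0 < T * / d) by (apply Rmult_lt_0_compat; lra). lra.
Qed.

(** Here [n] and [y] differ by a factor of at least 2, and [ln 2 > 1/2]. *)
Lemma kernel_error_far n : (1 <= n)%nat -> 4 * N <= INR n \/ INR n <= N / 2 ->
  Rabs (Si (T * (ln y - ln (INR n))) - step_at kappa (ln y - ln (INR n))) <= 4 / T.
Proof.
  intros Hn Hf. assert (HT := sqrt_ge_1). assert (Hn1 := INR_ge_1 n Hn).
  set (x := ln y - ln (INR n)). assert (L2 := ln_lt_2).
  assert (Hx : 1 / 2 <= Rabs x).
  { unfold x. destruct Hf as [h|h].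
    - rewrite Rabs_minus_sym. eapply Rle_trans; [|apply Rle_abs].
      assert (ln (2 * y) <= ln (INR n)) by (apply ln_le; lra). rewrite ln_mult in H by lra. lra.
    - eapply Rle_trans; [|apply Rle_abs].
      assert (ln (2 * INR n) <= ln y) by (apply ln_le; lra). rewrite ln_mult in H by lra. lra. }
  eapply Rle_trans; [apply Si_step_far; [lra|]|].
  { intros h0. rewrite h0, Rabs_R0 in Hx. lra. }
  apply Rle_trans with (2 / (T * (1 / 2))); [|right; field; lra].
  unfold Rdiv at 1 2. apply Rmult_le_compat_l; [lra|]. apply Rinv_le_contravar; [lra|].
  apply Rmult_le_compat_l; lra.
Qed.

(** Indices far from [y] cost [4 / T] against the total mass [M]. The others are comparable with
    [N], where [g] is at most [4 K N^(d-c)], and their errors add up to a harmonic sum. *)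
Lemma kernel_error_sum (g : nat -> R) K M d c X P : 0 <= K -> 0 < d <= 1 / 8 -> c = 1 + 2 * d ->
  (forall n, 0 <= g n) -> (forall n, (1 <= n)%nat -> g n <= K * Rpower (INR n) (d - c)) ->
  (forall X, rsum (seq 1 X) g <= M) -> (1 <= m)%nat -> INR P <= 4 * N < INR P + 1 ->
  rsum (seq 1 X) (fun n => g n * Rabs (Si (T * (ln y - ln (INR n))) - step_at kappa (ln y - ln (INR n))))
  <= 4 / T * M + 256 * T * K * Rpower N (d - c) * (3 + 2 * ln (4 * N)).
Proof.
  intros HK Hd Hc Hg0 Hg HM Hm1 HP. assert (HT := sqrt_ge_1).
  set (Z := 256 * T * K * Rpower N (d - c)).
  assert (HZ : 0 <= Z).
  { unfold Z. assert (q := Rpower_pos N (d - c)). apply Rmult_le_pos; [|lra]. nra. }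
  apply Rle_trans with (rsum (seq 1 X) (fun n => 4 / T * g n + Z * (if le_dec n P then inv_dist n m else 0))).
  - apply rsum_le. intros n Hn. apply in_seq in Hn. assert (Hn1 : (1 <= n)%nat) by lia.
    specialize (Hg0 n). specialize (Hg n Hn1). assert (Hnr := INR_ge_1 n Hn1).
    assert (PT : 0 < 4 / T) by (apply Rdiv_lt_0_compat; lra).
    assert (Pid := inv_dist_nonneg n m).
    destruct (Rle_dec (INR n) (N / 2)) as [h|h]; [|destruct (Rle_dec (4 * N) (INR n)) as [h'|h']].
    + assert (B := kernel_error_far n Hn1 (or_intror h)).
      assert (0 <= Z * (if le_dec n P then inv_dist n m else 0)) by (apply Rmult_le_pos; auto; destruct (le_dec n P); lra).
      assert (g n * Rabs (Si (T * (ln y - ln (INR n))) - step_at kappa (ln y - ln (INR n))) <= g n * (4 / T)) by (apply Rmult_le_compat_l; auto).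
      lra.
    + assert (B := kernel_error_far n Hn1 (or_introl h')).
      assert (0 <= Z * (if le_dec n P then inv_dist n m else 0)) by (apply Rmult_le_pos; auto; destruct (le_dec n P); lra).
      assert (g n * Rabs (Si (T * (ln y - ln (INR n))) - step_at kappa (ln y - ln (INR n))) <= g n * (4 / T)) by (apply Rmult_le_compat_l; auto).
      lra.
    + destruct (le_dec n P) as [q|q].
      2:{ exfalso. assert (P + 1 <= n)%nat by lia. apply le_INR in H. rewrite plus_INR in H. simpl in H. lra. }
      assert (B := kernel_error_near n Hn1 ltac:(lra)).
      (* Here [n > N / 2], and [2^(c-d) <= 4] because [c - d = 1 + d]. *)
      assert (G : g n <= 4 * K * Rpower N (d - c)).
      { eapply Rle_trans; [exact Hg|]. rewrite (Rmult_comm 4), Rmult_assoc. apply Rmult_le_compat_l; auto.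
        apply Rle_trans with (Rpower (N / 2) (d - c)); [apply Rpower_le_base_neg; lra|].
        replace (N / 2) with (N * / 2) by field. rewrite <- Rpower_mult_distr by lra.
        rewrite Rmult_comm. apply Rmult_le_compat_r; [left; apply Rpower_pos|].
        unfold Rpower. rewrite ln_Rinv by lra. replace 4 with (exp (ln 4)) by (apply exp_ln; lra). apply exp_le.
        replace 4 with (2 * 2) by ring. rewrite ln_mult by lra. assert (L2 := ln_lt_2). nra. }
      apply Rle_trans with (4 * K * Rpower N (d - c) * (64 * T * inv_dist n m)).
      * apply Rmult_le_compat; auto. apply Rabs_pos.
      * unfold Z. replace (4 * K * Rpower N (d - c) * (64 * T * inv_dist n m)) with (256 * T * K * Rpower N (d - c) * inv_dist n m) by ring.
        assert (0 <= 4 / T * g n) by (apply Rmult_le_pos; lra). lra.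
  - rewrite rsum_plus, !rsum_scal. apply Rplus_le_compat.
    + apply Rmult_le_compat_l; auto. left. apply Rdiv_lt_0_compat; lra.
    + apply Rmult_le_compat_l; auto.
      assert (HP1 : (m <= P)%nat).
      { apply INR_le. assert (INR m < INR P + 1) by lra. rewrite <- S_INR in H. apply INR_lt in H. apply le_INR. lia. }
      apply Rle_trans with (rsum (seq 1 P) (fun n => inv_dist n m)).
      * destruct (Nat.le_ge_cases X P) as [h|h].
        -- rewrite (seq_1_app X P h), rsum_app.
           assert (0 <= rsum (seq (S X) (P - X)) (fun n => inv_dist n m)) by (apply rsum_nonneg; intros; apply inv_dist_nonneg).
           assert (rsum (seq 1 X) (fun n => if le_dec n P then inv_dist n m else 0) <= rsum (seq 1 X) (fun n => inv_dist n m)); [|lra].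
           apply rsum_le. intros n _. destruct (le_dec n P); [lra|apply inv_dist_nonneg].
        -- rewrite (seq_1_app P X h), rsum_app.
           rewrite (rsum_ext (seq (S P) (X - P)) _ (fun _ => 0)), rsum_const.
           2:{ intros n Hn. apply in_seq in Hn. destruct (le_dec n P); [lia|auto]. }
           rewrite Rmult_0_r, Rplus_0_r. apply rsum_le. intros n _. destruct (le_dec n P); [lra|apply inv_dist_nonneg].
      * eapply Rle_trans; [apply inv_dist_sum; auto|].
        assert (ln (INR P) <= ln (4 * N)); [|lra]. apply ln_le; [apply lt_0_INR; lia|lra].
Qed.
End KernelError.

Definition in_interval (y1 y2 : R) (n : nat) : bool :=
  if Rlt_dec y1 (INR n) then if Rle_dec (INR n) y2 then true else false else false.

Lemma in_interval_spec y1 y2 n : in_interval y1 y2 n = true <-> y1 < INR n <= y2.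
Proof.
  unfold in_interval. destruct (Rlt_dec y1 (INR n)), (Rle_dec (INR n) y2); split; intros; auto; try discriminate; lra.
Qed.

Lemma step_difference kappa y1 y2 n : 0 < y1 -> y1 < y2 -> (1 <= n)%nat ->
  2 * step_at kappa (ln y2 - ln (INR n)) - 2 * step_at kappa (ln y1 - ln (INR n)) = if in_interval y1 y2 n then 4 * kappa else 0.
Proof.
  intros H1 H2 Hn. apply INR_ge_1 in Hn. unfold step_at, in_interval.
  assert (L : forall y, 0 < y -> (0 <= ln y - ln (INR n) <-> INR n <= y)).
  { intros y Hy. split; intros h.
    - apply Rnot_lt_le. intros h'. assert (ln y < ln (INR n)) by (apply ln_increasing; auto). lra.
    - assert (ln (INR n) <= ln y) by (apply ln_le; lra). lra. }
  assert (L1 := L y1 H1). assert (L2 := L y2 ltac:(lra)).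
  destruct (Rle_dec 0 (ln y2 - ln (INR n))) as [a|a], (Rle_dec 0 (ln y1 - ln (INR n))) as [b|b],
    (Rlt_dec y1 (INR n)) as [c|c], (Rle_dec (INR n) y2) as [d|d]; try ring; exfalso;
    try (apply L1 in b; lra); try (apply b, L1; lra); try (apply a, L2; lra); try (apply L2 in a; lra);
    apply a, L2; apply L1 in b; lra.
Qed.

Lemma RInt_inv_1p T : 0 <= T -> is_RInt (fun y => / (1 + y)) 0 T (ln (1 + T)).
Proof.
  intros HT. replace (ln (1 + T)) with (minus (ln (1 + T)) (ln (1 + 0))).
  2:{ rewrite Rplus_0_r, ln_1. unfold minus, plus, opp; simpl. ring. }
  apply (is_RInt_derive (fun y => ln (1 + y))).
  - intros y Hy. rewrite Rmin_left in Hy by lra. auto_derive; [lra|]. field. lra.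
  - intros y Hy. rewrite Rmin_left in Hy by lra. apply (ex_derive_continuous (V := R_NormedModule)). auto_derive. lra.
Qed.

Lemma RInt_inv_1m T : 0 <= T -> is_RInt (fun y => / (1 - y)) (- T) 0 (ln (1 + T)).
Proof.
  intros HT. replace (ln (1 + T)) with (minus (- ln (1 - 0)) (- ln (1 - - T))).
  2:{ rewrite Rminus_0_r, ln_1. unfold minus, plus, opp; simpl. replace (1 - - T) with (1 + T) by ring. ring. }
  apply (is_RInt_derive (fun y => - ln (1 - y))).
  - intros y Hy. rewrite Rmax_right in Hy by lra. auto_derive; [lra|]. field. lra.
  - intros y Hy. rewrite Rmax_right in Hy by lra. apply (ex_derive_continuous (V := R_NormedModule)). auto_derive. lra.
Qed.

Lemma CInt_norm_le_inv f A T : 0 <= T -> cont_on_seg f (- T) T ->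
  (forall y, - T <= y <= T -> Cmod (f y) <= A / (1 + Rabs y)) -> Cmod (CInt f (- T) T) <= 2 * A * ln (1 + T).
Proof.
  intros HT Hf HA.
  assert (C1 : cont_on_seg f (- T) 0) by (intros t Ht; apply Hf; apply seg_le in Ht; [|lra]; apply le_seg; lra).
  assert (C2 : cont_on_seg f 0 T) by (intros t Ht; apply Hf; apply seg_le in Ht; [|lra]; apply le_seg; lra).
  rewrite <- (CInt_Chasles f (- T) 0 T) by auto. eapply Rle_trans; [apply Cmod_triangle|].
  assert (I1 := is_RInt_scal (V := R_NormedModule) _ _ _ A _ (RInt_inv_1p T HT)).
  assert (I2 := is_RInt_scal (V := R_NormedModule) _ _ _ A _ (RInt_inv_1m T HT)).
  assert (B1 : Cmod (CInt f 0 T) <= A * ln (1 + T)).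
  { replace (A * ln (1 + T)) with (RInt (fun y => scal A (/ (1 + y))) 0 T) by (apply is_RInt_unique; exact I1).
    apply CInt_norm_le; auto; [eexists; exact I1|]. intros t Ht. specialize (HA t ltac:(lra)).
    rewrite Rabs_right in HA by lra. exact HA. }
  assert (B2 : Cmod (CInt f (- T) 0) <= A * ln (1 + T)).
  { replace (A * ln (1 + T)) with (RInt (fun y => scal A (/ (1 - y))) (- T) 0) by (apply is_RInt_unique; exact I2).
    apply CInt_norm_le; auto; [lra|eexists; exact I2|]. intros t Ht. specialize (HA t ltac:(lra)).
    rewrite Rabs_left1 in HA by lra. exact HA. }
  lra.
Qed.

(** * The shift of the contour and the truncated formula *)

Section Perron.
Variables (gam : nat -> C) (L : C -> C) (K M ML d c s0 N : R).
Hypotheses (Hd : 0 < d <= 1 / 8) (Hc : c = 1 + 2 * d) (Hs0 : s0 = 1 / 2 + 3 * d) (HN : 1 <= N).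
Hypothesis (HK : forall n, (1 <= n)%nat -> Cmod (gam n) <= K * Rpower (INR n) d).
Hypothesis (HM : forall n, rsum (seq 1 n) (fun k => Cmod (gam k) * Rpower (INR k) (- c)) <= M).
Notation T := (sqrt N).
Hypothesis (HLd : holo_on_rect L s0 c (- T) T).
Hypothesis (HLs : forall y, - T <= y <= T -> L (c, y) = dirichlet_series gam (c, y)).
Hypothesis (HLb : forall z, in_rect s0 c (- T) T z -> Cmod (L z) <= ML).
Variables (y1 y2 : R).
Hypotheses (Hy1 : N <= y1) (Hy12 : y1 < y2) (Hy2 : y2 <= 2 * N).

(** The path moves from real part [c] to real part [s0]. On the new side the kernel supplies
    [N^(s0-c)] and the decay [1 / (1 + |y|)], whose integral is a logarithm; on the horizontal sides
    it supplies [1 / T]. *)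
Lemma perron_right_integral :
  Cmod (CInt (fun y => L (c, y) * expint (ln y1) (ln y2) (0, y))%C (- T) T) <=
  32 * ML * Rpower N (s0 - c) * ln (1 + T) + 4 * ML / T.
Proof.
  assert (HT : 1 <= T) by (rewrite <- sqrt_1; apply sqrt_le_1_alt; auto).
  assert (ML0 : 0 <= ML) by (eapply Rle_trans; [apply Cmod_ge_0|apply (HLb (c, 0)); split; simpl; lra]).
  assert (Hw : ln y1 <= ln y2) by (apply ln_le; lra).
  assert (Hw0 : 0 <= ln y1) by (apply ln_nonneg; lra).
  set (E := expint (ln y1) (ln y2)) in *. set (f := fun z => (L z * E (z - RtoC c))%C).
  assert (Hf : holo_on_rect f s0 c (- T) T).
  { intros z Hz. destruct (HLd z Hz) as [l Hl]. destruct (Cdiff_expint (ln y1) (ln y2) (z - RtoC c)%C) as [l' Hl'].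
    eexists. apply (Cdiff_mult L (fun z => E (z - RtoC c)%C)); [exact Hl|].
    apply (Cdiff_comp E (fun z => z - RtoC c)%C); [apply Cdiff_shift|exact Hl']. }
  assert (G := goursat f s0 c (- T) T ltac:(lra) ltac:(lra) Hf).
  assert (Hb := cont_rect_boundary _ _ _ _ _ (holo_cont_rect _ _ _ _ _ Hf)).
  destruct (boundary_sides s0 c (- T) T ltac:(lra) ltac:(lra) f Hb) as [F1 [F2 [F3 F4]]].
  unfold RectInt in G.
  replace (CInt (fun y => L (c, y) * E (0, y))%C (- T) T) with (CInt (fun y => f (c, y)) (- T) T).
  2:{ apply CInt_ext. intros y _. unfold f. do 2 f_equal. unfold Cminus, Cplus, Copp, RtoC; simpl. f_equal; ring. }
  assert (EQ : (CInt (fun y => f (c, y)) (- T) T = CInt (fun y => f (s0, y)) (- T) T +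
      (- Ci) * (CInt (fun x => f (x, T)) s0 c - CInt (fun x => f (x, (- T)%R)) s0 c))%C).
  { assert (Ci2 : (Ci * Ci = - RtoC 1)%C) by (unfold Ci, Cmult, Copp, RtoC; simpl; f_equal; ring).
    set (R0 := CInt (fun y => f (c, y)) (- T) T) in *. set (L0 := CInt (fun y => f (s0, y)) (- T) T) in *.
    set (T0 := CInt (fun x => f (x, T)) s0 c) in *. set (B0 := CInt (fun x => f (x, (- T)%R)) s0 c) in *.
    transitivity (- Ci * (B0 + Ci * R0 - T0 - Ci * L0) + L0 + - Ci * (T0 - B0))%C; [|rewrite G; ring].
    replace (- Ci * (B0 + Ci * R0 - T0 - Ci * L0))%C with (- (Ci * Ci) * R0 + (Ci * Ci) * L0 - Ci * (B0 - T0))%C by ring.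
    rewrite Ci2. ring. }
  rewrite EQ. eapply Rle_trans; [apply Cmod_triangle|]. rewrite Cmod_mult, Cmod_opp, Cmod_Ci, Rmult_1_l.
  assert (Ebound : forall x y, s0 <= x <= c -> (x, y) <> RtoC c -> Cmod (E ((x, y) - RtoC c)%C) <= 2 * Rpower N (x - c) / Cmod ((x, y) - RtoC c)%C).
  { intros x y Hx Hne. assert (Hn : ((x, y) - RtoC c)%C <> RtoC 0) by (apply sub_neq_0; auto).
    assert (Hp : 0 < Cmod ((x, y) - RtoC c)) by (apply Cmod_gt_0; auto).
    eapply Rle_trans; [apply expint_bound; auto; simpl; lra|].
    unfold Rdiv. apply Rmult_le_compat_r; [left; apply Rinv_0_lt_compat; auto|]. apply Rmult_le_compat_l; [lra|].
    unfold Rpower. apply exp_le. simpl. assert (ln N <= ln y1) by (apply ln_le; lra). nra. }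
  apply Rplus_le_compat.
  - replace (32 * ML * Rpower N (s0 - c) * ln (1 + T)) with (2 * (16 * ML * Rpower N (s0 - c)) * ln (1 + T)) by ring.
    apply CInt_norm_le_inv; [lra|auto|]. intros y Hy. unfold f. rewrite Cmod_mult.
    (* Since [c - s0 = 1/2 - d >= 3/8], this yields [1 + |y| <= 8 |z - c|]. *)
    assert (Hz : Rabs y + 3 / 8 <= 2 * Cmod ((s0, y) - RtoC c)).
    { assert (h1 := re_le_Cmod ((s0, y) - RtoC c)%C). assert (h2 := Rabs_Im_le_Cmod ((s0, y) - RtoC c)%C). simpl in h1, h2.
      rewrite Rabs_left in h1 by lra. replace (y + - 0) with y in h2 by ring. lra. }
    assert (Py := Rabs_pos y).
    assert (Hne : (s0, y) <> RtoC c) by (intros h; rewrite h in Hz; replace (RtoC c - RtoC c)%C with (RtoC 0) in Hz by ring; rewrite Cmod_0 in Hz; lra).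
    assert (B := Ebound s0 y ltac:(lra) Hne).
    assert (Pp := Rpower_pos N (s0 - c)).
    apply Rle_trans with (ML * (2 * Rpower N (s0 - c) / Cmod ((s0, y) - RtoC c))).
    + apply Rmult_le_compat; try apply Cmod_ge_0; auto. apply HLb. split; simpl; lra.
    + replace (16 * ML * Rpower N (s0 - c) / (1 + Rabs y)) with (ML * (2 * Rpower N (s0 - c) * (8 / (1 + Rabs y)))) by (field; lra).
      apply Rmult_le_compat_l; auto. unfold Rdiv at 1. apply Rmult_le_compat_l; [lra|].
      apply Rmult_le_reg_r with (Cmod ((s0, y) - RtoC c) * (1 + Rabs y)).
      { apply Rmult_lt_0_compat; lra. }
      replace (/ Cmod ((s0, y) - RtoC c) * (Cmod ((s0, y) - RtoC c) * (1 + Rabs y))) with (1 + Rabs y) by (field; lra).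
      replace (8 / (1 + Rabs y) * (Cmod ((s0, y) - RtoC c) * (1 + Rabs y))) with (8 * Cmod ((s0, y) - RtoC c)) by (field; lra).
      lra.
  - assert (Hor : forall y, Rabs y = T -> cont_on_seg (fun x => f (x, y)) s0 c -> Cmod (CInt (fun x => f (x, y)) s0 c) <= 2 * ML / T).
    { intros y Hy Hcont.
      assert (Q : 0 <= 2 * ML / T) by (apply Rdiv_le_0_compat; lra).
      eapply Rle_trans; [apply (CInt_norm_le_const _ (2 * ML / T)); [lra|auto|]|nra].
      intros x Hx. unfold f. rewrite Cmod_mult.
      assert (Hyr : - T <= y <= T) by (apply Rabs_le_between; lra).
      assert (Hz : T <= Cmod ((x, y) - RtoC c)).
      { assert (h2 := Rabs_Im_le_Cmod ((x, y) - RtoC c)%C). simpl in h2. replace (y + - 0) with y in h2 by ring. lra. }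
      assert (Hne : (x, y) <> RtoC c) by (intros h; rewrite h in Hz; replace (RtoC c - RtoC c)%C with (RtoC 0) in Hz by ring; rewrite Cmod_0 in Hz; lra).
      assert (B := Ebound x y ltac:(lra) Hne).
      assert (Pw : Rpower N (x - c) <= 1) by (rewrite <- (Rpower_O N) by lra; apply Rpower_le_exp; lra).
      assert (Pp := Rpower_pos N (x - c)).
      replace (2 * ML / T) with (ML * (2 * / T)) by (field; lra).
      apply Rmult_le_compat; try apply Cmod_ge_0; [apply HLb; split; simpl; lra|].
      eapply Rle_trans; [exact B|]. unfold Rdiv.
      apply Rmult_le_compat; [lra|left; apply Rinv_0_lt_compat; lra|lra|]. apply Rinv_le_contravar; lra. }
    eapply Rle_trans; [apply Cmod_sub_triangle|].
    assert (B1 := Hor T ltac:(apply Rabs_right; lra) F2).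
    assert (B2 := Hor (- T) ltac:(rewrite Rabs_Ropp; apply Rabs_right; lra) F1).
    replace (4 * ML / T) with (2 * ML / T + 2 * ML / T) by (field; lra). lra.
Qed.

(** The kernel depends on [s - c], so the sum appears with the weight [n^(-c)], which partial
    summation removes later. With [T = sqrt N] the truncation errors [M / T] and [T N^(d-c)] are
    both [N^(-1/2)] up to small powers. *)
Theorem perron X : 2 * N <= INR X ->
  Cmod (lsum (seq 1 X) (fun n => if in_interval y1 y2 n then gam n * ncpow n (- RtoC c) else RtoC 0)%C) <=
  32 * ML * Rpower N (s0 - c) * ln (1 + T) + 4 * ML / T + 16 * M / T
   + 1024 * T * K * Rpower N (d - c) * (3 + 2 * ln (4 * N)).
Proof.
  intros HX.
  assert (HT : 1 <= T) by (rewrite <- sqrt_1; apply sqrt_le_1_alt; auto).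
  destruct Si_limit as [kappa [Hk HSi]].
  set (V := fun n => 2 * Si (T * (ln y2 - ln (INR n))) - 2 * Si (T * (ln y1 - ln (INR n)))).
  set (t := fun n => (gam n * ncpow n (- RtoC c))%C).
  set (g := fun n => Cmod (gam n) * Rpower (INR n) (- c)).
  assert (Ht : forall n, Cmod (t n) = g n) by (intros n; unfold t; rewrite Cmod_dirichlet_summand; reflexivity).
  assert (Hg0 : forall n, 0 <= g n) by (intros n; rewrite <- Ht; apply Cmod_ge_0).
  assert (HK0 : 0 <= K).
  { assert (h := HK 1%nat (Nat.le_refl _)). assert (P := Cmod_ge_0 (gam 1%nat)). assert (Q := Rpower_pos (INR 1) d). nra. }
  assert (HS : Csums (fun n => t n * RtoC (V n))%C (CInt (fun y => L (c, y) * expint (ln y1) (ln y2) (0, y))%C (- T) T)).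
  { assert (Cn : forall n a b, cont_on_seg (fun y => ncpow n (- (0, y))) a b).
    { intros n a b x Hx. apply cont_ext with (fun y => Cexp (RtoC y * (- (Ci * RtoC (ln (INR n)))))%C).
      - intros y. unfold ncpow. f_equal. unfold Ci, Copp, Cmult, RtoC; simpl. f_equal; ring.
      - apply (cont_on_seg_Cexp _ a b); auto. }
    destruct (seg_bounded (fun y => expint (ln y1) (ln y2) (0, y)) (- T) T ltac:(lra)) as [W HW].
    { intros x _. apply Rcont_expint_v. }
    assert (HH := CInt_termwise (fun n y => t n * ncpow n (- (0, y)))%C (fun y => L (c, y)) (fun y => expint (ln y1) (ln y2) (0, y)) g (- T) T W M).
    eapply Csums_ext; [|apply HH]; clear HH.
    - intros n Hn. unfold V. rewrite <- perron_kernel, <- CInt_scal.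
      + apply CInt_ext. intros y _. ring.
      + intros x Hx. apply cont_mult; [apply (Cn n (- T) T); auto|apply Rcont_expint_v].
    - lra.
    - intros n Hn x Hx. apply cont_mult; [apply cont_const|apply (Cn n (- T) T); auto].
    - apply cont_vseg. intros y Hy. apply seg_le in Hy; [|lra]. destruct (HLd (c, y)) as [l Hl]; [split; simpl; lra|]. eapply Cdiff_cont; eauto.
    - intros x _. apply Rcont_expint_v.
    - auto.
    - intros n y Hn Hy. rewrite Cmod_mult, Ht, Cmod_ncpow. simpl. rewrite Ropp_0, Rpower_O by (apply INR_ge_1 in Hn; lra). lra.
    - auto.
    - auto.
    - intros y Hy. rewrite HLs by auto.
      eapply Csums_ext; [|apply dirichlet_sums; exists M; exact HM].
      intros n Hn. cbv beta. unfold t. rewrite <- Cmult_assoc, <- ncpow_plus. do 2 f_equal.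
      unfold Copp, Cplus, RtoC; simpl. f_equal; ring. }
  destruct (nat_floor y1 ltac:(lra)) as [m1 [Hm1 Hm1']]. destruct (nat_floor y2 ltac:(lra)) as [m2 [Hm2 Hm2']].
  destruct (nat_floor (4 * N) ltac:(lra)) as [P [HP1 HP]].
  assert (HgK : forall n, (1 <= n)%nat -> g n <= K * Rpower (INR n) (d - c)).
  { intros n Hn. unfold g, Rminus. rewrite Rpower_plus, <- Rmult_assoc. apply Rmult_le_compat_r; [left; apply Rpower_pos|auto]. }
  set (e1 := fun n => Rabs (Si (T * (ln y1 - ln (INR n))) - step_at kappa (ln y1 - ln (INR n)))).
  set (e2 := fun n => Rabs (Si (T * (ln y2 - ln (INR n))) - step_at kappa (ln y2 - ln (INR n)))).
  set (BB := 4 / T * M + 256 * T * K * Rpower N (d - c) * (3 + 2 * ln (4 * N))).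
  assert (S1 : forall Y, rsum (seq 1 Y) (fun n => g n * e1 n) <= BB).
  { intros Y. apply (kernel_error_sum kappa Hk HSi N y1 m1 HN ltac:(lra) Hm1' g K M d c Y P); auto. }
  assert (S2 : forall Y, rsum (seq 1 Y) (fun n => g n * e2 n) <= BB).
  { intros Y. apply (kernel_error_sum kappa Hk HSi N y2 m2 HN ltac:(lra) Hm2' g K M d c Y P); auto. }
  set (A := lsum (seq 1 X) (fun n => if in_interval y1 y2 n then t n else RtoC 0)).
  set (J := CInt (fun y => L (c, y) * expint (ln y1) (ln y2) (0, y))%C (- T) T) in *.
  assert (HA : Cmod (J - RtoC (4 * kappa) * A) <= 4 * BB).
  { apply (Csums_close _ _ _ _ X HS). intros Y HY.
    replace (RtoC (4 * kappa) * A)%C with (lsum (seq 1 Y) (fun n => t n * RtoC (if in_interval y1 y2 n then (4 * kappa)%R else 0))%C).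
    2:{ unfold A. rewrite (seq_1_app X Y HY), lsum_app. rewrite (lsum_zero (seq (S X) (Y - X))).
        - rewrite Cplus_0_r, <- lsum_scal. apply lsum_ext. intros n _. destruct (in_interval y1 y2 n); ring.
        - intros n Hn. apply in_seq in Hn. destruct (in_interval y1 y2 n) eqn:E; [|ring].
          apply in_interval_spec in E. assert (INR X < INR n) by (apply lt_INR; lia). lra. }
    rewrite <- lsum_minus. eapply Rle_trans; [apply lsum_norm_le|].
    apply Rle_trans with (rsum (seq 1 Y) (fun n => 2 * (g n * e2 n) + 2 * (g n * e1 n))).
    - apply rsum_le. intros n Hn. apply in_seq in Hn.
      rewrite <- step_difference by (lra || lia).
      match goal with |- Cmod ?u <= _ => replace u with (t n * (RtoC (2 * (Si (T * (ln y2 - ln (INR n))) - step_at kappa (ln y2 - ln (INR n)))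
         - 2 * (Si (T * (ln y1 - ln (INR n))) - step_at kappa (ln y1 - ln (INR n))))))%C end.
      2:{ unfold V. replace (t n * RtoC (2 * Si (T * (ln y2 - ln (INR n))) - 2 * Si (T * (ln y1 - ln (INR n)))) - t n * RtoC (2 * step_at kappa (ln y2 - ln (INR n)) - 2 * step_at kappa (ln y1 - ln (INR n))))%C with
           (t n * (RtoC (2 * Si (T * (ln y2 - ln (INR n))) - 2 * Si (T * (ln y1 - ln (INR n)))) - RtoC (2 * step_at kappa (ln y2 - ln (INR n)) - 2 * step_at kappa (ln y1 - ln (INR n)))))%C by ring.
          f_equal. rewrite <- RtoC_minus. f_equal. ring. }
      rewrite Cmod_mult, Ht, Cmod_R.
      assert (Tr : Rabs (2 * (Si (T * (ln y2 - ln (INR n))) - step_at kappa (ln y2 - ln (INR n))) - 2 * (Si (T * (ln y1 - ln (INR n))) - step_at kappa (ln y1 - ln (INR n)))) <= 2 * e2 n + 2 * e1 n).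
      { unfold Rminus at 1. eapply Rle_trans; [apply Rabs_triang|]. rewrite Rabs_Ropp, !Rabs_mult, !(Rabs_right 2) by lra. unfold e1, e2. lra. }
      specialize (Hg0 n). nra.
    - rewrite rsum_plus, !rsum_scal. specialize (S1 Y). specialize (S2 Y). lra. }
  assert (B := perron_right_integral). fold J in B.
  assert (Tr := Cmod_sub_lower (RtoC (4 * kappa) * A) J). rewrite Cmod_sub_comm in Tr.
  rewrite Cmod_mult, Cmod_R, (Rabs_right (4 * kappa)) in Tr by lra.
  assert (PA := Cmod_ge_0 A).
  (* The bound [kappa >= 1/2] permits division by the jump [4 kappa]. *)
  assert (Fin : Cmod A <= 32 * ML * Rpower N (s0 - c) * ln (1 + T) + 4 * ML / T + 4 * BB) by nra.
  unfold BB in Fin. unfold A, t in Fin.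
  eapply Rle_trans; [exact Fin|]. right. field. lra.
Qed.
End Perron.

(** * Sums twisted by a character *)

Lemma Cmod_lt_locally (l : C) eps : 0 < eps -> @locally C_UniformSpace l (fun y => Cmod (y - l) < eps).
Proof.
  intros He. exists (mkposreal (eps / 2) ltac:(lra)). intros y Hy. apply ball_Cmod in Hy. simpl in Hy. lra.
Qed.

Lemma punctured_limit_unique (f g : C -> C) (z l l' : C) : (forall w, w <> z -> f w = g w) ->
  filterlim f (@locally' C_UniformSpace z) (@locally C_UniformSpace l) ->
  filterlim g (@locally' C_UniformSpace z) (@locally C_UniformSpace l') -> l = l'.
Proof.
  intros E Hf Hg. apply NNPP. intros Hne.
  set (D := Cmod (l - l')). assert (HD : 0 < D) by (apply Cmod_gt_0, sub_neq_0; auto).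
  destruct (Hf _ (Cmod_lt_locally l (D / 2) ltac:(lra))) as [e1 H1].
  destruct (Hg _ (Cmod_lt_locally l' (D / 2) ltac:(lra))) as [e2 H2].
  set (r := Rmin e1 e2 / 2).
  assert (Hm : 0 < Rmin e1 e2) by (apply Rmin_pos; apply cond_pos).
  assert (M1 := Rmin_l e1 e2). assert (M2 := Rmin_r e1 e2).
  set (w := (z + RtoC r)%C).
  assert (Hw : forall e : R, Rmin e1 e2 <= e -> @ball C_UniformSpace z e w).
  { intros e He. unfold w. destruct z as [x y]. split; simpl.
    - change (Rabs (x + r - x) < e). replace (x + r - x) with r by ring. unfold r. rewrite Rabs_right; lra.
    - change (Rabs (y + 0 - y) < e). replace (y + 0 - y) with 0 by ring. rewrite Rabs_R0. lra. }
  assert (Hwz : w <> z).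
  { intros h. unfold w in h. assert (h2 : RtoC r = RtoC 0) by (replace (RtoC r) with (z + RtoC r - z)%C by ring; rewrite h; ring).
    apply RtoC_inj in h2. unfold r in h2. lra. }
  assert (A1 := H1 w (Hw e1 M1) Hwz). assert (A2 := H2 w (Hw e2 M2) Hwz). cbv beta in A1, A2.
  rewrite <- E in A2 by auto. rewrite Cmod_sub_comm in A1.
  assert (T := Cmod_triangle (l - f w) (f w - l')).
  replace (l - f w + (f w - l'))%C with (l - l')%C in T by ring. fold D in T. lra.
Qed.

Lemma Cdiff_pow_shift z0 k z : exists l, Cdiff (fun w => (w - z0) ^ k)%C z l.
Proof.
  induction k as [|k [l IH]]; [exists (RtoC 0); exact (Cdiff_const (RtoC 1) z)|].
  eexists. apply (Cdiff_mult (fun w => w - z0)%C (fun w => (w - z0) ^ k)%C); [apply Cdiff_shift|exact IH].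
Qed.

(** Away from 1 the continuation is [G / (s - 1)^k]; at 1 it takes the limit whenever there is one,
    as the clause on removable singularities demands. *)
Lemma continuation_exists k u G : entire G ->
  (forall s, 1 < Re s -> G s = ((s - RtoC 1) ^ k * dirichlet_series u s)%C) ->
  exists Phi, continuation k u Phi /\ forall s, s <> RtoC 1 -> exists l, Cdiff Phi s l.
Proof.
  intros HG Hs. set (Phi0 := fun s => (G s / (s - RtoC 1) ^ k)%C).
  set (lim1 := epsilon (inhabits (RtoC 0)) (fun l => filterlim Phi0 (@locally' C_UniformSpace (RtoC 1)) (@locally C_UniformSpace l))).
  set (Phi := fun s => if excluded_middle_informative (s = RtoC 1) then lim1 else Phi0 s).
  assert (EP : forall s, s <> RtoC 1 -> Phi s = Phi0 s).
  { intros s h. unfold Phi. destruct (excluded_middle_informative _); tauto. }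
  assert (Hnz : forall s, s <> RtoC 1 -> ((s - RtoC 1) ^ k)%C <> RtoC 0) by (intros s h; apply Cpow_nz, sub_neq_0; auto).
  exists Phi. split.
  - constructor.
    + intros s h. assert (s <> RtoC 1) by (intros ->; simpl in h; lra).
      rewrite EP by auto. unfold Phi0. rewrite Hs by auto. field. apply Hnz; auto.
    + exists G. split; auto. intros s h. rewrite EP by auto. unfold Phi0. field. apply Hnz; auto.
    + intros l Hl. unfold Phi at 1. destruct (excluded_middle_informative (RtoC 1 = RtoC 1)) as [_|h]; [|tauto].
      assert (Hl0 : filterlim Phi0 (@locally' C_UniformSpace (RtoC 1)) (@locally C_UniformSpace l)).
      { intros P HP. destruct (Hl P HP) as [e1 H1]. exists e1. intros y Hy Hy1. rewrite <- EP by auto. apply H1; auto. }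
      apply (punctured_limit_unique Phi0 Phi0 (RtoC 1)); auto.
      exact (epsilon_spec (inhabits (RtoC 0))
        (fun l => filterlim Phi0 (@locally' C_UniformSpace (RtoC 1)) (@locally C_UniformSpace l)) (ex_intro _ l Hl0)).
  - intros s h. destruct (Cdiff_of_ex_derive G s (HG s)) as [l1 H1]. destruct (Cdiff_pow_shift (RtoC 1) k s) as [l2 H2].
    eexists. apply (Cdiff_ext_near Phi0 Phi s _ (Cmod (s - RtoC 1))).
    + apply Cmod_gt_0, sub_neq_0; auto.
    + intros w Hw. symmetry. apply EP. intros ->. unfold Cdist in Hw. rewrite Cmod_sub_comm in Hw. lra.
    + apply (Cdiff_mult G (fun s => / (s - RtoC 1) ^ k)%C); [exact H1|].
      apply (Cdiff_inv (fun s => (s - RtoC 1) ^ k)%C); [apply Hnz; auto|exact H2].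
Qed.

Lemma ln_Rpower_bounds A r l : 0 <= ln r <= l -> Rabs (ln (Rpower r A)) <= Rabs A * l.
Proof.
  intros H. unfold Rpower. rewrite ln_exp, Rabs_mult, (Rabs_right (ln r)) by lra.
  apply Rmult_le_compat_l; [apply Rabs_pos|lra].
Qed.

(** * Bounds for the logarithm of a twisted series and for twisted sums *)

Section TwistedSums.
Variables (a b : nat -> C) (m : nat).
Hypothesis HF : dirichlet_series_conditions a b m.
Notation beta := (log_coef b).

(** The growth hypothesis bounds [ln |Phi|] on both sides by a multiple of [1 + ln (q Ym)], so zeros
    are excluded and a logarithm exists. [log_growth] with radius [d] turns this control of the real
    part into a bound for the modulus, compared with the point on the line of real part 2, where the
    series converges absolutely. *)
Lemma twisted_log_bound d : 0 < d <= 1 / 8 -> exists C1, 0 < C1 /\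
  forall q chi Y0 Y1 Ym, (1 <= q)%nat -> dirichlet_character q chi -> Y0 < Y1 -> 1 <= Ym ->
  (forall y, Y0 < y < Y1 -> 1 <= Rabs y <= Ym) ->
  exists L, (forall z, in_box (1 / 2 + d) 3 Y0 Y1 z -> exists l, Cdiff L z l) /\
    (forall z, in_box 1 3 Y0 Y1 z -> L z = dirichlet_series (twist beta chi) z) /\
    (forall x y, 1 / 2 + 2 * d < x <= 2 -> Y0 + d < y < Y1 - d -> Cmod (L (x, y)) <= C1 * (1 + ln (INR q * Ym))).
Proof.
  intros Hd. destruct (ds_twist_growth _ _ _ HF d ltac:(lra)) as [A [B [C0 [D0 [HC0 [HD0 Hgr]]]]]].
  destruct (abs_conv_beta a b m HF 2 ltac:(lra)) as [M2 HM2].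
  assert (M20 : 0 <= M2) by (apply (HM2 O)).
  set (C2 := 1 + Rabs (ln C0) + Rabs (ln D0) + Rabs A + Rabs B).
  assert (PA := Rabs_pos A). assert (PB := Rabs_pos B). assert (PC := Rabs_pos (ln C0)). assert (PD := Rabs_pos (ln D0)).
  assert (HC2 : 1 <= C2) by (unfold C2; lra).
  set (Q := 2 * exp 2 * C2 / d * 2).
  assert (HQ : 0 < Q).
  { unfold Q. assert (pe := exp_pos 2). apply Rmult_lt_0_compat; [|lra]. apply Rdiv_lt_0_compat; [|lra]. nra. }
  exists (M2 + Q). split; [lra|].
  intros q chi Y0 Y1 Ym Hq Hchi HY HYm Hy.
  assert (Hchi1 := char_mod_le_1 q Hq chi Hchi).
  destruct (ds_twist_entire _ _ _ HF q chi Hq Hchi) as [G [HG1 HG2]].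
  destruct (continuation_exists m (twist a chi) G HG1 HG2) as [Phi [Hcont HPhi]].
  set (l := ln (INR q * Ym)).
  assert (Hq1 := INR_ge_1 q Hq).
  assert (Hl : 0 <= l) by (unfold l; apply ln_nonneg; nra).
  set (U := in_box (1 / 2 + d) 3 Y0 Y1).
  (* The box avoids the real axis and with it the possible pole at 1. *)
  assert (Hne1 : forall z, U z -> z <> RtoC 1).
  { intros z [_ Hz] ->. simpl in Hz. specialize (Hy 0 Hz). rewrite Rabs_R0 in Hy. lra. }
  assert (Hbd : forall z, U z -> 0 < Cmod (Phi z) /\ Rabs (ln (Cmod (Phi z))) <= C2 * (1 + l)).
  { intros z [Hz1 Hz2]. destruct (Hy _ Hz2) as [Hi1 Hi2].
    destruct (Hgr q chi Phi z Hq Hchi Hcont ltac:(lra) Hi1) as [B1 B2].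
    set (r := INR q * Rabs (Im z)) in *.
    assert (Hr1 : 1 <= r) by (unfold r; nra).
    assert (Hr2 : r <= INR q * Ym) by (unfold r; nra).
    assert (Hlr : 0 <= ln r <= l) by (split; [apply ln_nonneg; auto|apply ln_le; lra]).
    assert (P1 := Rpower_pos r A). assert (P2 := Rpower_pos r B).
    assert (Hpos : 0 < Cmod (Phi z)) by (assert (0 < C0 * Rpower r A) by (apply Rmult_lt_0_compat; auto); lra).
    split; auto.
    assert (K1 := ln_le _ _ ltac:(apply Rmult_lt_0_compat; [exact HC0|exact P1]) B1).
    assert (K2 := ln_le _ _ Hpos B2).
    rewrite ln_mult in K1, K2 by auto.
    assert (J1 := ln_Rpower_bounds A r l Hlr). assert (J2 := ln_Rpower_bounds B r l Hlr).
    apply Rabs_le_between in J1. apply Rabs_le_between in J2.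
    assert (E1 := Rle_abs (ln D0)). assert (E2 := Rle_abs (- ln C0)). rewrite Rabs_Ropp in E2.
    apply Rabs_le. unfold C2. split; ring_simplify; nra. }
  set (ym := (Y0 + Y1) / 2). set (zb := (2, ym) : C).
  assert (HU : forall z, U z -> exists l, Cdiff Phi z l) by (intros z Hz; apply HPhi; auto).
  assert (Hzb : U zb) by (split; simpl; unfold ym; lra).
  assert (Hnz : forall z, U z -> Phi z <> RtoC 0) by (intros z Hz; apply Cmod_neq_0; apply Hbd; auto).
  assert (HPs : forall z, 1 < Re z -> Phi z = Cexp (dirichlet_series (twist beta chi) z)).
  { intros z Hz. rewrite (continuation_series _ _ _ Hcont) by auto. apply (twist_exp a b m HF q); auto. }
  destruct (box_log (1 / 2 + d) 3 Y0 Y1 Phi zb (dirichlet_series (twist beta chi) zb) HU Hnz Hzb) as [L [HL1 [HL2 HL3]]].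
  { apply HPs. simpl. lra. }
  assert (HLd : forall z, U z -> exists l, Cdiff L z l) by (intros z Hz; eexists; apply HL1; auto).
  assert (HLs : forall z, in_box 1 3 Y0 Y1 z -> L z = dirichlet_series (twist beta chi) z).
  (* Both functions are logarithms of [Phi] with the same derivative, and the choice of branch makes
     them agree at [zb]. *)
  { intros z Hz.
    assert (Z := box_zero_derivative 1 3 Y0 Y1 (fun w => L w - dirichlet_series (twist beta chi) w)%C).
    assert (HZ : forall w, in_box 1 3 Y0 Y1 w -> Cdiff (fun w => L w - dirichlet_series (twist beta chi) w)%C w 0).
    { intros w [Hw1 Hw2]. assert (Hmid : 1 < (1 + Re w) / 2 < Re w) by lra.
      assert (D1 := HL1 w ltac:(split; lra)).
      assert (D2 := Cdiff_dirichlet _ ((1 + Re w) / 2) w (abs_conv_twist chi Hchi1 _ _ (abs_conv_beta a b m HF ((1 + Re w) / 2) ltac:(lra))) ltac:(lra)).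
      assert (D3 := Cdiff_comp Cexp (dirichlet_series (twist beta chi)) w _ _ D2 (Cdiff_Cexp _)).
      destruct (half_plane_nbhd w 1 ltac:(lra)) as [dd [Hdd Hnb]].
      assert (D4 := Cdiff_ext_near _ Phi w _ dd Hdd (fun v Hv => eq_sym (HPs v (Hnb v Hv))) D3).
      assert (E := Cder_eq _ _ _ D4). rewrite E, <- HPs in D1 by lra.
      assert (D5 := Cdiff_minus _ _ _ _ _ D1 D2).
      match type of D5 with Cdiff _ _ ?l => replace (RtoC 0) with l; [exact D5|] end.
      field. apply Hnz. split; lra. }
    specialize (Z HZ z zb Hz ltac:(split; simpl; unfold ym; lra)). cbv beta in Z. rewrite HL3 in Z.
    replace (L z) with (L z - dirichlet_series (twist beta chi) z + dirichlet_series (twist beta chi) z)%C by ring. rewrite Z. ring. }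
  exists L. split; [exact HLd|]. split; [exact HLs|].
  intros x y Hx Hyy.
  assert (G1 := log_growth (1 / 2 + d) 3 Y0 Y1 L d (C2 * (1 + l)) x 2 y ltac:(lra) ltac:(nra) HLd).
  assert (HRe : forall z, U z -> Rabs (Re (L z)) <= C2 * (1 + l)).
  { intros z Hz. destruct (Hbd z Hz) as [_ B2]. rewrite <- (HL2 z Hz), Cmod_Cexp, ln_exp in B2. exact B2. }
  specialize (G1 HRe ltac:(lra) ltac:(lra) ltac:(lra) Hyy).
  rewrite (HLs (2, y)) in G1 by (split; simpl; lra).
  assert (G2 : Cmod (dirichlet_series (twist beta chi) (2, y)) <= M2).
  { apply (Csums_norm_le (fun k => twist beta chi k * ncpow k (- (2, y)))%C).
    - apply dirichlet_sums. apply abs_conv_twist; auto. exists M2. exact HM2.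
    - intros n. eapply Rle_trans; [apply lsum_norm_le|]. eapply Rle_trans; [|apply (HM2 n)].
      apply rsum_le. intros k Hk. rewrite Cmod_dirichlet_summand. apply Rmult_le_compat_r; [left; apply Rpower_pos|].
      apply twist_le; auto. }
  fold l. eapply Rle_trans; [exact G1|].
  assert (pe := exp_pos 2).
  assert (F : 2 * exp 2 * (C2 * (1 + l)) / d * (2 - x) <= Q * (1 + l)).
  { unfold Q. replace (2 * exp 2 * (C2 * (1 + l)) / d * (2 - x)) with ((2 * exp 2 * C2 / d * (1 + l)) * (2 - x)) by (field; lra).
    replace (2 * exp 2 * C2 / d * 2 * (1 + l)) with ((2 * exp 2 * C2 / d * (1 + l)) * 2) by (field; lra).
    apply Rmult_le_compat_l; [|lra]. apply Rmult_le_pos; [|lra]. apply Rdiv_le_0_compat; [nra|lra]. }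
  nra.
Qed.

Lemma dirichlet_series_shift u t z :
  dirichlet_series (fun n => u n * ncpow n (0, t))%C z = dirichlet_series u (z - (0, t))%C.
Proof.
  unfold dirichlet_series, CSeries.
  assert (E : forall n, dirichlet_term (fun n => u n * ncpow n (0, t))%C z n = dirichlet_term u (z - (0, t))%C n).
  { intros n. unfold dirichlet_term. rewrite <- Cmult_assoc, <- ncpow_plus. do 2 f_equal. ring. }
  f_equal; apply Series_ext; intros n; rewrite E; reflexivity.
Qed.

(** Perron's formula for the coefficients multiplied by [n^(it)], that is, for [L] shifted by [t].
    The exponent [3 d] is made of [s0 - c = - 1/2 + d], of the bound for [L] and of the logarithm
    from the kernel, the last two costing [N^d] each. *)
Theorem twisted_sum_bound d : 0 < d <= 1 / 8 -> exists K, 0 < K /\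
  forall N q chi t y1 y2 X, 1 <= N -> (1 <= q)%nat -> INR q <= N -> dirichlet_character q chi ->
  sqrt N + 2 <= Rabs t <= N * N -> N <= y1 -> y1 < y2 -> y2 <= 2 * N -> 2 * N <= INR X ->
  Cmod (lsum (seq 1 X) (fun n => if in_interval y1 y2 n then
     twist beta chi n * ncpow n (0, t) * ncpow n (- RtoC (1 + 2 * d)) else RtoC 0)%C)
   <= K * Rpower N (- (1 / 2) + 3 * d).
Proof.
  intros Hd. destruct (twisted_log_bound d Hd) as [C1 [HC1 HL]].
  destruct (log_coef_bound b d (ds_log_bound_all _ _ _ HF d ltac:(lra))) as [K0 [HK0 HK]].
  destruct (abs_conv_beta a b m HF (1 + 2 * d) ltac:(lra)) as [M HM].
  assert (HM0 : 0 <= M) by (apply (HM O)).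
  set (id := / d). assert (Hid : 8 <= id).
  { unfold id. replace 8 with (/ (1 / 8)) by field. apply Rinv_le_contravar; lra. }
  set (R1 := C1 * (3 + 3 * id)).
  set (KK := 32 * R1 * (2 * id) + 4 * R1 + 16 * M + 1024 * K0 * (7 + 2 * id)).
  assert (HR1 : 0 < R1) by (unfold R1; nra).
  exists (KK + 1). split; [unfold KK; nra|].
  intros N q chi t y1 y2 X HN Hq HqN Hchi Ht Hy1 Hy12 Hy2 HX.
  assert (Hchi1 := char_mod_le_1 q Hq chi Hchi).
  set (T := sqrt N) in *.
  assert (HT : 1 <= T) by (unfold T; rewrite <- sqrt_1; apply sqrt_le_1_alt; auto).
  assert (HTN : T * T = N) by (apply sqrt_sqrt; lra).
  assert (HTN' : T <= N) by nra.
  set (Ym := 3 * (N * N)).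
  (* The heights are those of the shifted rectangle, widened by 1 to leave room for the radius [d].
     From [T + 2 <= |t| <= N^2] they lie between 1 and [3 N^2] in modulus. *)
  destruct (HL q chi (- t - T - 1) (- t + T + 1) Ym Hq Hchi ltac:(lra) ltac:(unfold Ym; nra)) as [L [L1 [L2 L3]]].
  { intros y Hy. unfold Ym. unfold Rabs in *. destruct (Rcase_abs y), (Rcase_abs t); nra. }
  set (gam := fun n => (twist beta chi n * ncpow n (0, t))%C).
  assert (Hgam : forall n, Cmod (gam n) <= Cmod (beta n)).
  { intros n. unfold gam. rewrite Cmod_mult, Cmod_ncpow. simpl Re. 
    replace (Rpower (INR n) 0) with 1 by (unfold Rpower; rewrite Rmult_0_l, exp_0; auto).
    rewrite Rmult_1_r. apply twist_le; auto. }
  set (p := Rpower N d). assert (Hp1 : 1 <= p) by (apply Rpower_ge_1; lra).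
  assert (HlnN : ln N <= p * id) by (apply ln_le_Rpower; lra).
  assert (HlnN0 : 0 <= ln N) by (apply ln_nonneg; lra).
  assert (ln3 : ln 3 <= 2).
  { rewrite <- (ln_exp 2). apply ln_le; [lra|]. assert (h := exp_ge_1_plus 2). lra. }
  assert (ln4 : ln 4 <= 2).
  { replace 4 with (2 * 2) by ring. rewrite ln_mult by lra.
    assert (ln 2 <= 1); [|lra]. rewrite <- (ln_exp 1). apply ln_le; [lra|]. assert (h := exp_ge_1_plus 1). lra. }
  set (ML := R1 * p).
  assert (HML : C1 * (1 + ln (INR q * Ym)) <= ML).
  { assert (Hq1 := INR_ge_1 q Hq).
    assert (ln (INR q * Ym) <= 2 + 3 * ln N).
    { unfold Ym. rewrite ln_mult by nra. rewrite ln_mult by nra. rewrite ln_mult by lra.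
      assert (ln (INR q) <= ln N) by (apply ln_le; lra). lra. }
    unfold ML, R1. rewrite Rmult_assoc. apply Rmult_le_compat_l; [lra|]. nra. }
  assert (PR := perron gam (fun z => L (z - (0, t))%C) K0 M ML d (1 + 2 * d) (1 / 2 + 3 * d) N Hd eq_refl eq_refl HN).
  specialize (PR ltac:(intros n Hn; eapply Rle_trans; [apply Hgam|apply HK; auto])).
  specialize (PR ltac:(intros n; eapply Rle_trans; [apply rsum_le|apply (HM n)]; intros k _; apply Rmult_le_compat_r; [left; apply Rpower_pos|apply Hgam])).
  fold T in PR.
  assert (P1 : holo_on_rect (fun z => L (z - (0, t))%C) (1 / 2 + 3 * d) (1 + 2 * d) (- T) T).
  { intros z [Hz1 Hz2]. destruct (L1 (z - (0, t))%C) as [l Hl].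
    - destruct z as [zx zy]. simpl in *. split; simpl; lra.
    - eexists. apply (Cdiff_comp L (fun z => z - (0, t))%C); [apply Cdiff_shift|exact Hl]. }
  specialize (PR P1).
  assert (P2 : forall y, - T <= y <= T -> L (((1 + 2 * d)%R, y) - (0, t))%C = dirichlet_series gam (1 + 2 * d, y)).
  { intros y Hy. unfold gam. rewrite dirichlet_series_shift. apply L2. split; simpl; lra. }
  specialize (PR P2).
  assert (P3 : forall z, in_rect (1 / 2 + 3 * d) (1 + 2 * d) (- T) T z -> Cmod (L (z - (0, t))%C) <= ML).
  { intros [zx zy] [Hz1 Hz2]. simpl in Hz1, Hz2. eapply Rle_trans; [|exact HML].
    replace ((zx, zy) - (0, t))%C with ((zx - 0, zy - t) : C) by reflexivity. apply L3; lra. }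
  specialize (PR P3 y1 y2 Hy1 Hy12 Hy2 X HX).
  eapply Rle_trans; [exact PR|].
  assert (ET : T = Rpower N (1 / 2)) by (unfold T; rewrite <- Rpower_sqrt by lra; f_equal; field).
  set (w := Rpower N (- (1 / 2))). assert (Hw : 0 < w) by apply Rpower_pos.
  assert (EiT : / T = w) by (unfold w; rewrite Rpower_Ropp, <- ET; auto).
  assert (EF : Rpower N (- (1 / 2) + 3 * d) = w * (p * p * p)).
  { unfold w, p. rewrite <- !Rpower_plus. f_equal. ring. }
  assert (E1 : Rpower N (1 / 2 + 3 * d - (1 + 2 * d)) = w * p).
  { unfold w, p. rewrite <- !Rpower_plus. f_equal. field. }
  assert (E2 : T * Rpower N (d - (1 + 2 * d)) * p = w).
  { unfold w, p. rewrite ET, <- !Rpower_plus. f_equal. field. }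
  assert (lnT : ln (1 + T) <= 2 * id * p).
  { apply Rle_trans with (ln (4 * N)); [apply ln_le; nra|]. rewrite ln_mult by lra. nra. }
  assert (ln4N : 3 + 2 * ln (4 * N) <= (7 + 2 * id) * p).
  { rewrite ln_mult by lra. nra. }
  rewrite EF, E1. unfold Rdiv. rewrite EiT.
  assert (p3 : p <= p * p * p) by nra. assert (p31 : 1 <= p * p * p) by nra.
  assert (T1 : 32 * ML * (w * p) * ln (1 + T) <= 32 * R1 * (2 * id) * (w * (p * p * p))).
  { unfold ML. apply Rle_trans with (32 * (R1 * p) * (w * p) * (2 * id * p)); [|right; ring].
    apply Rmult_le_compat_l; [|exact lnT]. apply Rmult_le_pos; [|nra]. nra. }
  assert (T2 : 4 * ML * w <= 4 * R1 * (w * (p * p * p))).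
  { unfold ML. replace (4 * (R1 * p) * w) with (4 * R1 * (w * p)) by ring.
    apply Rmult_le_compat_l; [lra|]. apply Rmult_le_compat_l; lra. }
  assert (T3 : 16 * M * w <= 16 * M * (w * (p * p * p))).
  { apply Rmult_le_compat_l; [lra|]. nra. }
  assert (T4 : 1024 * T * K0 * Rpower N (d - (1 + 2 * d)) * (3 + 2 * ln (4 * N)) <= 1024 * K0 * (7 + 2 * id) * (w * (p * p * p))).
  { apply Rle_trans with (1024 * T * K0 * Rpower N (d - (1 + 2 * d)) * ((7 + 2 * id) * p)).
    - apply Rmult_le_compat_l; auto. apply Rmult_le_pos; [|left; apply Rpower_pos]. nra.
    - replace (1024 * T * K0 * Rpower N (d - (1 + 2 * d)) * ((7 + 2 * id) * p)) with
        (1024 * K0 * (7 + 2 * id) * (T * Rpower N (d - (1 + 2 * d)) * p)) by ring. rewrite E2.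
      apply Rmult_le_compat_l; [|nra]. apply Rmult_le_pos; lra. }
  unfold KK. assert (0 < w * (p * p * p)) by nra. lra.
Qed.
End TwistedSums.

(** * Diophantine approximation and partial summation *)

Lemma pigeonhole (n : nat) (g : nat -> nat) : (forall i, (i <= n)%nat -> (g i < n)%nat) ->
  exists i j, (i < j)%nat /\ (j <= n)%nat /\ g i = g j.
Proof.
  intros Hg. apply NNPP. intros Hno.
  assert (ND : NoDup (map g (seq 0 (S n)))).
  { apply NoDup_map_NoDup_ForallPairs; [|apply seq_NoDup].
    intros x y Hx Hy E. apply in_seq in Hx. apply in_seq in Hy.
    destruct (Nat.lt_trichotomy x y) as [h|[h|h]]; auto; exfalso; apply Hno.
    - exists x, y. split; [lia|split; [lia|auto]].
    - exists y, x. split; [lia|split; [lia|auto]]. }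
  assert (IN : incl (map g (seq 0 (S n))) (seq 0 n)).
  { intros x Hx. apply in_map_iff in Hx. destruct Hx as [i [<- Hi]]. apply in_seq in Hi. apply in_seq.
    specialize (Hg i ltac:(lia)). lia. }
  assert (L := NoDup_incl_length ND IN). rewrite length_map, !length_seq in L. lia.
Qed.

(** Pigeonhole on the fractional parts of [i al] for [0 <= i <= n], where [n] is the integer part of
    [Q]. The constant is 2 because [Q] is real and [1 / n <= 2 / Q]. *)
Lemma dirichlet_approx (al Q : R) : 1 <= Q -> exists (a : Z) (q : nat),
  (1 <= q)%nat /\ INR q <= Q /\ Rabs (al - IZR a / INR q) <= 2 / (INR q * Q).
Proof.
  intros HQ. destruct (nat_floor Q HQ) as [n [Hn HnQ]]. assert (Hn1 := INR_ge_1 n Hn).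
  set (fr := fun i => frac_part (INR i * al)).
  assert (Hfr : forall i, 0 <= fr i < 1).
  { intros i. destruct (base_fp (INR i * al)) as [h1 h2]. unfold fr. lra. }
  set (g := fun i => Z.to_nat (Int_part (INR n * fr i))).
  assert (Hg : forall i, IZR (Int_part (INR n * fr i)) <= INR n * fr i < IZR (Int_part (INR n * fr i)) + 1).
  { intros i. destruct (base_Int_part (INR n * fr i)) as [h1 h2]. lra. }
  assert (Hg0 : forall i, (0 <= Int_part (INR n * fr i))%Z).
  { intros i. assert (-1 < Int_part (INR n * fr i))%Z; [|lia]. apply lt_IZR. specialize (Hg i). specialize (Hfr i). nra. }
  destruct (pigeonhole n g) as [i [j [Hij [Hjn E]]]].
  { intros i _. unfold g. apply INR_lt. rewrite INR_IZR_INZ, Z2Nat.id by auto. specialize (Hg i). specialize (Hfr i). nra. }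
  assert (E' : Int_part (INR n * fr i) = Int_part (INR n * fr j)) by (unfold g in E; specialize (Hg0 i) as q1; specialize (Hg0 j) as q2; lia).
  assert (B : Rabs (fr j - fr i) <= / INR n).
  { assert (G1 := Hg i). assert (G2 := Hg j). rewrite E' in G1.
    apply Rmult_le_reg_l with (INR n); [lra|]. rewrite Rinv_r by lra.
    rewrite <- (Rabs_right (INR n)) at 1 by lra. rewrite <- Rabs_mult. apply Rabs_le. lra. }
  exists (Int_part (INR j * al) - Int_part (INR i * al))%Z, (j - i)%nat.
  assert (Hq : 1 <= INR (j - i)) by (apply INR_ge_1; lia).
  split; [lia|]. split.
  - apply Rle_trans with (INR n); [apply le_INR; lia|lra].
  - assert (Eq : al - IZR (Int_part (INR j * al) - Int_part (INR i * al)) / INR (j - i) = (fr j - fr i) / INR (j - i)).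
    { unfold fr, frac_part. rewrite minus_IZR. rewrite minus_INR in * by lia. field. lra. }
    rewrite Eq. unfold Rdiv. rewrite Rabs_mult, (Rabs_right (/ INR (j - i))) by (apply Rle_ge; left; apply Rinv_0_lt_compat; lra).
    rewrite Rinv_mult, <- Rmult_assoc, (Rmult_comm 2), (Rmult_comm (Rabs _)), Rmult_assoc.
    apply Rmult_le_compat_l; [left; apply Rinv_0_lt_compat; lra|]. eapply Rle_trans; [exact B|].
    apply Rmult_le_reg_l with (INR n * Q); [nra|].
    replace (INR n * Q * / INR n) with Q by (field; lra). replace (INR n * Q * (2 * / Q)) with (2 * INR n) by (field; lra). lra.
Qed.

(** * Summation by parts *)

Lemma lsum_one {A} (x : A) (h : A -> C) : lsum [x] h = h x.
Proof. unfold lsum; simpl. ring. Qed.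

Lemma abel_identity (u w : nat -> C) s m :
  lsum (seq s (S m)) (fun n => u n * w n)%C =
  (lsum (seq s (S m)) u * w (s + m)%nat - lsum (seq 0 m) (fun k => lsum (seq s (S k)) u * (w (s + S k)%nat - w (s + k)%nat)))%C.
Proof.
  induction m as [|m IH].
  - unfold lsum; simpl. rewrite Nat.add_0_r. ring.
  - rewrite (seq_S (S m) s), !lsum_app, IH, (seq_S m 0), lsum_app, !lsum_one. change (0 + m)%nat with m. ring.
Qed.

(** Last weight plus total variation of the weights. All partial sums of [u] start at [s], which
    fits a piece with a fixed left end. *)
Lemma abel_bound (u w : nat -> C) s m B W TV :
  (forall k, (k <= m)%nat -> Cmod (lsum (seq s k) u) <= B) ->
  ((1 <= m)%nat -> Cmod (w (s + m - 1)%nat) <= W) -> 0 <= B -> 0 <= W -> 0 <= TV ->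
  rsum (seq 0 (m - 1)) (fun k => Cmod (w (s + S k)%nat - w (s + k)%nat)%C) <= TV ->
  Cmod (lsum (seq s m) (fun n => u n * w n)%C) <= B * (W + TV).
Proof.
  intros HB HW B0 W0 TV0 HTV. destruct m as [|m].
  - unfold lsum; simpl. rewrite Cmod_0. apply Rmult_le_pos; lra.
  - rewrite abel_identity. eapply Rle_trans; [apply Cmod_sub_triangle|]. rewrite Rmult_plus_distr_l.
    apply Rplus_le_compat.
    + rewrite Cmod_mult. apply Rmult_le_compat; try apply Cmod_ge_0; auto.
      replace (s + m)%nat with (s + S m - 1)%nat by lia. apply HW. lia.
    + eapply Rle_trans; [apply lsum_norm_le|].
      apply Rle_trans with (rsum (seq 0 m) (fun k => B * Cmod (w (s + S k)%nat - w (s + k)%nat)%C)).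
      * apply rsum_le. intros k Hk. apply in_seq in Hk. rewrite Cmod_mult. apply Rmult_le_compat_r; [apply Cmod_ge_0|].
        apply HB. lia.
      * rewrite rsum_scal. apply Rmult_le_compat_l; auto. replace (S m - 1)%nat with m in HTV by lia. auto.
Qed.

Lemma rsum_telescope (g : nat -> R) s m : rsum (seq 0 m) (fun k => g (s + S k)%nat - g (s + k)%nat) = g (s + m)%nat - g s.
Proof.
  induction m as [|m IH]; [unfold rsum; simpl; rewrite Nat.add_0_r; ring|].
  rewrite seq_S, rsum_app, IH. unfold rsum; simpl. replace (s + S m)%nat with (S (s + m)) by lia. ring.
Qed.

Lemma e_lipschitz x y : Cmod (e x - e y) <= 4 * PI * Rabs (x - y).
Proof.
  assert (P := PI_RGT_0).
  assert (E : forall z, e z = (cos (2 * PI * z), sin (2 * PI * z))).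
  { intros z. unfold e, Cexp; simpl. replace (2 * PI * z * 0 - 0 * 1) with 0 by ring. replace (2 * PI * z * 1 + 0 * 0) with (2 * PI * z) by ring.
    rewrite exp_0. f_equal; ring. }
  rewrite !E. eapply Rle_trans; [apply Cmod_le_Re_Im|]. simpl.
  assert (h1 := cos_lipschitz (2 * PI * x) (2 * PI * y)). assert (h2 := sin_lipschitz (2 * PI * x) (2 * PI * y)).
  replace (2 * PI * x - 2 * PI * y) with ((2 * PI) * (x - y)) in h1, h2 by ring.
  rewrite Rabs_mult, (Rabs_right (2 * PI)) in h1, h2 by lra. unfold Rminus in *. lra.
Qed.

Lemma e_IZR (k : Z) : e (IZR k) = RtoC 1.
Proof.
  assert (K : forall n : nat, e (INR n) = RtoC 1).
  { intros n. rewrite <- (Rmult_1_r (INR n)), e_scal, e_1. clear. induction n; simpl; [auto|]. rewrite IHn. ring. }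
  destruct (Z.le_ge_cases 0 k) as [h|h].
  - rewrite <- (Z2Nat.id k), <- INR_IZR_INZ by auto. apply K.
  - assert (E : (e (IZR k) * e (INR (Z.to_nat (- k))) = RtoC 1)%C).
    { rewrite <- e_plus, INR_IZR_INZ, Z2Nat.id, opp_IZR by lia. replace (IZR k + - IZR k) with 0 by ring. apply e_0. }
    rewrite K, Cmult_1_r in E. auto.
Qed.

(** * Counting proper prime powers and restricting sums to intervals *)

Definition proper_prime_power (n : nat) : Prop := exists p k, is_prime p /\ (2 <= k)%nat /\ n = (p ^ k)%nat.

Definition proper_prime_power_b (n : nat) : bool :=
  if excluded_middle_informative (proper_prime_power n) then true else false.

(** A proper power [p^k] up to [X] has [p <= sqrt X] and [k <= log2 X]. *)
Lemma proper_prime_power_count X :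
  (length (filter proper_prime_power_b (seq 1 X)) <= Nat.sqrt X * Nat.log2 X)%nat.
Proof.
  set (l' := flat_map (fun p => map (fun k => (p ^ k)%nat) (seq 1 (Nat.log2 X))) (seq 1 (Nat.sqrt X))).
  apply Nat.le_trans with (length l').
  - apply NoDup_incl_length; [apply NoDup_filter, seq_NoDup|].
    intros n Hn. apply filter_In in Hn. destruct Hn as [Hn Hb]. apply in_seq in Hn.
    unfold proper_prime_power_b in Hb. destruct (excluded_middle_informative _) as [[p [k [Hp [Hk E]]]]|]; [|discriminate].
    assert (Hp2 := prime_ge_2_nat p Hp).
    apply in_flat_map. exists p. split.
    + apply in_seq. split; [lia|]. apply Nat.lt_succ_r. apply Nat.sqrt_le_square.
      assert (p ^ 2 <= p ^ k)%nat by (apply Nat.pow_le_mono_r; lia). simpl in H. lia.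
    + apply in_map_iff. exists k. split; auto. apply in_seq. split; [lia|]. apply Nat.lt_succ_r.
      apply Nat.log2_le_pow2; [lia|]. assert (2 ^ k <= p ^ k)%nat by (apply Nat.pow_le_mono_l; lia). lia.
  - unfold l'. assert (G : forall l, length (flat_map (fun p => map (fun k => (p ^ k)%nat) (seq 1 (Nat.log2 X))) l) = (length l * Nat.log2 X)%nat).
    { induction l as [|p l IH]; [reflexivity|]. simpl. rewrite length_app, length_map, length_seq, IH. auto. }
    rewrite G, length_seq. auto.
Qed.

Lemma sqrt_nat_le X : INR (Nat.sqrt X) <= sqrt (INR X).
Proof.
  apply Rsqr_incr_0_var; [|apply sqrt_pos]. rewrite Rsqr_sqrt by apply pos_INR.
  unfold Rsqr. rewrite <- mult_INR. apply le_INR. apply (Nat.sqrt_spec X). lia.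
Qed.

Lemma log2_nat_le X : (1 <= X)%nat -> INR (Nat.log2 X) <= 2 * ln (INR X).
Proof.
  intros HX. assert (H := proj1 (Nat.log2_spec X ltac:(lia))). apply le_INR in H.
  rewrite pow_INR in H. simpl INR in H. assert (L2 := ln_lt_2).
  assert (P : 0 < (1 + 1) ^ Nat.log2 X) by (apply pow_lt; lra).
  apply ln_le in H; auto. rewrite <- Rpower_pow in H by lra. unfold Rpower in H. rewrite ln_exp in H.
  replace (1 + 1) with 2 in H by ring. assert (q := pos_INR (Nat.log2 X)). nra.
Qed.

Lemma lsum_interval (F : nat -> C) n0 k X y y2 : INR n0 <= y < INR n0 + 1 -> INR (n0 + k) <= y2 < INR (n0 + k) + 1 ->
  (n0 + k <= X)%nat ->
  lsum (seq 1 X) (fun n => if in_interval y y2 n then F n else RtoC 0) = lsum (seq (S n0) k) F.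
Proof.
  intros H0 H1 HX.
  rewrite (seq_1_app n0 X) by lia. rewrite lsum_app.
  replace (X - n0)%nat with (k + (X - n0 - k))%nat by lia. rewrite seq_app, lsum_app.
  rewrite (lsum_zero (seq 1 n0)).
  2:{ intros n Hn. apply in_seq in Hn. destruct (in_interval y y2 n) eqn:E; auto. apply in_interval_spec in E.
      assert (INR n <= INR n0) by (apply le_INR; lia). lra. }
  rewrite (lsum_zero (seq (S n0 + k) (X - n0 - k))).
  2:{ intros n Hn. apply in_seq in Hn. destruct (in_interval y y2 n) eqn:E; auto. apply in_interval_spec in E.
      assert (INR (n0 + k) + 1 <= INR n) by (rewrite <- S_INR; apply le_INR; lia). lra. }
  rewrite Cplus_0_l, Cplus_0_r. apply lsum_ext. intros n Hn. apply in_seq in Hn.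
  destruct (in_interval y y2 n) eqn:E; auto. exfalso.
  assert (in_interval y y2 n = true); [|congruence]. apply in_interval_spec.
  assert (INR n0 + 1 <= INR n) by (rewrite <- S_INR; apply le_INR; lia).
  assert (INR n <= INR (n0 + k)) by (apply le_INR; lia). lra.
Qed.

(** * The phase function *)

(** At an interior point of [[1, oo)] the derivative within the half-line is the ordinary one;
    increments are cut to length below [x - 1] to stay in the domain. *)
Lemma D_in_is_derive f df x : 1 < x -> D_in f df ge1 x -> is_derive f x (df x).
Proof.
  intros Hx H. apply is_derive_Reals. intros eps He. destruct (H eps He) as [al [Hal Hlim]].
  assert (Hm : 0 < Rmin al (x - 1)) by (apply Rmin_pos; lra).
  exists (mkposreal _ Hm). intros h Hh0 Hh. simpl in Hh.
  assert (M1 := Rmin_l al (x - 1)). assert (M2 := Rmin_r al (x - 1)).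
  assert (Hh2 : Rabs h < x - 1) by lra. apply Rabs_def2 in Hh2.
  specialize (Hlim (x + h)). simpl in Hlim. unfold R_dist, D_x, ge1 in Hlim.
  replace (x + h - x) with h in Hlim by ring. apply Hlim. split; [|lra]. split; lra.
Qed.

Lemma lipschitz_of_derive (h dh : R -> R) u v B : (forall x, u <= x <= v -> is_derive h x (dh x)) ->
  (forall x, u <= x <= v -> Rabs (dh x) <= B) ->
  forall x y, u <= x <= v -> u <= y <= v -> Rabs (h x - h y) <= B * Rabs (x - y).
Proof.
  intros Hd HB x y Hx Hy.
  assert (sub : forall z, Rmin y x <= z <= Rmax y x -> u <= z <= v).
  { intros z. unfold Rmin, Rmax. destruct (Rle_dec y x); lra. }
  destruct (MVT_gen h y x dh) as [c [Hc E]].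
  - intros z Hz. apply Hd, sub. lra.
  - intros z Hz. apply continuity_pt_filterlim. apply (ex_derive_continuous (V := R_NormedModule)). eexists. apply Hd, sub, Hz.
  - rewrite E, Rabs_mult. apply Rmult_le_compat_r; [apply Rabs_pos|]. apply HB, sub, Hc.
Qed.

Section Phase.
Variables (f : R -> R) (df : nat -> R -> R).
Hypothesis Hf : phase_conditions f df.

Lemma df_derive k x : (k < 4)%nat -> 1 < x -> is_derive (df k) x (df (S k) x).
Proof. intros Hk Hx. apply D_in_is_derive; auto. apply (df_S _ _ (phase_C4 _ _ Hf)); auto. lra. Qed.

(** Monotonicity and the doubling condition make [f x] comparable with [f N] on [[N, 2N]], so bounds
    for derivatives at [x] become bounds in terms of [N]. *)
Lemma phase_bounds : exists C0, 1 <= C0 /\ forall N x, 1 <= N -> N <= x <= 2 * N ->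
  f N / (C0 * (N * N)) <= Rabs (df 2 x) <= C0 * f N / (N * N) /\ Rabs (df 3 x) <= C0 * f N / (N * N * N).
Proof.
  destruct (phase_double _ _ Hf) as [_ [c0 H0]].
  destruct (phase_derivatives _ _ Hf 2%nat ltac:(lia)) as [[c2 H2] [c2' H2']].
  destruct (phase_derivatives _ _ Hf 3%nat ltac:(lia)) as [[c3 H3] _].
  assert (Pos := phase_pos _ _ Hf).
  set (k0 := Rabs c0 + 1). set (k2 := Rabs c2 + 1). set (k2' := Rabs c2' + 1). set (k3 := Rabs c3 + 1).
  assert (A0 := Rle_abs c0). assert (A2 := Rle_abs c2). assert (A2' := Rle_abs c2'). assert (A3 := Rle_abs c3).
  assert (B0 := Rabs_pos c0). assert (B2 := Rabs_pos c2). assert (B2' := Rabs_pos c2'). assert (B3 := Rabs_pos c3).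
  assert (K0 : 1 <= k0) by (unfold k0; lra). assert (K2 : 1 <= k2) by (unfold k2; lra).
  assert (K2' : 1 <= k2') by (unfold k2'; lra). assert (K3 : 1 <= k3) by (unfold k3; lra).
  exists (k0 * k2 + 4 * k2' + k0 * k3). split; [nra|].
  intros N x HN Hx. assert (PN := Pos N HN). assert (Px := Pos x ltac:(lra)).
  assert (F1 : f N <= f x) by (apply (phase_incr _ _ Hf); lra).
  assert (F2 : f x <= k0 * f N).
  { apply Rle_trans with (f (2 * N)); [apply (phase_incr _ _ Hf); lra|].
    specialize (H0 N HN). rewrite !Rabs_right in H0 by (apply Rle_ge; left; apply Pos; lra).
    apply Rle_trans with (c0 * f N); auto. apply Rmult_le_compat_r; [lra|unfold k0; lra]. }
  specialize (H2 x ltac:(lra)). specialize (H2' x ltac:(lra)). specialize (H3 x ltac:(lra)).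
  assert (Hx2 : 0 < x ^ 2) by (simpl; nra). assert (Hx3 : 0 < x ^ 3) by (apply pow_lt; lra).
  assert (D2 : 0 < f x / x ^ 2) by (apply Rdiv_lt_0_compat; auto). assert (D3 : 0 < f x / x ^ 3) by (apply Rdiv_lt_0_compat; auto).
  rewrite (Rabs_right (f x / x ^ 2)) in H2, H2' by lra. rewrite (Rabs_right (f x / x ^ 3)) in H3 by lra.
  assert (NN : 0 < N * N) by nra. assert (NNN : 0 < N * N * N) by nra.
  assert (U2 : f x / x ^ 2 <= k0 * f N / (N * N)).
  { unfold Rdiv. apply Rmult_le_compat; [lra|left; apply Rinv_0_lt_compat; auto|auto|]. apply Rinv_le_contravar; auto. simpl. nra. }
  assert (N2x : N * N <= x * x) by nra.
  assert (U3 : f x / x ^ 3 <= k0 * f N / (N * N * N)).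
  { unfold Rdiv. apply Rmult_le_compat; [lra|left; apply Rinv_0_lt_compat; auto|auto|]. apply Rinv_le_contravar; auto.
    replace (x ^ 3) with (x * x * x) by ring. apply Rmult_le_compat; lra. }
  assert (L2 : f N / (4 * (N * N)) <= f x / x ^ 2).
  { unfold Rdiv. apply Rmult_le_compat; [lra|left; apply Rinv_0_lt_compat; lra|auto|]. apply Rinv_le_contravar; auto. simpl. nra. }
  assert (Q2 : 0 < f N / (N * N)) by (apply Rdiv_lt_0_compat; auto). assert (Q3 : 0 < f N / (N * N * N)) by (apply Rdiv_lt_0_compat; auto).
  set (CC := k0 * k2 + 4 * k2' + k0 * k3).
  assert (HCC1 : k0 * k2 <= CC) by (unfold CC; nra). assert (HCC2 : 4 * k2' <= CC) by (unfold CC; nra). assert (HCC3 : k0 * k3 <= CC) by (unfold CC; nra).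
  split; [split|].
  - assert (L3 : f x / x ^ 2 <= k2' * Rabs (df 2 x)).
    { eapply Rle_trans; [exact H2'|]. apply Rmult_le_compat_r; [apply Rabs_pos|unfold k2'; lra]. }
    apply Rle_trans with (f N / (4 * (N * N)) * / k2').
    + replace (f N / (CC * (N * N))) with (f N / (N * N) * / CC) by (field; split; lra).
      replace (f N / (4 * (N * N)) * / k2') with (f N / (N * N) * / (4 * k2')) by (field; split; lra).
      apply Rmult_le_compat_l; [lra|]. apply Rinv_le_contravar; lra.
    + apply Rmult_le_reg_r with k2'; [lra|]. rewrite Rmult_assoc, Rinv_l by lra. lra.
  - eapply Rle_trans; [exact H2|]. apply Rle_trans with (k2 * (k0 * f N / (N * N))).
    + apply Rmult_le_compat; [assert (h := Rabs_pos (df 2 x))| | |]; try lra.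
      * apply Rnot_lt_le. intros hneg. assert (c2 * (f x / x ^ 2) < 0) by nra. lra.
      * unfold k2; lra.
    + unfold Rdiv in *. replace (k2 * (k0 * f N * / (N * N))) with ((k0 * k2) * (f N * / (N * N))) by ring.
      replace (CC * f N * / (N * N)) with (CC * (f N * / (N * N))) by ring. apply Rmult_le_compat_r; lra.
  - eapply Rle_trans; [exact H3|]. apply Rle_trans with (k3 * (k0 * f N / (N * N * N))).
    + apply Rmult_le_compat; [assert (h := Rabs_pos (df 3 x))| | |]; try lra.
      * apply Rnot_lt_le. intros hneg. assert (c3 * (f x / x ^ 3) < 0) by nra. lra.
      * unfold k3; lra.
    + unfold Rdiv in *. replace (k3 * (k0 * f N * / (N * N * N))) with ((k0 * k3) * (f N * / (N * N * N))) by ring.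
      replace (CC * f N * / (N * N * N)) with (CC * (f N * / (N * N * N))) by ring. apply Rmult_le_compat_r; lra.
Qed.

(* [phi x = f x - r x - tau ln x], with tau chosen so that [phi'] vanishes at [y]. *)
Lemma phase_lipschitz C0 N V y y2 r tau q2 len :
  1 <= C0 -> 1 < N -> 0 < V -> N <= y -> y <= y2 -> y2 <= 2 * N -> y2 - y <= len -> 0 <= q2 ->
  (forall x, N <= x <= 2 * N -> Rabs (df 3 x) <= C0 * V / (N * N * N)) ->
  tau = y * (df 1 y - r) -> Rabs tau <= 5 * C0 * V -> Rabs (df 1 y + y * df 2 y - r) <= q2 ->
  forall x x', y <= x <= y2 -> y <= x' <= y2 ->
  Rabs ((df 0 x - r * x - tau * ln x) - (df 0 x' - r * x' - tau * ln x')) <=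
   (len * (q2 / N + len * (11 * C0 * V / (N * N * N)))) * Rabs (x - x').
Proof.
  intros HC HN HV Hy Hyy Hy2 Hlen Hq2 H3 Htau Htb Hg.
  assert (HNNN : 0 < N * N * N) by (apply Rmult_lt_0_compat; nra).
  (* [11 = 1 + 10]: the third derivative of [f] contributes 1, and [2 tau / x^3] with
     [|tau| <= 5 C0 V] contributes 10. *)
  set (B3 := 11 * C0 * V / (N * N * N)).
  assert (HB3 : 0 < B3) by (unfold B3; apply Rdiv_lt_0_compat; nra).
  assert (D2 : forall x, y <= x <= y2 -> Rabs (df 2 x + tau / (x * x)) <= q2 / N + len * B3).
  { intros x Hx.
    assert (L := lipschitz_of_derive (fun x => df 2 x + tau / (x * x)) (fun x => df 3 x - 2 * tau / (x * x * x)) y y2 B3).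
    assert (L' := fun h1 h2 => L h1 h2 x y Hx ltac:(lra)). clear L.
    (* With this [tau] the second derivative of the phase at [y] becomes the quantity controlled by
       the rational approximation, divided by [y]. *)
    assert (E : df 2 y + tau / (y * y) = (df 1 y + y * df 2 y - r) / y) by (rewrite Htau; field; lra).
    assert (Hy0 : Rabs (df 2 y + tau / (y * y)) <= q2 / N).
    { rewrite E. unfold Rdiv. rewrite Rabs_mult, (Rabs_right (/ y)) by (apply Rle_ge; left; apply Rinv_0_lt_compat; lra).
      apply Rmult_le_compat; [apply Rabs_pos|left; apply Rinv_0_lt_compat; lra|auto|apply Rinv_le_contravar; lra]. }
    assert (Hstep : Rabs (df 2 x + tau / (x * x) - (df 2 y + tau / (y * y))) <= B3 * Rabs (x - y)).
    { apply L'.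
      - intros z Hz. apply (is_derive_plus (V := R_NormedModule) (df 2) (fun x => tau / (x * x)) z (df 3 z) (- (2 * tau / (z * z * z)))).
        + apply df_derive; [lia|lra].
        + auto_derive; [nra|]. field. lra.
      - intros z Hz. unfold Rminus. eapply Rle_trans; [apply Rabs_triang|]. rewrite Rabs_Ropp.
        assert (Zp : 0 < z * z * z) by (apply Rmult_lt_0_compat; nra).
        assert (Nz : N * N * N <= z * z * z) by (apply Rmult_le_compat; nra).
        assert (T2 : Rabs (2 * tau / (z * z * z)) <= 10 * C0 * V / (N * N * N)).
        { unfold Rdiv. rewrite !Rabs_mult, (Rabs_right 2), (Rabs_right (/ (z * z * z))) by (try lra; apply Rle_ge; left; apply Rinv_0_lt_compat; auto).
          apply Rmult_le_compat; [assert (h := Rabs_pos tau); lra|left; apply Rinv_0_lt_compat; auto|lra|apply Rinv_le_contravar; auto]. }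
        specialize (H3 z ltac:(lra)). unfold B3.
        replace (11 * C0 * V / (N * N * N)) with (C0 * V / (N * N * N) + 10 * C0 * V / (N * N * N)) by (field; lra). lra. }
    rewrite (Rabs_right (x - y)) in Hstep by lra.
    assert (Tr := Rabs_triang (df 2 x + tau / (x * x) - (df 2 y + tau / (y * y))) (df 2 y + tau / (y * y))).
    replace (df 2 x + tau / (x * x) - (df 2 y + tau / (y * y)) + (df 2 y + tau / (y * y))) with (df 2 x + tau / (x * x)) in Tr by ring.
    assert (B3 * (x - y) <= len * B3) by (rewrite Rmult_comm; apply Rmult_le_compat_r; lra). lra. }
  assert (D1 : forall x, y <= x <= y2 -> Rabs (df 1 x - r - tau / x) <= len * (q2 / N + len * B3)).
  { intros x Hx.
    assert (L := lipschitz_of_derive (fun x => df 1 x - r - tau / x) (fun x => df 2 x + tau / (x * x)) y y2 (q2 / N + len * B3)).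
    assert (L' := fun h1 => L h1 D2 x y Hx ltac:(lra)). clear L.
    assert (E : df 1 y - r - tau / y = 0) by (rewrite Htau; field; lra).
    cbv beta in L'. rewrite E, Rminus_0_r in L'.
    eapply Rle_trans; [apply L'|].
    - intros z Hz.
      apply is_derive_ext with (fun x => plus (df 1 x) (- r - tau / x)); [intros w; unfold plus; simpl; ring|].
      apply (is_derive_plus (V := R_NormedModule) (df 1) (fun x => - r - tau / x) z (df 2 z) (tau / (z * z))).
      + apply df_derive; [lia|lra].
      + auto_derive; [lra|]. field. lra.
    - rewrite Rabs_right by lra. rewrite Rmult_comm. apply Rmult_le_compat_r; [|lra].
      assert (0 <= q2 / N) by (apply Rdiv_le_0_compat; lra). nra. }
  intros x x' Hx Hx'.
  apply (lipschitz_of_derive (fun x => df 0 x - r * x - tau * ln x) (fun x => df 1 x - r - tau / x) y y2); auto.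
  intros z Hz.
  apply is_derive_ext with (fun x => plus (df 0 x) (- r * x - tau * ln x)); [intros w; unfold plus; simpl; ring|].
  replace (df 1 z - r - tau / z) with (plus (df 1 z) (- r - tau / z)) by (unfold plus; simpl; ring).
  apply (is_derive_plus (V := R_NormedModule) (df 0) (fun x => - r * x - tau * ln x)).
  - apply df_derive; [lia|lra].
  - auto_derive; [lra|]. field. lra.
Qed.
End Phase.

(** * Dissection of the sum over primes *)

(** Cut off outside the residues prime to [q], since every Dirichlet character mod [q] vanishes
    there. *)
Definition add_char (a : Z) (q : nat) (x : Z) : C :=
  if excluded_middle_informative (cunit q x) then e (IZR a * IZR x / INR q) else RtoC 0.

Lemma add_char_congr a q x y : (1 <= q)%nat -> congr q x y -> add_char a q x = add_char a q y.
Proof.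
  intros Hq Hc. assert (Hq1 := INR_ge_1 q Hq). unfold add_char.
  destruct (excluded_middle_informative (cunit q x)) as [h|h], (excluded_middle_informative (cunit q y)) as [h'|h']; auto.
  - destruct Hc as [k Hk].
    replace (IZR a * IZR x / INR q) with (IZR a * IZR y / INR q + IZR (a * k)).
    + rewrite e_plus, e_IZR. ring.
    + replace x with (y + k * Z.of_nat q)%Z by lia. rewrite plus_IZR, !mult_IZR, <- INR_IZR_INZ. field. lra.
  - exfalso. apply h'. apply (congr_unit q Hq x); auto.
  - exfalso. apply h. apply (congr_unit q Hq y); auto. eapply congr_sym; eauto.
Qed.

Lemma add_char_le_1 a q x : Cmod (add_char a q x) <= 1.
Proof. unfold add_char. destruct (excluded_middle_informative _); [rewrite Cmod_e|rewrite Cmod_0]; lra. Qed.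

Lemma Cexp_RtoC x : Cexp (RtoC x) = RtoC (exp x).
Proof. unfold Cexp, RtoC; simpl. rewrite cos_0, sin_0. f_equal; ring. Qed.

Lemma ncpow_real n x : ncpow n (RtoC x) = RtoC (Rpower (INR n) x).
Proof. unfold ncpow. rewrite <- RtoC_mult. apply Cexp_RtoC. Qed.

Lemma ncpow_imaginary n tau : ncpow n (0, 2 * PI * tau) = e (tau * ln (INR n)).
Proof. unfold ncpow, e. f_equal. unfold Cmult, RtoC, Ci; simpl. f_equal; ring. Qed.

Lemma large_power x c : 0 < x -> 1 <= c -> exists N0, 1 < N0 /\ forall N, N0 <= N -> c <= Rpower N x.
Proof.
  intros Hx Hc. exists (Rmax 2 (Rpower c (/ x))). assert (M1 := Rmax_l 2 (Rpower c (/ x))). assert (M2 := Rmax_r 2 (Rpower c (/ x))).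
  split; [lra|]. intros N HN.
  replace c with (Rpower (Rpower c (/ x)) x) at 1 by (rewrite Rpower_mult, Rinv_l, Rpower_1; lra).
  apply Rpower_le_base; [apply Rpower_pos|lra|lra].
Qed.

(** A full step of length [L r / sqrt Q] costs [B r], which is [B sqrt Q / L] per unit of length for
    every [r]; only the last, incomplete step may add [B sqrt Q]. Since [r >= 1], each step advances
    by at least [L / sqrt Q], which bounds the number of steps. *)
Lemma greedy_dissection (S : R -> R -> C) (B Q L N N' : R) : 0 <= B -> 1 <= Q -> 0 < L ->
  (forall y, S y y = RtoC 0) ->
  (forall y1 y2 y3, y1 <= y2 -> y2 <= y3 -> S y1 y3 = S y1 y2 + S y2 y3)%C ->
  (forall y, N <= y -> y < N' -> exists r, 1 <= r <= sqrt Q /\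
    forall y2, y < y2 -> y2 <= N' -> y2 - y <= L * (r / sqrt Q) -> Cmod (S y y2) <= B * r) ->
  N < N' -> Cmod (S N N') <= B * sqrt Q * (1 + (N' - N) / L).
Proof.
  intros HB HQ HL H0 Hadd Hpc HN.
  assert (HsQ : 1 <= sqrt Q) by (rewrite <- sqrt_1; apply sqrt_le_1_alt; auto).
  assert (HLQ : 0 < L / sqrt Q) by (apply Rdiv_lt_0_compat; lra).
  assert (G : forall n y, N <= y -> y <= N' -> N' - y <= INR n * (L / sqrt Q) ->
     Cmod (S y N') <= B * sqrt Q * (1 + (N' - y) / L)).
  { induction n as [|n IH]; intros y Hy1 Hy2 Hn.
    - simpl in Hn. assert (y = N') by lra. subst y. rewrite H0, Cmod_0.
      apply Rmult_le_pos; [nra|]. replace (N' - N') with 0 by ring. unfold Rdiv. lra.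
    - destruct (Req_dec y N') as [->|Hne].
      { rewrite H0, Cmod_0. apply Rmult_le_pos; [nra|]. replace (N' - N') with 0 by ring. unfold Rdiv. lra. }
      destruct (Hpc y Hy1 ltac:(lra)) as [r [Hr Hb]].
      set (l := L * (r / sqrt Q)) in *.
      assert (Hl : L / sqrt Q <= l).
      { unfold l. replace (L * (r / sqrt Q)) with (L / sqrt Q * r) by (field; lra). nra. }
      assert (Pos : 0 <= (N' - y) / L) by (apply Rdiv_le_0_compat; lra).
      destruct (Rle_dec N' (y + l)) as [h|h].
      + eapply Rle_trans; [apply Hb; lra|].
        apply Rle_trans with (B * sqrt Q); [apply Rmult_le_compat_l; lra|].
        assert (0 <= B * sqrt Q) by nra. nra.
      + rewrite (Hadd y (y + l) N') by lra. eapply Rle_trans; [apply Cmod_triangle|].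
        assert (B1 := Hb (y + l) ltac:(lra) ltac:(lra) ltac:(lra)).
        rewrite S_INR in Hn.
        assert (B2 := IH (y + l) ltac:(lra) ltac:(lra) ltac:(lra)).
        replace (B * sqrt Q * (1 + (N' - y) / L)) with (B * r + B * sqrt Q * (1 + (N' - (y + l)) / L)); [lra|].
        unfold l. field. split; lra. }
  destruct (archimed ((N' - N) / (L / sqrt Q))) as [Ha _].
  assert (Pos : 0 < (N' - N) / (L / sqrt Q)) by (apply Rdiv_lt_0_compat; lra).
  apply (G (Z.to_nat (up ((N' - N) / (L / sqrt Q))))); [lra|lra|].
  rewrite INR_IZR_INZ, Z2Nat.id by (apply le_IZR; lra).
  apply Rmult_le_reg_r with (/ (L / sqrt Q)); [apply Rinv_0_lt_compat; auto|].
  rewrite Rmult_assoc, Rinv_r by lra. unfold Rdiv in *. lra.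
Qed.

(** * The sum over a single piece *)

Section Pieces.
Variables (a b : nat -> C) (m : nat).
Hypothesis HF : dirichlet_series_conditions a b m.
Notation beta := (log_coef b).

(** The cut-off additive character depends only on the residue, is bounded by 1 and vanishes off the
    units, so the expansion in characters applies to it. *)
Lemma additive_sum_bound d : 0 < d <= 1 / 8 -> exists K, 0 < K /\
  forall N q (r : Z) t y1 y2 X, 1 <= N -> (1 <= q)%nat -> INR q <= N ->
  sqrt N + 2 <= Rabs t <= N * N -> N <= y1 -> y1 < y2 -> y2 <= 2 * N -> 2 * N <= INR X ->
  Cmod (lsum (seq 1 X) (fun n => if in_interval y1 y2 n then
     beta n * ncpow n (0, t) * ncpow n (- RtoC (1 + 2 * d)) * add_char r q (Z.of_nat n) else RtoC 0)%C)
   <= sqrt (INR q) * (K * Rpower N (- (1 / 2) + 3 * d)).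
Proof.
  intros Hd. destruct (twisted_sum_bound a b m HF d Hd) as [K [HK H]]. exists K. split; auto.
  intros N q r t y1 y2 X HN Hq HqN Ht Hy1 Hy12 Hy2 HX.
  assert (E := char_expansion_bound q Hq (seq 1 X)
    (fun n => if in_interval y1 y2 n then beta n * ncpow n (0, t) * ncpow n (- RtoC (1 + 2 * d)) else RtoC 0)%C
    (add_char r q) (K * Rpower N (- (1 / 2) + 3 * d))).
  rewrite (lsum_ext _ _ (fun n => (if in_interval y1 y2 n then beta n * ncpow n (0, t) * ncpow n (- RtoC (1 + 2 * d)) else RtoC 0) * add_char r q (Z.of_nat n))%C).
  2:{ intros n _. destruct (in_interval y1 y2 n); ring. }
  apply E.
  - intros; apply add_char_congr; auto.
  - apply add_char_le_1.
  - intros x Hx. unfold add_char. destruct (excluded_middle_informative _); tauto.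
  - intros chi Hchi. eapply Rle_trans; [|apply (H N q chi t y1 y2 X); auto].
    right. f_equal. apply lsum_ext. intros n _. destruct (in_interval y1 y2 n); [unfold twist|]; ring.
Qed.

Variables (f : R -> R) (df : nat -> R -> R).
Hypothesis Hf : phase_conditions f df.

(** The conditions [len^2 <= q Q N] and [len^3 V <= N^3] bound [len D], the variation of the
    remaining phase, by a constant. Abel summation then transfers the bound for the sums twisted by
    the additive character and by [n^(it)]. *)
Lemma piece_bound_beta d C0 : 0 < d <= 1 / 8 -> 1 <= C0 -> exists K, 0 < K /\
  forall N V Q q (r : Z) y y2 len X, 1 < N -> 0 < V -> 1 <= Q -> (1 <= q)%nat -> INR q <= N ->
  (forall x, N <= x <= 2 * N -> Rabs (df 3 x) <= C0 * V / (N * N * N)) ->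
  N <= y -> y < y2 -> y2 <= 2 * N -> 2 * N <= INR X ->
  Rabs (y * (df 1%nat y - IZR r / INR q)) <= 5 * C0 * V ->
  sqrt N + 2 <= Rabs (2 * PI * (y * (df 1%nat y - IZR r / INR q))) <= N * N ->
  Rabs (df 1%nat y + y * df 2%nat y - IZR r / INR q) <= 2 / (INR q * Q) ->
  y2 - y <= len -> len * len <= INR q * Q * N -> len * len * len * V <= N * N * N ->
  Cmod (lsum (seq 1 X) (fun n => if in_interval y y2 n then
     if excluded_middle_informative (cunit q (Z.of_nat n)) then beta n * e (f (INR n)) else RtoC 0 else RtoC 0)%C)
   <= K * sqrt (INR q) * Rpower N (1 / 2 + 5 * d).
Proof.
  intros Hd HC0. destruct (additive_sum_bound d Hd) as [K1 [HK1 H1]].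
  assert (PIp := PI_RGT_0).
  (* In units of [(2N)^c]: the last weight is at most 1, the increasing factor [n^c] varies by at
     most 1, and the phase adds [4 pi len D]. *)
  set (TVc := 2 + 4 * PI * (2 + 11 * C0)). assert (HTVc : 0 < TVc) by (unfold TVc; nra).
  exists (4 * K1 * TVc). split; [nra|].
  intros N V Q q r y y2 len X HN HV HQ Hq HqN H3 Hy Hyy Hy2 HX Htau Ht Hg Hlen Hl2 Hl3.
  set (al := IZR r / INR q) in *. set (tau := y * (df 1%nat y - al)) in *. set (t := 2 * PI * tau) in *.
  set (c := 1 + 2 * d).
  assert (Hq1 := INR_ge_1 q Hq).
  assert (HqQ : 0 < INR q * Q) by nra.
  set (phi := fun x => df 0%nat x - al * x - tau * ln x).
  set (D := len * (2 / (INR q * Q) / N + len * (11 * C0 * V / (N * N * N)))).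
  assert (HNNN : 0 < N * N * N) by (apply Rmult_lt_0_compat; nra).
  assert (Hphi : forall x x', y <= x <= y2 -> y <= x' <= y2 -> Rabs (phi x - phi x') <= D * Rabs (x - x')).
  { apply (phase_lipschitz f df Hf C0 N V y y2 al tau (2 / (INR q * Q)) len); auto; try lra.
    left. apply Rdiv_lt_0_compat; lra. }
  assert (Hlen0 : 0 < len) by lra.
  assert (HD0 : 0 <= D).
  { unfold D. apply Rmult_le_pos; [lra|]. apply Rplus_le_le_0_compat.
    - apply Rdiv_le_0_compat; [|lra]. apply Rdiv_le_0_compat; lra.
    - apply Rmult_le_pos; [lra|]. apply Rdiv_le_0_compat; [nra|auto]. }
  assert (HlD : len * D <= 2 + 11 * C0).
  { unfold D. replace (len * (len * (2 / (INR q * Q) / N + len * (11 * C0 * V / (N * N * N))))) with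
      (2 * (len * len / (INR q * Q * N)) + 11 * C0 * (len * len * len * V / (N * N * N))) by (field; repeat split; nra).
    assert (len * len / (INR q * Q * N) <= 1).
    { apply Rmult_le_reg_r with (INR q * Q * N); [nra|]. unfold Rdiv. rewrite Rmult_assoc, Rinv_l by nra. lra. }
    assert (len * len * len * V / (N * N * N) <= 1).
    { apply Rmult_le_reg_r with (N * N * N); [nra|]. unfold Rdiv. rewrite Rmult_assoc, Rinv_l by nra. lra. }
    assert (11 * C0 * (len * len * len * V / (N * N * N)) <= 11 * C0 * 1) by (apply Rmult_le_compat_l; lra). lra. }
  destruct (nat_floor y ltac:(lra)) as [n0 [Hn0 Hn0']]. destruct (nat_floor y2 ltac:(lra)) as [n1 [Hn1 Hn1']].
  assert (Hn01 : (n0 <= n1)%nat).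
  { apply Nat.lt_succ_r. apply INR_lt. rewrite S_INR. lra. }
  set (k := (n1 - n0)%nat). assert (Ek : (n0 + k = n1)%nat) by (unfold k; lia).
  assert (Hn1X : (n1 <= X)%nat) by (apply INR_le; lra).
  rewrite (lsum_interval _ n0 k X) by (rewrite ?Ek; auto).
  (* [u] collects the factors treated by characters and Perron's formula; [w] undoes the weight
     [n^(-c)] and carries the slowly varying rest of the phase. *)
  set (u := fun n => (beta n * ncpow n (0, t) * ncpow n (- RtoC c) * add_char r q (Z.of_nat n))%C).
  set (w := fun n => (RtoC (Rpower (INR n) c) * e (phi (INR n)))%C).
  assert (Hrange : forall j, (S n0 <= j <= n1)%nat -> y <= INR j <= y2 /\ 1 <= INR j <= 2 * N).
  { intros j Hj. assert (INR n0 + 1 <= INR j) by (rewrite <- S_INR; apply le_INR; lia).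
    assert (INR j <= INR n1) by (apply le_INR; lia). assert (1 <= INR j) by (apply INR_ge_1; lia). lra. }
  rewrite (lsum_ext _ _ (fun n => u n * w n)%C).
  2:{ intros n Hn. apply in_seq in Hn. destruct (Hrange n ltac:(lia)) as [R1 R2]. unfold u, w, add_char.
      destruct (excluded_middle_informative _) as [h|h]; [|ring].
      unfold t. rewrite ncpow_imaginary.
      replace (- RtoC c)%C with (RtoC (- c)) by apply RtoC_opp. rewrite ncpow_real.
      rewrite <- INR_IZR_INZ.
      replace (f (INR n)) with (tau * ln (INR n) + (IZR r * INR n / INR q + phi (INR n))).
      - rewrite !e_plus.
        replace (RtoC (Rpower (INR n) (- c)) * e (IZR r * INR n / INR q) * (RtoC (Rpower (INR n) c) * e (phi (INR n))))%C with
          (RtoC (Rpower (INR n) (- c)) * RtoC (Rpower (INR n) c) * e (IZR r * INR n / INR q) * e (phi (INR n)))%C by ring.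
        assert (E1 : (RtoC (Rpower (INR n) (- c)) * RtoC (Rpower (INR n) c) = RtoC 1)%C).
        { rewrite <- RtoC_mult, <- Rpower_plus. replace (- c + c) with 0 by ring. rewrite Rpower_O by lra. auto. }
        transitivity (beta n * (e (tau * ln (INR n)) * (e (IZR r * INR n / INR q) * e (phi (INR n)))) * (RtoC (Rpower (INR n) (- c)) * RtoC (Rpower (INR n) c)))%C; [rewrite E1|]; ring.
      - rewrite <- (df_0 _ _ (phase_C4 _ _ Hf)) by lra. unfold phi, al. field. lra. }
  set (B := sqrt (INR q) * (K1 * Rpower N (- (1 / 2) + 3 * d))).
  assert (PB := Rpower_pos N (- (1 / 2) + 3 * d)). assert (Psq := sqrt_pos (INR q)).
  assert (HB0 : 0 <= B) by (unfold B; apply Rmult_le_pos; auto; nra).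
  set (W := Rpower (2 * N) c). assert (HW0 : 0 < W) by apply Rpower_pos.
  assert (HRp : forall j, (S n0 <= j <= n1)%nat -> Rpower (INR j) c <= W).
  { intros j Hj. destruct (Hrange j Hj). apply Rpower_le_base; [lra|lra|unfold c; lra]. }
  assert (HA := abel_bound u w (S n0) k B W (W + W * (4 * PI) * (len * D))).
  assert (HlD0 : 0 <= len * D) by (apply Rmult_le_pos; lra).
  eapply Rle_trans; [apply HA|].
  - intros j Hj. destruct j as [|j].
    + unfold lsum; simpl. rewrite Cmod_0. auto.
    + assert (Hjr := Hrange (n0 + S j)%nat ltac:(lia)).
      assert (INR (n0 + S j) >= INR n0 + 1) by (rewrite <- S_INR; apply Rle_ge, le_INR; lia).
      rewrite <- (lsum_interval u n0 (S j) X y (INR (n0 + S j))) by (try lia; lra).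
      apply H1; auto; lra.
  - intros Hk. unfold w. rewrite Cmod_mult, Cmod_R, Cmod_e, Rmult_1_r, Rabs_right by (apply Rle_ge; left; apply Rpower_pos).
    apply HRp. lia.
  - auto.
  - lra.
  - apply Rplus_le_le_0_compat; [lra|]. apply Rmult_le_pos; [|lra]. nra.
  - apply Rle_trans with (rsum (seq 0 (k - 1)) (fun j => (Rpower (INR (S n0 + S j)) c - Rpower (INR (S n0 + j)) c) + W * (4 * PI) * D)).
    + apply rsum_le. intros j Hj. apply in_seq in Hj. unfold w.
      destruct (Hrange (S n0 + j)%nat ltac:(lia)) as [A1 A2]. destruct (Hrange (S n0 + S j)%nat ltac:(lia)) as [A3 A4].
      set (x := INR (S n0 + j)) in *. set (x' := INR (S n0 + S j)) in *.
      assert (Ex : x' = x + 1) by (unfold x, x'; rewrite <- S_INR; f_equal; lia).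
      replace (RtoC (Rpower x' c) * e (phi x') - RtoC (Rpower x c) * e (phi x))%C with
        (RtoC (Rpower x' c - Rpower x c) * e (phi x') + RtoC (Rpower x c) * (e (phi x') - e (phi x)))%C by (rewrite RtoC_minus; ring).
      eapply Rle_trans; [apply Cmod_triangle|]. rewrite !Cmod_mult, !Cmod_R, Cmod_e, Rmult_1_r.
      assert (Mono : Rpower x c <= Rpower x' c) by (apply Rpower_le_base; [lra|lra|unfold c; lra]).
      rewrite (Rabs_right (Rpower x' c - Rpower x c)) by lra. apply Rplus_le_compat_l.
      assert (Px := Rpower_pos x c). rewrite (Rabs_right (Rpower x c)) by lra. rewrite Rmult_assoc.
      apply Rmult_le_compat; [lra|apply Cmod_ge_0|apply (HRp (S n0 + j)%nat); lia|].
      eapply Rle_trans; [apply e_lipschitz|]. apply Rmult_le_compat_l; [lra|].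
      assert (P := Hphi x' x A3 A1). replace (x' - x) with 1 in P by lra. rewrite Rabs_R1, Rmult_1_r in P. exact P.
    + rewrite rsum_plus, rsum_const, length_seq. rewrite (rsum_telescope (fun n => Rpower (INR n) c) (S n0)).
      assert (P1 := Rpower_pos (INR (S n0)) c).
      apply Rplus_le_compat.
      * destruct k as [|k'].
        { simpl Nat.sub. rewrite Nat.add_0_r. lra. }
        assert (Hh := HRp (S n0 + (S k' - 1))%nat ltac:(lia)). lra.
      * replace (W * (4 * PI) * (len * D)) with (len * (W * (4 * PI) * D)) by ring.
        apply Rmult_le_compat_r; [apply Rmult_le_pos; [nra|lra]|].
        (* [k] integers give [k - 1] increments, and [k - 1 <= y2 - y] because [n0 > y - 1]. *)
        destruct k as [|k']; [simpl; lra|]. replace (S k' - 1)%nat with k' by lia.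
        assert (INR n1 = INR n0 + INR k' + 1) by (rewrite <- Ek, plus_INR, S_INR; ring). lra.
  - assert (EW : W <= 4 * Rpower N c).
    { unfold W. rewrite <- Rpower_mult_distr by lra. apply Rmult_le_compat_r; [left; apply Rpower_pos|].
      apply Rle_trans with (Rpower 2 2); [apply Rpower_le_exp; unfold c; lra|].
      replace 2 with (INR 2) at 2 by (simpl; ring). rewrite Rpower_pow by lra. simpl; lra. }
    assert (EF : Rpower N (1 / 2 + 5 * d) = Rpower N (- (1 / 2) + 3 * d) * Rpower N c).
    { rewrite <- Rpower_plus. f_equal. unfold c. field. }
    assert (PNc := Rpower_pos N c).
    apply Rle_trans with (B * (W * TVc)).
    + apply Rmult_le_compat_l; auto. unfold TVc.
      replace (W + (W + W * (4 * PI) * (len * D))) with (W * (2 + 4 * PI * (len * D))) by ring.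
      apply Rmult_le_compat_l; [lra|]. apply Rplus_le_compat_l. apply Rmult_le_compat_l; lra.
    + rewrite EF. unfold B.
      replace (4 * K1 * TVc * sqrt (INR q) * (Rpower N (- (1 / 2) + 3 * d) * Rpower N c)) with
        (sqrt (INR q) * (K1 * Rpower N (- (1 / 2) + 3 * d)) * ((4 * Rpower N c) * TVc)) by ring.
      apply Rmult_le_compat_l; auto. apply Rmult_le_compat_r; lra.
Qed.

(** The index set does not depend on the interval, so additivity in the interval is a comparison of
    terms. *)
Definition prime_sum (X : nat) (y y2 : R) : C :=
  lsum (seq 1 X) (fun n => if in_interval y y2 n then if prime_b n then a n * e (f (INR n)) else RtoC 0 else RtoC 0)%C.

Lemma prime_unit q p N : is_prime p -> (1 <= q)%nat -> INR q <= N -> N < INR p -> cunit q (Z.of_nat p).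
Proof.
  intros Hp Hq HqN HN. unfold cunit. apply Zgcd_1_rel_prime. apply prime_rel_prime; auto.
  intros Hdiv. apply Z.divide_pos_le in Hdiv; [|lia].
  assert (q < p)%nat by (apply INR_lt; lra). lia.
Qed.

(** At primes the terms agree, because [a_p = b_p] and [q <= N < p] makes [p] a unit. The difference
    lives on proper prime powers, which number [O(sqrt N log N)] and have coefficients [O(N^d)]. *)
Lemma prime_sum_vs_beta d : 0 < d <= 1 / 8 -> exists K, 0 < K /\
  forall N q y y2 X, 1 <= N -> (1 <= q)%nat -> INR q <= N -> N <= y -> y2 <= 2 * N -> INR X <= 4 * N -> (1 <= X)%nat ->
  Cmod (prime_sum X y y2 - lsum (seq 1 X) (fun n => if in_interval y y2 n then
     if excluded_middle_informative (cunit q (Z.of_nat n)) then beta n * e (f (INR n)) else RtoC 0 else RtoC 0))%C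
   <= K * Rpower N (1 / 2 + 5 * d).
Proof.
  intros Hd. destruct (log_coef_bound b d (ds_log_bound_all _ _ _ HF d ltac:(lra))) as [K0 [HK0 HK]].
  set (id := / d). assert (Hid : 8 <= id).
  { unfold id. replace 8 with (/ (1 / 8)) by field. apply Rinv_le_contravar; lra. }
  exists (4 * K0 * (4 * (2 + id)) * 2 + 1). split; [nra|].
  intros N q y y2 X HN Hq HqN Hy Hy2 HX HX1. unfold prime_sum. rewrite <- lsum_minus.
  eapply Rle_trans; [apply lsum_norm_le|].
  set (p := Rpower N d). assert (Hp1 : 1 <= p) by (apply Rpower_ge_1; lra).
  apply Rle_trans with (rsum (filter proper_prime_power_b (seq 1 X)) (fun _ => 4 * K0 * p)).
  - assert (Z : forall l, (forall n, In n l -> (1 <= n)%nat) -> rsum l (fun n => Cmod ((if in_interval y y2 n then if prime_b n then a n * e (f (INR n)) else RtoC 0 else RtoC 0)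
        - (if in_interval y y2 n then if excluded_middle_informative (cunit q (Z.of_nat n)) then beta n * e (f (INR n)) else RtoC 0 else RtoC 0))%C)
       <= rsum (filter proper_prime_power_b l) (fun _ => 4 * K0 * p)).
    { induction l as [|n l IH]; intros Hl; [unfold rsum; simpl; lra|].
      rewrite rsum_cons. cbn [filter]. specialize (IH (fun k h => Hl k (or_intror h))). assert (Hn := Hl n (or_introl eq_refl)).
      destruct (in_interval y y2 n) eqn:EI.
      2:{ replace (RtoC 0 - RtoC 0)%C with (RtoC 0) by ring. rewrite Cmod_0.
          destruct (proper_prime_power_b n); [rewrite rsum_cons; assert (0 <= 4 * K0 * p) by nra; lra|lra]. }
      apply in_interval_spec in EI.
      destruct (prime_b n) eqn:EP.
      + apply prime_b_spec in EP. destruct (excluded_middle_informative _) as [h|h].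
        2:{ exfalso. apply h. apply (prime_unit q n N); auto. lra. }
        rewrite (a_prime a b m HF n EP). replace (beta n * e (f (INR n)) - beta n * e (f (INR n)))%C with (RtoC 0) by ring. rewrite Cmod_0.
        destruct (proper_prime_power_b n); [rewrite rsum_cons; assert (0 <= 4 * K0 * p) by nra; lra|lra].
      + assert (Bn : Cmod (RtoC 0 - (if excluded_middle_informative (cunit q (Z.of_nat n)) then beta n * e (f (INR n)) else RtoC 0))%C <= Cmod (beta n)).
        { destruct (excluded_middle_informative _).
          - replace (RtoC 0 - beta n * e (f (INR n)))%C with (- (beta n * e (f (INR n))))%C by ring. rewrite Cmod_opp, Cmod_mult, Cmod_e. lra.
          - replace (RtoC 0 - RtoC 0)%C with (RtoC 0) by ring. rewrite Cmod_0. apply Cmod_ge_0. }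
        destruct (proper_prime_power_b n) eqn:EPP.
        * rewrite rsum_cons. apply Rplus_le_compat; auto. eapply Rle_trans; [exact Bn|].
          eapply Rle_trans; [apply HK; auto|]. replace (4 * K0 * p) with (K0 * (4 * p)) by ring. apply Rmult_le_compat_l; auto.
          apply Rle_trans with (Rpower (2 * N) d); [apply Rpower_le_base; try lra; apply INR_ge_1 in Hn; lra|].
          rewrite <- Rpower_mult_distr by lra. fold p. apply Rmult_le_compat_r; [lra|].
          apply Rle_trans with (Rpower 2 1); [apply Rpower_le_exp; lra|rewrite Rpower_1; lra].
        * assert (beta n = RtoC 0).
          { unfold log_coef. destruct (excluded_middle_informative (is_prime_power n)) as [[p' [k [Hp' [Hk E]]]]|]; auto.
            exfalso. destruct (Nat.eq_dec k 1) as [->|hk].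
            - rewrite Nat.pow_1_r in E. subst n. apply prime_b_spec in Hp'. congruence.
            - unfold proper_prime_power_b in EPP. destruct (excluded_middle_informative (proper_prime_power n)) as [|h]; [discriminate|].
              apply h. exists p', k. split; [auto|]. split; [lia|auto]. }
          assert (Hz : Cmod (beta n) = 0) by (rewrite H; apply Cmod_0). lra. }
    apply Z. intros n Hn. apply in_seq in Hn. lia.
  - rewrite rsum_const.
    assert (Cnt := proper_prime_power_count X). apply le_INR in Cnt. rewrite mult_INR in Cnt.
    assert (S1 := sqrt_nat_le X). assert (S2 := log2_nat_le X HX1).
    assert (HXr := INR_ge_1 X HX1).
    assert (T1 : sqrt (INR X) <= 2 * sqrt N).
    { replace (2 * sqrt N) with (sqrt (4 * N)). apply sqrt_le_1_alt; lra.
      rewrite sqrt_mult by lra. replace 4 with (2 * 2) by ring. rewrite sqrt_square by lra. auto. }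
    assert (ln4 : ln 4 <= 2).
    { replace 4 with (2 * 2) by ring. rewrite ln_mult by lra.
      assert (ln 2 <= 1); [|lra]. rewrite <- (ln_exp 1). apply ln_le; [lra|]. assert (h := exp_ge_1_plus 1). lra. }
    assert (HlnN : ln N <= p * id) by (apply ln_le_Rpower; lra).
    assert (T2 : ln (INR X) <= (2 + id) * p).
    { apply Rle_trans with (ln (4 * N)); [apply ln_le; lra|]. rewrite ln_mult by lra. nra. }
    assert (T3 : INR (length (filter proper_prime_power_b (seq 1 X))) <= (2 * sqrt N) * (2 * ((2 + id) * p))).
    { eapply Rle_trans; [exact Cnt|]. apply Rmult_le_compat; try apply pos_INR; lra. }
    assert (EN : Rpower N (1 / 2 + 5 * d) = sqrt N * (p * p * p * p * p)).
    { unfold p. rewrite <- Rpower_sqrt by lra. rewrite <- !Rpower_plus. f_equal. field. }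
    rewrite EN. assert (Ps := sqrt_pos N).
    apply Rle_trans with ((2 * sqrt N) * (2 * ((2 + id) * p)) * (4 * K0 * p)); [apply Rmult_le_compat_r; [nra|auto]|].
    replace (2 * sqrt N * (2 * ((2 + id) * p)) * (4 * K0 * p)) with ((4 * K0 * (4 * (2 + id))) * (sqrt N * (p * p))) by ring.
    assert (p2 : 1 <= p * p) by nra. assert (p3 : 1 <= p * p * p) by nra.
    assert (p5 : p * p <= p * p * p * p * p) by nra.
    assert (Q1 : sqrt N * (p * p) <= sqrt N * (p * p * p * p * p)) by (apply Rmult_le_compat_l; auto).
    assert (Q0 : 0 <= sqrt N * (p * p)) by nra.
    assert (Z0 : 0 <= 4 * K0 * (4 * (2 + id))) by nra.
    nra.
Qed.

Lemma prime_sum_add X y1 y2 y3 : y1 <= y2 -> y2 <= y3 -> prime_sum X y1 y3 = (prime_sum X y1 y2 + prime_sum X y2 y3)%C.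
Proof.
  intros H1 H2. unfold prime_sum. rewrite <- lsum_plus. apply lsum_ext. intros n _. unfold in_interval.
  destruct (Rlt_dec y1 (INR n)), (Rle_dec (INR n) y3), (Rle_dec (INR n) y2), (Rlt_dec y2 (INR n)); try lra; ring.
Qed.

Lemma prime_sum_empty X y : prime_sum X y y = RtoC 0.
Proof.
  apply lsum_zero. intros n _. destruct (in_interval y y n) eqn:E; auto. apply in_interval_spec in E. lra.
Qed.
End Pieces.

Lemma sum_n_lsum (F : nat -> C) n : @sum_n C_AbelianMonoid F n = lsum (seq 0 (S n)) F.
Proof.
  induction n as [|n IH]; [rewrite sum_O; unfold lsum; simpl; ring|].
  rewrite sum_Sn, IH, (seq_S (S n)), lsum_app, lsum_one. reflexivity.
Qed.

Lemma not_prime_0 : ~ is_prime 0.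
Proof. intros H. apply prime_ge_2_nat in H. lia. Qed.

Lemma sum_primes_between_eq (a : nat -> C) (f : R -> R) N N' X : 0 < N' -> (Z.to_nat (up N') <= X)%nat ->
  sum_primes_between (fun p => a p * e (f (INR p)))%C N N' = prime_sum a f X N N'.
Proof.
  intros HN' HX. unfold sum_primes_between, prime_sum. rewrite sum_n_lsum.
  change (seq 0 (S (Z.to_nat (up N')))) with (0%nat :: seq 1 (Z.to_nat (up N'))). rewrite lsum_cons.
  destruct (is_prime_dec 0) as [h|_]; [exfalso; apply not_prime_0; auto|]. rewrite Cplus_0_l.
  rewrite (seq_1_app _ X HX), lsum_app. rewrite (lsum_zero (seq (S (Z.to_nat (up N'))) _)).
  - rewrite Cplus_0_r. apply lsum_ext. intros p _. unfold in_interval, prime_b.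
    destruct (is_prime_dec p), (Rlt_dec N (INR p)), (Rle_dec (INR p) N'); reflexivity.
  - intros n Hn. apply in_seq in Hn. destruct (in_interval N N' n) eqn:E; auto. apply in_interval_spec in E.
    destruct (archimed N') as [Ha _]. exfalso.
    assert (INR (Z.to_nat (up N')) <= INR n) by (apply le_INR; lia).
    rewrite INR_IZR_INZ, Z2Nat.id in H by (apply le_IZR; lra). lra.
Qed.

(** * Assembly of the pieces *)

Section Main.
Variables (f : R -> R) (df : nat -> R -> R) (a b : nat -> C) (m : nat).
Hypotheses (Hf : phase_conditions f df) (HF : dirichlet_series_conditions a b m).

Lemma prime_sum_large eta d : 0 < eta -> 0 < d <= 1 / 8 -> exists K N0, 0 < K /\ 1 < N0 /\ forall N N' X,
  N0 <= N -> N < N' -> N' <= 2 * N -> 2 * N <= INR X -> INR X <= 4 * N -> (1 <= X)%nat ->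
  Rpower N (3 / 4 + eta) <= f N -> f N <= Rpower N (3 / 2 - eta) ->
  Cmod (prime_sum a f X N N') <= K * Rpower N (3 / 4 + 5 * d) * Rpower (f N) (1 / 6).
Proof.
  intros Heta Hd. destruct (phase_bounds f df Hf) as [C0 [HC0 HPB]].
  destruct (piece_bound_beta a b m HF f df Hf d C0 Hd HC0) as [K1 [HK1 H1]].
  destruct (prime_sum_vs_beta a b m HF f d Hd) as [K2 [HK2 H2]].
  (* The three thresholds serve, in this order, for [8 C0 sqrt N <= V^(2/3)], [C0 sqrt N <= V] and
     [40 C0 V <= N^2]. *)
  destruct (large_power (2 / 3 * eta) (8 * C0) ltac:(lra) ltac:(lra)) as [N1 [HN1 L1]].
  destruct (large_power (1 / 4) C0 ltac:(lra) ltac:(lra)) as [N2 [HN2 L2]].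
  destruct (large_power (1 / 2) (40 * C0) ltac:(lra) ltac:(lra)) as [N3 [HN3 L3]].
  assert (HCC : 1 <= C0 * C0) by nra.
  set (B0 := K1 + K2).
  exists (2 * B0), (Rmax N1 (Rmax N2 N3)).
  assert (M1 := Rmax_l N1 (Rmax N2 N3)). assert (M2 := Rmax_r N1 (Rmax N2 N3)).
  assert (M3 := Rmax_l N2 N3). assert (M4 := Rmax_r N2 N3).
  split; [unfold B0; lra|]. split; [lra|].
  intros N N' X HN HNN' HN' HX1 HX2 HX3 HV1 HV2.
  specialize (L1 N ltac:(lra)). specialize (L2 N ltac:(lra)). specialize (L3 N ltac:(lra)).
  set (V := f N) in *.
  assert (HN1' : 1 < N) by lra.
  assert (HV34 : Rpower N (3 / 4) <= V) by (eapply Rle_trans; [apply Rpower_le_exp; [lra|]|exact HV1]; lra).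
  assert (HV32 : V <= Rpower N (3 / 2)) by (eapply Rle_trans; [exact HV2|apply Rpower_le_exp; lra]).
  assert (HVge1 : 1 <= V) by (eapply Rle_trans; [apply (Rpower_ge_1 N (3 / 4)); lra|exact HV34]).
  set (v := Rpower V (1 / 3)). set (s := sqrt N).
  assert (Hv : 0 < v) by apply Rpower_pos.
  assert (Hv1 : 1 <= v) by (apply Rpower_ge_1; lra).
  assert (Ev : v * v * v = V).
  { unfold v. rewrite <- !Rpower_plus. replace (1 / 3 + 1 / 3 + 1 / 3) with 1 by field. apply Rpower_1. lra. }
  assert (Es : s * s = N) by (apply sqrt_sqrt; lra).
  assert (Esp : s = Rpower N (1 / 2)) by (unfold s; rewrite <- Rpower_sqrt by lra; f_equal; field).
  assert (Hs1 : 1 < s) by (unfold s; rewrite <- sqrt_1; apply sqrt_lt_1_alt; lra).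
  assert (Hvs : v <= s).
  { unfold v. rewrite Esp. apply Rle_trans with (Rpower (Rpower N (3 / 2)) (1 / 3)).
    - apply Rpower_le_base; lra.
    - rewrite Rpower_mult. right. f_equal. field. }
  assert (Hv2 : 8 * C0 * s <= v * v).
  { apply Rle_trans with (Rpower N (2 / 3 * eta) * s); [apply Rmult_le_compat_r; lra|].
    rewrite Esp, <- Rpower_plus. unfold v. rewrite <- Rpower_plus.
    apply Rle_trans with (Rpower (Rpower N (3 / 4 + eta)) (1 / 3 + 1 / 3)).
    - rewrite Rpower_mult. right. f_equal. field.
    - apply Rpower_le_base; [apply Rpower_pos|auto|lra]. }
  set (Q := s / v). set (L := N / v).
  assert (HQ1 : 1 <= Q).
  { unfold Q. apply Rmult_le_reg_r with v; [lra|]. unfold Rdiv. rewrite Rmult_assoc, Rinv_l; lra. }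
  assert (HQs : Q <= s).
  { unfold Q. apply Rmult_le_reg_r with v; [lra|]. unfold Rdiv. rewrite Rmult_assoc, Rinv_l by lra.
    rewrite Rmult_1_r. rewrite <- (Rmult_1_r s) at 1. apply Rmult_le_compat_l; lra. }
  assert (HsN : s <= N) by (rewrite <- Es; rewrite <- (Rmult_1_r s) at 1; apply Rmult_le_compat_l; lra).
  assert (HQN : Q <= N) by lra.
  assert (HL0 : 0 < L) by (unfold L; apply Rdiv_lt_0_compat; lra).
  assert (HsQ : 1 <= sqrt Q) by (rewrite <- sqrt_1; apply sqrt_le_1_alt; auto).
  assert (EsQ : sqrt Q * sqrt Q = Q) by (apply sqrt_sqrt; lra).
  set (B := B0 * Rpower N (1 / 2 + 5 * d)).
  assert (PNd := Rpower_pos N (1 / 2 + 5 * d)).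
  assert (HB : 0 <= B) by (unfold B, B0; apply Rmult_le_pos; lra).
  assert (G := greedy_dissection (prime_sum a f X) B Q L N N' HB HQ1 HL0 (prime_sum_empty a f X) (prime_sum_add a f X)).
  assert (Hpc : forall y, N <= y -> y < N' -> exists r, 1 <= r <= sqrt Q /\
    forall y2, y < y2 -> y2 <= N' -> y2 - y <= L * (r / sqrt Q) -> Cmod (prime_sum a f X y y2) <= B * r).
  { intros y Hy Hy'.
    destruct (dirichlet_approx (df 1%nat y + y * df 2%nat y) Q HQ1) as [r [q [Hq [HqQ Happ]]]].
    assert (Hq1 := INR_ge_1 q Hq).
    assert (Hsq : 1 <= sqrt (INR q)) by (rewrite <- sqrt_1; apply sqrt_le_1_alt; auto).
    assert (Esq : sqrt (INR q) * sqrt (INR q) = INR q) by (apply sqrt_sqrt; lra).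
    (* The cost parameter of the piece is the loss [sqrt q] of the expansion in characters. *)
    exists (sqrt (INR q)). split; [split; [auto|apply sqrt_le_1_alt; auto]|].
    intros y2 Hyy Hy2 Hlen. set (len := L * (sqrt (INR q) / sqrt Q)) in *.
    set (rq := IZR r / INR q) in *. set (tau := y * (df 1%nat y - rq)).
    destruct (HPB N y ltac:(lra) ltac:(lra)) as [[D2l D2u] _]. fold V in D2l, D2u.
    assert (NN : 0 < N * N) by (apply Rmult_lt_0_compat; lra).
    assert (Nyy : N * N <= y * y) by (apply Rmult_le_compat; lra).
    assert (yyN : y * y <= 4 * (N * N)) by (replace (4 * (N * N)) with ((2 * N) * (2 * N)) by ring; apply Rmult_le_compat; lra).
    assert (E1 : V / C0 <= Rabs (y * y * df 2%nat y) <= 4 * C0 * V).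
    { rewrite Rabs_mult, (Rabs_right (y * y)) by lra. assert (Pd := Rabs_pos (df 2%nat y)). split.
      - apply Rle_trans with (N * N * (V / (C0 * (N * N)))); [right; field; split; lra|].
        apply Rmult_le_compat; [lra| |lra|auto]. apply Rdiv_le_0_compat; [lra|apply Rmult_lt_0_compat; lra].
      - apply Rle_trans with (4 * (N * N) * (C0 * V / (N * N))); [|right; field; lra].
        apply Rmult_le_compat; [lra|auto|lra|auto]. }
    assert (HQq : Q <= INR q * Q) by (rewrite <- (Rmult_1_l Q) at 1; apply Rmult_le_compat_r; lra).
    (* The approximation error moves [tau] by at most [4 s v], which is at most half of the lower
       bound [V / C0] for [y^2 |f''(y)|]. This is where [8 C0 s <= v^2], and so the lower bound on
       [f N], enters. *)
    assert (E2 : Rabs (y * (df 1%nat y + y * df 2%nat y - rq)) <= V / (2 * C0)).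
    { rewrite Rabs_mult, (Rabs_right y) by lra.
      apply Rle_trans with (2 * N * (2 / Q)).
      - apply Rmult_le_compat; [lra|apply Rabs_pos|lra|]. eapply Rle_trans; [exact Happ|].
        unfold Rdiv. apply Rmult_le_compat_l; [lra|]. apply Rinv_le_contravar; lra.
      - unfold Q. rewrite <- Es, <- Ev.
        replace (2 * (s * s) * (2 / (s / v))) with (4 * (s * v)) by (field; split; lra).
        apply Rmult_le_reg_r with (2 * C0); [lra|].
        replace (v * v * v / (2 * C0) * (2 * C0)) with (v * v * v) by (field; lra).
        replace (4 * (s * v) * (2 * C0)) with (8 * C0 * s * v) by ring. apply Rmult_le_compat_r; lra. }
    assert (Etau : tau = y * (df 1%nat y + y * df 2%nat y - rq) - y * y * df 2%nat y) by (unfold tau; ring).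
    assert (HVC : V / (2 * C0) <= C0 * V).
    { apply Rmult_le_reg_r with (2 * C0); [lra|]. replace (V / (2 * C0) * (2 * C0)) with V by (field; lra).
      replace (C0 * V * (2 * C0)) with (V * (2 * (C0 * C0))) by ring. rewrite <- (Rmult_1_r V) at 1. apply Rmult_le_compat_l; lra. }
    assert (EVC : V / C0 = V / (2 * C0) + V / (2 * C0)) by (field; lra).
    assert (Tl : V / (2 * C0) <= Rabs tau).
    { rewrite Etau, Rabs_minus_sym. eapply Rle_trans; [|apply Rabs_triang_inv]. lra. }
    assert (Tu : Rabs tau <= 5 * C0 * V).
    { rewrite Etau. unfold Rminus at 1. eapply Rle_trans; [apply Rabs_triang|]. rewrite Rabs_Ropp. lra. }
    assert (PI3 : 3 < PI) by (assert (h := PI2_3_2); unfold Rdiv in h; lra).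
    assert (PI4 := PI_4).
    (* The twist must exceed the truncation height [sqrt N], so that the contour stays clear of the
       pole, and remain polynomial in [N]. *)
    assert (Tt : s + 2 <= Rabs (2 * PI * tau) <= N * N).
    { rewrite Rabs_mult, (Rabs_right (2 * PI)) by lra. split.
      - apply Rle_trans with (3 * s); [lra|].
        assert (C0 * s <= V).
        { apply Rle_trans with (Rpower N (3 / 4)); auto.
          replace (3 / 4) with (1 / 4 + 1 / 2) by field. rewrite Rpower_plus, <- Esp. apply Rmult_le_compat_r; lra. }
        apply Rle_trans with (6 * (V / (2 * C0))).
        + apply Rmult_le_reg_r with C0; [lra|]. replace (6 * (V / (2 * C0)) * C0) with (3 * V) by (field; lra). lra.
        + assert (0 <= V / (2 * C0)) by (apply Rdiv_le_0_compat; lra). apply Rmult_le_compat; lra.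
      - apply Rle_trans with (8 * (5 * C0 * V)).
        + apply Rmult_le_compat; [lra|apply Rabs_pos|lra|auto].
        + replace (8 * (5 * C0 * V)) with (40 * C0 * V) by ring.
          replace (N * N) with (Rpower N (1 / 2) * Rpower N (3 / 2)).
          * apply Rmult_le_compat; lra.
          * rewrite <- Rpower_plus. replace (1 / 2 + 3 / 2) with (1 + 1) by field. rewrite Rpower_plus, Rpower_1 by lra. auto. }
    assert (Hrat : 0 <= sqrt (INR q) / sqrt Q <= 1).
    { split; [apply Rdiv_le_0_compat; lra|]. apply Rmult_le_reg_r with (sqrt Q); [lra|].
      unfold Rdiv. rewrite Rmult_assoc, Rinv_l by lra. assert (h := sqrt_le_1_alt _ _ HqQ). lra. }
    assert (HlenL : len <= L) by (unfold len; rewrite <- (Rmult_1_r L) at 2; apply Rmult_le_compat_l; lra).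
    assert (Hlen0 : 0 <= len) by (unfold len; apply Rmult_le_pos; lra).
    assert (P1 := H1 N V Q q r y y2 len X HN1' ltac:(lra) HQ1 Hq ltac:(lra)).
    specialize (P1 ltac:(intros x Hx; apply HPB; lra) Hy Hyy ltac:(lra) HX1).
    specialize (P1 Tu Tt Happ Hlen).
    assert (Hl2 : len * len <= INR q * Q * N).
    { right. unfold len. replace (L * (sqrt (INR q) / sqrt Q) * (L * (sqrt (INR q) / sqrt Q))) with
        (L * L * (sqrt (INR q) * sqrt (INR q)) / (sqrt Q * sqrt Q)) by (field; lra).
      rewrite Esq, EsQ. unfold L, Q. rewrite <- Es. field. split; lra. }
    assert (Hl3 : len * len * len * V <= N * N * N).
    { apply Rle_trans with (L * L * L * V).
      - apply Rmult_le_compat_r; [lra|]. apply Rmult_le_compat; [apply Rmult_le_pos; lra|lra| |lra]. apply Rmult_le_compat; lra.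
      - right. unfold L. rewrite <- Ev. field. lra. }
    specialize (P1 Hl2 Hl3).
    assert (P2 := H2 N q y y2 X ltac:(lra) Hq ltac:(lra) Hy ltac:(lra) HX2 HX3).
    match type of P1 with Cmod ?u <= _ => set (beta_sum := u) in * end.
    replace (prime_sum a f X y y2) with ((prime_sum a f X y y2 - beta_sum) + beta_sum)%C by ring.
    eapply Rle_trans; [apply Cmod_triangle|]. eapply Rle_trans; [apply Rplus_le_compat; [exact P2|exact P1]|].
    unfold B, B0. 
    replace ((K1 + K2) * Rpower N (1 / 2 + 5 * d) * sqrt (INR q)) with (K2 * Rpower N (1 / 2 + 5 * d) * sqrt (INR q) + K1 * sqrt (INR q) * Rpower N (1 / 2 + 5 * d)) by ring.
    (* Since [sqrt q >= 1], the contribution of the proper prime powers fits into the same cost. *)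
    apply Rplus_le_compat_r. assert (0 < K2 * Rpower N (1 / 2 + 5 * d)) by (apply Rmult_lt_0_compat; auto).
    rewrite <- (Rmult_1_r (K2 * Rpower N (1 / 2 + 5 * d))) at 1. apply Rmult_le_compat_l; lra. }
  specialize (G Hpc HNN'). eapply Rle_trans; [exact G|].
  assert (HNL : (N' - N) / L <= v).
  { unfold L. apply Rmult_le_reg_r with (N / v); [auto|]. unfold Rdiv at 1. rewrite Rmult_assoc, Rinv_l by (unfold L in HL0; lra).
    replace (v * (N / v)) with N by (field; lra). lra. }
  (* The interval has at most [v] lengths [L], and [1 + v <= 2 v]. *)
  apply Rle_trans with (B * sqrt Q * (2 * v)).
  - apply Rmult_le_compat_l; [apply Rmult_le_pos; lra|]. lra.
  - right. unfold B.
    assert (ESQ : sqrt Q = Rpower N (1 / 4) * / Rpower V (1 / 6)).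
    { rewrite <- Rpower_Ropp. rewrite <- Rpower_sqrt by lra. unfold Q, v, Rdiv. rewrite Esp, <- Rpower_Ropp.
      rewrite <- Rpower_mult_distr by apply Rpower_pos. rewrite !Rpower_mult. f_equal; f_equal; field. }
    assert (Evv : v = Rpower V (1 / 6) * Rpower V (1 / 6)) by (unfold v; rewrite <- Rpower_plus; f_equal; field).
    assert (P6 := Rpower_pos V (1 / 6)).
    rewrite ESQ, Evv.
    replace (Rpower N (3 / 4 + 5 * d)) with (Rpower N (1 / 2 + 5 * d) * Rpower N (1 / 4)) by (rewrite <- Rpower_plus; f_equal; field).
    field. lra.
Qed.
End Main.

Theorem theorem2 (f : R -> R) (df : nat -> R -> R) (a b : nat -> C) (m : nat)
  (Hf : phase_conditions f df) (HF : dirichlet_series_conditions a b m)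
  (eta : R) (Heta : 0 < eta) (eps : R) (Heps : 0 < eps) :
  exists K : R, forall N N' : R,
    1 <= N -> N < N' -> N' <= 2 * N ->
    Rpower N (3 / 4 + eta) <= f N -> f N <= Rpower N (3 / 2 - eta) ->
    Cmod (sum_primes_between (fun p => a p * e (f (INR p)))%C N N')
      <= K * Rpower N (3 / 4 + eps) * Rpower (f N) (1 / 6).
Proof.
  (* The total loss is [N^(5d)], and the analytic estimates require [d <= 1/8]. *)
  set (d := Rmin (eps / 5) (1 / 8)).
  assert (Hd : 0 < d <= 1 / 8) by (split; [apply Rmin_pos; lra|apply Rmin_r]).
  assert (Hd5 : 5 * d <= eps) by (assert (h := Rmin_l (eps / 5) (1 / 8)); fold d in h; lra).
  destruct (prime_sum_large f df a b m Hf HF eta d Heta Hd) as [K [N0 [HK [HN0 H]]]].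
  (* Small [N] are absorbed in the constant: [X0 > 2 N0 + 1] bounds [up N'] whenever [N < N0], so
     the sum is at most [K0], while both powers on the right-hand side are at least 1. *)
  destruct (nat_floor (2 * N0 + 2) ltac:(lra)) as [X0 [HX0 HX0']].
  set (K0 := rsum (seq 1 X0) (fun n => Cmod (a n))).
  assert (HK0 : 0 <= K0) by (apply rsum_nonneg; intros; apply Cmod_ge_0).
  exists (K + K0). intros N N' HN HNN' HN' HV1 HV2.
  assert (HV : 1 <= f N) by (eapply Rle_trans; [apply (Rpower_ge_1 N (3 / 4 + eta)); lra|exact HV1]).
  assert (P1 : 1 <= Rpower N (3 / 4 + eps)) by (apply Rpower_ge_1; lra).
  assert (P2 : 1 <= Rpower (f N) (1 / 6)) by (apply Rpower_ge_1; lra).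
  destruct (Rle_dec N0 N) as [h|h].
  - destruct (archimed (2 * N)) as [U1 U2].
    assert (Hup : (0 <= up (2 * N))%Z) by (apply le_IZR; lra).
    set (X := Z.to_nat (up (2 * N))).
    assert (EX : INR X = IZR (up (2 * N))) by (unfold X; rewrite INR_IZR_INZ, Z2Nat.id; auto).
    destruct (archimed N') as [W1 W2].
    assert (HXup : (Z.to_nat (up N') <= X)%nat).
    { apply Nat.lt_succ_r. apply INR_lt. rewrite S_INR, EX, INR_IZR_INZ, Z2Nat.id by (apply le_IZR; lra). rewrite <- plus_IZR.
      apply IZR_lt, lt_IZR. rewrite plus_IZR. lra. }
    rewrite (sum_primes_between_eq a f N N' X) by (auto; lra).
    assert (HX1 : (1 <= X)%nat) by (apply INR_le; simpl; lra).
    eapply Rle_trans; [apply (H N N' X); auto; lra|].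
    assert (Q : Rpower N (3 / 4 + 5 * d) <= Rpower N (3 / 4 + eps)) by (apply Rpower_le_exp; lra).
    apply Rmult_le_compat_r; [lra|]. apply Rmult_le_compat; try lra. left; apply Rpower_pos.
  - rewrite (sum_primes_between_eq a f N N' X0).
    + apply Rle_trans with K0.
      * unfold prime_sum. eapply Rle_trans; [apply lsum_norm_le|]. apply rsum_le. intros n _.
        assert (Z := Cmod_ge_0 (a n)).
        destruct (in_interval N N' n); [destruct (prime_b n)|]; rewrite ?Cmod_0; auto. rewrite Cmod_mult, Cmod_e. lra.
      * assert (1 <= Rpower N (3 / 4 + eps) * Rpower (f N) (1 / 6)) by nra. rewrite Rmult_assoc. nra.
    + lra.
    + apply Nat.lt_succ_r. apply INR_lt. rewrite S_INR.
      destruct (archimed N') as [W1 W2]. rewrite INR_IZR_INZ, Z2Nat.id by (apply le_IZR; lra). lra.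
Qed.
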